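(* Let $c,d\in\{-1,0,1\}$, $f(x,y,z)=-dx^2-cxy-y^2+z$, and consider the discontinuous piecewise linear system in $\mathbb R^3$ $$(\dot x,\dot y,\dot z)^T=\begin{cases}X_{a,0}^+(x,y,z)+\varepsilon X_1^+(x,y,z), & f(x,y,z)>0,\\ X_{a,0}^-(x,y,z)+\varepsilon X_1^-(x,y,z), & f(x,y,z)<0,\end{cases}$$ where $$X_{a,0}^\pm(x,y,z)=\begin{pmatrix}x\\ -z\mp1\\ x+y\end{pmatrix},\qquad X_1^\pm(x,y,z)=\begin{pmatrix}\alpha_0^\pm+\alpha_1^\pm x+\alpha_2^\pm y+\alpha_3^\pm z\\ \beta_0^\pm+\beta_1^\pm x+\beta_2^\pm y+\beta_3^\pm z\\ \kappa_0^\pm+\kappa_1^\pm x+\kappa_2^\pm y+\kappa_3^\pm z\end{pmatrix}.$$ Then for $\varepsilon=0$ the system has the invariant plane $\mathcal S=\{(x,y,z)\in\mathbb R^3:x=0\}$, which contains a period annulus $\mathcal A=\mathcal A_1\cup\mathcal A_2$ foliated by crossing periodic orbits, where $$\mathcal A_1=\{(0,y,z)\in\mathbb R^3:\ y^2+(z-1)^2>1,\ z\le y^2\},\qquad \mathcal A_2=\{(0,y,z)\in\mathbb R^3:\ y^2+(z+1)^2>5,\ z\ge y^2\}.$$ Furthermore, there exist real parameters $\alpha_j^\pm,\beta_j^\pm,\kappa_j^\pm$ ($j=0,1,2,3$) such that for every $\varepsilon\neq0$ sufficiently small the system admits at least $7$ limit cycles converging, as $\varepsilon\to0$, to some of the periodic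 orbits of the unperturbed system contained in the plane $\mathcal S$.
   Context: The switching manifold is $\Sigma=f^{-1}(0)$. A crossing periodic orbit is a periodic orbit made of an orbit segment of the vector field in $\{f>0\}$ and an orbit segment of the vector field in $\{f<0\}$, meeting $\Sigma$ at points where both vector fields are transversal to $\Sigma$ and point to the same side. A limit cycle is an isolated periodic orbit. *)

(* Defs.v *)
From Stdlib Require Import Reals.
From Coquelicot Require Import Coquelicot.
Open Scope R_scope.

(* With Coquelicot's product structure, [norm] on R3 is the Euclidean norm. *)
Notation R3 := (R * R * R)%type.

(* p' = pos p where sw p > 0, p' = neg p where sw p < 0; the switching manifold
   is sw p = 0. *)
Record pw_system : Type := PwSystem {
  sw : R3 -> R;
  pos : R3 -> R3;
  neg : R3 -> R3
}.

(* Solutions in Filippov's sense. Off the switching manifold they are classical.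
   At a point p of the manifold the difference quotients of phi accumulate only
   on the segment [neg p, pos p]; for continuous sw, pos and neg (so that the
   Filippov set-valued field is upper semicontinuous with compact convex values)
   this amounts to phi being locally absolutely continuous with derivative almost
   everywhere in the Filippov set. Sliding motions are therefore included. *)
Definition solution (Z : pw_system) (phi : R -> R3) : Prop :=
  forall t : R,
    (0 < sw Z (phi t) -> is_derive phi t (pos Z (phi t))) /\
    (sw Z (phi t) < 0 -> is_derive phi t (neg Z (phi t))) /\
    (sw Z (phi t) = 0 ->
      forall eta : posreal,
        locally' 0 (fun s : R =>
          exists l : R, 0 <= l <= 1 /\
            norm (minus (scal (/ s) (minus (phi (t + s)) (phi t)))
                        (plus (scal l (pos Z (phi t)))
                              (scal (1 - l) (neg Z (phi t))))) < eta)).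

Definition invariant_set (Z : pw_system) (A : R3 -> Prop) : Prop :=
  forall phi : R -> R3, solution Z phi ->
    (exists t0, A (phi t0)) -> forall t, A (phi t).

Definition periodic_solution (Z : pw_system) (phi : R -> R3) (T : R) : Prop :=
  solution Z phi /\ 0 < T /\ (forall t, phi (t + T) = phi t) /\
  (exists t, phi t <> phi 0).

Definition range_of (phi : R -> R3) (G : R3 -> Prop) : Prop :=
  forall p, G p <-> exists t, phi t = p.

Definition periodic_orbit (Z : pw_system) (G : R3 -> Prop) : Prop :=
  exists (phi : R -> R3) (T : R), periodic_solution Z phi T /\ range_of phi G.

Definition lie_derivative (h : R3 -> R) (X : R3 -> R3) (p : R3) : R :=
  Derive (fun t : R => h (plus p (scal t (X p)))) 0.

Definition crossing_point (Z : pw_system) (p : R3) : Prop :=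
  sw Z p = 0 /\
  0 < lie_derivative (sw Z) (pos Z) p * lie_derivative (sw Z) (neg Z) p.

(* One orbit segment in each of the two zones. *)
Definition crossing_periodic_orbit (Z : pw_system) (G : R3 -> Prop) : Prop :=
  exists (phi : R -> R3) (tau T : R),
    periodic_solution Z phi T /\ range_of phi G /\
    0 < tau < T /\
    (forall t, 0 < t < tau -> 0 < sw Z (phi t)) /\
    (forall t, tau < t < T -> sw Z (phi t) < 0) /\
    crossing_point Z (phi 0) /\ crossing_point Z (phi tau).

Definition in_tube (r : R) (A B : R3 -> Prop) : Prop :=
  forall p, A p -> exists q, B q /\ norm (minus p q) < r.

(* Periodic orbits being compact, the r-tubes form a neighbourhood base. *)
Definition limit_cycle (Z : pw_system) (G : R3 -> Prop) : Prop :=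
  periodic_orbit Z G /\
  exists r : posreal, forall G' : R3 -> Prop,
    periodic_orbit Z G' -> in_tube r G' G -> forall p, G' p <-> G p.

(* Hausdorff convergence of G eps to G0 as eps tends to 0, eps <> 0. *)
Definition converges_to (G : R -> R3 -> Prop) (G0 : R3 -> Prop) : Prop :=
  forall eta : posreal,
    locally' 0 (fun eps : R => in_tube eta (G eps) G0 /\ in_tube eta G0 (G eps)).

Definition homeomorphism_between {U V : UniformSpace} (A : U -> Prop)
    (B : V -> Prop) (h : U -> V) (g : V -> U) : Prop :=
  continuous_on A h /\ continuous_on B g /\
  (forall x, A x -> B (h x) /\ g (h x) = x) /\
  (forall y, B y -> A (g y) /\ h (g y) = y).

(* The model annulus is the exterior of the closed unit disc, foliated by the
   circles centred at the origin. *)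
Definition period_annulus (Z : pw_system) (A : R3 -> Prop) : Prop :=
  exists (h : R * R -> R3) (g : R3 -> R * R),
    homeomorphism_between (fun q : R * R => 1 < fst q ^ 2 + snd q ^ 2) A h g /\
    forall r : R, 1 < r ->
      crossing_periodic_orbit Z
        (fun p => exists q : R * R, fst q ^ 2 + snd q ^ 2 = r ^ 2 /\ h q = p).

Definition quadric (c d : R) (p : R3) : R :=
  let '(x, y, z) := p in - d * x ^ 2 - c * x * y - y ^ 2 + z.

Definition X0_pos (p : R3) : R3 :=
  let '(x, y, z) := p in (x, - z - 1, x + y).

Definition X0_neg (p : R3) : R3 :=
  let '(x, y, z) := p in (x, - z + 1, x + y).

(* Only the entries of index 0, 1, 2, 3 of the coefficient families matter. *)
Definition X1 (alpha beta kappa : nat -> R) (p : R3) : R3 :=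
  let '(x, y, z) := p in
  (alpha 0%nat + alpha 1%nat * x + alpha 2%nat * y + alpha 3%nat * z,
   beta 0%nat + beta 1%nat * x + beta 2%nat * y + beta 3%nat * z,
   kappa 0%nat + kappa 1%nat * x + kappa 2%nat * y + kappa 3%nat * z).

Definition unperturbed (c d : R) : pw_system :=
  PwSystem (quadric c d) X0_pos X0_neg.

Definition perturbed (c d : R) (ap bp kp am bm km : nat -> R) (eps : R)
    : pw_system :=
  PwSystem (quadric c d)
    (fun p => plus (X0_pos p) (scal eps (X1 ap bp kp p)))
    (fun p => plus (X0_neg p) (scal eps (X1 am bm km p))).

Definition plane_S (p : R3) : Prop :=
  let '(x, y, z) := p in x = 0.

Definition annulus_A1 (p : R3) : Prop :=
  let '(x, y, z) := p in x = 0 /\ y ^ 2 + (z - 1) ^ 2 > 1 /\ z <= y ^ 2.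

Definition annulus_A2 (p : R3) : Prop :=
  let '(x, y, z) := p in x = 0 /\ y ^ 2 + (z + 1) ^ 2 > 5 /\ z >= y ^ 2.

Definition annulus_A (p : R3) : Prop := annulus_A1 p \/ annulus_A2 p.

(* Main.v *)
Require Import Defs.
From Stdlib Require Import Reals.
From Coquelicot Require Import Coquelicot.
From Stdlib Require Import ZArith Lra Lia Psatz List ClassicalEpsilon FunctionalExtensionality.
Open Scope R_scope.

(** In the coordinates Y = y + x/2 and w = z - x/2 -+ 1 the unperturbed fields split into x' = x and a
    rotation of the (Y, w)-plane. Hence x = 0 is invariant, also for Filippov solutions, and on it the orbits are
    made of circle arcs around (0, -1) and (0, 1). Both circles through (0, s, s^2), s > 1, also pass through
    (0, -s, s^2), so the arcs close up; these orbits fill the annulus, and [hmap], [gmap] straighten it to the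
    exterior of a disc, level s to radius s.

    The perturbation is taken from an eight-parameter family ([zonep], [zonem]) for which both zones stay
    explicitly solvable: a spiral in the plane and an expanding transverse coordinate ([field], [flow]).
    A closed orbit near the one of level s crosses the manifold at points with x = O(eps). Since x expands along
    a turn, its first order is determined by s ([Kf]); the remaining equation, that the radius is the same after
    a turn, has as first order the Melnikov function [mel], which is linear in the eight parameters.

    The eight basic functions are independent ([mel_independent]). With u = 1/s they become germs at
    u = 0 that are smooth but mix odd and even parts with hyperbolic functions. A combination that vanishes for
    large s is flat at u = 0, hence flat also for u < 0, and comparing u with -u separates its ingredients.
    Independent functions interpolate, so some combination alternates in sign at eight points, and
    a generic change of level makes its seven zeros simple ([mel_simple_zeros]).

    At a simple zero, the equations of a closed orbit are solved for small eps by the contraction principle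
    ([branch_exists], [bifurcation]). They are divided by eps, so that only strict differentiability in the
    unknowns, uniform in eps, is available; this is the calculus of [sd]. The arcs of the flows between
    the points found in this way have the right signs and glue to a crossing periodic orbit that tends to
    the unperturbed one ([Gam_crossing], [Gam_close]).

    The closed orbit is isolated because its return map is a saddle or a source: x is multiplied by a factor
    larger than 1, while s moves by eps times a multiple, nonzero at a simple zero, of its deviation. A periodic
    orbit in a thin tube crosses the manifold only near the two crossing points ([next_crossing], [prev_crossing]),
    and its crossings form a bounded set that is invariant under the return map in both directions, hence
    one point ([saddle_trivial], [Gam_limit_cycle]). The seven unperturbed orbits have different levels, so the
    limit cycles are different for small eps. *)

(** * Curves in space *)

Definition px (p : R3) : R := fst (fst p).
Definition py (p : R3) : R := snd (fst p).
Definition pz (p : R3) : R := snd p.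

Lemma norm_R3 (p : R3) :
  norm p = sqrt (Rabs (sqrt (Rabs (px p) ^ 2 + Rabs (py p) ^ 2)) ^ 2 + Rabs (pz p) ^ 2).
Proof.
  destruct p as [[x y] z].
  change (sqrt (sqrt (Rabs x ^ 2 + Rabs y ^ 2) ^ 2 + Rabs z ^ 2) =
    sqrt (Rabs (sqrt (Rabs x ^ 2 + Rabs y ^ 2)) ^ 2 + Rabs z ^ 2)).
  rewrite (Rabs_pos_eq (sqrt _)) by apply sqrt_pos. reflexivity.
Qed.

Lemma norm_R3' (p : R3) : norm p = sqrt (px p ^ 2 + py p ^ 2 + pz p ^ 2).
Proof.
  rewrite norm_R3. f_equal. rewrite !pow2_abs.
  rewrite pow2_sqrt; [reflexivity|]. nra.
Qed.

Lemma px_le_norm p : Rabs (px p) <= norm p.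
Proof. rewrite norm_R3', <- sqrt_Rsqr_abs. apply sqrt_le_1_alt. unfold Rsqr; nra. Qed.
Lemma py_le_norm p : Rabs (py p) <= norm p.
Proof. rewrite norm_R3', <- sqrt_Rsqr_abs. apply sqrt_le_1_alt. unfold Rsqr; nra. Qed.
Lemma pz_le_norm p : Rabs (pz p) <= norm p.
Proof. rewrite norm_R3', <- sqrt_Rsqr_abs. apply sqrt_le_1_alt. unfold Rsqr; nra. Qed.

Lemma norm_le_sum p : norm p <= Rabs (px p) + Rabs (py p) + Rabs (pz p).
Proof.
  rewrite norm_R3'.
  pose proof (Rabs_pos (px p)); pose proof (Rabs_pos (py p)); pose proof (Rabs_pos (pz p)).
  rewrite <- (sqrt_pow2 (Rabs (px p) + Rabs (py p) + Rabs (pz p))) by lra.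
  apply sqrt_le_1_alt. rewrite <- (pow2_abs (px p)), <- (pow2_abs (py p)), <- (pow2_abs (pz p)). nra.
Qed.

Lemma px_minus p q : px (minus p q) = px p - px q. Proof. reflexivity. Qed.
Lemma py_minus p q : py (minus p q) = py p - py q. Proof. reflexivity. Qed.
Lemma pz_minus p q : pz (minus p q) = pz p - pz q. Proof. reflexivity. Qed.
Lemma px_plus p q : px (plus p q) = px p + px q. Proof. reflexivity. Qed.
Lemma py_plus p q : py (plus p q) = py p + py q. Proof. reflexivity. Qed.
Lemma pz_plus p q : pz (plus p q) = pz p + pz q. Proof. reflexivity. Qed.
Lemma px_scal (k : R) (p : R3) : px (scal k p) = k * px p. Proof. reflexivity. Qed.
Lemma py_scal (k : R) (p : R3) : py (scal k p) = k * py p. Proof. reflexivity. Qed.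
Lemma pz_scal (k : R) (p : R3) : pz (scal k p) = k * pz p. Proof. reflexivity. Qed.

Lemma norm_minus_self (p : R3) : norm (minus p p) = 0.
Proof.
  rewrite norm_R3', px_minus, py_minus, pz_minus, !Rminus_diag.
  replace (0 ^ 2 + 0 ^ 2 + 0 ^ 2) with 0 by ring. apply sqrt_0.
Qed.

Lemma R3_eq p q : px p = px q -> py p = py q -> pz p = pz q -> p = q.
Proof. destruct p as [[a b] c], q as [[a' b'] c']; unfold px, py, pz; simpl; congruence. Qed.

(** Filippov solutions are defined through the accumulation of these quotients. *)
Definition DQ (f : R -> R3) (t s : R) : R3 := scal (/ s) (minus (f (t + s)) (f t)).

Lemma locally'_ball (P : R -> Prop) :
  locally' 0 P <-> exists d : posreal, forall s, s <> 0 -> Rabs s < d -> P s.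
Proof.
  split.
  - intros [d Hd]. exists d. intros s Hs Hsd. apply Hd; [|assumption].
    change (Rabs (s - 0) < d). rewrite Rminus_0_r. assumption.
  - intros [d Hd]. exists d. intros s Hs Hsd. apply Hd; [assumption|].
    change (Rabs (s - 0) < d) in Hs. rewrite Rminus_0_r in Hs. assumption.
Qed.

Lemma is_derive_R_DQ (f : R -> R) t l :
  is_derive f t l <-> forall eta : posreal, exists d : posreal, forall s, s <> 0 -> Rabs s < d ->
    Rabs ((f (t + s) - f t) / s - l) < eta.
Proof.
  rewrite is_derive_Reals. split; intros H.
  - intros [e He]. destruct (H e He) as [d Hd]. exists d. apply Hd.
  - intros e He. destruct (H (mkposreal e He)) as [d Hd]. exists d. apply Hd.
Qed.

Lemma min3 (a b c : posreal) : exists d : posreal, d <= a /\ d <= b /\ d <= c.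
Proof.
  exists (mkposreal (Rmin a (Rmin b c)) ltac:(repeat apply Rmin_pos; apply cond_pos)). simpl.
  repeat split.
  - apply Rmin_l.
  - eapply Rle_trans; [apply Rmin_r|apply Rmin_l].
  - eapply Rle_trans; [apply Rmin_r|apply Rmin_r].
Qed.

Lemma is_derive_px (f : R -> R3) t (v : R3) : is_derive f t v -> is_derive (fun s => px (f s)) t (px v).
Proof.
  intros [_ H]. split; [apply is_linear_scal_l|].
  intros x Hx eps. specialize (H x Hx eps). revert H. apply filter_imp. intros y Hy.
  eapply Rle_trans; [|exact Hy].
  exact (px_le_norm (minus (minus (f y) (f x)) (scal (minus y x) v))).
Qed.
Lemma is_derive_py (f : R -> R3) t (v : R3) : is_derive f t v -> is_derive (fun s => py (f s)) t (py v).
Proof.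
  intros [_ H]. split; [apply is_linear_scal_l|].
  intros x Hx eps. specialize (H x Hx eps). revert H. apply filter_imp. intros y Hy.
  eapply Rle_trans; [|exact Hy].
  exact (py_le_norm (minus (minus (f y) (f x)) (scal (minus y x) v))).
Qed.
Lemma is_derive_pz (f : R -> R3) t (v : R3) : is_derive f t v -> is_derive (fun s => pz (f s)) t (pz v).
Proof.
  intros [_ H]. split; [apply is_linear_scal_l|].
  intros x Hx eps. specialize (H x Hx eps). revert H. apply filter_imp. intros y Hy.
  eapply Rle_trans; [|exact Hy].
  exact (pz_le_norm (minus (minus (f y) (f x)) (scal (minus y x) v))).
Qed.

Lemma is_derive_R3 (f : R -> R3) t (v : R3) :
  is_derive (fun s => px (f s)) t (px v) -> is_derive (fun s => py (f s)) t (py v) ->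
  is_derive (fun s => pz (f s)) t (pz v) -> is_derive f t v.
Proof.
  intros [_ H1] [_ H2] [_ H3]. split; [apply is_linear_scal_l|].
  intros x Hx eps.
  assert (He : 0 < eps / 3) by (pose proof (cond_pos eps); lra).
  specialize (H1 x Hx (mkposreal _ He)). specialize (H2 x Hx (mkposreal _ He)).
  specialize (H3 x Hx (mkposreal _ He)).
  generalize (filter_and _ _ H1 (filter_and _ _ H2 H3)). apply filter_imp.
  intros y [A [B C]]. simpl in A, B, C.
  eapply Rle_trans; [apply norm_le_sum|].
  change (Rabs (px (minus (minus (f y) (f x)) (scal (minus y x) v))) <= eps / 3 * norm (minus y x)) in A.
  change (Rabs (py (minus (minus (f y) (f x)) (scal (minus y x) v))) <= eps / 3 * norm (minus y x)) in B.
  change (Rabs (pz (minus (minus (f y) (f x)) (scal (minus y x) v))) <= eps / 3 * norm (minus y x)) in C.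
  eapply Rle_trans; [apply Rplus_le_compat; [apply Rplus_le_compat; [exact A|exact B]|exact C]|].
  set (n1 := norm (minus y x)). change (norm _) with n1. right. field.
Qed.

Lemma is_derive_DQ (f : R -> R3) t (v : R3) : is_derive f t v ->
  forall eta : posreal, exists d : posreal, forall s, s <> 0 -> Rabs s < d ->
    norm (minus (DQ f t s) v) < eta.
Proof.
  intros H eta.
  assert (He : 0 < eta / 3) by (pose proof (cond_pos eta); lra).
  destruct (proj1 (is_derive_R_DQ _ _ _) (is_derive_px _ _ _ H) (mkposreal _ He)) as [d1 H1].
  destruct (proj1 (is_derive_R_DQ _ _ _) (is_derive_py _ _ _ H) (mkposreal _ He)) as [d2 H2].
  destruct (proj1 (is_derive_R_DQ _ _ _) (is_derive_pz _ _ _ H) (mkposreal _ He)) as [d3 H3].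
  destruct (min3 d1 d2 d3) as [d [D1 [D2 D3]]]. exists d. intros s Hs Hsd.
  specialize (H1 s Hs ltac:(lra)); specialize (H2 s Hs ltac:(lra)); specialize (H3 s Hs ltac:(lra)).
  simpl in H1, H2, H3.
  eapply Rle_lt_trans; [apply norm_le_sum|].
  unfold DQ. rewrite px_minus, py_minus, pz_minus, px_scal, py_scal, pz_scal, px_minus, py_minus, pz_minus.
  unfold Rdiv in H1, H2, H3. rewrite Rmult_comm in H1, H2, H3. lra.
Qed.

Definition curve_cont (f : R -> R3) (t : R) : Prop :=
  forall eta, 0 < eta -> exists d, 0 < d /\ forall s, Rabs (s - t) < d -> norm (minus (f s) (f t)) < eta.

Lemma curve_cont_px f t : curve_cont f t -> continuous (fun s => px (f s)) t.
Proof.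
  intros H. apply continuity_pt_filterlim. intros e He.
  destruct (H e He) as [d [Hd H']]. exists d. split; [assumption|]. intros x [_ Hx].
  eapply Rle_lt_trans; [|apply (H' x Hx)]. exact (px_le_norm (minus (f x) (f t))).
Qed.
Lemma curve_cont_py f t : curve_cont f t -> continuous (fun s => py (f s)) t.
Proof.
  intros H. apply continuity_pt_filterlim. intros e He.
  destruct (H e He) as [d [Hd H']]. exists d. split; [assumption|]. intros x [_ Hx].
  eapply Rle_lt_trans; [|apply (H' x Hx)]. exact (py_le_norm (minus (f x) (f t))).
Qed.
Lemma curve_cont_pz f t : curve_cont f t -> continuous (fun s => pz (f s)) t.
Proof.
  intros H. apply continuity_pt_filterlim. intros e He.
  destruct (H e He) as [d [Hd H']]. exists d. split; [assumption|]. intros x [_ Hx].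
  eapply Rle_lt_trans; [|apply (H' x Hx)]. exact (pz_le_norm (minus (f x) (f t))).
Qed.

Lemma DQ_step (f : R -> R3) t s : s <> 0 ->
  norm (minus (f (t + s)) (f t)) = Rabs s * norm (DQ f t s).
Proof.
  intros Hs. unfold DQ. rewrite !norm_R3'.
  rewrite px_scal, py_scal, pz_scal.
  rewrite <- sqrt_Rsqr_abs. rewrite <- sqrt_mult_alt by apply Rle_0_sqr. f_equal.
  unfold Rsqr. field. assumption.
Qed.

(** The quotients need not converge at a point of the manifold; boundedness is what survives there and is enough for
    continuity. *)
Lemma DQ_bounded_cont (f : R -> R3) t C (d : posreal) :
  (forall s, s <> 0 -> Rabs s < d -> norm (DQ f t s) <= C) -> curve_cont f t.
Proof.
  intros H eta Heta. 
  assert (HC : 0 < Rabs C + 1) by (pose proof (Rabs_pos C); lra).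
  exists (Rmin d (eta / (Rabs C + 1))). split.
  { apply Rmin_pos; [apply cond_pos|]. apply Rdiv_lt_0_compat; assumption. }
  intros s Hs. destruct (Req_dec s t) as [->|N].
  { rewrite norm_minus_self. assumption. }
  replace s with (t + (s - t)) by ring. rewrite DQ_step by lra.
  assert (A := H (s - t) ltac:(lra) (Rlt_le_trans _ _ _ Hs (Rmin_l _ _))).
  assert (B := Rlt_le_trans _ _ _ Hs (Rmin_r _ _)).
  assert (D := Rle_abs C).
  apply Rle_lt_trans with (Rabs (s - t) * (Rabs C + 1)).
  { apply Rmult_le_compat_l; [apply Rabs_pos|lra]. }
  apply (Rmult_lt_compat_r (Rabs C + 1)) in B; [|assumption].
  unfold Rdiv in B. rewrite Rmult_assoc, Rinv_l, Rmult_1_r in B by lra. assumption.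
Qed.

Lemma is_derive_curve_cont (f : R -> R3) t v : is_derive f t v -> curve_cont f t.
Proof.
  intros H. destruct (is_derive_DQ _ _ _ H (mkposreal 1 Rlt_0_1)) as [d Hd].
  apply (DQ_bounded_cont f t (norm v + 1) d). intros s Hs Hsd.
  specialize (Hd s Hs Hsd). simpl in Hd.
  assert (A : DQ f t s = plus (minus (DQ f t s) v) v).
  { unfold minus. rewrite <- plus_assoc, plus_opp_l, plus_zero_r. reflexivity. }
  rewrite A. eapply Rle_trans; [exact (norm_triangle (minus (DQ f t s) v) v)|]. lra.
Qed.

(** * Filippov solutions *)

Lemma norm_plus_R3 (p q : R3) : norm (plus p q) <= norm p + norm q.
Proof. exact (norm_triangle p q). Qed.

Lemma norm_scal_R3 (k : R) (p : R3) : norm (scal k p) = Rabs k * norm p.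
Proof.
  rewrite !norm_R3', px_scal, py_scal, pz_scal, <- sqrt_Rsqr_abs, <- sqrt_mult_alt by apply Rle_0_sqr.
  f_equal. unfold Rsqr. ring.
Qed.

Lemma norm_pos_R3 (p : R3) : 0 <= norm p.
Proof. exact (norm_ge_0 p). Qed.

Lemma norm_minus_sym (p q : R3) : norm (minus p q) = norm (minus q p).
Proof.
  rewrite !norm_R3', !px_minus, !py_minus, !pz_minus. f_equal. ring.
Qed.

Lemma norm_minus_tri (p q r : R3) : norm (minus p r) <= norm (minus p q) + norm (minus q r).
Proof.
  replace (minus p r) with (plus (minus p q) (minus q r)); [apply norm_plus_R3|].
  apply R3_eq; rewrite ?px_plus, ?py_plus, ?pz_plus, ?px_minus, ?py_minus, ?pz_minus; ring.
Qed.

(** On the manifold the difference quotients lie within 1 of a segment, hence are bounded. *)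
Lemma solution_cont Z phi : solution Z phi -> forall t, curve_cont phi t.
Proof.
  intros H t. destruct (H t) as [Hp [Hn H0]].
  destruct (Rtotal_order (sw Z (phi t)) 0) as [C|[C|C]].
  - exact (is_derive_curve_cont _ _ _ (Hn C)).
  - specialize (H0 C (mkposreal 1 Rlt_0_1)). apply locally'_ball in H0. destruct H0 as [d Hd].
    apply (DQ_bounded_cont phi t (1 + (norm (Defs.pos Z (phi t)) + norm (Defs.neg Z (phi t)))) d).
    intros s Hs Hsd. destruct (Hd s Hs Hsd) as [l [Hl Hn']]. simpl in Hn'.
    fold (DQ phi t s) in Hn'.
    set (w := plus (scal l (Defs.pos Z (phi t))) (scal (1 - l) (Defs.neg Z (phi t)))) in *.
    assert (A : norm w <= norm (Defs.pos Z (phi t)) + norm (Defs.neg Z (phi t))).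
    { unfold w. eapply Rle_trans; [apply norm_plus_R3|]. rewrite !norm_scal_R3.
      pose proof (norm_pos_R3 (Defs.pos Z (phi t))). pose proof (norm_pos_R3 (Defs.neg Z (phi t))).
      rewrite !Rabs_pos_eq by lra. nra. }
    replace (DQ phi t s) with (plus (minus (DQ phi t s) w) w).
    + eapply Rle_trans; [apply norm_plus_R3|]. apply Rplus_le_compat; [left; exact Hn'|exact A].
    + apply R3_eq; rewrite ?px_plus, ?py_plus, ?pz_plus, ?px_minus, ?py_minus, ?pz_minus; ring.
  - exact (is_derive_curve_cont _ _ _ (Hp C)).
Qed.

(** The supremum of the times up to which g stays positive. *)
Lemma first_zero (g : R -> R) t0 t' : (forall t, t0 <= t <= t' -> continuous g t) -> 0 < g t0 -> t0 < t' -> g t' <= 0 ->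
  exists t1, t0 < t1 <= t' /\ g t1 = 0 /\ forall t, t0 <= t < t1 -> 0 < g t.
Proof.
  intros Hc H0 Ht Hg.
  set (E := fun t => t0 <= t <= t' /\ forall u, t0 <= u <= t -> 0 < g u).
  assert (HE0 : E t0) by (split; [lra|]; intros u Hu; replace u with t0 by lra; assumption).
  destruct (completeness E) as [t1 [Hub Hlub]].
  { exists t'. intros x [Hx _]. lra. }
  { exists t0. assumption. }
  assert (A1 : t0 <= t1) by (apply Hub; assumption).
  assert (A2 : t1 <= t') by (apply Hlub; intros x [Hx _]; lra).
  assert (Hpos : forall t, t0 <= t < t1 -> 0 < g t).
  { intros t Hlt. destruct (excluded_middle_informative (exists x, E x /\ t < x)) as [[x [[Hx1 Hx2] Hx3]]|N].
    - apply Hx2. lra.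
    - exfalso. assert (t1 <= t); [|lra]. apply Hlub. intros x Hx.
      destruct (Rle_lt_dec x t); [assumption|]. exfalso. apply N. exists x. split; assumption. }
  assert (Hloc : forall t, t0 <= t <= t' -> forall e, 0 < e -> exists d, 0 < d /\ forall s, Rabs (s - t) < d -> Rabs (g s - g t) < e).
  { intros t Htt e He. destruct (proj2 (continuity_pt_filterlim g t) (Hc t Htt) e He) as [d [Hd Hd']].
    exists d. split; [assumption|]. intros s Hs. destruct (Req_dec s t) as [->|N].
    { rewrite Rminus_diag, Rabs_R0. assumption. }
    apply Hd'. split; [|assumption]. split; [exact I|]. intros E1. apply N. symmetry. assumption. }
  assert (Hz : g t1 = 0).
  { destruct (Rtotal_order (g t1) 0) as [C|[C|C]]; [|assumption|]; exfalso.
    - destruct (Hloc t1 ltac:(lra) (- g t1) ltac:(lra)) as [d [Hd Hd']].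
      assert (t0 < t1). { destruct A1 as [A1|A1]; [assumption|]. rewrite <- A1 in C. lra. }
      pose (s := Rmax t0 (t1 - d / 2)).
      assert (t0 <= s < t1). { unfold s. split; [apply Rmax_l|]. apply Rmax_lub_lt; lra. }
      assert (B : Rabs (s - t1) < d).
      { assert (t1 - d/2 <= s) by (unfold s; apply Rmax_r). apply Rabs_def1; lra. }
      specialize (Hd' s B). apply Rabs_def2 in Hd'. specialize (Hpos s H1). lra.
    - destruct (Hloc t1 ltac:(lra) (g t1) C) as [d [Hd Hd']].
      assert (t1 < t'). { destruct A2 as [A2|A2]; [assumption|]. rewrite A2 in C. lra. }
      pose (s := Rmin t' (t1 + d / 2)).
      assert (t1 < s). { unfold s. apply Rmin_glb_lt; lra. }
      assert (E s).
      { split. { split; [lra|]. unfold s. apply Rmin_l. }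
        intros u Hu. destruct (Rlt_le_dec u t1); [apply Hpos; lra|].
        assert (s <= t1 + d/2) by (unfold s; apply Rmin_r).
        assert (B : Rabs (u - t1) < d) by (apply Rabs_def1; lra).
        specialize (Hd' u B). apply Rabs_def2 in Hd'. lra. }
      specialize (Hub s H2). lra. }
  exists t1. split; [|split; assumption]. split; [|assumption].
  destruct A1 as [A1|A1]; [assumption|]. rewrite <- A1 in Hz. lra.
Qed.

Lemma last_zero (g : R -> R) t0 t' : (forall t, t' <= t <= t0 -> continuous g t) -> 0 < g t0 -> t' < t0 -> g t' <= 0 ->
  exists t1, t' <= t1 < t0 /\ g t1 = 0 /\ forall t, t1 < t <= t0 -> 0 < g t.
Proof.
  intros Hc H0 Ht Hg.
  destruct (first_zero (fun t => g (- t)) (- t0) (- t')) as [t1 [A [B C]]].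
  - intros t Htt. apply (continuous_comp (fun t => - t) g); [|apply Hc; lra].
    apply (continuous_opp (fun t : R => t)). apply continuous_id.
  - rewrite Ropp_involutive. assumption.
  - lra.
  - rewrite Ropp_involutive. assumption.
  - exists (- t1). split; [lra|]. split; [assumption|]. intros t Hlt.
    replace t with (- - t) by ring. apply C. lra.
Qed.

(** Derivative of the switching function at p in the direction v. *)
Definition dquadric (c d : R) (p v : R3) : R :=
  (- 2 * d * px p - c * py p) * px v + (- c * px p - 2 * py p) * py v + pz v.
Definition quadric2 (c d : R) (v : R3) : R :=
  - d * px v ^ 2 - c * px v * py v - py v ^ 2.

Lemma quadric_plus c d p h v :
  quadric c d (plus p (scal h v)) = quadric c d p + h * dquadric c d p v + h ^ 2 * quadric2 c d v.
Proof.
  destruct p as [[x y] z], v as [[vx vy] vz]. unfold quadric, dquadric, quadric2, px, py, pz; simpl.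
  unfold plus, scal; simpl. unfold plus, scal; simpl. unfold mult; simpl. ring.
Qed.

Lemma lie_quadric c d X p : lie_derivative (quadric c d) X p = dquadric c d p (X p).
Proof.
  unfold lie_derivative. apply is_derive_unique.
  apply is_derive_ext with (fun t => quadric c d p + t * dquadric c d p (X p) + t ^ 2 * quadric2 c d (X p)).
  { intros t. symmetry. apply quadric_plus. }
  auto_derive; [exact I|]. ring.
Qed.

Lemma dquadric_bound c d p : exists C, 0 < C /\ forall v, Rabs (dquadric c d p v) <= C * norm v.
Proof.
  set (gx := - 2 * d * px p - c * py p). set (gy := - c * px p - 2 * py p).
  exists (Rabs gx + Rabs gy + 1). pose proof (Rabs_pos gx). pose proof (Rabs_pos gy). split; [lra|].
  intros v. unfold dquadric. fold gx gy.
  pose proof (px_le_norm v). pose proof (py_le_norm v). pose proof (pz_le_norm v).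
  eapply Rle_trans; [apply Rabs_triang|]. 
  eapply Rle_trans; [apply Rplus_le_compat_r, Rabs_triang|]. rewrite !Rabs_mult.
  pose proof (Rabs_pos (px v)). pose proof (Rabs_pos (py v)). nra.
Qed.

Lemma quadric2_bound c d v : Rabs (quadric2 c d v) <= (Rabs d + Rabs c + 1) * norm v ^ 2.
Proof.
  unfold quadric2.
  pose proof (px_le_norm v). pose proof (py_le_norm v).
  replace (- d * px v ^ 2 - c * px v * py v - py v ^ 2)
    with (- (d * (px v * px v) + c * (px v * py v) + py v * py v)) by ring.
  rewrite Rabs_Ropp. eapply Rle_trans; [apply Rabs_triang|].
  eapply Rle_trans; [apply Rplus_le_compat_r, Rabs_triang|]. rewrite !Rabs_mult.
  set (a := Rabs (px v)) in *. set (b := Rabs (py v)) in *. set (n := norm v) in *.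
  assert (0 <= a) by apply Rabs_pos. assert (0 <= b) by apply Rabs_pos.
  assert (a * a <= n ^ 2) by nra. assert (a * b <= n ^ 2) by nra. assert (b * b <= n ^ 2) by nra.
  pose proof (Rabs_pos c). pose proof (Rabs_pos d). nra.
Qed.

Lemma dquadric_lin c d p k u v :
  dquadric c d p (plus (scal k u) v) = k * dquadric c d p u + dquadric c d p v.
Proof.
  unfold dquadric. rewrite px_plus, py_plus, pz_plus, px_scal, py_scal, pz_scal. ring.
Qed.

(** The switching function is a quadratic polynomial, so its increment along the solution is s times the derivative in
    the direction of the difference quotient, up to s^2. That derivative is affine in the direction and at least m >
    0, up to sg, on the whole Filippov segment, hence it stays positive for all difference quotients near the segment.
    With sg = 1 the solution passes from sw < 0 to sw > 0, with sg = -1 conversely. *)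
Lemma crossing_local c d P N phi t sg : sg = 1 \/ sg = - 1 ->
  solution (PwSystem (quadric c d) P N) phi -> quadric c d (phi t) = 0 ->
  0 < sg * dquadric c d (phi t) (P (phi t)) -> 0 < sg * dquadric c d (phi t) (N (phi t)) ->
  exists dl, 0 < dl /\ forall h, 0 < h < dl ->
    0 < sg * quadric c d (phi (t + h)) /\ sg * quadric c d (phi (t - h)) < 0.
Proof.
  intros Hsg Hs H0 HP HN.
  set (p := phi t) in *.
  set (m := Rmin (sg * dquadric c d p (P p)) (sg * dquadric c d p (N p))).
  assert (Hm : 0 < m) by (apply Rmin_pos; assumption).
  destruct (dquadric_bound c d p) as [C [HC HCb]].
  assert (He : 0 < m / (2 * C)) by (apply Rdiv_lt_0_compat; lra).
  destruct (Hs t) as [_ [_ H1]]. simpl in H1. fold p in H1.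
  specialize (H1 H0 (mkposreal _ He)). apply locally'_ball in H1. destruct H1 as [d1 Hd1].
  (* B bounds the difference quotients near t, K their quadratic term *)
  set (B := m / (2 * C) + (norm (P p) + norm (N p))).
  assert (HB : 0 <= B) by (unfold B; pose proof (norm_pos_R3 (P p)); pose proof (norm_pos_R3 (N p)); lra).
  set (K := (Rabs d + Rabs c + 1) * B ^ 2 + 1).
  assert (HK : 0 < K).
  { unfold K. pose proof (Rabs_pos d). pose proof (Rabs_pos c). pose proof (pow2_ge_0 B). nra. }
  assert (Hkey : forall s, s <> 0 -> Rabs s < d1 -> Rabs s < m / (2 * K) ->
     exists D, 0 < D /\ sg * quadric c d (phi (t + s)) = s * D).
  { intros s Hs0 Hsd HsK. destruct (Hd1 s Hs0 Hsd) as [l [Hl Hn]]. simpl in Hn.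
    fold (DQ phi t s) in Hn. set (V := DQ phi t s) in *.
    set (w := plus (scal l (P p)) (scal (1 - l) (N p))) in *.
    assert (HV : phi (t + s) = plus p (scal s V)).
    { apply R3_eq; unfold V, DQ; rewrite ?px_plus, ?py_plus, ?pz_plus, ?px_scal, ?py_scal, ?pz_scal,
        ?px_minus, ?py_minus, ?pz_minus; unfold p; field; assumption. }
    exists (sg * (dquadric c d p V + s * quadric2 c d V)). split.
    - assert (Hw : m <= sg * dquadric c d p w).
      { unfold w. rewrite dquadric_lin. 
        replace (scal (1 - l) (N p)) with (plus (scal (1-l) (N p)) (zero : R3)) by apply plus_zero_r.
        rewrite dquadric_lin.
        replace (dquadric c d p zero) with 0 by (unfold dquadric, px, py, pz, zero; simpl; unfold zero; simpl; ring).
        pose proof (Rmin_l (sg * dquadric c d p (P p)) (sg * dquadric c d p (N p))).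
        pose proof (Rmin_r (sg * dquadric c d p (P p)) (sg * dquadric c d p (N p))).
        fold m in H, H1. nra. }
      assert (HVw : Rabs (dquadric c d p V - dquadric c d p w) < m / 2).
      { replace (dquadric c d p V - dquadric c d p w) with (dquadric c d p (minus V w)).
        - eapply Rle_lt_trans; [apply HCb|]. 
          apply (Rmult_lt_compat_l C) in Hn; [|assumption].
          replace (C * (m / (2 * C))) with (m / 2) in Hn by (field; lra). assumption.
        - unfold dquadric. rewrite px_minus, py_minus, pz_minus. ring. }
      assert (HVB : norm V <= B).
      { replace V with (plus (minus V w) w).
        - eapply Rle_trans; [apply norm_plus_R3|]. unfold B. apply Rplus_le_compat; [left; exact Hn|].
          unfold w. eapply Rle_trans; [apply norm_plus_R3|]. rewrite !norm_scal_R3.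
          pose proof (norm_pos_R3 (P p)). pose proof (norm_pos_R3 (N p)).
          rewrite !Rabs_pos_eq by lra. nra.
        - apply R3_eq; rewrite ?px_plus, ?py_plus, ?pz_plus, ?px_minus, ?py_minus, ?pz_minus; ring. }
      assert (HQ : Rabs (s * quadric2 c d V) < m / 2).
      { rewrite Rabs_mult. apply Rle_lt_trans with (Rabs s * K).
        - apply Rmult_le_compat_l; [apply Rabs_pos|]. eapply Rle_trans; [apply quadric2_bound|].
          unfold K. pose proof (Rabs_pos d). pose proof (Rabs_pos c). pose proof (norm_pos_R3 V).
          assert (norm V ^ 2 <= B ^ 2) by (apply pow_incr; lra). nra.
        - apply (Rmult_lt_compat_r K) in HsK; [|assumption].
          replace (m / (2 * K) * K) with (m / 2) in HsK by (field; lra). assumption. }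
      apply Rabs_def2 in HVw. apply Rabs_def2 in HQ.
      destruct Hsg as [-> | ->]; lra.
    - rewrite HV, quadric_plus, H0. ring. }
  exists (Rmin d1 (m / (2 * K))). split.
  { apply Rmin_pos; [apply cond_pos|]. apply Rdiv_lt_0_compat; lra. }
  intros h Hh.
  assert (h < d1) by (eapply Rlt_le_trans; [apply Hh|apply Rmin_l]).
  assert (h < m / (2 * K)) by (eapply Rlt_le_trans; [apply Hh|apply Rmin_r]).
  split.
  - destruct (Hkey h) as [D [HD ->]]; try (rewrite Rabs_pos_eq; lra); try lra. nra.
  - destruct (Hkey (- h)) as [D [HD E]]; try (rewrite Rabs_Ropp, Rabs_pos_eq; lra); try lra.
    unfold Rminus. rewrite E. nra.
Qed.

(** * Gluing two arcs into a periodic solution *)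

Lemma is_derive_shift_R3 (f : R -> R3) a t v :
  is_derive f (t - a) v -> is_derive (fun s => f (s - a)) t v.
Proof.
  intros H.
  assert (D : is_derive (fun s : R => s - a) t 1) by (auto_derive; [exact I|ring]).
  generalize (is_derive_comp f (fun s => s - a) t v 1 H D).
  intros H'. replace v with (scal 1 v : R3) by (apply (scal_one (v : R3))). exact H'.
Qed.

Lemma is_derive_ext_near (f g : R -> R3) t v d : 0 < d -> (forall s, Rabs (s - t) < d -> f s = g s) ->
  is_derive f t v -> is_derive g t v.
Proof.
  intros Hd H. apply is_derive_ext_loc. exists (mkposreal d Hd). intros s Hs. apply H. exact Hs.
Qed.

(** The time is reduced modulo t1 + t2 with the integer part, then split between the two arcs. *)
Definition glued (f1 f2 : R -> R3) (t1 t2 : R) (t : R) : R3 :=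
  let u := t - (t1 + t2) * IZR (Int_part (t / (t1 + t2))) in
  if Rle_dec u t1 then f1 u else f2 (u - t1).

Section Glue.
Variables (f1 f2 : R -> R3) (t1 t2 : R).
Hypotheses (Ht1 : 0 < t1) (Ht2 : 0 < t2) (E1 : f1 t1 = f2 0) (E2 : f2 t2 = f1 0).
Let T := t1 + t2.
Let phi := glued f1 f2 t1 t2.

Lemma period_decomp t : exists k : Z, IZR k * T <= t < IZR k * T + T.
Proof.
  assert (HT : 0 < T) by (unfold T; lra).
  exists (Int_part (t / T)). destruct (base_Int_part (t / T)) as [A B].
  assert (C : t = t / T * T) by (field; lra). split.
  - rewrite C at 2. apply Rmult_le_compat_r; lra.
  - rewrite C at 1. nra.
Qed.

Lemma Int_part_period t (k : Z) : IZR k * T <= t < IZR k * T + T -> Int_part (t / T) = k.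
Proof.
  intros H. assert (HT : 0 < T) by (unfold T; lra).
  symmetry. apply Int_part_spec. split.
  - apply Rmult_lt_reg_r with T; [assumption|]. unfold Rdiv. rewrite Rmult_minus_distr_r, Rmult_assoc, Rinv_l by lra. lra.
  - apply Rmult_le_reg_r with T; [assumption|]. unfold Rdiv. rewrite Rmult_assoc, Rinv_l by lra. lra.
Qed.

Lemma glued_fst t (k : Z) : IZR k * T <= t <= IZR k * T + t1 -> phi t = f1 (t - IZR k * T).
Proof.
  intros H. unfold phi, glued. fold T. rewrite (Int_part_period t k) by (unfold T; unfold T in H; lra).
  rewrite (Rmult_comm T). destruct (Rle_dec (t - IZR k * T) t1); [reflexivity|lra].
Qed.

Lemma glued_snd t (k : Z) : IZR k * T + t1 <= t <= IZR k * T + T -> phi t = f2 (t - IZR k * T - t1).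
Proof.
  intros H. destruct (Req_dec t (IZR k * T + T)) as [E|N].
  - rewrite (glued_fst t (k + 1)).
    + rewrite plus_IZR. replace (t - (IZR k + 1) * T) with 0 by lra.
      replace (t - IZR k * T - t1) with t2 by (unfold T in E; unfold T; lra). congruence.
    + rewrite plus_IZR. lra.
  - unfold phi, glued. fold T. rewrite (Int_part_period t k) by lra.
    rewrite (Rmult_comm T). destruct (Rle_dec (t - IZR k * T) t1); [|reflexivity].
    replace (t - IZR k * T) with t1 by lra. rewrite Rminus_diag. congruence.
Qed.

Lemma glued_periodic t : phi (t + T) = phi t.
Proof.
  destruct (period_decomp t) as [k Hk].
  destruct (Rle_lt_dec (t - IZR k * T) t1) as [C|C].
  - rewrite (glued_fst t k) by lra. rewrite (glued_fst (t + T) (k + 1)).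
    + f_equal. rewrite plus_IZR. ring.
    + rewrite plus_IZR. lra.
  - rewrite (glued_snd t k) by lra. rewrite (glued_snd (t + T) (k + 1)).
    + f_equal. rewrite plus_IZR. ring.
    + rewrite plus_IZR. lra.
Qed.

Variable Z : pw_system.
Hypotheses (D1 : forall t, is_derive f1 t (Defs.pos Z (f1 t)))
           (D2 : forall t, is_derive f2 t (Defs.neg Z (f2 t)))
           (S1 : forall t, 0 < t < t1 -> 0 < sw Z (f1 t))
           (S2 : forall t, 0 < t < t2 -> sw Z (f2 t) < 0)
           (Z1 : sw Z (f1 0) = 0) (Z2 : sw Z (f2 0) = 0).

(** Off the junctions the curve is locally one of the two arcs. At a junction the left and right difference quotients
    tend to the two fields, which are the ends of the Filippov segment (l = 0 and l = 1). *)
Lemma glued_solution : solution Z phi.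
Proof.
  assert (HT : T = t1 + t2) by reflexivity.
  intros t. destruct (period_decomp t) as [k Hk].
  destruct (Req_dec t (IZR k * T)) as [C0|C0].
  { assert (Ep : phi t = f1 0) by (rewrite (glued_fst t k) by lra; f_equal; lra).
    rewrite Ep, Z1. repeat split; try lra.
    intros _ eta. apply locally'_ball.
    destruct (is_derive_DQ _ _ _ (D1 0) eta) as [d1 Hd1].
    destruct (is_derive_DQ _ _ _ (D2 t2) eta) as [d2 Hd2].
    exists (mkposreal (Rmin (Rmin d1 d2) (Rmin t1 t2)) ltac:(repeat apply Rmin_pos; try apply cond_pos; assumption)).
    simpl. intros s Hs Hsd.
    assert (Rabs s < d1 /\ Rabs s < d2 /\ Rabs s < t1 /\ Rabs s < t2) as [A1 [A2 [A3 A4]]].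
    { repeat split; eapply Rlt_le_trans; try exact Hsd.
      - eapply Rle_trans; [apply Rmin_l|apply Rmin_l].
      - eapply Rle_trans; [apply Rmin_l|apply Rmin_r].
      - eapply Rle_trans; [apply Rmin_r|apply Rmin_l].
      - eapply Rle_trans; [apply Rmin_r|apply Rmin_r]. }
    apply Rabs_def2 in A3. apply Rabs_def2 in A4.
    destruct (Rlt_le_dec s 0) as [Cs|Cs].
    - exists 0. split; [lra|].
      specialize (Hd2 s Hs A2). unfold DQ in Hd2.
      rewrite (glued_snd (t + s) (k - 1)); rewrite ?minus_IZR; try lra.
      replace (t + s - (IZR k - 1) * T - t1) with (t2 + s) by lra.
      rewrite E2 in Hd2.
      replace (plus _ _) with (Defs.neg Z (f1 0) : R3); [exact Hd2|].
      apply R3_eq; rewrite ?px_plus, ?py_plus, ?pz_plus, ?px_scal, ?py_scal, ?pz_scal; ring.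
    - exists 1. split; [lra|].
      specialize (Hd1 s Hs A1). unfold DQ in Hd1. rewrite Rplus_0_l in Hd1.
      rewrite (glued_fst (t + s) k) by lra.
      replace (t + s - IZR k * T) with s by lra.
      replace (plus _ _) with (Defs.pos Z (f1 0) : R3); [exact Hd1|].
      apply R3_eq; rewrite ?px_plus, ?py_plus, ?pz_plus, ?px_scal, ?py_scal, ?pz_scal; ring. }
  destruct (Req_dec t (IZR k * T + t1)) as [C1|C1].
  { assert (Ep : phi t = f2 0) by (rewrite (glued_snd t k) by lra; f_equal; lra).
    rewrite Ep, Z2. repeat split; try lra.
    intros _ eta. apply locally'_ball.
    destruct (is_derive_DQ _ _ _ (D1 t1) eta) as [d1 Hd1].
    destruct (is_derive_DQ _ _ _ (D2 0) eta) as [d2 Hd2].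
    exists (mkposreal (Rmin (Rmin d1 d2) (Rmin t1 t2)) ltac:(repeat apply Rmin_pos; try apply cond_pos; assumption)).
    simpl. intros s Hs Hsd.
    assert (Rabs s < d1 /\ Rabs s < d2 /\ Rabs s < t1 /\ Rabs s < t2) as [A1 [A2 [A3 A4]]].
    { repeat split; eapply Rlt_le_trans; try exact Hsd.
      - eapply Rle_trans; [apply Rmin_l|apply Rmin_l].
      - eapply Rle_trans; [apply Rmin_l|apply Rmin_r].
      - eapply Rle_trans; [apply Rmin_r|apply Rmin_l].
      - eapply Rle_trans; [apply Rmin_r|apply Rmin_r]. }
    apply Rabs_def2 in A3. apply Rabs_def2 in A4.
    destruct (Rlt_le_dec s 0) as [Cs|Cs].
    - exists 1. split; [lra|].
      specialize (Hd1 s Hs A1). unfold DQ in Hd1.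
      rewrite (glued_fst (t + s) k) by lra.
      replace (t + s - IZR k * T) with (t1 + s) by lra.
      rewrite E1 in Hd1.
      replace (plus _ _) with (Defs.pos Z (f2 0) : R3); [exact Hd1|].
      apply R3_eq; rewrite ?px_plus, ?py_plus, ?pz_plus, ?px_scal, ?py_scal, ?pz_scal; ring.
    - exists 0. split; [lra|].
      specialize (Hd2 s Hs A2). unfold DQ in Hd2. rewrite Rplus_0_l in Hd2.
      rewrite (glued_snd (t + s) k) by lra.
      replace (t + s - IZR k * T - t1) with s by lra.
      replace (plus _ _) with (Defs.neg Z (f2 0) : R3); [exact Hd2|].
      apply R3_eq; rewrite ?px_plus, ?py_plus, ?pz_plus, ?px_scal, ?py_scal, ?pz_scal; ring. }
  destruct (Rlt_le_dec t (IZR k * T + t1)) as [C2|C2].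
  - rewrite (glued_fst t k) by lra.
    assert (P := S1 (t - IZR k * T) ltac:(lra)).
    split; [intros _|split; intros; lra].
    apply (is_derive_ext_near (fun s => f1 (s - IZR k * T)) phi t _
             (Rmin (t - IZR k * T) (IZR k * T + t1 - t))).
    + apply Rmin_pos; lra.
    + intros s Hs. symmetry. apply glued_fst.
      assert (A := Rlt_le_trans _ _ _ Hs (Rmin_l _ _)). assert (B := Rlt_le_trans _ _ _ Hs (Rmin_r _ _)).
      apply Rabs_def2 in A. apply Rabs_def2 in B. lra.
    + apply is_derive_shift_R3. apply D1.
  - rewrite (glued_snd t k) by lra.
    assert (P := S2 (t - IZR k * T - t1) ltac:(lra)).
    split; [intros; lra|split; [intros _|intros; lra]].
    apply (is_derive_ext_near (fun s => f2 (s - (IZR k * T + t1))) phi t _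
             (Rmin (t - (IZR k * T + t1)) (IZR k * T + T - t))).
    + apply Rmin_pos; lra.
    + intros s Hs. symmetry. rewrite (glued_snd s k). { f_equal. ring. }
      assert (A := Rlt_le_trans _ _ _ Hs (Rmin_l _ _)). assert (B := Rlt_le_trans _ _ _ Hs (Rmin_r _ _)).
      apply Rabs_def2 in A. apply Rabs_def2 in B. lra.
    + apply is_derive_shift_R3. replace (t - (IZR k * T + t1)) with (t - IZR k * T - t1) by ring. apply D2.
Qed.

Definition arcs_range (p : R3) : Prop :=
  (exists t, 0 <= t <= t1 /\ f1 t = p) \/ (exists t, 0 <= t <= t2 /\ f2 t = p).

Lemma glued_range : range_of phi arcs_range.
Proof.
  assert (HT : T = t1 + t2) by reflexivity.
  intros p. split.
  - intros [[t [Ht <-]]|[t [Ht <-]]].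
    + exists t. rewrite (glued_fst t 0); [f_equal; ring|lra].
    + exists (t + t1). rewrite (glued_snd (t + t1) 0); [f_equal; ring|lra].
  - intros [t <-]. destruct (period_decomp t) as [k Hk].
    destruct (Rle_lt_dec (t - IZR k * T) t1) as [C|C].
    + left. exists (t - IZR k * T). split; [lra|]. symmetry. apply glued_fst. lra.
    + right. exists (t - IZR k * T - t1). split; [lra|]. symmetry. apply glued_snd. lra.
Qed.

Lemma glued_periodic_solution : f1 0 <> f2 0 -> periodic_solution Z phi T.
Proof.
  intros N. assert (HT : T = t1 + t2) by reflexivity.
  split; [|split; [|split]].
  - apply glued_solution.
  - lra.
  - exact glued_periodic.
  - exists t1. rewrite (glued_fst t1 0), (glued_fst 0 0) by lra.
    replace (t1 - 0 * T) with t1 by ring. replace (0 - 0 * T) with 0 by ring. congruence.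
Qed.

Lemma glued_crossing_orbit : f1 0 <> f2 0 ->
  crossing_point Z (f1 0) -> crossing_point Z (f2 0) -> crossing_periodic_orbit Z arcs_range.
Proof.
  intros N C1 C2. assert (HT : T = t1 + t2) by reflexivity.
  exists phi, t1, T. split; [apply glued_periodic_solution; assumption|]. split; [apply glued_range|].
  split; [lra|]. split.
  { intros t Ht. rewrite (glued_fst t 0) by lra. apply S1. lra. }
  split.
  { intros t Ht. rewrite (glued_snd t 0) by lra. apply S2. lra. }
  rewrite (glued_fst 0 0), (glued_snd t1 0) by lra.
  replace (0 - 0 * T) with 0 by ring. replace (t1 - 0 * T - t1) with 0 by ring. split; assumption.
Qed.
End Glue.

(** * Linear zones and their flows *)

Lemma cont_plus {U : UniformSpace} (f g : U -> R) x :
  continuous f x -> continuous g x -> continuous (fun s => f s + g s) x.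
Proof. exact (continuous_plus f g x). Qed.
Lemma cont_minus {U : UniformSpace} (f g : U -> R) x :
  continuous f x -> continuous g x -> continuous (fun s => f s - g s) x.
Proof. exact (continuous_minus f g x). Qed.
Lemma cont_mult {U : UniformSpace} (f g : U -> R) x :
  continuous f x -> continuous g x -> continuous (fun s => f s * g s) x.
Proof. exact (continuous_mult f g x). Qed.
Lemma cont_const {U : UniformSpace} (k : R) (x : U) : continuous (fun _ => k) x.
Proof. exact (continuous_const k x). Qed.

Lemma cont_comp {U : UniformSpace} (f : R -> R) (g : U -> R) u :
  continuous g u -> continuous f (g u) -> continuous (fun v => f (g v)) u.
Proof. intros H1 H2. exact (continuous_comp g f u H1 H2). Qed.
Lemma cont_opp {U : UniformSpace} (g : U -> R) u : continuous g u -> continuous (fun v => - g v) u.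
Proof. exact (continuous_opp g u). Qed.
Lemma cont_div_const {U : UniformSpace} (g : U -> R) k u : continuous g u -> continuous (fun v => g v / k) u.
Proof. intros H. apply (cont_mult g (fun _ => / k)); [exact H|apply cont_const]. Qed.
Lemma cont_div {U : UniformSpace} (f g : U -> R) u : g u <> 0 -> continuous f u -> continuous g u -> continuous (fun v => f v / g v) u.
Proof.
  intros N Hf Hg. apply (cont_mult f (fun v => / g v)); [exact Hf|]. apply (cont_comp Rinv g); [exact Hg|].
  apply continuity_pt_filterlim. apply (continuity_pt_inv (fun x => x)); [apply continuity_pt_id|exact N].
Qed.
Lemma cont_pow {U : UniformSpace} (g : U -> R) n u : continuous g u -> continuous (fun v => g v ^ n) u.
Proof. intros H. induction n; simpl; [apply cont_const|apply cont_mult; assumption]. Qed.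
Lemma cont_abs {U : UniformSpace} (g : U -> R) u : continuous g u -> continuous (fun v => Rabs (g v)) u.
Proof. intros H. apply (cont_comp Rabs g); [exact H|]. apply continuity_pt_filterlim, Rcontinuity_abs. Qed.
Lemma cont_D (f : R -> R) x : ex_derive f x -> continuous f x.
Proof. exact (ex_derive_continuous f x). Qed.

Ltac ctac := repeat lazymatch goal with
  | |- continuous (fun _ => ?c) _ => apply cont_const
  | |- continuous (fun v => @?f v + @?g v) _ => apply (cont_plus f g)
  | |- continuous (fun v => @?f v - @?g v) _ => apply (cont_minus f g)
  | |- continuous (fun v => @?f v * @?g v) _ => apply (cont_mult f g)
  | |- continuous (fun v => - @?f v) _ => apply (cont_opp f)
  | |- continuous (fun v => @?f v / ?k) _ => apply (cont_div_const f k)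
  | |- continuous (fun v => @?f v ^ ?n) _ => apply (cont_pow f n)
  | |- continuous (fun v => Rabs (@?f v)) _ => apply (cont_abs f)
  | H : continuous ?f ?u |- continuous ?f ?u => exact H
  | |- _ => first [assumption | fail 1]
  end.

(** Parameters of one perturbed zone: zm is -1 where sw > 0 and +1 where sw < 0. In the coordinates tY, tw, centred at
    the unperturbed equilibrium of the plane, the perturbation is chosen so that the planar part stays autonomous: zl
    is half its divergence, zn deforms circles into ellipses, zk displaces the centre. The coordinate x is forced by
    the affine function zg0 + zg1 tY + zg2 tw. All flows are then explicit. *)
Record zone : Type := Zone {
  zm : R; zl : R; zn : R; zk : R; zg0 : R; zg1 : R; zg2 : R }.

(** The shifts by x/2 remove x from the planar part of the unperturbed field. *)
Definition tY (p : R3) : R := py p + px p / 2.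
Definition tw (Z : zone) (p : R3) : R := pz p - px p / 2 - zm Z.

Definition field (Z : zone) (eps : R) (p : R3) : R3 :=
  let g := zg0 Z + zg1 Z * tY p + zg2 Z * tw Z p in
  (px p + eps * g,
   - pz p + zm Z + eps * ((zl Z + zn Z) * tY p - g / 2),
   px p + py p + eps * (zk Z + (zl Z - zn Z) * tw Z p + g / 2)).

Definition zg (Z : zone) p := zg0 Z + zg1 Z * tY p + zg2 Z * tw Z p.
Lemma px_field Z eps p : px (field Z eps p) = px p + eps * zg Z p. Proof. reflexivity. Qed.
Lemma py_field Z eps p : py (field Z eps p) = - pz p + zm Z + eps * ((zl Z + zn Z) * tY p - zg Z p / 2).
Proof. reflexivity. Qed.
Lemma pz_field Z eps p : pz (field Z eps p) = px p + py p + eps * (zk Z + (zl Z - zn Z) * tw Z p + zg Z p / 2).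
Proof. reflexivity. Qed.

Section Zone.
Variables (Z : zone) (eps : R).
Definition cDl := 1 + eps ^ 2 * (zl Z ^ 2 - zn Z ^ 2).
Definition cdet := (eps * (zl Z + zn Z) - 1) * (eps * (zl Z - zn Z) - 1) + 1.
(** Angular velocity of the perturbed planar rotation. *)
Definition om := sqrt (1 - eps ^ 2 * zn Z ^ 2).
(** The conditions under which the centre, the invariant plane and the frequency below exist; they hold for small eps.
    *)
Definition zgood := cDl <> 0 /\ cdet <> 0 /\ 0 < 1 - eps ^ 2 * zn Z ^ 2.
(** (eps y1, eps w1) is the centre of the perturbed rotation. *)
Definition y1 := - zk Z / cDl.
Definition w1 := eps * (zl Z + zn Z) * y1.
(** The plane x = eps (cP dY + cQ dw + cR) is invariant: the linear system solved by cP and cQ says that the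
    transverse coordinate cH satisfies H' = H. *)
Definition cP := ((eps * (zl Z - zn Z) - 1) * zg1 Z - zg2 Z) / cdet.
Definition cQ := (zg1 Z + (eps * (zl Z + zn Z) - 1) * zg2 Z) / cdet.
Definition cR := - (zg0 Z + zg1 Z * (eps * y1) + zg2 Z * (eps * w1)).

Definition dY p := tY p - eps * y1.
Definition dw p := tw Z p - eps * w1.
(** In the coordinates cU, cV the planar part is a multiple of a rotation; cH is the distance to the invariant plane.
    *)
Definition cU p := dY p - eps * zn Z * dw p.
Definition cV p := om * dw p.
Definition cH p := px p - eps * (cP * dY p + cQ * dw p + cR).

(** Inverse of the coordinate change (cH, cU, cV). *)
Definition zinv (h u v : R) : R3 :=
  let w := v / om in let Y := u + eps * zn Z * w in
  let x := h + eps * (cP * Y + cQ * w + cR) in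
  (x, Y + eps * y1 - x / 2, w + eps * w1 + zm Z + x / 2).

Definition flow (t : R) (p : R3) : R3 :=
  zinv (exp t * cH p)
       (exp (eps * zl Z * t) * (cU p * cos (om * t) - cV p * sin (om * t)))
       (exp (eps * zl Z * t) * (cU p * sin (om * t) + cV p * cos (om * t))).

Hypothesis G : zgood.

Lemma om_pos : 0 < om. Proof. apply sqrt_lt_R0, G. Qed.
Lemma om_sqr : om * om = 1 - eps ^ 2 * zn Z ^ 2.
Proof. apply sqrt_sqrt. destruct G as [_ [_ H]]. lra. Qed.

Lemma center_eq : y1 + zk Z + (zl Z - zn Z) * (eps * w1) = 0.
Proof. unfold w1, y1. pose proof (proj1 G). unfold cDl in *. field. assumption. Qed.

Lemma cP_eq : (eps * (zl Z + zn Z) - 1) * cP + cQ = zg1 Z.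
Proof. unfold cP, cQ. pose proof (proj1 (proj2 G)). unfold cdet in *. field. assumption. Qed.
Lemma cQ_eq : - cP + (eps * (zl Z - zn Z) - 1) * cQ = zg2 Z.
Proof. unfold cP, cQ. pose proof (proj1 (proj2 G)). unfold cdet in *. field. assumption. Qed.

Lemma zinv_coords p : zinv (cH p) (cU p) (cV p) = p.
Proof.
  pose proof om_pos. unfold zinv, cH, cU, cV.
  replace (om * dw p / om) with (dw p) by (field; lra).
  apply R3_eq; unfold px, py, pz; simpl; fold (px p) (py p) (pz p); unfold dY, dw, tY, tw; field.
Qed.

Lemma dw_zinv h u v : dw (zinv h u v) = v / om.
Proof. unfold dw, tw, zinv, px, pz. simpl. field. pose proof om_pos; lra. Qed.
Lemma dY_zinv h u v : dY (zinv h u v) = u + eps * zn Z * (v / om).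
Proof. unfold dY, tY, zinv, px, py. simpl. field. pose proof om_pos; lra. Qed.
Lemma cU_zinv h u v : cU (zinv h u v) = u.
Proof. unfold cU. rewrite dY_zinv, dw_zinv. ring. Qed.
Lemma cV_zinv h u v : cV (zinv h u v) = v.
Proof. unfold cV. rewrite dw_zinv. field. pose proof om_pos; lra. Qed.
Lemma cH_zinv h u v : cH (zinv h u v) = h.
Proof. unfold cH. rewrite dY_zinv, dw_zinv. unfold zinv, px. simpl. ring. Qed.

Lemma coords_inj p q : cH p = cH q -> cU p = cU q -> cV p = cV q -> p = q.
Proof. intros A B C. rewrite <- (zinv_coords p), <- (zinv_coords q). congruence. Qed.

Lemma flow_0 p : flow 0 p = p.
Proof.
  unfold flow. rewrite !Rmult_0_r, exp_0, cos_0, sin_0.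
  rewrite <- (zinv_coords p) at 6. f_equal; ring.
Qed.

Lemma cH_flow t p : cH (flow t p) = exp t * cH p.
Proof. apply cH_zinv. Qed.
Lemma cU_flow t p : cU (flow t p) = exp (eps * zl Z * t) * (cU p * cos (om * t) - cV p * sin (om * t)).
Proof. apply cU_zinv. Qed.
Lemma cV_flow t p : cV (flow t p) = exp (eps * zl Z * t) * (cU p * sin (om * t) + cV p * cos (om * t)).
Proof. apply cV_zinv. Qed.

Lemma vY_field p : py (field Z eps p) + px (field Z eps p) / 2 = - dw p + eps * (zl Z + zn Z) * dY p.
Proof. rewrite px_field, py_field. unfold dw, dY, w1, tw, tY. field. Qed.
Lemma vw_field p : pz (field Z eps p) - px (field Z eps p) / 2 = dY p + eps * (zl Z - zn Z) * dw p.
Proof.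
  pose proof (center_eq) as C2. apply (f_equal (Rmult eps)) in C2. rewrite Rmult_0_r in C2.
  apply Rminus_diag_uniq. rewrite <- C2.
  rewrite px_field, pz_field. unfold dw, dY, tw, tY. field.
Qed.
Lemma dU_field p :
  (py (field Z eps p) + px (field Z eps p) / 2) - eps * zn Z * (pz (field Z eps p) - px (field Z eps p) / 2)
  = eps * zl Z * cU p - om * cV p.
Proof.
  replace (om * cV p) with ((om * om) * dw p) by (unfold cV; ring). rewrite om_sqr, vY_field, vw_field.
  unfold cU. ring.
Qed.
Lemma dV_field p :
  om * (pz (field Z eps p) - px (field Z eps p) / 2) = eps * zl Z * cV p + om * cU p.
Proof. rewrite vw_field. unfold cU, cV. ring. Qed.
Lemma dH_field p :
  px (field Z eps p) - eps * (cP * (py (field Z eps p) + px (field Z eps p) / 2)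
      + cQ * (pz (field Z eps p) - px (field Z eps p) / 2)) = cH p.
Proof.
  rewrite vY_field, vw_field.
  replace (px (field Z eps p)) with (px p + eps * (zg0 Z + zg1 Z * (dY p + eps * y1) + zg2 Z * (dw p + eps * w1))).
  - unfold cH, cR. rewrite <- cP_eq, <- cQ_eq. ring.
  - rewrite px_field. unfold zg, dY, dw. ring.
Qed.

(** The field is diagonal in these coordinates: H' = H, U' = eps l U - om V, V' = eps l V + om U. *)
Lemma derive_coords phi t : is_derive phi t (field Z eps (phi t)) ->
  is_derive (fun s => cH (phi s)) t (cH (phi t)) /\
  is_derive (fun s => cU (phi s)) t (eps * zl Z * cU (phi t) - om * cV (phi t)) /\
  is_derive (fun s => cV (phi s)) t (eps * zl Z * cV (phi t) + om * cU (phi t)).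
Proof.
  intros H.
  pose proof (is_derive_px _ _ _ H) as Hx. pose proof (is_derive_py _ _ _ H) as Hy.
  pose proof (is_derive_pz _ _ _ H) as Hz.
  rewrite <- (dH_field (phi t)) at 1. rewrite <- dU_field, <- dV_field.
  set (fx := px (field Z eps (phi t))) in *. set (fy := py (field Z eps (phi t))) in *.
  set (fz := pz (field Z eps (phi t))) in *.
  set (X := fun s => px (phi s)) in *. set (Y := fun s => py (phi s)) in *. set (W := fun s => pz (phi s)) in *.
  assert (E : forall f l, is_derive f t l -> ex_derive f t /\ Derive f t = l).
  { intros f l Hf. split; [exists l; exact Hf|apply is_derive_unique; exact Hf]. }
  destruct (E _ _ Hx) as [Ex1 Ex2]. destruct (E _ _ Hy) as [Ey1 Ey2]. destruct (E _ _ Hz) as [Ez1 Ez2].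
  split; [|split].
  - apply (is_derive_ext (fun s => X s - eps * (cP * (Y s + X s / 2 - eps * y1) + cQ * (W s - X s / 2 - zm Z - eps * w1) + cR)));
      [reflexivity|].
    auto_derive; [repeat split; assumption|].
    change (fun x => X x) with X; change (fun x => Y x) with Y; change (fun x => W x) with W; rewrite Ex2, Ey2, Ez2; field.
  - apply (is_derive_ext (fun s => (Y s + X s / 2 - eps * y1) - eps * zn Z * (W s - X s / 2 - zm Z - eps * w1)));
      [reflexivity|].
    auto_derive; [repeat split; assumption|].
    change (fun x => X x) with X; change (fun x => Y x) with Y; change (fun x => W x) with W; rewrite Ex2, Ey2, Ez2; field.
  - apply (is_derive_ext (fun s => om * (W s - X s / 2 - zm Z - eps * w1)));
      [reflexivity|].
    auto_derive; [repeat split; assumption|].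
    change (fun x => X x) with X; change (fun x => Y x) with Y; change (fun x => W x) with W; rewrite Ex2, Ez2; field.
Qed.

Lemma const_interval (f : R -> R) a b : a <= b -> (forall t, a <= t <= b -> continuous f t) ->
  (forall t, a < t < b -> is_derive f t 0) -> f a = f b.
Proof.
  intros Hab Hc Hd. destruct (Req_dec a b) as [->|N]; [reflexivity|].
  destruct (MVT_gen f a b (fun _ => 0)) as [x [_ Hx]].
  - intros x Hx. rewrite Rmin_left, Rmax_right in Hx by lra. apply Hd. lra.
  - intros x Hx. rewrite Rmin_left, Rmax_right in Hx by lra. apply continuity_pt_filterlim, Hc. lra.
  - lra.
Qed.

Lemma coords_cont phi t : curve_cont phi t -> continuous (fun s => cH (phi s)) t /\ continuous (fun s => cU (phi s)) t /\
  continuous (fun s => cV (phi s)) t.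
Proof.
  intros H. pose proof (curve_cont_px _ _ H). pose proof (curve_cont_py _ _ H). pose proof (curve_cont_pz _ _ H).
  unfold cH, cU, cV, dY, dw, tY, tw. split; [|split]; ctac.
Qed.

(** The vector (u, v), rotated back by the angle o t and rescaled, is constant; this is its first component. *)
Lemma spiral_integral (u v : R -> R) l o a b : a <= b -> (forall t, continuous u t /\ continuous v t) ->
  (forall t, a < t < b -> is_derive u t (l * u t - o * v t) /\ is_derive v t (l * v t + o * u t)) ->
  exp (- (l * a)) * (u a * cos (o * a) + v a * sin (o * a)) = exp (- (l * b)) * (u b * cos (o * b) + v b * sin (o * b)).
Proof.
  intros Hab C H.
  apply (const_interval (fun t => exp (- (l * t)) * (u t * cos (o * t) + v t * sin (o * t)))); [exact Hab| |].
  - intros t _. destruct (C t) as [C1 C2].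
    assert (continuous (fun t => exp (- (l * t))) t) by (apply cont_D; auto_derive; exact I).
    assert (continuous (fun t => cos (o * t)) t) by (apply cont_D; auto_derive; exact I).
    assert (continuous (fun t => sin (o * t)) t) by (apply cont_D; auto_derive; exact I). ctac.
  - intros t Ht. destruct (H t Ht) as [D1 D2].
    auto_derive; [split; [eexists; exact D1|split; [eexists; exact D2|exact I]]|].
    change (fun x => u x) with u; change (fun x => v x) with v.
    rewrite (is_derive_unique u _ _ D1), (is_derive_unique v _ _ D2). ring.
Qed.

(** Uniqueness for the linear system, by its first integrals. The derivative is only required inside the interval: at
    the endpoints an orbit of the piecewise system sits on the manifold and need not be differentiable. *)
Lemma zone_unique_le phi a b : a <= b -> (forall t, curve_cont phi t) ->
  (forall t, a < t < b -> is_derive phi t (field Z eps (phi t))) ->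
  phi b = flow (b - a) (phi a) /\ phi a = flow (a - b) (phi b).
Proof.
  intros Hab Hc Hd. set (l := eps * zl Z).
  assert (CH := fun t => coords_cont phi t (Hc t)). assert (DD := fun t Ht => derive_coords phi t (Hd t Ht)).
  assert (I1 : exp (- a) * cH (phi a) = exp (- b) * cH (phi b)).
  { apply (const_interval (fun t => exp (- t) * cH (phi t))); [exact Hab| |].
    - intros t _. apply (cont_mult (fun t => exp (- t))); [apply cont_D; auto_derive; exact I|exact (proj1 (CH t))].
    - intros t Ht. destruct (DD t Ht) as [D _]. set (f := fun s => cH (phi s)) in *.
      apply (is_derive_ext (fun t => exp (- t) * f t)); [reflexivity|].
      auto_derive; [exists (cH (phi t)); exact D|].
      change (fun x => f x) with f. rewrite (is_derive_unique f _ _ D). unfold f. ring. }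
  assert (I2 := spiral_integral (fun t => cU (phi t)) (fun t => cV (phi t)) l om a b Hab (fun t => proj2 (CH t)) (fun t Ht => proj2 (DD t Ht))).
  (* the plane rotated by a quarter turn obeys the same equation *)
  assert (I3 : exp (- (l * a)) * (cV (phi a) * cos (om * a) + - cU (phi a) * sin (om * a))
             = exp (- (l * b)) * (cV (phi b) * cos (om * b) + - cU (phi b) * sin (om * b))).
  { apply (spiral_integral (fun t => cV (phi t)) (fun t => - cU (phi t)) l om a b Hab).
    - intros t. destruct (CH t) as [_ [C1 C2]]. split; [exact C2|apply (cont_opp (fun s => cU (phi s))); exact C1].
    - intros t Ht. destruct (DD t Ht) as [_ [D1 D2]]. split.
      + replace (l * cV (phi t) - om * - cU (phi t)) with (l * cV (phi t) + om * cU (phi t)) by ring. exact D2.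
      + replace (l * - cU (phi t) + om * cV (phi t)) with (- (l * cU (phi t) - om * cV (phi t))) by ring.
        exact (is_derive_opp (fun s => cU (phi s)) t _ D1). }
  cbv beta in I2.
  assert (K : forall t1 t2,
     exp (- t1) * cH (phi t1) = exp (- t2) * cH (phi t2) ->
     exp (- (l * t1)) * (cU (phi t1) * cos (om * t1) + cV (phi t1) * sin (om * t1))
     = exp (- (l * t2)) * (cU (phi t2) * cos (om * t2) + cV (phi t2) * sin (om * t2)) ->
     exp (- (l * t1)) * (cV (phi t1) * cos (om * t1) + - cU (phi t1) * sin (om * t1))
     = exp (- (l * t2)) * (cV (phi t2) * cos (om * t2) + - cU (phi t2) * sin (om * t2)) ->
     phi t2 = flow (t2 - t1) (phi t1)).
  { clear - G. intros t1 t2 J1 J2 J3.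
    assert (Sc : sin (om * t2) * sin (om * t2) + cos (om * t2) * cos (om * t2) = 1) by apply sin2_cos2.
    assert (Ee : exp (l * t2) * exp (- (l * t2)) = 1) by (rewrite <- exp_plus, Rplus_opp_r; apply exp_0).
    apply coords_inj; [rewrite cH_flow|rewrite cU_flow|rewrite cV_flow]; fold l;
      replace (om * (t2 - t1)) with (om * t2 - om * t1) by ring; replace (l * (t2 - t1)) with (l * t2 + - (l * t1)) by ring;
      rewrite ?cos_minus, ?sin_minus, ?exp_plus.
    - replace (t2 - t1) with (t2 + - t1) by ring. rewrite exp_plus, Rmult_assoc, J1, <- Rmult_assoc, <- exp_plus, Rplus_opp_r, exp_0. ring.
    - match goal with |- _ = ?r => replace r with (exp (l * t2) * (
        cos (om * t2) * (exp (- (l * t1)) * (cU (phi t1) * cos (om * t1) + cV (phi t1) * sin (om * t1))) -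
        sin (om * t2) * (exp (- (l * t1)) * (cV (phi t1) * cos (om * t1) + - cU (phi t1) * sin (om * t1))))) by ring end.
      rewrite J2, J3.
      match goal with |- ?p = ?r => replace r with ((exp (l * t2) * exp (- (l * t2))) * (p * (sin (om * t2) * sin (om * t2) + cos (om * t2) * cos (om * t2)))) by ring end.
      rewrite Sc, Ee. ring.
    - match goal with |- _ = ?r => replace r with (exp (l * t2) * (
        sin (om * t2) * (exp (- (l * t1)) * (cU (phi t1) * cos (om * t1) + cV (phi t1) * sin (om * t1))) +
        cos (om * t2) * (exp (- (l * t1)) * (cV (phi t1) * cos (om * t1) + - cU (phi t1) * sin (om * t1))))) by ring end.
      rewrite J2, J3.
      match goal with |- ?p = ?r => replace r with ((exp (l * t2) * exp (- (l * t2))) * (p * (sin (om * t2) * sin (om * t2) + cos (om * t2) * cos (om * t2)))) by ring end.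
      rewrite Sc, Ee. ring. }
  split; apply K; first [assumption | symmetry; assumption].
Qed.

Lemma flow_derive t p : is_derive (fun s => flow s p) t (field Z eps (flow t p)).
Proof.
  pose proof om_pos as Ho.
  set (q := flow t p).
  pose proof (dH_field q) as EH.
  set (l := eps * zl Z) in *.
  set (fu := fun s => exp (l * s) * (cU p * cos (om * s) - cV p * sin (om * s))).
  set (fv := fun s => exp (l * s) * (cU p * sin (om * s) + cV p * cos (om * s))).
  set (fh := fun s => exp s * cH p).
  assert (Dh : is_derive fh t (fh t)) by (unfold fh; auto_derive; [exact I|ring]).
  assert (Du : is_derive fu t (l * fu t - om * fv t)) by (unfold fu, fv; auto_derive; [exact I|ring]).
  assert (Dv : is_derive fv t (l * fv t + om * fu t)) by (unfold fu, fv; auto_derive; [exact I|ring]).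
  assert (HU : cU q = fu t) by apply cU_flow. assert (HV : cV q = fv t) by apply cV_flow.
  assert (HH : cH q = fh t) by apply cH_flow.
  pose proof (dU_field q) as EU. pose proof (dV_field q) as EV. rewrite HU, HV in EU, EV. rewrite HH in EH. fold l in EU, EV.
  assert (E : forall f l, is_derive f t l -> ex_derive f t /\ Derive f t = l).
  { intros f k Hf. split; [exists k; exact Hf|apply is_derive_unique; exact Hf]. }
  destruct (E _ _ Dh) as [Dh1 Dh2]. destruct (E _ _ Du) as [Du1 Du2]. destruct (E _ _ Dv) as [Dv1 Dv2].
  set (X := px (field Z eps q)) in *. set (Y := py (field Z eps q)) in *. set (W := pz (field Z eps q)) in *.
  set (dv := l * fv t + om * fu t) in *. set (du := l * fu t - om * fv t) in *.
  assert (Fw : W - X / 2 = dv / om). { rewrite <- EV. field. lra. }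
  assert (FY : Y + X / 2 = du + eps * zn Z * (dv / om)). { rewrite <- Fw, <- EU. ring. }
  assert (FX : X = fh t + eps * (cP * (du + eps * zn Z * (dv / om)) + cQ * (dv / om))).
  { rewrite FY, Fw in EH. lra. }
  apply is_derive_R3.
  - apply is_derive_ext with (fun s => fh s + eps * (cP * (fu s + eps * zn Z * (fv s / om)) + cQ * (fv s / om) + cR)).
    { intros s. reflexivity. }
    auto_derive; [repeat split; assumption|].
    change (Derive (fun x => fh x) t) with (Derive fh t). change (Derive (fun x => fu x) t) with (Derive fu t).
    change (Derive (fun x => fv x) t) with (Derive fv t). rewrite Dh2, Du2, Dv2.
    transitivity X; [|reflexivity]. rewrite FX. field. lra.
  - apply is_derive_ext with (fun s => (fu s + eps * zn Z * (fv s / om)) + eps * y1 - (fh s + eps * (cP * (fu s + eps * zn Z * (fv s / om)) + cQ * (fv s / om) + cR)) / 2).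
    { intros s. reflexivity. }
    auto_derive; [repeat split; assumption|].
    change (Derive (fun x => fh x) t) with (Derive fh t). change (Derive (fun x => fu x) t) with (Derive fu t).
    change (Derive (fun x => fv x) t) with (Derive fv t). rewrite Dh2, Du2, Dv2.
    transitivity Y; [|reflexivity]. replace Y with ((Y + X / 2) - X / 2) by ring. rewrite FY, FX. field. lra.
  - apply is_derive_ext with (fun s => fv s / om + eps * w1 + zm Z + (fh s + eps * (cP * (fu s + eps * zn Z * (fv s / om)) + cQ * (fv s / om) + cR)) / 2).
    { intros s. reflexivity. }
    auto_derive; [repeat split; assumption|].
    change (Derive (fun x => fh x) t) with (Derive fh t). change (Derive (fun x => fu x) t) with (Derive fu t).
    change (Derive (fun x => fv x) t) with (Derive fv t). rewrite Dh2, Du2, Dv2.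
    transitivity W; [|reflexivity]. replace W with ((W - X / 2) + X / 2) by ring. rewrite Fw, FX. field. lra.
Qed.
End Zone.

(** * Smooth germs and flat functions *)

Lemma der_const (c u : R) : is_derive (fun _ : R => c) u 0.
Proof. auto_derive; [exact I|reflexivity]. Qed.
Lemma der_ext (f g : R -> R) (u l : R) : (forall v : R, f v = g v) -> is_derive f u l -> is_derive g u l.
Proof. exact (is_derive_ext f g u l). Qed.
Lemma der_plus (f g : R -> R) (u a b : R) : is_derive f u a -> is_derive g u b -> is_derive (fun v => f v + g v) u (a + b).
Proof. exact (is_derive_plus f g u a b). Qed.
Lemma der_minus (f g : R -> R) (u a b : R) : is_derive f u a -> is_derive g u b -> is_derive (fun v => f v - g v) u (a - b).
Proof. exact (is_derive_minus f g u a b). Qed.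
Lemma der_id (u : R) : is_derive (fun v : R => v) u 1.
Proof. auto_derive; [exact I|reflexivity]. Qed.

(** All that the flatness argument uses of smoothness, in a form closed under the operations at hand. *)
Fixpoint sm (n : nat) (r : R) (f : R -> R) : Prop :=
  (exists C, forall u, Rabs u < r -> Rabs (f u) <= C) /\
  match n with
  | O => True
  | S m => exists f', (forall u, Rabs u < r -> is_derive f u (f' u)) /\ sm m r f'
  end.

Lemma sm_bound n r f : sm n r f -> exists C, 0 <= C /\ forall u, Rabs u < r -> Rabs (f u) <= C.
Proof.
  intros H. assert (B : exists C, forall u, Rabs u < r -> Rabs (f u) <= C) by (destruct n; apply H).
  destruct B as [C HC]. exists (Rabs C). split; [apply Rabs_pos|]. intros u Hu.
  eapply Rle_trans; [apply HC, Hu|apply Rle_abs].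
Qed.

Lemma sm_S n r f : sm (S n) r f -> sm n r f.
Proof.
  revert f. induction n; intros f [B [f' [D H]]].
  - split; [exact B|exact I].
  - split; [exact B|]. exists f'. split; [exact D|]. apply IHn, H.
Qed.

Lemma sm_ext n r f g : (forall u, f u = g u) -> sm n r f -> sm n r g.
Proof.
  intros E. destruct n; intros [[C B] H].
  - split; [|exact I]. exists C. intros u Hu. rewrite <- E. auto.
  - split. { exists C. intros u Hu. rewrite <- E. auto. }
    destruct H as [f' [D H]]. exists f'. split; [|exact H].
    intros u Hu. apply (der_ext f g); auto.
Qed.

Lemma sm_const n r c : sm n r (fun _ => c).
Proof.
  revert c. induction n; intros c; (split; [exists (Rabs c); intros; lra|]).
  - exact I.
  - exists (fun _ => 0). split; [|apply IHn]. intros u _. apply der_const.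
Qed.

Lemma sm_id n r : sm n r (fun u => u).
Proof.
  destruct n; (split; [exists r; intros; lra|]).
  - exact I.
  - exists (fun _ => 1). split; [|apply sm_const]. intros u _. apply der_id.
Qed.

Lemma sm_plus n r f g : sm n r f -> sm n r g -> sm n r (fun u => f u + g u).
Proof.
  revert f g. induction n; intros f g Hf Hg;
  destruct (sm_bound _ _ _ Hf) as [C1 [_ B1]]; destruct (sm_bound _ _ _ Hg) as [C2 [_ B2]];
  (split; [exists (C1 + C2); intros u Hu; eapply Rle_trans; [apply Rabs_triang|]; specialize (B1 u Hu); specialize (B2 u Hu); lra|]).
  - exact I.
  - destruct Hf as [_ [f' [Df Hf]]], Hg as [_ [g' [Dg Hg]]].
    exists (fun u => f' u + g' u). split; [|apply IHn; assumption].
    intros u Hu. exact (is_derive_plus f g u _ _ (Df u Hu) (Dg u Hu)).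
Qed.

Lemma is_derive_mult_R (f g : R -> R) u a b : is_derive f u a -> is_derive g u b ->
  is_derive (fun x => f x * g x) u (a * g u + f u * b).
Proof.
  intros Hf Hg. exact (is_derive_mult f g u a b Hf Hg Rmult_comm).
Qed.

Lemma sm_mult n r f g : sm n r f -> sm n r g -> sm n r (fun u => f u * g u).
Proof.
  revert f g. induction n; intros f g Hf Hg;
  destruct (sm_bound _ _ _ Hf) as [C1 [P1 B1]]; destruct (sm_bound _ _ _ Hg) as [C2 [P2 B2]];
  (split; [exists (C1 * C2); intros u Hu; rewrite Rabs_mult; apply Rmult_le_compat; try apply Rabs_pos; auto|]).
  - exact I.
  - assert (Hf0 := sm_S _ _ _ Hf). assert (Hg0 := sm_S _ _ _ Hg).
    destruct Hf as [_ [f' [Df Hf]]], Hg as [_ [g' [Dg Hg]]].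
    exists (fun u => f' u * g u + f u * g' u). split.
    + intros u Hu. apply is_derive_mult_R; auto.
    + apply sm_plus; apply IHn; assumption.
Qed.

Lemma sm_opp n r f : sm n r f -> sm n r (fun u => - f u).
Proof.
  intros H. apply (sm_ext n r (fun u => (-1) * f u)); [intros; ring|]. apply sm_mult; [apply sm_const|exact H].
Qed.
Lemma sm_minus n r f g : sm n r f -> sm n r g -> sm n r (fun u => f u - g u).
Proof. intros Hf Hg. apply (sm_plus n r f (fun u => - g u)); [exact Hf|apply sm_opp, Hg]. Qed.

Lemma sm_pow n r f k : sm n r f -> sm n r (fun u => f u ^ k).
Proof. intros H. induction k; simpl; [apply sm_const|apply sm_mult; assumption]. Qed.

Lemma sm_exp n r f : sm n r f -> sm n r (fun u => exp (f u)).
Proof.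
  revert f. induction n; intros f Hf;
  destruct (sm_bound _ _ _ Hf) as [C1 [P1 B1]];
  (split; [exists (exp C1); intros u Hu; rewrite Rabs_pos_eq by (left; apply exp_pos);
     destruct (Rle_lt_or_eq_dec (f u) C1) as [L|E];
     [eapply Rle_trans; [apply Rle_abs|apply B1, Hu] | left; apply exp_increasing, L | rewrite E; lra] |]).
  - exact I.
  - assert (Hf0 := sm_S _ _ _ Hf). destruct Hf as [_ [f' [Df Hf]]].
    exists (fun u => f' u * exp (f u)). split.
    + intros u Hu. exact (is_derive_comp exp f u _ _ (is_derive_exp (f u)) (Df u Hu)).
    + apply sm_mult; [exact Hf|apply IHn; exact Hf0].
Qed.

Lemma sm_inv n r f c : 0 < c -> (forall u, Rabs u < r -> c <= f u) -> sm n r f -> sm n r (fun u => / f u).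
Proof.
  intros Hc Hb. revert f Hb. induction n; intros f Hb Hf;
  (split; [exists (/ c); intros u Hu; specialize (Hb u Hu); rewrite Rabs_pos_eq by (left; apply Rinv_0_lt_compat; lra);
     apply Rinv_le_contravar; lra |]).
  - exact I.
  - assert (Hf0 := sm_S _ _ _ Hf). destruct Hf as [_ [f' [Df Hf]]].
    exists (fun u => - f' u * (/ f u * / f u)). split.
    + intros u Hu. specialize (Hb u Hu). 
      replace (- f' u * (/ f u * / f u)) with (- f' u / f u ^ 2) by (field; lra).
      apply is_derive_inv; [auto|lra].
    + apply sm_mult; [apply sm_opp; exact Hf|]. apply sm_mult; apply IHn; assumption.
Qed.

Lemma sm_cosh n r f : sm n r f -> sm n r (fun u => cosh (f u)).
Proof.
  intros H. unfold cosh. apply (sm_mult n r (fun u => exp (f u) + exp (- f u)) (fun _ => / 2)); [|apply sm_const].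
  apply sm_plus; apply sm_exp; [exact H|apply sm_opp, H].
Qed.
Lemma sm_sinh n r f : sm n r f -> sm n r (fun u => sinh (f u)).
Proof.
  intros H. unfold sinh. apply (sm_mult n r (fun u => exp (f u) - exp (- f u)) (fun _ => / 2)); [|apply sm_const].
  apply sm_minus; apply sm_exp; [exact H|apply sm_opp, H].
Qed.

Fixpoint pev (l : list R) (u : R) : R := match l with nil => 0 | a :: l' => a + u * pev l' u end.
(** With pint, u^k times a polynomial has an antiderivative of the same shape, which makes Taylor's formula an
    induction. *)
Fixpoint pint (k : nat) (l : list R) : list R :=
  match l with nil => nil | a :: l' => a / INR k :: pint (S k) l' end.

Lemma pint_length k l : length (pint k l) = length l.
Proof. revert k; induction l; intros k; simpl; [reflexivity|]. f_equal. apply IHl. Qed.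

Lemma pint_derive k l u : is_derive (fun v => v ^ S k * pev (pint (S k) l) v) u (u ^ k * pev l u).
Proof.
  revert k. induction l; intros k.
  - simpl pev. apply (der_ext (fun _ => 0)); [intros; ring|]. rewrite Rmult_0_r. apply der_const.
  - apply (der_ext (fun v => a / INR (S k) * v ^ S k + v ^ S (S k) * pev (pint (S (S k)) l) v)).
    { intros v. cbn [pint pev]. simpl (v ^ S (S k)). simpl (v ^ S k). ring. }
    replace (u ^ k * pev (a :: l) u) with (a / INR (S k) * (INR (S k) * u ^ k) + u ^ S k * pev l u).
    2: { cbn [pev]. simpl (u ^ S k). field. apply not_0_INR. lia. }
    apply (der_plus (fun v => a / INR (S k) * v ^ S k)); [|apply IHl].
    apply (is_derive_scal (fun v => v ^ S k)).
    auto_derive; [exact I|]. simpl pred. rewrite Rmult_1_l. reflexivity.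
Qed.

(** Mean value theorem. *)
Lemma derive_small (f f' : R -> R) r C n : (forall u, Rabs u < r -> is_derive f u (f' u)) -> f 0 = 0 ->
  (forall u, Rabs u < r -> Rabs (f' u) <= C * Rabs u ^ n) -> 0 <= C ->
  forall u, Rabs u < r -> Rabs (f u) <= C * Rabs u ^ S n.
Proof.
  intros D H0 B HC u Hu.
  destruct (MVT_gen f 0 u f') as [x [Hx E]].
  - intros x Hx. apply D. apply Rabs_def1; apply Rabs_def2 in Hu; revert Hx; unfold Rmin, Rmax;
    destruct (Rle_dec 0 u); lra.
  - intros x Hx. apply continuity_pt_filterlim. 
    assert (Hx' : Rabs x < r). { apply Rabs_def1; apply Rabs_def2 in Hu; revert Hx; unfold Rmin, Rmax;
    destruct (Rle_dec 0 u); lra. }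
    apply (ex_derive_continuous f x). exists (f' x). apply D, Hx'.
  - assert (Hxu : Rabs x <= Rabs u).
    { unfold Rmin, Rmax in Hx. unfold Rabs. destruct (Rle_dec 0 u), (Rcase_abs x), (Rcase_abs u); lra. }
    rewrite H0, !Rminus_0_r in E. rewrite E, Rabs_mult. simpl.
    apply Rle_trans with (C * Rabs x ^ n * Rabs u).
    + apply Rmult_le_compat_r; [apply Rabs_pos|]. apply B. lra.
    + rewrite (Rmult_comm (Rabs u)), <- Rmult_assoc. apply Rmult_le_compat_r; [apply Rabs_pos|].
      apply Rmult_le_compat_l; [exact HC|]. apply pow_incr. split; [apply Rabs_pos|exact Hxu].
Qed.

(** Induction on n: integrate the Taylor polynomial of the derivative. *)
Lemma sm_taylor n r f : 0 < r -> sm n r f -> exists l C, length l = n /\ 0 <= C /\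
  forall u, Rabs u < r -> Rabs (f u - pev l u) <= C * Rabs u ^ n.
Proof.
  intros Hr. revert f. induction n; intros f Hf.
  - destruct (sm_bound _ _ _ Hf) as [C [HC B]]. exists nil, C. repeat split; [exact HC|].
    intros u Hu. simpl. rewrite Rminus_0_r, Rmult_1_r. auto.
  - destruct Hf as [_ [f' [D H]]]. destruct (IHn f' H) as [l [C [L [HC B]]]].
    exists (f 0 :: pint 1 l), C. split; [simpl; rewrite pint_length; congruence|]. split; [exact HC|].
    apply (derive_small (fun u => f u - pev (f 0 :: pint 1 l) u) (fun u => f' u - pev l u)); [| |exact B|exact HC].
    + intros u Hu. apply (der_minus f (fun u => pev (f 0 :: pint 1 l) u)); [auto|].
      apply (der_ext (fun v => f 0 + v ^ 1 * pev (pint 1 l) v)).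
      { intros v. simpl. ring. }
      replace (pev l u) with (0 + u ^ 0 * pev l u) by (simpl; ring).
      apply (der_plus (fun _ => f 0)); [apply der_const|]. apply pint_derive.
    + simpl. ring.
Qed.

(** A polynomial with n coefficients that is O(u^n) on one side of 0 vanishes: divide out the constant term
    repeatedly. *)
Lemma pev_small l d C : 0 < d -> (forall u, 0 < u < d -> Rabs (pev l u) <= C * u ^ length l) ->
  List.Forall (fun a => a = 0) l.
Proof.
  intros Hd. revert C. induction l as [|a l IH]; intros C H; [constructor|].
  assert (E : a = 0).
  { destruct (Req_dec a 0) as [|N]; [assumption|exfalso].
    assert (HB : exists B, 0 <= B /\ forall u, 0 < u < 1 -> Rabs (pev l u) <= B).
    { clear. induction l as [|b l [B [HB IH]]].
      - exists 0. split; [lra|]. intros. simpl. rewrite Rabs_R0. lra.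
      - exists (Rabs b + B). split; [pose proof (Rabs_pos b); lra|]. intros u Hu. simpl.
        eapply Rle_trans; [apply Rabs_triang|]. rewrite Rabs_mult, (Rabs_pos_eq u) by lra.
        specialize (IH u Hu). pose proof (Rabs_pos (pev l u)). nra. }
    destruct HB as [B [HB1 HB2]].
    assert (Ha : 0 < Rabs a) by (apply Rabs_pos_lt; assumption).
    set (K := Rabs C + B + 1). assert (HK : 0 < K) by (unfold K; pose proof (Rabs_pos C); lra).
    set (u := Rmin (Rmin (d / 2) (1 / 2)) (Rabs a / (2 * K))).
    assert (Hu0 : 0 < u). { unfold u. repeat apply Rmin_pos; try lra. apply Rdiv_lt_0_compat; lra. }
    assert (Hu1 : u <= d / 2) by (unfold u; eapply Rle_trans; [apply Rmin_l|apply Rmin_l]).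
    assert (Hu2 : u <= 1 / 2) by (unfold u; eapply Rle_trans; [apply Rmin_l|apply Rmin_r]).
    assert (Hu3 : u * K <= Rabs a / 2).
    { assert (u <= Rabs a / (2 * K)) by (unfold u; apply Rmin_r).
      apply (Rmult_le_compat_r K) in H0; [|lra]. replace (Rabs a / (2 * K) * K) with (Rabs a / 2) in H0 by (field; lra). exact H0. }
    specialize (H u ltac:(lra)). specialize (HB2 u ltac:(lra)). simpl in H.
    assert (P : u ^ length l <= 1). { rewrite <- (pow1 (length l)). apply pow_incr. lra. }
    assert (P0 : 0 <= u ^ length l) by (apply pow_le; lra).
    assert (A1 : C * (u * u ^ length l) <= Rabs C * u).
    { pose proof (Rle_abs C). pose proof (Rabs_pos C). apply Rle_trans with (Rabs C * (u * u ^ length l)).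
      - apply Rmult_le_compat_r; [apply Rmult_le_pos; lra|lra].
      - apply Rmult_le_compat_l; [lra|]. nra. }
    assert (A2 : Rabs (u * pev l u) <= u * B). { rewrite Rabs_mult, (Rabs_pos_eq u) by lra. apply Rmult_le_compat_l; lra. }
    assert (A3 : Rabs a <= Rabs (a + u * pev l u) + Rabs (u * pev l u)).
    { replace a with ((a + u * pev l u) + - (u * pev l u)) at 1 by ring. eapply Rle_trans; [apply Rabs_triang|]. rewrite Rabs_Ropp. lra. }
    unfold K in Hu3. nra. }
  subst a. constructor; [reflexivity|]. apply (IH C). intros u Hu. specialize (H u Hu). simpl in H.
  rewrite Rplus_0_l, Rabs_mult, (Rabs_pos_eq u) in H by lra.
  apply Rmult_le_reg_l with u; [lra|]. nra.
Qed.

(** * The Melnikov function *)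

Lemma pev_zero l u : List.Forall (fun a => a = 0) l -> pev l u = 0.
Proof. induction 1; simpl; [reflexivity|]. subst. rewrite IHForall. ring. Qed.

(** A smooth germ that vanishes for u > 0 has zero Taylor polynomial, so it is also O(u^n) for u < 0. This is what
    replaces analyticity. *)
Lemma flat_reflect n r f d : 0 < r -> 0 < d <= r -> sm n r f -> (forall u, 0 < u < d -> f u = 0) ->
  exists C, 0 <= C /\ forall u, Rabs u < r -> Rabs (f u) <= C * Rabs u ^ n.
Proof.
  intros Hr Hd H Hz. destruct (sm_taylor n r f Hr H) as [l [C [L [HC B]]]].
  assert (Z : List.Forall (fun a => a = 0) l).
  { apply (pev_small l d C); [lra|]. intros u Hu. rewrite L.
    specialize (B u ltac:(rewrite Rabs_pos_eq; lra)). rewrite (Hz u Hu), (Rabs_pos_eq u) in B by lra.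
    rewrite Rminus_0_l, Rabs_Ropp in B. exact B. }
  exists C. split; [exact HC|]. intros u Hu. specialize (B u Hu). rewrite (pev_zero l u Z), Rminus_0_r in B. exact B.
Qed.

Lemma pint_zero k l : List.Forall (fun a => a = 0) (pint (S k) l) -> List.Forall (fun a => a = 0) l.
Proof.
  revert k. induction l as [|a l IH]; intros k H; [constructor|]. cbn [pint] in H.
  apply Forall_cons_iff in H. destruct H as [H2 H3]. constructor; [|apply (IH _ H3)].
  apply (Rmult_eq_reg_r (/ INR (S k))); [|apply Rinv_neq_0_compat, not_0_INR; lia].
  unfold Rdiv in H2. rewrite H2. ring.
Qed.

(** The Taylor polynomial of f vanishes, hence so does that of f1. *)
Lemma flat_derive n r f f1 d C : 0 < r -> 0 < d <= r -> sm (S n) r f ->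
  (forall u, Rabs u < r -> is_derive f u (f1 u)) -> (forall u, 0 < u < d -> Rabs (f u) <= C * u ^ S n) ->
  exists C', 0 <= C' /\ forall u, Rabs u < r -> Rabs (f1 u) <= C' * Rabs u ^ n.
Proof.
  intros Hr Hd H D1 Hz. destruct H as [_ [f' [D H]]].
  destruct (sm_taylor n r f' Hr H) as [l [C1 [L [HC B]]]].
  set (g := fun u => f u - pev (f 0 :: pint 1 l) u).
  assert (Bg : forall u, Rabs u < r -> Rabs (g u) <= C1 * Rabs u ^ S n).
  { apply (derive_small g (fun u => f' u - pev l u)); [| |exact B|exact HC].
    - intros u Hu. apply (der_minus f (fun u => pev (f 0 :: pint 1 l) u)); [auto|].
      apply (der_ext (fun v => f 0 + v ^ 1 * pev (pint 1 l) v)).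
      { intros v. simpl. ring. }
      replace (pev l u) with (0 + u ^ 0 * pev l u) by (simpl; ring).
      apply (der_plus (fun _ => f 0)); [apply der_const|]. apply pint_derive.
    - unfold g. simpl. ring. }
  assert (Z : List.Forall (fun a => a = 0) (f 0 :: pint 1 l)).
  { apply (pev_small _ d (C + C1)); [lra|]. intros u Hu. simpl length. rewrite pint_length, L.
    specialize (Bg u ltac:(rewrite Rabs_pos_eq; lra)). rewrite (Rabs_pos_eq u) in Bg by lra.
    specialize (Hz u Hu). unfold g in Bg.
    replace (pev (f 0 :: pint 1 l) u) with (f u - (f u - pev (f 0 :: pint 1 l) u)) by ring.
    eapply Rle_trans; [apply Rabs_triang|]. rewrite Rabs_Ropp. lra. }
  inversion Z; subst. apply pint_zero in H3.
  exists C1. split; [exact HC|]. intros u Hu. specialize (B u Hu).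
  rewrite (pev_zero l u H3), Rminus_0_r in B.
  replace (f1 u) with (f' u); [exact B|].
  rewrite <- (is_derive_unique f u _ (D u Hu)). apply is_derive_unique. auto.
Qed.

(** Half of the transit time of the unperturbed orbit through the zone sw > 0, for the orbit crossing the manifold at
    (0, s, s^2) and (0, -s, s^2). *)
Definition ta (s : R) : R := atan (s / (s ^ 2 + 1)).
(** Half of the transit time through the zone sw < 0; that arc is the longer one, hence the PI. *)
Definition tb (s : R) : R := PI - atan (s / (s ^ 2 - 1)).
(** exp (- ta) Kf and exp ta Kf are the first order x-displacements of the two crossing points. They solve the
    transport equations of x through the two zones, which have a unique solution because x expands. *)
Definition Kf (d0 d1 d2 s : R) : R :=
  ((d0 + d2 * s ^ 2) * sinh (tb s) - d1 * s * cosh (tb s)) / sinh (ta s + tb s).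
(** First order change of the squared radius along one turn, with the radius equations of the two zones weighted so
    that the displacement of the second crossing point cancels, divided by 8 s. The parameter gam = 1 - c enters
    through the term x Y of the quadric. *)
Definition mel (gam kp km nu lp lm d0 d1 d2 s : R) : R :=
  Kf d0 d1 d2 s * (2 * gam * s * cosh (ta s) - sinh (ta s))
  + nu * s * (s ^ 2 + 1) * (2 * s ^ 2 - 1) - kp * s * (2 * s ^ 2 - 1) + km * s * (2 * s ^ 2 + 3)
  - lp * ta s * (s ^ 4 + 3 * s ^ 2 + 1) * (2 * s ^ 2 - 1)
  - lm * tb s * (s ^ 4 - s ^ 2 + 1) * (2 * s ^ 2 + 3).

(** ta (1/u) = al u and tb (1/u) = PI - be u, both odd analytic germs at u = 0: the Melnikov function is studied near
    s = infinity. *)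
Definition al (u : R) : R := atan (u / (1 + u ^ 2)).
Definition be (u : R) : R := atan (u / (1 - u ^ 2)).

Lemma half_sqr u : Rabs u < 1 / 2 -> u ^ 2 < 1 / 4 /\ 0 <= u ^ 2.
Proof. intros H. apply Rabs_def2 in H. split; nra. Qed.

Lemma al_derive u : is_derive al u ((1 - u ^ 2) * / (1 + 3 * u ^ 2 + u ^ 4)).
Proof.
  unfold al. auto_derive.
  - nra.
  - field. repeat split; nra.
Qed.
Lemma be_derive u : Rabs u < 1 / 2 -> is_derive be u ((1 + u ^ 2) * / (1 - u ^ 2 + u ^ 4)).
Proof.
  intros H. apply half_sqr in H. unfold be. auto_derive.
  - nra.
  - field. repeat split; nra.
Qed.

Lemma atan_bnd x : Rabs (atan x) <= 2.
Proof. pose proof (atan_bound x). pose proof PI_4. apply Rabs_le. lra. Qed.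

Lemma sm_poly2 n r a b c : sm n r (fun u => a + b * u ^ 2 + c * u ^ 4).
Proof.
  apply (sm_plus n r (fun u => a + b * u ^ 2) (fun u => c * u ^ 4)).
  - apply (sm_plus n r (fun u => a) (fun u => b * u ^ 2)); [apply sm_const|].
    apply (sm_mult n r (fun _ => b)); [apply sm_const|apply sm_pow, sm_id].
  - apply (sm_mult n r (fun _ => c)); [apply sm_const|apply sm_pow, sm_id].
Qed.

Lemma sm_al n : sm n (1 / 2) al.
Proof.
  destruct n; (split; [exists 2; intros; apply atan_bnd|]); [exact I|].
  exists (fun u => (1 - u ^ 2) * / (1 + 3 * u ^ 2 + u ^ 4)). split; [intros; apply al_derive|].
  apply sm_mult.
  - apply (sm_ext n _ (fun u => 1 + (-1) * u ^ 2 + 0 * u ^ 4)); [intros; ring|apply sm_poly2].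
  - apply (sm_inv n _ (fun u => 1 + 3 * u ^ 2 + u ^ 4) 1); [lra| |].
    + intros u _. nra.
    + apply (sm_ext n _ (fun u => 1 + 3 * u ^ 2 + 1 * u ^ 4)); [intros; ring|apply sm_poly2].
Qed.
Lemma sm_be n : sm n (1 / 2) be.
Proof.
  destruct n; (split; [exists 2; intros; apply atan_bnd|]); [exact I|].
  exists (fun u => (1 + u ^ 2) * / (1 - u ^ 2 + u ^ 4)). split; [intros; apply be_derive; assumption|].
  apply sm_mult.
  - apply (sm_ext n _ (fun u => 1 + 1 * u ^ 2 + 0 * u ^ 4)); [intros; ring|apply sm_poly2].
  - apply (sm_inv n _ (fun u => 1 - u ^ 2 + u ^ 4) (1/2)); [lra| |].
    + intros u Hu. apply half_sqr in Hu. nra.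
    + apply (sm_ext n _ (fun u => 1 + (-1) * u ^ 2 + 1 * u ^ 4)); [intros; ring|apply sm_poly2].
Qed.

Lemma al_odd u : al (- u) = - al u.
Proof. unfold al. rewrite <- atan_opp. f_equal. field. nra. Qed.
Lemma be_odd u : Rabs u < 1 / 2 -> be (- u) = - be u.
Proof. intros H. apply half_sqr in H. unfold be. rewrite <- atan_opp. f_equal. field. nra. Qed.

(** * Linear independence of the Melnikov functions *)

Section Indep.
Variables gam kp km nu lp lm d0 d1 d2 : R.
Hypothesis Hgam : gam = 0 \/ 1 <= gam.

(** With u = 1/s, GG is u^6 sinh (ta + tb) mel. PP collects the odd part and VV the even part of the terms without
    exponentials; the terms from Kf are multiples of WW. *)
Definition PP u := nu * u * (1 + u ^ 2) * (2 - u ^ 2) + (km * (2 + 3 * u ^ 2) - kp * (2 - u ^ 2)) * u ^ 3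
  - lp * al u * (1 + 3 * u ^ 2 + u ^ 4) * (2 - u ^ 2) + lm * be u * (1 - u ^ 2 + u ^ 4) * (2 + 3 * u ^ 2).
Definition VV u := - lm * PI * (1 - u ^ 2 + u ^ 4) * (2 + 3 * u ^ 2).
Definition WW u := u ^ 3 * (2 * gam * cosh (al u) - u * sinh (al u)).
Definition R1 u := (d0 * u ^ 2 + d2) * sinh (al u) + d1 * u * cosh (al u).
Definition GG u := (PP u + VV u) * sinh (PI + al u - be u)
  + WW u * ((d0 * u ^ 2 + d2) * sinh (PI - be u) - d1 * u * cosh (PI - be u)).

Lemma sinh_pos x : 0 < x -> 0 < sinh x.
Proof. intros H. unfold sinh. assert (exp (- x) < exp x) by (apply exp_increasing; lra). lra. Qed.

Lemma al_lt_be u : 0 < u < 1 / 2 -> 0 < al u /\ al u < be u /\ be u < PI / 2.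
Proof.
  intros H. assert (Hs := half_sqr u ltac:(rewrite Rabs_pos_eq; lra)).
  unfold al, be. repeat split.
  - rewrite <- atan_0. apply atan_increasing. apply Rdiv_lt_0_compat; lra.
  - apply atan_increasing. unfold Rdiv. apply Rmult_lt_compat_l; [lra|]. apply Rinv_lt_contravar; nra.
  - apply atan_bound.
Qed.

Lemma mel_GG u : 0 < u < 1 / 2 ->
  u ^ 6 * sinh (PI + al u - be u) * mel gam kp km nu lp lm d0 d1 d2 (/ u) = GG u.
Proof.
  intros H. assert (Hs := half_sqr u ltac:(rewrite Rabs_pos_eq; lra)).
  destruct (al_lt_be u H) as [A1 [A2 A3]].
  assert (Hsh : 0 < sinh (PI + al u - be u)) by (apply sinh_pos; pose proof PI_RGT_0; lra).
  assert (Ea : ta (/ u) = al u) by (unfold ta, al; f_equal; field; split; nra).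
  assert (Eb : tb (/ u) = PI - be u) by (unfold tb, be; do 2 f_equal; field; split; nra).
  unfold mel, Kf. rewrite Ea, Eb.
  replace (al u + (PI - be u)) with (PI + al u - be u) by ring.
  unfold GG, PP, VV, WW. field. split; lra.
Qed.

Ltac smtac := repeat first [apply sm_const | apply sm_id | apply sm_al | apply sm_be
    | apply sm_pow | apply sm_cosh | apply sm_sinh
    | apply sm_opp | apply sm_minus | apply sm_plus | apply sm_mult].

Lemma sm_GG n : sm n (1 / 2) GG.
Proof. unfold GG, PP, VV, WW. smtac. Qed.
Lemma sm_R1 n : sm n (1 / 2) R1.
Proof. unfold R1. smtac. Qed.

(** PP is odd, so a combination of GG u and GG (- u) eliminates it. The exponentials of al and be that multiply WW
    combine into the constant sinh (2 PI). *)
Lemma GG_reflect u : Rabs u < 1 / 2 ->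
  sinh (PI - al u + be u) * GG u + sinh (PI + al u - be u) * GG (- u) =
  2 * VV u * sinh (PI + al u - be u) * sinh (PI - al u + be u) - WW u * sinh (2 * PI) * R1 u.
Proof.
  intros H.
  assert (EP : PP (- u) = - PP u). { unfold PP. rewrite al_odd, be_odd by assumption. ring. }
  assert (EV : VV (- u) = VV u) by (unfold VV; ring).
  assert (EW : WW (- u) = - (u ^ 3 * (2 * gam * cosh (al u) - u * sinh (al u)))).
  { unfold WW. rewrite al_odd. unfold cosh, sinh. rewrite Ropp_involutive. field. }
  unfold GG. rewrite EP, EV, EW, al_odd, be_odd by assumption. unfold WW, R1.
  replace (PI + - al u - - be u) with (PI - al u + be u) by ring.
  replace (PI - - be u) with (PI + be u) by ring.
  set (P := PP u). set (V := VV u). set (a := al u). set (b := be u).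
  set (W := u ^ 3 * (2 * gam * cosh a - u * sinh a)).
  unfold sinh, cosh. replace (2 * PI) with (PI + PI) by ring.
  unfold Rminus. rewrite !Ropp_plus_distr, !Ropp_involutive, !exp_plus, !exp_Ropp.
  pose proof (exp_pos PI). pose proof (exp_pos a). pose proof (exp_pos b). 
  field. repeat split; lra.
Qed.

Variable dl : R.
Hypothesis Hdl : 0 < dl <= 1 / 2.
Hypothesis Hzero : forall u, 0 < u < dl -> GG u = 0.

(** GG vanishes for u > 0 and is therefore flat for u < 0. *)
Lemma GG_flat n : exists C, 0 <= C /\ forall u, 0 < u < dl ->
  Rabs (2 * VV u * sinh (PI + al u - be u) * sinh (PI - al u + be u) - WW u * sinh (2 * PI) * R1 u) <= C * u ^ n.
Proof.
  destruct (flat_reflect n (1 / 2) GG dl ltac:(lra) Hdl (sm_GG n) Hzero) as [C [HC B]].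
  assert (S1 : sm 0 (1 / 2) (fun u => sinh (PI + al u - be u))) by smtac.
  destruct (sm_bound _ _ _ S1) as [C1 [HC1 B1]].
  exists (C1 * C). split; [apply Rmult_le_pos; assumption|]. intros u Hu.
  assert (Hu' : Rabs u < 1 / 2) by (rewrite Rabs_pos_eq; lra).
  rewrite <- GG_reflect by exact Hu'. rewrite (Hzero u Hu), Rmult_0_r, Rplus_0_l, Rabs_mult, Rmult_assoc.
  apply Rmult_le_compat; try apply Rabs_pos; [apply B1, Hu'|].
  specialize (B (- u) ltac:(rewrite Rabs_Ropp; exact Hu')). rewrite Rabs_Ropp, (Rabs_pos_eq u) in B by lra. exact B.
Qed.

Lemma sinh_increasing x y : x < y -> sinh x < sinh y.
Proof.
  intros H. unfold sinh. assert (exp (- y) < exp (- x)) by (apply exp_increasing; lra).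
  assert (exp x < exp y) by (apply exp_increasing; lra). lra.
Qed.

Lemma cosh_ge1 x : 1 <= cosh x.
Proof.
  unfold cosh. pose proof (exp_pos x). rewrite exp_Ropp.
  assert (E : exp x * / exp x = 1) by (apply Rinv_r; lra). assert (0 < / exp x) by (apply Rinv_0_lt_compat; lra).
  pose proof (pow2_ge_0 (exp x - / exp x)). set (e := exp x) in *. set (f := / e) in *. nra.
Qed.

Lemma sinh_ge x : 0 <= x -> x <= sinh x.
Proof.
  intros Hx. destruct (Req_dec x 0) as [->|N]. { rewrite sinh_0. lra. }
  destruct (MVT_gen sinh 0 x cosh) as [c [Hc E]].
  - intros z _. apply is_derive_Reals, derivable_pt_lim_sinh.
  - intros z _. apply derivable_continuous_pt. exists (cosh z). apply derivable_pt_lim_sinh.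
  - rewrite sinh_0, !Rminus_0_r in E. rewrite E.
    pose proof (cosh_ge1 c).
    nra.
Qed.

(** At u = 0 the term with VV tends to a nonzero multiple of lm, while WW = O(u^3). *)
Lemma lm_zero : lm = 0.
Proof.
  destruct (Req_dec lm 0) as [|N]; [assumption|exfalso].
  destruct (GG_flat 1) as [C [HC B]].
  assert (S2 : sm 0 (1 / 2) (fun u => (2 * gam * cosh (al u) - u * sinh (al u)) * sinh (2 * PI) * R1 u)).
  { unfold R1. smtac. }
  destruct (sm_bound _ _ _ S2) as [C2 [HC2 B2]].
  (* m bounds the term with VV from below, uniformly in u; then u is chosen too small for the other terms *)
  assert (Hs1 : 0 < sinh (PI / 2)) by (apply sinh_pos; pose proof PI_RGT_0; lra).
  set (m := Rabs lm * PI * sinh (PI / 2) * sinh (PI / 2)).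
  assert (Hlm : 0 < Rabs lm) by (apply Rabs_pos_lt; assumption).
  assert (Hm : 0 < m). { unfold m. pose proof PI_RGT_0. apply Rmult_lt_0_compat; [|exact Hs1]. apply Rmult_lt_0_compat; [|exact Hs1]. apply Rmult_lt_0_compat; [exact Hlm|lra]. }
  set (u := Rmin (dl / 2) (m / (2 * (C + C2 + 1)))).
  assert (Hu0 : 0 < u). { unfold u. apply Rmin_pos; [lra|]. apply Rdiv_lt_0_compat; lra. }
  assert (Hu1 : u <= dl / 2) by (unfold u; apply Rmin_l).
  assert (Hu2 : u * (C + C2 + 1) <= m / 2).
  { assert (X : u <= m / (2 * (C + C2 + 1))) by (unfold u; apply Rmin_r).
    apply (Rmult_le_compat_r (C + C2 + 1)) in X; [|lra].
    replace (m / (2 * (C + C2 + 1)) * (C + C2 + 1)) with (m / 2) in X by (field; lra). exact X. }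
  assert (Hu : 0 < u < dl) by lra. assert (Hu' : 0 < u < 1 / 2) by lra.
  assert (Hur : Rabs u < 1 / 2) by (rewrite Rabs_pos_eq; lra).
  specialize (B u Hu). specialize (B2 u Hur). rewrite pow_1 in B.
  destruct (al_lt_be u Hu') as [A1 [A2 A3]].
  assert (I1 : sinh (PI / 2) < sinh (PI + al u - be u)) by (apply sinh_increasing; lra).
  assert (I2 : sinh (PI / 2) < sinh (PI - al u + be u)) by (apply sinh_increasing; pose proof PI_RGT_0; lra).
  set (s1 := sinh (PI + al u - be u)) in *. set (s2 := sinh (PI - al u + be u)) in *.
  assert (Hss : sinh (PI / 2) * sinh (PI / 2) <= s1 * s2) by (apply Rmult_le_compat; lra).
  assert (L : m <= Rabs (2 * VV u * s1 * s2)).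
  { unfold VV. destruct (half_sqr u Hur) as [Q1 Q2].
    replace (2 * (- lm * PI * (1 - u ^ 2 + u ^ 4) * (2 + 3 * u ^ 2)) * s1 * s2)
      with (- (lm * (PI * (2 * ((1 - u ^ 2 + u ^ 4) * (2 + 3 * u ^ 2)) * (s1 * s2))))) by ring.
    rewrite Rabs_Ropp, !Rabs_mult. unfold m. rewrite !Rmult_assoc. apply Rmult_le_compat_l; [lra|].
    rewrite (Rabs_pos_eq PI) by (pose proof PI_RGT_0; lra). apply Rmult_le_compat_l; [pose proof PI_RGT_0; lra|].
    rewrite <- !Rabs_mult. rewrite Rabs_pos_eq.
    - assert (1 <= 2 * ((1 - u ^ 2 + u ^ 4) * (2 + 3 * u ^ 2))) by nra.
      assert (0 < sinh (PI / 2) * sinh (PI / 2)) by (apply Rmult_lt_0_compat; assumption).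
      rewrite <- !Rmult_assoc. nra.
    - assert (0 < 2 * ((1 - u ^ 2 + u ^ 4) * (2 + 3 * u ^ 2))) by nra.
      assert (0 < s1 * s2) by nra. rewrite <- !Rmult_assoc. nra. }
  assert (U : Rabs (WW u * sinh (2 * PI) * R1 u) <= C2 * u).
  { unfold WW. replace (u ^ 3 * (2 * gam * cosh (al u) - u * sinh (al u)) * sinh (2 * PI) * R1 u)
      with (u ^ 3 * ((2 * gam * cosh (al u) - u * sinh (al u)) * sinh (2 * PI) * R1 u)) by ring.
    rewrite Rabs_mult, (Rabs_pos_eq (u ^ 3)) by (apply pow_le; lra).
    rewrite (Rmult_comm C2). apply Rmult_le_compat; [apply pow_le; lra|apply Rabs_pos| |exact B2].
    simpl. nra. }
  set (X := 2 * VV u * s1 * s2) in *. set (Y := WW u * sinh (2 * PI) * R1 u) in *.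
  assert (Rabs X <= Rabs (X - Y) + Rabs Y).
  { replace X with ((X - Y) + Y) at 1 by ring. apply Rabs_triang. }
  nra.
Qed.

Lemma atan_ge x : 0 <= x <= 1 -> x / 2 <= atan x.
Proof.
  intros Hx. destruct (Req_dec x 0) as [->|N]. { rewrite atan_0. lra. }
  destruct (MVT_gen atan 0 x (fun z => / (1 + z ^ 2))) as [c [Hc E]].
  - intros z _. auto_derive; [exact I|]. field. nra.
  - intros z _. apply derivable_continuous_pt, derivable_pt_atan.
  - rewrite atan_0, !Rminus_0_r in E. rewrite E. rewrite Rmin_left, Rmax_right in Hc by lra.
    assert (/ 2 <= / (1 + c ^ 2)) by (apply Rinv_le_contravar; nra). nra.
Qed.

Lemma al_ge u : 0 < u < 1 / 2 -> u / 4 <= al u.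
Proof.
  intros Hu. assert (A : u / 2 <= u / (1 + u ^ 2)).
  { unfold Rdiv. apply Rmult_le_compat_l; [lra|]. apply Rinv_le_contravar; nra. }
  assert (B : u / (1 + u ^ 2) <= 1).
  { apply Rmult_le_reg_r with (1 + u ^ 2); [nra|]. unfold Rdiv. rewrite Rmult_assoc, Rinv_l by nra. nra. }
  assert (0 < u / (1 + u ^ 2)) by lra.
  unfold al. pose proof (atan_ge (u / (1 + u ^ 2)) ltac:(lra)). lra.
Qed.

(** The dichotomy gam = 0 or gam >= 1 enters here: WW vanishes to order 5 in the first case and to order 3 in the
    second, but is never flat. *)
Lemma WW_ge u : 0 < u < 1 / 2 -> u ^ 5 / 4 <= Rabs (WW u).
Proof.
  intros Hu. unfold WW. rewrite Rabs_mult, (Rabs_pos_eq (u ^ 3)) by (apply pow_le; lra).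
  replace (u ^ 5 / 4) with (u ^ 3 * (u ^ 2 / 4)) by field.
  apply Rmult_le_compat_l; [apply pow_le; lra|].
  pose proof (al_ge u Hu) as A. pose proof (sinh_ge (al u) ltac:(lra)) as S.
  assert (Sc : sinh (al u) <= cosh (al u)). { unfold sinh, cosh. pose proof (exp_pos (- al u)). lra. }
  pose proof (cosh_ge1 (al u)) as Cc.
  destruct Hgam as [-> | H1].
  - replace (2 * 0 * cosh (al u) - u * sinh (al u)) with (- (u * sinh (al u))) by ring.
    rewrite Rabs_Ropp, Rabs_pos_eq by nra. nra.
  - rewrite Rabs_pos_eq; nra.
Qed.

Lemma R1_flat n : exists C, forall u, 0 < u < dl -> Rabs (R1 u) <= C * u ^ n.
Proof.
  destruct (GG_flat (n + 5)) as [C [HC B]].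
  assert (Hs : 0 < sinh (2 * PI)) by (apply sinh_pos; pose proof PI_RGT_0; lra).
  exists (4 * C / sinh (2 * PI)). intros u Hu. specialize (B u Hu).
  unfold VV in B. rewrite lm_zero in B.
  replace (2 * (- 0 * PI * (1 - u ^ 2 + u ^ 4) * (2 + 3 * u ^ 2)) * sinh (PI + al u - be u) * sinh (PI - al u + be u))
    with 0 in B by ring.
  rewrite Rminus_0_l, Rabs_Ropp, !Rabs_mult, (Rabs_pos_eq (sinh _)), pow_add in B by lra.
  pose proof (WW_ge u ltac:(lra)) as W. pose proof (Rabs_pos (R1 u)).
  assert (0 < u ^ 5) by (apply pow_lt; lra).
  apply Rmult_le_reg_l with (u ^ 5 / 4 * sinh (2 * PI)).
  { apply Rmult_lt_0_compat; lra. }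
  replace (u ^ 5 / 4 * sinh (2 * PI) * (4 * C / sinh (2 * PI) * u ^ n)) with (C * (u ^ n * u ^ 5)) by (field; lra).
  eapply Rle_trans; [|exact B]. apply Rmult_le_compat_r; [assumption|]. apply Rmult_le_compat_r; lra.
Qed.

Definition R1' u := ((2 * d0 * u) * sinh (al u) + (d0 * u ^ 2 + d2) * (cosh (al u) * ((1 - u ^ 2) * / (1 + 3 * u ^ 2 + u ^ 4))))
  + (d1 * cosh (al u) + d1 * u * (sinh (al u) * ((1 - u ^ 2) * / (1 + 3 * u ^ 2 + u ^ 4)))).

Lemma R1_derive u : is_derive R1 u (R1' u).
Proof.
  pose proof (al_derive u) as D.
  assert (Ds : is_derive (fun v => sinh (al v)) u (cosh (al u) * ((1 - u ^ 2) * / (1 + 3 * u ^ 2 + u ^ 4)))).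
  { rewrite Rmult_comm. apply (is_derive_comp sinh al u _ _); [|exact D]. apply is_derive_Reals, derivable_pt_lim_sinh. }
  assert (Dc : is_derive (fun v => cosh (al v)) u (sinh (al u) * ((1 - u ^ 2) * / (1 + 3 * u ^ 2 + u ^ 4)))).
  { rewrite Rmult_comm. apply (is_derive_comp cosh al u _ _); [|exact D]. apply is_derive_Reals, derivable_pt_lim_cosh. }
  unfold R1'.
  apply (der_plus (fun v => (d0 * v ^ 2 + d2) * sinh (al v)) (fun v => d1 * v * cosh (al v))).
  - apply (is_derive_mult_R (fun v => d0 * v ^ 2 + d2) (fun v => sinh (al v))); [|exact Ds]. auto_derive; [exact I|ring].
  - apply (is_derive_mult_R (fun v => d1 * v) (fun v => cosh (al v))); [|exact Dc]. auto_derive; [exact I|ring].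
Qed.

(** Eliminating sinh (al u) between R1 and its derivative leaves a polynomial times cosh (al u). Both are flat, so the
    polynomial vanishes; these are its coefficients. *)
Lemma R1_poly : d1 * d2 + d2 ^ 2 = 0 /\ 3 * d1 * d2 - d0 * d1 + 2 * d0 * d2 - d1 ^ 2 - d2 ^ 2 = 0 /\
  d1 * d2 - 3 * d0 * d1 + d0 ^ 2 - 2 * d0 * d2 + d1 ^ 2 = 0 /\ d0 * d1 + d0 ^ 2 = 0.
Proof.
  destruct (R1_flat 8) as [C B].
  destruct (flat_derive 7 (1 / 2) R1 R1' dl C ltac:(lra) Hdl (sm_R1 8) (fun u _ => R1_derive u) B) as [C' [HC' B']].
  assert (Z : List.Forall (fun a => a = 0) ((d1 * d2 + d2 ^ 2) :: 0 :: (3 * d1 * d2 - d0 * d1 + 2 * d0 * d2 - d1 ^ 2 - d2 ^ 2)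
     :: 0 :: (d1 * d2 - 3 * d0 * d1 + d0 ^ 2 - 2 * d0 * d2 + d1 ^ 2) :: 0 :: (- (d0 * d1 + d0 ^ 2)) :: nil)).
  { assert (SB : sm 0 (1 / 2) (fun u => (d0 * u ^ 2 + d2) * (1 + 3 * u ^ 2 + u ^ 4))) by smtac.
    assert (SA : sm 0 (1 / 2) (fun u => (2 * d0 * u) * (1 + 3 * u ^ 2 + u ^ 4) + d1 * u * (1 - u ^ 2))) by smtac.
    destruct (sm_bound _ _ _ SB) as [CB [HCB BB]]. destruct (sm_bound _ _ _ SA) as [CA [HCA BA]].
    apply (pev_small _ dl (CB * C' + CA * Rabs C)); [lra|]. intros u Hu. simpl length.
    assert (Hu' : Rabs u < 1 / 2) by (rewrite Rabs_pos_eq; lra).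
    specialize (B u Hu). specialize (B' u Hu'). specialize (BB u Hu'). specialize (BA u Hu').
    rewrite (Rabs_pos_eq u) in B' by lra.
    assert (E : pev ((d1 * d2 + d2 ^ 2) :: 0 :: (3 * d1 * d2 - d0 * d1 + 2 * d0 * d2 - d1 ^ 2 - d2 ^ 2)
     :: 0 :: (d1 * d2 - 3 * d0 * d1 + d0 ^ 2 - 2 * d0 * d2 + d1 ^ 2) :: 0 :: (- (d0 * d1 + d0 ^ 2)) :: nil) u * cosh (al u)
     = (d0 * u ^ 2 + d2) * (1 + 3 * u ^ 2 + u ^ 4) * R1' u
       - ((2 * d0 * u) * (1 + 3 * u ^ 2 + u ^ 4) + d1 * u * (1 - u ^ 2)) * R1 u
       - d1 * u * (1-u^2) * 0).
    { unfold R1', R1. simpl pev. field. nra. }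
    set (pv := pev _ u) in *. 
    pose proof (cosh_ge1 (al u)) as Cc.
    apply Rle_trans with (Rabs (pv * cosh (al u))).
    { rewrite Rabs_mult, (Rabs_pos_eq (cosh _)) by lra. pose proof (Rabs_pos pv). nra. }
    rewrite E, Rmult_0_r, Rminus_0_r. eapply Rle_trans; [apply Rabs_triang|]. rewrite Rabs_Ropp.
    rewrite (Rabs_mult _ (R1' u)), (Rabs_mult _ (R1 u)).
    replace ((CB * C' + CA * Rabs C) * u ^ 7) with (CB * (C' * u ^ 7) + CA * (Rabs C * u ^ 7)) by ring.
    apply Rplus_le_compat.
    - apply Rmult_le_compat; try apply Rabs_pos; assumption.
    - apply Rmult_le_compat; try apply Rabs_pos; [assumption|].
      eapply Rle_trans; [exact B|]. assert (P : 0 <= u ^ 7) by (apply pow_le; lra).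
      apply Rle_trans with (Rabs C * u ^ 8).
      + apply Rmult_le_compat_r; [apply pow_le; lra|apply Rle_abs].
      + apply Rmult_le_compat_l; [apply Rabs_pos|]. change (u ^ 8) with (u * u ^ 7). nra. }
  rewrite !Forall_cons_iff in Z. intuition lra.
Qed.

(** Real solutions of the quadratic relations, by cases. *)
Lemma d_zero : d0 = 0 /\ d1 = 0 /\ d2 = 0.
Proof.
  destruct R1_poly as [A [B [D E]]].
  assert (F2 : d2 = 0 \/ d1 = - d2).
  { destruct (Req_dec d2 0) as [|N]; [left; assumption|right]. apply (Rmult_eq_reg_l d2); [nra|assumption]. }
  assert (F0 : d0 = 0 \/ d1 = - d0).
  { destruct (Req_dec d0 0) as [|N]; [left; assumption|right]. apply (Rmult_eq_reg_l d0); [nra|assumption]. }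
  assert (X : d1 ^ 2 = 0 -> d1 = 0) by (intros; nra).
  assert (X2 : d2 ^ 2 = 0 -> d2 = 0) by (intros; nra).
  assert (X0 : d0 ^ 2 = 0 -> d0 = 0) by (intros; nra).
  destruct F2 as [F2|F2], F0 as [F0|F0].
  - rewrite F2, F0 in B. assert (d1 = 0) by (apply X; lra). auto.
  - rewrite F2, F0 in D. assert (d0 = 0) by (apply X0; lra). lra.
  - rewrite F0, F2 in B. assert (d2 = 0) by (apply X2; lra). lra.
  - assert (d0 = d2) as E0 by lra. rewrite F2, E0 in B. assert (d2 = 0) by (apply X2; lra). lra.
Qed.

(** Only PP survives once lm and the d's are known to vanish. *)
Lemma PP_zero u : 0 < u < dl -> PP u = 0.
Proof.
  intros Hu. destruct d_zero as [E0 [E1 E2]]. pose proof (Hzero u Hu) as H.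
  unfold GG, VV in H. rewrite lm_zero, E0, E1, E2 in H.
  replace ((PP u + - 0 * PI * (1 - u ^ 2 + u ^ 4) * (2 + 3 * u ^ 2)) * sinh (PI + al u - be u) +
     WW u * ((0 * u ^ 2 + 0) * sinh (PI - be u) - 0 * u * cosh (PI - be u))) with
    (PP u * sinh (PI + al u - be u)) in H by ring.
  destruct (al_lt_be u ltac:(lra)) as [A1 [A2 A3]].
  assert (0 < sinh (PI + al u - be u)) by (apply sinh_pos; pose proof PI_RGT_0; lra).
  apply Rmult_integral in H. lra.
Qed.

Lemma al_taylor u : Rabs u < 1 / 2 ->
  Rabs (al u - (u - 4 / 3 * u ^ 3 + 11 / 5 * u ^ 5 - 29 / 7 * u ^ 7)) <= 200 * Rabs u ^ 8.
Proof.
  apply (derive_small (fun u => al u - (u - 4 / 3 * u ^ 3 + 11 / 5 * u ^ 5 - 29 / 7 * u ^ 7))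
    (fun u => (1 - u ^ 2) * / (1 + 3 * u ^ 2 + u ^ 4) - (1 - 4 * u ^ 2 + 11 * u ^ 4 - 29 * u ^ 6)) (1 / 2) 200 7).
  - intros v Hv. apply (der_minus al); [apply al_derive|]. auto_derive; [exact I|]. field.
  - unfold al. replace (0 / (1 + 0 ^ 2)) with 0 by field. rewrite atan_0. ring.
  - intros v Hv. destruct (half_sqr v Hv) as [Q1 Q2].
    replace ((1 - v ^ 2) * / (1 + 3 * v ^ 2 + v ^ 4) - (1 - 4 * v ^ 2 + 11 * v ^ 4 - 29 * v ^ 6))
      with (v ^ 7 * (v * (76 + 29 * v ^ 2) / (1 + 3 * v ^ 2 + v ^ 4))) by (field; nra).
    rewrite Rabs_mult, <- RPow_abs, Rmult_comm. apply Rmult_le_compat_r; [apply pow_le, Rabs_pos|].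
    unfold Rdiv. rewrite !Rabs_mult.
    rewrite (Rabs_pos_eq (76 + 29 * v ^ 2)) by nra.
    rewrite (Rabs_pos_eq (/ _)) by (left; apply Rinv_0_lt_compat; nra).
    assert (/ (1 + 3 * v ^ 2 + v ^ 4) <= 1). { rewrite <- Rinv_1 at 2. apply Rinv_le_contravar; nra. }
    assert (0 < / (1 + 3 * v ^ 2 + v ^ 4)) by (apply Rinv_0_lt_compat; nra).
    pose proof (Rabs_pos v). 
    assert (Rabs v * (76 + 29 * v ^ 2) <= 1 / 2 * 100) by (apply Rmult_le_compat; nra).
    assert (0 <= Rabs v * (76 + 29 * v ^ 2)) by (apply Rmult_le_pos; nra). nra.
  - lra.
Qed.

(** The coefficients of u, u^3, u^5 and u^7 of PP are a regular linear system; the one of u^7 contains lp alone. *)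
Lemma rest_zero : nu = 0 /\ kp = 0 /\ km = 0 /\ lp = 0.
Proof.
  assert (Z : List.Forall (fun a => a = 0)
    (0 :: (2 * nu - 2 * lp) :: 0 :: (nu + 2 * km - 2 * kp - lp * (5 - 8 / 3)) :: 0 ::
     (- nu + 3 * km + kp - lp * (- 1 - 20 / 3 + 22 / 5)) :: 0 :: (- lp * (- 1 + 4 / 3 + 11 - 58 / 7)) :: nil)).
  { assert (St : sm 0 (1 / 2) (fun u => lp * ((1 + 3 * u ^ 2 + u ^ 4) * (2 - u ^ 2)))) by smtac.
    destruct (sm_bound _ _ _ St) as [C1 [HC1 B1]].
    assert (St2 : sm 0 (1 / 2) (fun u => lp * (u * (- 11 / 5 - 145 / 7 + 4 / 3 + (- 11 / 5 + 29 / 7) * u ^ 2 + 29 / 7 * u ^ 4)))) by smtac.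
    destruct (sm_bound _ _ _ St2) as [C2 [HC2 B2]].
    apply (pev_small _ dl (C1 * 200 + C2)); [lra|]. intros u Hu. simpl length.
    assert (Hu' : Rabs u < 1 / 2) by (rewrite Rabs_pos_eq; lra).
    pose proof (PP_zero u Hu) as P. unfold PP in P. rewrite lm_zero in P.
    pose proof (al_taylor u Hu') as A. rewrite (Rabs_pos_eq u) in A by lra.
    specialize (B1 u Hu'). specialize (B2 u Hu').
    set (rr := al u - (u - 4 / 3 * u ^ 3 + 11 / 5 * u ^ 5 - 29 / 7 * u ^ 7)) in *.
    assert (Ea : al u = (u - 4 / 3 * u ^ 3 + 11 / 5 * u ^ 5 - 29 / 7 * u ^ 7) + rr) by (unfold rr; ring).
    rewrite Ea in P.
    match goal with |- Rabs ?p <= _ => replace p with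
      ((lp * ((1 + 3 * u ^ 2 + u ^ 4) * (2 - u ^ 2))) * rr
        + u ^ 8 * (lp * (u * (- 11 / 5 - 145 / 7 + 4 / 3 + (- 11 / 5 + 29 / 7) * u ^ 2 + 29 / 7 * u ^ 4)))) end.
    - eapply Rle_trans; [apply Rabs_triang|]. rewrite !(Rabs_mult _ rr), (Rabs_mult (u ^ 8)), (Rabs_pos_eq (u ^ 8)) by (apply pow_le; lra).
      replace ((C1 * 200 + C2) * u ^ 8) with (C1 * (200 * u ^ 8) + C2 * u ^ 8) by ring. apply Rplus_le_compat.
      + apply Rmult_le_compat; try apply Rabs_pos; assumption.
      + rewrite Rmult_comm. apply Rmult_le_compat_r; [apply pow_le; lra|assumption].
    - symmetry. apply Rminus_diag_uniq. eapply eq_trans; [|exact P]. simpl pev. field. }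
  rewrite !Forall_cons_iff in Z. intuition lra.
Qed.
End Indep.

Theorem mel_independent gam kp km nu lp lm d0 d1 d2 N : gam = 0 \/ 1 <= gam ->
  (forall s, N < s -> mel gam kp km nu lp lm d0 d1 d2 s = 0) ->
  (nu = 0 /\ kp = 0 /\ km = 0 /\ lp = 0) /\ lm = 0 /\ (d0 = 0 /\ d1 = 0 /\ d2 = 0).
Proof.
  intros Hg H.
  set (dl := Rmin (1 / 2) (/ (Rabs N + 1))).
  assert (HN : 0 < Rabs N + 1) by (pose proof (Rabs_pos N); lra).
  assert (Hdl : 0 < dl <= 1 / 2).
  { split; [unfold dl; apply Rmin_pos; [lra|apply Rinv_0_lt_compat, HN]|apply Rmin_l]. }
  assert (Z : forall u, 0 < u < dl -> GG gam kp km nu lp lm d0 d1 d2 u = 0).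
  { intros u Hu. rewrite <- mel_GG by lra. rewrite H; [ring|].
    assert (u < / (Rabs N + 1)) by (eapply Rlt_le_trans; [apply Hu|apply Rmin_r]).
    apply Rinv_lt_contravar in H0; [|apply Rmult_lt_0_compat; [lra|apply Rinv_0_lt_compat, HN]].
    rewrite Rinv_inv in H0. pose proof (Rle_abs N). lra. }
  split; [|split].
  - eapply rest_zero; eassumption.
  - eapply lm_zero; eassumption.
  - eapply d_zero; eassumption.
Qed.

(** * Seven simple zeros *)

Fixpoint comb (n : nat) (k : nat -> R) (f : nat -> R -> R) (s : R) : R :=
  match n with O => 0 | S m => comb m k f s + k m * f m s end.

Lemma comb_ext n k k' f s : (forall i, (i < n)%nat -> k i = k' i) -> comb n k f s = comb n k' f s.
Proof.
  induction n; intros H; simpl; [reflexivity|]. rewrite IHn by (intros; apply H; lia). rewrite H by lia. reflexivity.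
Qed.

Lemma comb_lin n k k' a f s : comb n (fun i => k i + a * k' i) f s = comb n k f s + a * comb n k' f s.
Proof. induction n; simpl; [ring|]. rewrite IHn. ring. Qed.

(** Induction on n: the new function minus its interpolant at the old points is a nontrivial combination, so it is
    nonzero at some point beyond them. *)
Lemma interpolation_points f n : (forall k N, (forall s, N < s -> comb n k f s = 0) -> forall i, (i < n)%nat -> k i = 0) ->
  forall N, exists p : nat -> R, (forall i, (i < n)%nat -> N < p i) /\
   (forall i, (S i < n)%nat -> p i < p (S i)) /\
   forall v : nat -> R, exists k, forall i, (i < n)%nat -> comb n k f (p i) = v i.
Proof.
  induction n; intros H N.
  - exists (fun _ => 0). repeat split; try (intros; lia). intros v. exists v. intros; lia.
  - destruct (fun X => IHn X N) as [p [P1 [P2 P3]]].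
    { intros k M Hk i Hi. 
      generalize (H (fun j => if Nat.eqb j n then 0 else k j) M). intros H'.
      specialize (H' ltac:(intros s Hs; simpl; rewrite Nat.eqb_refl, Rmult_0_l, Rplus_0_r; rewrite <- (Hk s Hs);
        apply comb_ext; intros j Hj; destruct (Nat.eqb_spec j n); [lia|reflexivity]) i ltac:(lia)).
      simpl in H'. destruct (Nat.eqb_spec i n); [lia|assumption]. }
    destruct (P3 (fun i => f n (p i))) as [kn Hkn].
    set (kk := fun j => if Nat.eqb j n then 1 else - kn j).
    assert (Ekk : forall s, comb (S n) kk f s = f n s - comb n kn f s).
    { intros s. simpl. unfold kk at 2. rewrite Nat.eqb_refl.
      rewrite (comb_ext n kk (fun i => 0 * kn i + (-1) * kn i)).
      - rewrite comb_lin. rewrite (comb_ext n (fun i => 0 * kn i) (fun i => 0 * kn i + 0 * 0)) by (intros; ring).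
        replace (comb n (fun i => 0 * kn i + 0 * 0) f s) with 0; [ring|].
        clear. induction n; simpl; [reflexivity|]. rewrite <- IHn. ring.
      - intros i Hi. unfold kk. destruct (Nat.eqb_spec i n); [lia|ring]. }
    set (M := match n with O => N | S m => Rmax N (p m) end).
    assert (Hex : exists s, M < s /\ comb (S n) kk f s <> 0).
    { destruct (excluded_middle_informative (exists s, M < s /\ comb (S n) kk f s <> 0)) as [|Nx]; [assumption|exfalso].
      assert (A : kk n = 0).
      { apply (H kk M); [|lia]. intros s Hs. destruct (Req_dec (comb (S n) kk f s) 0); [assumption|].
        exfalso. apply Nx. exists s. split; assumption. }
      unfold kk in A. rewrite Nat.eqb_refl in A. lra. }
    destruct Hex as [s0 [Hs0 Hn0]].
    assert (HN : N < s0). { unfold M in Hs0. destruct n; [assumption|]. eapply Rle_lt_trans; [apply Rmax_l|exact Hs0]. }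
    exists (fun i => if Nat.eqb i n then s0 else p i). split; [|split].
    + intros i Hi. destruct (Nat.eqb_spec i n); [assumption|]. apply P1. lia.
    + intros i Hi. destruct (Nat.eqb_spec i n); [lia|]. destruct (Nat.eqb_spec (S i) n).
      * unfold M in Hs0. subst n. eapply Rle_lt_trans; [apply Rmax_r|exact Hs0].
      * apply P2. lia.
    + intros v. destruct (P3 v) as [k Hk].
      set (k0 := fun j => if Nat.eqb j n then 0 else k j).
      assert (Ek0 : forall s, comb (S n) k0 f s = comb n k f s).
      { intros s. simpl. unfold k0 at 2. rewrite Nat.eqb_refl. rewrite (comb_ext n k0 k).
        - ring.
        - intros j Hj. unfold k0. destruct (Nat.eqb_spec j n); [lia|reflexivity]. }
      set (a := (v n - comb n k f s0) / comb (S n) kk f s0).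
      exists (fun j => k0 j + a * kk j). intros i Hi. rewrite comb_lin, Ek0.
      destruct (Nat.eqb_spec i n) as [->|Ni].
      * unfold a. field. assumption.
      * rewrite Ekk, Hkn, Hk by lia. ring.
Qed.

(** Near a point of positive derivative h is increasing and takes all nearby values, with positive derivative. *)
Lemma levels_near_increase (h h' : R -> R) x y xi a b : x < xi < y -> a < h xi < b ->
  (forall t, x < t < y -> is_derive h t (h' t)) -> (forall t, x < t < y -> continuous h' t) -> 0 < h' xi ->
  exists a' b', a <= a' /\ a' < b' /\ b' <= b /\ forall dl, a' < dl < b' -> exists s, x < s < y /\ h s = dl /\ h' s <> 0.
Proof.
  intros Hx Hab D C P.
  destruct (proj2 (continuity_pt_filterlim h' xi) (C xi Hx) (h' xi) P) as [d [Hd Hd']].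
  assert (Hd2 : forall t, Rabs (t - xi) < d -> 0 < h' t).
  { intros t Ht. destruct (Req_dec t xi) as [->|N]; [assumption|].
    assert (A : Rabs (h' t - h' xi) < h' xi).
    { apply Hd'. split; [|exact Ht]. split; [exact I|]. intros E. apply N. symmetry. exact E. }
    apply Rabs_def2 in A. lra. }
  set (e := Rmin (d / 2) (Rmin ((xi - x) / 2) ((y - xi) / 2))).
  assert (He : 0 < e). { unfold e. repeat apply Rmin_pos; lra. }
  assert (He1 : e <= d / 2) by apply Rmin_l.
  assert (He2 : e <= (xi - x) / 2) by (unfold e; eapply Rle_trans; [apply Rmin_r|apply Rmin_l]).
  assert (He3 : e <= (y - xi) / 2) by (unfold e; eapply Rle_trans; [apply Rmin_r|apply Rmin_r]).
  assert (Hcont : forall t, x < t < y -> continuity_pt h t).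
  { intros t Ht. apply continuity_pt_filterlim. apply (ex_derive_continuous h t). exists (h' t). apply D, Ht. }
  assert (Hinc : forall s t, xi - e <= s -> s < t -> t <= xi + e -> h s < h t).
  { intros s t H1 H2 H3. destruct (MVT_gen h s t h') as [c [Hc E]].
    - intros z Hz. rewrite Rmin_left, Rmax_right in Hz by lra. apply D. lra.
    - intros z Hz. rewrite Rmin_left, Rmax_right in Hz by lra. apply Hcont. lra.
    - rewrite Rmin_left, Rmax_right in Hc by lra.
      assert (0 < h' c). { apply Hd2. apply Rabs_def1; lra. } nra. }
  pose proof (Hinc (xi - e) xi ltac:(lra) ltac:(lra) ltac:(lra)) as L.
  pose proof (Hinc xi (xi + e) ltac:(lra) ltac:(lra) ltac:(lra)) as U.
  exists (Rmax a (h (xi - e))), (Rmin b (h (xi + e))).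
  split; [apply Rmax_l|]. split. { apply Rmax_lub_lt; apply Rmin_glb_lt; lra. }
  split; [apply Rmin_l|]. intros dl Hdl.
  assert (h (xi - e) < dl < h (xi + e)).
  { split; [eapply Rle_lt_trans; [apply Rmax_r|apply Hdl] | eapply Rlt_le_trans; [apply Hdl|apply Rmin_r]]. }
  destruct (first_zero (fun t => dl - h t) (xi - e) (xi + e)) as [z [Hz1 [Hz2 _]]]; try lra.
  { intros t Ht. apply (cont_minus (fun _ => dl) h); [apply cont_const|]. apply continuity_pt_filterlim, Hcont. lra. }
  exists z. split; [lra|]. split; [lra|]. assert (0 < h' z); [|lra]. apply Hd2. apply Rabs_def1; lra.
Qed.

(** Mean value theorem between the first time at the higher and the last time before it at the lower of two levels
    strictly between a and b. *)
Lemma increasing_at_intermediate_level (h h' : R -> R) x y a b : x < y -> a < b -> h x <= a -> b <= h y ->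
  (forall t, x <= t <= y -> is_derive h t (h' t)) -> 
  exists xi, x < xi < y /\ a < h xi < b /\ 0 < h' xi.
Proof.
  intros Hxy Hab Ha Hb D.
  set (c1 := a + (b - a) / 3). set (c2 := b - (b - a) / 3).
  assert (Hcont : forall t, x <= t <= y -> continuous h t).
  { intros t Ht. apply (ex_derive_continuous h t). exists (h' t). apply D, Ht. }
  destruct (first_zero (fun t => c2 - h t) x y) as [x2 [X1 [X2 X3]]]; try (unfold c1, c2 in *; lra).
  { intros t Ht. apply (cont_minus (fun _ => c2) h); [apply cont_const|apply Hcont; lra]. }
  destruct (last_zero (fun t => h t - c1) x2 x) as [x1 [Y1 [Y2 Y3]]]; try (unfold c1, c2 in *; lra).
  { intros t Ht. apply (cont_minus h (fun _ => c1)); [apply Hcont; lra|apply cont_const]. }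
  destruct (MVT_gen h x1 x2 h') as [c [Hc E]].
  - intros z Hz. rewrite Rmin_left, Rmax_right in Hz by lra. apply D. lra.
  - intros z Hz. rewrite Rmin_left, Rmax_right in Hz by lra. apply continuity_pt_filterlim, Hcont. lra.
  - rewrite Rmin_left, Rmax_right in Hc by lra.
    assert (P : 0 < h' c). { unfold c1, c2 in *. assert (0 < h x2 - h x1) by lra. nra. }
    assert (B1 : c1 <= h c). { destruct (Req_dec c x1) as [->|N]; [lra|]. specialize (Y3 c ltac:(lra)). lra. }
    assert (B2 : h c <= c2). { destruct (Req_dec c x2) as [->|N]; [lra|]. specialize (X3 c ltac:(lra)). lra. }
    exists c. split; [|split; [unfold c1, c2 in *; lra|exact P]].
    split; [destruct (Req_dec c x) as [->|N]|destruct (Req_dec c y) as [->|N]]; unfold c1, c2 in *; lra.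
Qed.

(** An open interval of levels that are taken simply, so that it can be shrunk further for each of finitely many
    pieces. *)
Lemma simple_levels (h h' : R -> R) x y a b : x < y -> a < b ->
  (h x <= a /\ b <= h y) \/ (h y <= a /\ b <= h x) ->
  (forall t, x <= t <= y -> is_derive h t (h' t)) -> (forall t, x <= t <= y -> continuous h' t) ->
  exists a' b', a <= a' /\ a' < b' /\ b' <= b /\ forall dl, a' < dl < b' -> exists s, x < s < y /\ h s = dl /\ h' s <> 0.
Proof.
  intros Hxy Hab [[Ha Hb]|[Ha Hb]] D C.
  - destruct (increasing_at_intermediate_level h h' x y a b Hxy Hab Ha Hb D) as [xi [X1 [X2 X3]]].
    apply (levels_near_increase h h' x y xi a b); auto; intros; [apply D|apply C]; lra.
  - destruct (increasing_at_intermediate_level (fun t => - h t) (fun t => - h' t) x y (- b) (- a)) as [xi [X1 [X2 X3]]]; try lra.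
    { intros t Ht. apply (is_derive_opp h t). apply D, Ht. }
    destruct (levels_near_increase (fun t => - h t) (fun t => - h' t) x y xi (- b) (- a)) as [a' [b' [Y1 [Y2 [Y3 Y4]]]]]; try lra.
    { intros t Ht. apply (is_derive_opp h t). apply D. lra. }
    { intros t Ht. apply (continuous_opp h'). apply C. lra. }
    exists (- b'), (- a'). repeat split; try lra. intros dl Hdl.
    destruct (Y4 (- dl)) as [s [S1 [S2 S3]]]; [lra|]. exists s. repeat split; lra.
Qed.

Definition kron (i j : nat) : R := if Nat.eqb i j then 1 else 0.
(** Index 0 is km, whose function s (2 s^2 + 3) is positive and serves as the unit of level. *)
Definition melb (gam : R) (i : nat) (s : R) : R :=
  mel gam (kron 1 i) (kron 0 i) (kron 2 i) (kron 3 i) (kron 4 i) (kron 5 i) (kron 6 i) (kron 7 i) s.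

Lemma mel_comb gam k s :
  comb 8 k (melb gam) s = mel gam (k 1%nat) (k 0%nat) (k 2%nat) (k 3%nat) (k 4%nat) (k 5%nat) (k 6%nat) (k 7%nat) s.
Proof. unfold comb, melb, kron, mel, Kf. simpl Nat.eqb. cbn iota. unfold Rdiv. ring. Qed.

Lemma melb_indep gam : gam = 0 \/ 1 <= gam ->
  forall k N, (forall s, N < s -> comb 8 k (melb gam) s = 0) -> forall i, (i < 8)%nat -> k i = 0.
Proof.
  intros Hg k N H.
  destruct (mel_independent gam (k 1%nat) (k 0%nat) (k 2%nat) (k 3%nat) (k 4%nat) (k 5%nat) (k 6%nat) (k 7%nat) N Hg)
    as [[A [B [C D]]] [E [F [G I]]]].
  { intros s Hs. rewrite <- mel_comb. apply H, Hs. }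
  intros i Hi. do 8 (destruct i as [|i]; [assumption|]). lia.
Qed.

Lemma ta_derive s : is_derive ta s ((1 - s ^ 2) / (s ^ 4 + 3 * s ^ 2 + 1)).
Proof. unfold ta. auto_derive; [nra|]. field. repeat split; nra. Qed.
Lemma tb_derive s : 1 < s -> is_derive tb s ((s ^ 2 + 1) / (s ^ 4 - s ^ 2 + 1)).
Proof. intros H. unfold tb. auto_derive; [nra|]. field. repeat split; nra. Qed.

Lemma ta_bounds s : 0 < s -> 0 < ta s < PI / 2.
Proof.
  intros H. unfold ta. split; [|apply atan_bound].
  rewrite <- atan_0. apply atan_increasing. apply Rdiv_lt_0_compat; nra.
Qed.
Lemma tb_bounds s : 1 < s -> PI / 2 < tb s < PI.
Proof.
  intros H. unfold tb. pose proof (atan_bound (s / (s ^ 2 - 1))).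
  assert (0 < atan (s / (s ^ 2 - 1))); [|lra].
  rewrite <- atan_0. apply atan_increasing. apply Rdiv_lt_0_compat; nra.
Qed.

(** On s > 1 only, where tb is smooth. *)
Definition contdiff (f : R -> R) : Prop :=
  exists f' : R -> R, forall s, 1 < s -> is_derive f s (f' s) /\ continuous f' s.

Lemma C1_cont f s : contdiff f -> 1 < s -> continuous f s.
Proof. intros [f' H] Hs. apply (ex_derive_continuous f s). exists (f' s). apply H, Hs. Qed.
Lemma C1_const c : contdiff (fun _ => c).
Proof. exists (fun _ => 0). intros s _. split; [apply der_const|apply cont_const]. Qed.
Lemma C1_id : contdiff (fun s => s).
Proof. exists (fun _ => 1). intros s _. split; [apply der_id|apply cont_const]. Qed.
Lemma C1_plus f g : contdiff f -> contdiff g -> contdiff (fun s => f s + g s).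
Proof.
  intros [f' F] [g' G]. exists (fun s => f' s + g' s). intros s Hs.
  destruct (F s Hs), (G s Hs). split; [apply der_plus|apply cont_plus]; assumption.
Qed.
Lemma C1_minus f g : contdiff f -> contdiff g -> contdiff (fun s => f s - g s).
Proof.
  intros [f' F] [g' G]. exists (fun s => f' s - g' s). intros s Hs.
  destruct (F s Hs), (G s Hs). split; [apply der_minus|apply cont_minus]; assumption.
Qed.
Lemma C1_mult f g : contdiff f -> contdiff g -> contdiff (fun s => f s * g s).
Proof.
  intros Cf Cg. pose proof (fun s => C1_cont f s Cf) as Kf. pose proof (fun s => C1_cont g s Cg) as Kg.
  destruct Cf as [f' F], Cg as [g' G]. exists (fun s => f' s * g s + f s * g' s). intros s Hs.
  destruct (F s Hs), (G s Hs). split; [apply is_derive_mult_R; assumption|].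
  apply (cont_plus (fun s => f' s * g s) (fun s => f s * g' s)); apply cont_mult; auto.
Qed.
Lemma C1_pow f n : contdiff f -> contdiff (fun s => f s ^ n).
Proof. intros H. induction n; simpl; [apply C1_const|apply C1_mult; assumption]. Qed.
Lemma C1_comp phi phi' f : (forall x, is_derive phi x (phi' x)) -> (forall x, continuous phi' x) -> contdiff f ->
  contdiff (fun s => phi (f s)).
Proof.
  intros D C Cf. pose proof (fun s => C1_cont f s Cf) as Kf. destruct Cf as [f' F].
  exists (fun s => f' s * phi' (f s)). intros s Hs. destruct (F s Hs) as [A B]. split.
  - exact (is_derive_comp phi f s _ _ (D (f s)) A).
  - apply cont_mult; [assumption|]. apply (continuous_comp f phi'); [apply Kf, Hs|apply C].
Qed.
Lemma C1_sinh f : contdiff f -> contdiff (fun s => sinh (f s)).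
Proof.
  apply (C1_comp sinh cosh).
  - intros x. apply is_derive_Reals, derivable_pt_lim_sinh.
  - intros x. apply continuity_pt_filterlim, derivable_continuous_pt. exists (sinh x). apply derivable_pt_lim_cosh.
Qed.
Lemma C1_cosh f : contdiff f -> contdiff (fun s => cosh (f s)).
Proof.
  apply (C1_comp cosh sinh).
  - intros x. apply is_derive_Reals, derivable_pt_lim_cosh.
  - intros x. apply continuity_pt_filterlim, derivable_continuous_pt. exists (cosh x). apply derivable_pt_lim_sinh.
Qed.
Lemma C1_inv f : (forall s, 1 < s -> f s <> 0) -> contdiff f -> contdiff (fun s => / f s).
Proof.
  intros N Cf. pose proof (fun s => C1_cont f s Cf) as Kf. destruct Cf as [f' F].
  exists (fun s => - f' s / f s ^ 2). intros s Hs. destruct (F s Hs) as [A B]. split.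
  - apply is_derive_inv; auto.
  - apply (cont_mult (fun s => - f' s) (fun s => / f s ^ 2)); [apply (continuous_opp f'); assumption|].
    apply (continuous_comp (fun s => f s ^ 2) Rinv).
    + apply (continuous_ext (fun s => f s * f s)); [intros; simpl; ring|]. apply cont_mult; auto.
    + apply continuity_pt_filterlim. apply (continuity_pt_inv (fun x => x)); [apply continuity_pt_id|].
      specialize (N s Hs). nra.
Qed.

Lemma C1_ta : contdiff ta.
Proof.
  exists (fun s => (1 - s ^ 2) / (s ^ 4 + 3 * s ^ 2 + 1)). intros s Hs. split; [apply ta_derive|].
  apply (ex_derive_continuous (fun s => (1 - s ^ 2) / (s ^ 4 + 3 * s ^ 2 + 1)) s). auto_derive. nra.
Qed.
Lemma C1_tb : contdiff tb.
Proof.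
  exists (fun s => (s ^ 2 + 1) / (s ^ 4 - s ^ 2 + 1)). intros s Hs. split; [apply tb_derive, Hs|].
  apply (ex_derive_continuous (fun s => (s ^ 2 + 1) / (s ^ 4 - s ^ 2 + 1)) s). auto_derive. nra.
Qed.

Ltac c1tac := repeat lazymatch goal with
  | |- contdiff (fun _ => ?c) => apply C1_const
  | |- contdiff (fun s => s) => apply C1_id
  | |- contdiff (fun s => ta s) => exact C1_ta
  | |- contdiff (fun s => tb s) => exact C1_tb
  | |- contdiff (fun s => @?f s + @?g s) => apply (C1_plus f g)
  | |- contdiff (fun s => @?f s - @?g s) => apply (C1_minus f g)
  | |- contdiff (fun s => @?f s * @?g s) => apply (C1_mult f g)
  | |- contdiff (fun s => @?f s ^ ?n) => apply (C1_pow f n)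
  | |- contdiff (fun s => sinh (@?f s)) => apply (C1_sinh f)
  | |- contdiff (fun s => cosh (@?f s)) => apply (C1_cosh f)
  end.

Lemma C1_Kf d0 d1 d2 : contdiff (Kf d0 d1 d2).
Proof.
  unfold Kf, Rdiv.
  apply (C1_mult (fun s => (d0 + d2 * s ^ 2) * sinh (tb s) - d1 * s * cosh (tb s)) (fun s => / sinh (ta s + tb s))); [c1tac|].
  apply (C1_inv (fun s => sinh (ta s + tb s))); [|c1tac].
  intros s Hs. pose proof (ta_bounds s ltac:(lra)). pose proof (tb_bounds s Hs).
  assert (0 < sinh (ta s + tb s)) by (apply sinh_pos; pose proof PI_RGT_0; lra). lra.
Qed.

Lemma C1_mel gam kp km nu lp lm d0 d1 d2 : contdiff (mel gam kp km nu lp lm d0 d1 d2).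
Proof. 
  unfold mel. c1tac. apply C1_Kf.
Qed.

(** The eight functions interpolate any values at eight points p 0 < ... < p 7. Alternating values give seven sign
    changes. Dividing by the positive function g turns a change of the coefficient km into a change of level, and a
    common level that is taken simply in all seven gaps exists by seven applications of simple_levels. *)
Theorem mel_simple_zeros gam : gam = 0 \/ 1 <= gam ->
  exists kp km nu lp lm d0 d1 d2 : R, exists s : nat -> R,
    (forall i, (i < 7)%nat -> 1 < s i) /\ (forall i, (S i < 7)%nat -> s i < s (S i)) /\
    forall i, (i < 7)%nat -> mel gam kp km nu lp lm d0 d1 d2 (s i) = 0 /\
      exists l, l <> 0 /\ is_derive (mel gam kp km nu lp lm d0 d1 d2) (s i) l.
Proof.
  intros Hg.
  set (g := fun s : R => s * (2 * s ^ 2 + 3)).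
  assert (gpos : forall s, 1 < s -> 0 < g s) by (intros s Hs; unfold g; nra).
  assert (Cg : contdiff g) by (unfold g; c1tac).
  destruct (interpolation_points (melb gam) 8 (melb_indep gam Hg) 1) as [p [P1 [P2 P3]]].
  destruct (P3 (fun i => (-1) ^ i * g (p i))) as [k Hk].
  set (F := fun dl => mel gam (k 1%nat) (k 0%nat - dl) (k 2%nat) (k 3%nat) (k 4%nat) (k 5%nat) (k 6%nat) (k 7%nat)).
  assert (EF : forall dl s, F dl s = comb 8 k (melb gam) s - dl * g s).
  { intros dl s. rewrite mel_comb. unfold F, mel, g. ring. }
  set (h := fun s => F 0 s * / g s).
  assert (Ch : contdiff h).
  { unfold h. apply C1_mult; [apply C1_mel|]. apply C1_inv; [intros s Hs; specialize (gpos s Hs); lra|exact Cg]. }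
  assert (EFh : forall dl s, 1 < s -> F dl s = (h s - dl) * g s).
  { intros dl s Hs. unfold h. rewrite (EF 0 s), (EF dl s). specialize (gpos s Hs). field. lra. }
  assert (Hp : forall i, (i < 8)%nat -> h (p i) = (-1) ^ i).
  { intros i Hi. unfold h. rewrite EF, Hk by assumption. specialize (gpos (p i) (P1 i Hi)). field. lra. }
  destruct Ch as [h' Dh].
  (* the interval of admissible levels is shrunk gap by gap *)
  assert (Hind : forall m, (m <= 7)%nat -> exists a b, -1 <= a /\ a < b /\ b <= 1 /\
     forall dl, a < dl < b -> forall i, (i < m)%nat -> exists s, p i < s < p (S i) /\ h s = dl /\ h' s <> 0).
  { induction m; intros Hm.
    - exists (-1), 1. repeat split; try lra. intros; lia.
    - destruct (IHm ltac:(lia)) as [a [b [A1 [A2 [A3 A4]]]]].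
      assert (Hgt : forall t, p m <= t <= p (S m) -> 1 < t).
      { intros t Ht. pose proof (P1 m ltac:(lia)). lra. }
      destruct (simple_levels h h' (p m) (p (S m)) a b) as [a' [b' [B1 [B2 [B3 B4]]]]].
      + apply P2. lia.
      + exact A2.
      + rewrite (Hp m), (Hp (S m)) by lia. simpl.
        assert (X : (-1) ^ m = 1 \/ (-1) ^ m = -1).
        { clear. induction m as [|m [E|E]]; simpl; [left; reflexivity|right|left]; rewrite E; ring. }
        destruct X as [-> | ->]; [right|left]; lra.
      + intros t Ht. apply Dh, Hgt, Ht.
      + intros t Ht. apply Dh, Hgt, Ht.
      + exists a', b'. repeat split; try lra. intros dl Hdl i Hi.
        destruct (Nat.eq_dec i m) as [->|Ni]; [apply B4; lra|apply A4; [lra|lia]]. }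
  destruct (Hind 7%nat ltac:(lia)) as [a [b [A1 [A2 [A3 A4]]]]].
  set (dl := (a + b) / 2).
  assert (Hs : forall i, exists s, (i < 7)%nat -> p i < s < p (S i) /\ h s = dl /\ h' s <> 0).
  { intros i. destruct (Nat.lt_ge_cases i 7) as [L|L].
    - destruct (A4 dl ltac:(unfold dl; lra) i L) as [s Hs]. exists s. auto.
    - exists 0. intros; lia. }
  set (s := fun i => proj1_sig (constructive_indefinite_description _ (Hs i))).
  assert (Hs' : forall i, (i < 7)%nat -> p i < s i < p (S i) /\ h (s i) = dl /\ h' (s i) <> 0).
  { intros i. unfold s. destruct (constructive_indefinite_description _ (Hs i)) as [si Hsi]. exact Hsi. }
  exists (k 1%nat), (k 0%nat - dl), (k 2%nat), (k 3%nat), (k 4%nat), (k 5%nat), (k 6%nat), (k 7%nat), s.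
  assert (H1 : forall i, (i < 7)%nat -> 1 < s i).
  { intros i Hi. destruct (Hs' i Hi) as [X _]. pose proof (P1 i ltac:(lia)). lra. }
  split; [exact H1|]. split.
  { intros i Hi. destruct (Hs' i ltac:(lia)) as [X _]. destruct (Hs' (S i) Hi) as [Y _]. lra. }
  intros i Hi. destruct (Hs' i Hi) as [X [Y Z]]. fold (F dl). specialize (H1 i Hi). split.
  - rewrite EFh, Y by assumption. ring.
  - exists (h' (s i) * g (s i)). split.
    + apply Rmult_integral_contrapositive_currified; [exact Z|]. specialize (gpos _ H1). lra.
    + apply (is_derive_ext_loc (fun t => (h t - dl) * g t)).
      * exists (mkposreal (s i - 1) ltac:(lra)). intros t Ht. symmetry. apply EFh.
        change (Rabs (t - s i) < s i - 1) in Ht. apply Rabs_def2 in Ht. lra.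
      * destruct Cg as [g' Dg]. 
        replace (h' (s i) * g (s i)) with ((h' (s i) - 0) * g (s i) + (h (s i) - dl) * g' (s i)) by (rewrite Y; ring).
        apply (is_derive_mult_R (fun t => h t - dl) g).
        -- apply (der_minus h (fun _ => dl)); [apply Dh, H1|apply der_const].
        -- apply Dg, H1.
Qed.

(** * Strict differentiability along a parameter *)

Section SD.
Context {V : Type}.
Variables (D : V -> V -> R) (v0 : V).
Hypothesis D0 : forall v w, 0 <= D v w.

(** F v eps is defined for eps <> 0, tends to f0 as (v, eps) tends to (v0, 0), and is strictly differentiable in v
    with derivative L, uniformly for small eps. Nothing is asked of the dependence on eps, so quotients by eps are
    allowed. The distance D is arbitrary. *)
Record sd (F : V -> R -> R) (f0 : R) (L : V -> V -> R) : Prop := SD {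
  sd_bound : exists C, 0 <= C /\ forall v w, Rabs (L v w) <= C * D v w;
  sd_lim : forall eta, 0 < eta -> exists d, 0 < d /\ forall v eps, D v v0 < d -> 0 < Rabs eps < d ->
     Rabs (F v eps - f0) < eta;
  sd_strict : forall eta, 0 < eta -> exists d, 0 < d /\ forall v w eps, D v v0 < d -> D w v0 < d -> 0 < Rabs eps < d ->
     Rabs (F v eps - F w eps - L v w) <= eta * D v w }.

Lemma sd_eq F f0 L f1 L1 : sd F f0 L -> f0 = f1 -> (forall v w, L v w = L1 v w) -> sd F f1 L1.
Proof.
  intros [[C [HC B]] A S] <- E. split.
  - exists C. split; [exact HC|]. intros v w. rewrite <- E. apply B.
  - exact A.
  - intros eta He. destruct (S eta He) as [d [Hd H]]. exists d. split; [exact Hd|]. intros. rewrite <- E. apply H; assumption.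
Qed.

Lemma sd_ext F G f0 L : (exists d, 0 < d /\ forall v eps, D v v0 < d -> 0 < Rabs eps < d -> F v eps = G v eps) ->
  sd F f0 L -> sd G f0 L.
Proof.
  intros [d0 [Hd0 E]] [B A S]. split; [exact B| |].
  - intros eta He. destruct (A eta He) as [d [Hd H]]. exists (Rmin d0 d). split; [apply Rmin_pos; assumption|].
    intros v eps H1 H2. pose proof (Rmin_l d0 d). pose proof (Rmin_r d0 d). rewrite <- E by lra. apply H; lra.
  - intros eta He. destruct (S eta He) as [d [Hd H]]. exists (Rmin d0 d). split; [apply Rmin_pos; assumption|].
    intros v w eps H1 H2 H3. pose proof (Rmin_l d0 d). pose proof (Rmin_r d0 d). rewrite <- !E by lra. apply H; lra.
Qed.

Lemma sd_eps (g : R -> R) : continuous g 0 -> sd (fun _ => g) (g 0) (fun _ _ => 0).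
Proof.
  intros C. split.
  - exists 0. split; [lra|]. intros. rewrite Rabs_R0. lra.
  - intros eta He. destruct (proj2 (continuity_pt_filterlim g 0) C eta He) as [d [Hd H]].
    exists d. split; [exact Hd|]. intros v eps _ [H1 H2]. apply H. split.
    + split; [exact I|]. intros <-. rewrite Rabs_R0 in H1. lra.
    + simpl. unfold Rdist. rewrite Rminus_0_r. exact H2.
  - intros eta He. exists 1. split; [lra|]. intros. 
    replace (g eps - g eps - 0) with 0 by ring. rewrite Rabs_R0. apply Rmult_le_pos; [lra|apply D0].
Qed.

Lemma sd_const c : sd (fun _ _ => c) c (fun _ _ => 0).
Proof. apply (sd_eps (fun _ => c)). apply cont_const. Qed.

Lemma sd_proj (p : V -> R) : (forall v w, Rabs (p v - p w) <= D v w) ->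
  sd (fun v _ => p v) (p v0) (fun v w => p v - p w).
Proof.
  intros H. split.
  - exists 1. split; [lra|]. intros. rewrite Rmult_1_l. apply H.
  - intros eta He. exists eta. split; [exact He|]. intros v eps Hv _. eapply Rle_lt_trans; [apply H|exact Hv].
  - intros eta He. exists 1. split; [lra|]. intros. rewrite Rminus_diag, Rabs_R0. apply Rmult_le_pos; [lra|apply D0].
Qed.

Lemma sd_plus F f L G g K : sd F f L -> sd G g K -> sd (fun v e => F v e + G v e) (f + g) (fun v w => L v w + K v w).
Proof.
  intros [[C1 [HC1 B1]] A1 S1] [[C2 [HC2 B2]] A2 S2]. split.
  - exists (C1 + C2). split; [lra|]. intros v w. eapply Rle_trans; [apply Rabs_triang|].
    specialize (B1 v w). specialize (B2 v w). lra.
  - intros eta He. destruct (A1 (eta / 2) ltac:(lra)) as [d1 [P1 Q1]]. destruct (A2 (eta / 2) ltac:(lra)) as [d2 [P2 Q2]].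
    exists (Rmin d1 d2). split; [apply Rmin_pos; assumption|]. intros v eps H1 H2.
    pose proof (Rmin_l d1 d2). pose proof (Rmin_r d1 d2).
    specialize (Q1 v eps ltac:(lra) ltac:(lra)). specialize (Q2 v eps ltac:(lra) ltac:(lra)).
    replace (F v eps + G v eps - (f + g)) with ((F v eps - f) + (G v eps - g)) by ring.
    eapply Rle_lt_trans; [apply Rabs_triang|]. lra.
  - intros eta He. destruct (S1 (eta / 2) ltac:(lra)) as [d1 [P1 Q1]]. destruct (S2 (eta / 2) ltac:(lra)) as [d2 [P2 Q2]].
    exists (Rmin d1 d2). split; [apply Rmin_pos; assumption|]. intros v w eps H1 H2 H3.
    pose proof (Rmin_l d1 d2). pose proof (Rmin_r d1 d2).
    specialize (Q1 v w eps ltac:(lra) ltac:(lra) ltac:(lra)). specialize (Q2 v w eps ltac:(lra) ltac:(lra) ltac:(lra)).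
    match goal with |- Rabs ?x <= _ => replace x with ((F v eps - F w eps - L v w) + (G v eps - G w eps - K v w)) by ring end.
    eapply Rle_trans; [apply Rabs_triang|]. lra.
Qed.

Lemma sd_mult F f L G g K : sd F f L -> sd G g K ->
  sd (fun v e => F v e * G v e) (f * g) (fun v w => g * L v w + f * K v w).
Proof.
  intros [[C1 [HC1 B1]] A1 S1] [[C2 [HC2 B2]] A2 S2]. split.
  - exists (Rabs g * C1 + Rabs f * C2). split.
    { pose proof (Rabs_pos f). pose proof (Rabs_pos g). nra. }
    intros v w. eapply Rle_trans; [apply Rabs_triang|]. rewrite !Rabs_mult.
    specialize (B1 v w). specialize (B2 v w). pose proof (Rabs_pos f). pose proof (Rabs_pos g).
    rewrite Rmult_plus_distr_r, !Rmult_assoc. apply Rplus_le_compat; apply Rmult_le_compat_l; assumption.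
  - intros eta He.
    set (m := Rmin 1 (eta / (Rabs f + Rabs g + 2))).
    assert (Hf := Rabs_pos f). assert (Hg := Rabs_pos g).
    assert (Hm : 0 < m). { unfold m. apply Rmin_pos; [lra|]. apply Rdiv_lt_0_compat; lra. }
    assert (Hm1 : m <= 1) by apply Rmin_l.
    assert (Hm2 : m * (Rabs f + Rabs g + 2) <= eta).
    { assert (X : m <= eta / (Rabs f + Rabs g + 2)) by apply Rmin_r.
      apply (Rmult_le_compat_r (Rabs f + Rabs g + 2)) in X; [|lra].
      replace (eta / (Rabs f + Rabs g + 2) * (Rabs f + Rabs g + 2)) with eta in X by (field; lra). exact X. }
    destruct (A1 m Hm) as [d1 [P1 Q1]]. destruct (A2 m Hm) as [d2 [P2 Q2]].
    exists (Rmin d1 d2). split; [apply Rmin_pos; assumption|]. intros v eps H1 H2.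
    pose proof (Rmin_l d1 d2). pose proof (Rmin_r d1 d2).
    specialize (Q1 v eps ltac:(lra) ltac:(lra)). specialize (Q2 v eps ltac:(lra) ltac:(lra)).
    replace (F v eps * G v eps - f * g) with ((F v eps - f) * (G v eps - g) + (F v eps - f) * g + f * (G v eps - g)) by ring.
    eapply Rle_lt_trans; [apply Rabs_triang|]. eapply Rle_lt_trans; [apply Rplus_le_compat_r, Rabs_triang|].
    rewrite !Rabs_mult.
    set (a := Rabs (F v eps - f)) in *. set (b := Rabs (G v eps - g)) in *.
    assert (0 <= a) by apply Rabs_pos. assert (0 <= b) by apply Rabs_pos. nra.
  - intros eta He.
    assert (Hf := Rabs_pos f). assert (Hg := Rabs_pos g).
    set (N := Rabs f + Rabs g + C1 + C2 + 4).
    assert (HN : 4 <= N) by (unfold N; lra).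
    set (m := Rmin 1 (eta / N)).
    assert (Hm : 0 < m). { unfold m. apply Rmin_pos; [lra|]. apply Rdiv_lt_0_compat; lra. }
    assert (Hm1 : m <= 1) by apply Rmin_l.
    assert (Hm2 : m * N <= eta).
    { assert (X : m <= eta / N) by apply Rmin_r.
      apply (Rmult_le_compat_r N) in X; [|lra]. replace (eta / N * N) with eta in X by (field; lra). exact X. }
    destruct (A1 m Hm) as [d1 [P1 Q1]]. destruct (A2 m Hm) as [d2 [P2 Q2]].
    destruct (S1 m Hm) as [d3 [P3 Q3]]. destruct (S2 m Hm) as [d4 [P4 Q4]].
    set (d := Rmin (Rmin d1 d2) (Rmin d3 d4)).
    assert (Hd : d <= d1 /\ d <= d2 /\ d <= d3 /\ d <= d4).
    { unfold d. pose proof (Rmin_l (Rmin d1 d2) (Rmin d3 d4)). pose proof (Rmin_r (Rmin d1 d2) (Rmin d3 d4)).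
      pose proof (Rmin_l d1 d2). pose proof (Rmin_r d1 d2). pose proof (Rmin_l d3 d4). pose proof (Rmin_r d3 d4). lra. }
    exists d. split; [unfold d; repeat apply Rmin_pos; assumption|]. intros v w eps H1 H2 H3.
    pose proof (Q1 v eps ltac:(lra) ltac:(lra)) as U1. pose proof (Q2 w eps ltac:(lra) ltac:(lra)) as U2.
    pose proof (Q3 v w eps ltac:(lra) ltac:(lra) ltac:(lra)) as U3.
    pose proof (Q4 v w eps ltac:(lra) ltac:(lra) ltac:(lra)) as U4.
    specialize (B1 v w). specialize (B2 v w).
    match goal with |- Rabs ?x <= _ => replace x with
      (F v eps * (G v eps - G w eps - K v w) + G w eps * (F v eps - F w eps - L v w)
       + (F v eps - f) * K v w + (G w eps - g) * L v w) by ring end.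
    assert (X1 : Rabs (F v eps) <= Rabs f + 1).
    { replace (F v eps) with ((F v eps - f) + f) by ring. eapply Rle_trans; [apply Rabs_triang|]. lra. }
    assert (X2 : Rabs (G w eps) <= Rabs g + 1).
    { replace (G w eps) with ((G w eps - g) + g) by ring. eapply Rle_trans; [apply Rabs_triang|]. lra. }
    specialize (D0 v w). set (dd := D v w) in *.
    eapply Rle_trans; [apply Rabs_triang|]. eapply Rle_trans; [apply Rplus_le_compat_r, Rabs_triang|].
    eapply Rle_trans; [apply Rplus_le_compat_r, Rplus_le_compat_r, Rabs_triang|]. rewrite !Rabs_mult.
    apply Rle_trans with ((Rabs f + 1) * (m * dd) + (Rabs g + 1) * (m * dd) + m * (C2 * dd) + m * (C1 * dd)).
    + repeat apply Rplus_le_compat; apply Rmult_le_compat; try apply Rabs_pos; lra.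
    + replace ((Rabs f + 1) * (m * dd) + (Rabs g + 1) * (m * dd) + m * (C2 * dd) + m * (C1 * dd)) with
        (m * (Rabs f + Rabs g + C1 + C2 + 2) * dd) by ring.
      apply Rmult_le_compat_r; [exact D0|]. unfold N in Hm2. nra.
Qed.

(** The outer function may depend on eps, which is needed for (exp (eps y) - 1) / eps. *)
Lemma sd_comp (phi : R -> R -> R) F f L p k : sd F f L ->
  (forall eta, 0 < eta -> exists d, 0 < d /\ forall x eps, Rabs (x - f) < d -> 0 < Rabs eps < d -> Rabs (phi eps x - p) < eta) ->
  (forall eta, 0 < eta -> exists d, 0 < d /\ forall x y eps, Rabs (x - f) < d -> Rabs (y - f) < d -> 0 < Rabs eps < d ->
     Rabs (phi eps x - phi eps y - k * (x - y)) <= eta * Rabs (x - y)) ->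
  sd (fun v e => phi e (F v e)) p (fun v w => k * L v w).
Proof.
  intros [[C [HC B]] A S] Hl Hs. split.
  - exists (Rabs k * C). split; [apply Rmult_le_pos; [apply Rabs_pos|exact HC]|].
    intros v w. rewrite Rabs_mult, Rmult_assoc. apply Rmult_le_compat_l; [apply Rabs_pos|apply B].
  - intros eta He. destruct (Hl eta He) as [d1 [P1 Q1]]. destruct (A d1 P1) as [d2 [P2 Q2]].
    exists (Rmin d1 d2). split; [apply Rmin_pos; assumption|]. intros v eps H1 H2.
    pose proof (Rmin_l d1 d2). pose proof (Rmin_r d1 d2). apply Q1; [apply Q2; lra|lra].
  - intros eta He.
    set (e1 := eta / (2 * (C + 1))). assert (He1 : 0 < e1) by (unfold e1; apply Rdiv_lt_0_compat; lra).
    set (e2 := Rmin 1 (eta / (2 * (Rabs k + 1)))).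
    assert (Hk := Rabs_pos k).
    assert (He2 : 0 < e2). { unfold e2. apply Rmin_pos; [lra|]. apply Rdiv_lt_0_compat; lra. }
    destruct (Hs e1 He1) as [d1 [P1 Q1]]. destruct (A d1 P1) as [d2 [P2 Q2]]. destruct (S e2 He2) as [d3 [P3 Q3]].
    set (d := Rmin d1 (Rmin d2 d3)).
    assert (Hd : d <= d1 /\ d <= d2 /\ d <= d3).
    { unfold d. pose proof (Rmin_l d1 (Rmin d2 d3)). pose proof (Rmin_r d1 (Rmin d2 d3)).
      pose proof (Rmin_l d2 d3). pose proof (Rmin_r d2 d3). lra. }
    exists d. split; [unfold d; repeat apply Rmin_pos; assumption|]. intros v w eps H1 H2 H3.
    specialize (Q1 (F v eps) (F w eps) eps (Q2 v eps ltac:(lra) ltac:(lra)) (Q2 w eps ltac:(lra) ltac:(lra)) ltac:(lra)).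
    specialize (Q3 v w eps ltac:(lra) ltac:(lra) ltac:(lra)). specialize (B v w). specialize (D0 v w). set (dd := D v w) in *.
    assert (X : Rabs (F v eps - F w eps) <= (C + 1) * dd).
    { replace (F v eps - F w eps) with ((F v eps - F w eps - L v w) + L v w) by ring.
      eapply Rle_trans; [apply Rabs_triang|]. assert (e2 <= 1) by apply Rmin_l. nra. }
    match goal with |- Rabs ?x <= _ => replace x with
      ((phi eps (F v eps) - phi eps (F w eps) - k * (F v eps - F w eps)) + k * (F v eps - F w eps - L v w)) by ring end.
    eapply Rle_trans; [apply Rabs_triang|]. rewrite Rabs_mult.
    apply Rle_trans with (e1 * ((C + 1) * dd) + Rabs k * (e2 * dd)).
    + apply Rplus_le_compat.
      * eapply Rle_trans; [exact Q1|]. apply Rmult_le_compat_l; lra.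
      * apply Rmult_le_compat_l; lra.
    + assert (E1 : e1 * (C + 1) = eta / 2) by (unfold e1; field; lra).
      assert (E2 : Rabs k * e2 <= eta / 2).
      { apply Rle_trans with ((Rabs k + 1) * (eta / (2 * (Rabs k + 1)))).
        - apply Rmult_le_compat; try lra. unfold e2. apply Rmin_r.
        - right. field. lra. }
      replace (e1 * ((C + 1) * dd) + Rabs k * (e2 * dd)) with ((e1 * (C + 1) + Rabs k * e2) * dd) by ring.
      apply Rmult_le_compat_r; lra.
Qed.

Lemma sd_comp_C1 (phi phi' : R -> R) F f L r : sd F f L -> 0 < r ->
  (forall x, Rabs (x - f) < r -> is_derive phi x (phi' x)) -> continuous phi' f ->
  sd (fun v e => phi (F v e)) (phi f) (fun v w => phi' f * L v w).
Proof.
  intros S Hr Dp Cp. apply (sd_comp (fun _ => phi) F f L (phi f) (phi' f) S).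
  - intros eta He.
    assert (C : continuous phi f).
    { apply (ex_derive_continuous phi f). exists (phi' f). apply Dp. rewrite Rminus_diag, Rabs_R0. exact Hr. }
    destruct (proj2 (continuity_pt_filterlim phi f) C eta He) as [d [Hd H]]. exists d. split; [exact Hd|].
    intros x _ Hx _. destruct (Req_dec x f) as [->|N]; [rewrite Rminus_diag, Rabs_R0; exact He|].
    apply H. split; [|exact Hx]. split; [exact I|]. intros E. apply N. symmetry. exact E.
  - intros eta He. destruct (proj2 (continuity_pt_filterlim phi' f) Cp eta He) as [d [Hd H]].
    exists (Rmin d r). split; [apply Rmin_pos; assumption|].
    intros x y _ Hx Hy _. pose proof (Rmin_l d r). pose proof (Rmin_r d r).
    assert (Hin : forall z, Rmin y x <= z <= Rmax y x -> Rabs (z - f) < Rmin d r).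
    { intros z Hz. apply Rabs_def2 in Hx. apply Rabs_def2 in Hy. apply Rabs_def1;
      revert Hz; unfold Rmin at 1, Rmax at 1; destruct (Rle_dec y x); lra. }
    destruct (MVT_gen phi y x phi') as [c [Hc E]].
    + intros z Hz. apply Dp. specialize (Hin z ltac:(lra)). lra.
    + intros z Hz. apply continuity_pt_filterlim. apply (ex_derive_continuous phi z). exists (phi' z). apply Dp.
      specialize (Hin z Hz). lra.
    + rewrite E. replace (phi' c * (x - y) - phi' f * (x - y)) with ((phi' c - phi' f) * (x - y)) by ring.
      rewrite Rabs_mult. apply Rmult_le_compat_r; [apply Rabs_pos|]. left.
      destruct (Req_dec c f) as [->|N]; [rewrite Rminus_diag, Rabs_R0; exact He|].
      apply H. split; [split; [exact I|intros X; apply N; symmetry; exact X]|].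
      specialize (Hin c Hc). simpl. unfold Rdist. lra.
Qed.

Lemma sd_minus F f L G g K : sd F f L -> sd G g K -> sd (fun v e => F v e - G v e) (f - g) (fun v w => L v w - K v w).
Proof.
  intros HF HG. 
  apply (sd_eq _ (f + (-1) * g) (fun v w => L v w + (g * 0 + (-1) * K v w))); [|ring|intros; ring].
  apply (sd_ext (fun v e => F v e + (-1) * G v e)).
  { exists 1. split; [lra|]. intros. ring. }
  apply sd_plus; [exact HF|]. apply (sd_mult (fun _ _ => -1) (-1) (fun _ _ => 0) G g K); [apply sd_const|exact HG].
Qed.

Lemma sd_inv F f L : f <> 0 -> sd F f L -> sd (fun v e => / F v e) (/ f) (fun v w => - / f ^ 2 * L v w).
Proof.
  intros N H. apply (sd_comp_C1 Rinv (fun x => - / x ^ 2) F f L (Rabs f) H).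
  - apply Rabs_pos_lt, N.
  - intros x Hx. assert (x <> 0). { intros ->. rewrite Rminus_0_l, Rabs_Ropp in Hx. lra. }
    auto_derive; [assumption|]. field. assumption.
  - apply (ex_derive_continuous (fun x => - / x ^ 2) f). auto_derive. nra.
Qed.

Lemma sd_atan F f L : sd F f L -> sd (fun v e => atan (F v e)) (atan f) (fun v w => / (1 + f ^ 2) * L v w).
Proof.
  intros H. apply (sd_comp_C1 atan (fun x => / (1 + x ^ 2)) F f L 1 H); [lra| |].
  - intros x _. auto_derive; [exact I|]. field. nra.
  - apply (ex_derive_continuous (fun x => / (1 + x ^ 2)) f). auto_derive. nra.
Qed.

Lemma sd_exp F f L : sd F f L -> sd (fun v e => exp (F v e)) (exp f) (fun v w => exp f * L v w).
Proof.
  intros H. apply (sd_comp_C1 exp exp F f L 1 H); [lra| |].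
  - intros x _. apply is_derive_exp.
  - apply (ex_derive_continuous exp f). auto_derive. exact I.
Qed.

(** By the mean value theorem the derivative in x is l exp (eps l c), which tends to l uniformly; the limit at f
    itself is the derivative of an exponential at 0. *)
Lemma sd_expm1 F f L l : sd F f L -> sd (fun v e => (exp (e * (l * F v e)) - 1) / e) (l * f) (fun v w => l * L v w).
Proof.
  intros H. 
  assert (Key : forall eta, 0 < eta -> exists d, 0 < d /\ forall x y eps, Rabs (x - f) < d -> Rabs (y - f) < d -> 0 < Rabs eps < d ->
     Rabs ((exp (eps * (l * x)) - 1) / eps - (exp (eps * (l * y)) - 1) / eps - l * (x - y)) <= eta * Rabs (x - y)).
  { intros eta He. 
    set (e1 := Rmin 1 (eta / (Rabs l + 1))). assert (Hl := Rabs_pos l). assert (Hf := Rabs_pos f).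
    assert (He1 : 0 < e1) by (unfold e1; apply Rmin_pos; [lra|apply Rdiv_lt_0_compat; lra]).
    assert (C : continuous exp 0) by (apply (ex_derive_continuous exp 0); auto_derive; exact I).
    destruct (proj2 (continuity_pt_filterlim exp 0) C e1 He1) as [d1 [Hd1 Q]].
    assert (Q' : forall z, Rabs z < d1 -> Rabs (exp z - 1) < e1).
    { intros z Hz. destruct (Req_dec z 0) as [->|N]. { rewrite exp_0, Rminus_diag, Rabs_R0. exact He1. }
      rewrite <- exp_0. apply Q. split; [split; [exact I|intros X; apply N; symmetry; exact X]|].
      simpl. unfold Rdist. rewrite Rminus_0_r. exact Hz. }
    set (M := (Rabs l + 1) * (Rabs f + 1)). assert (HM : 0 < M) by (unfold M; nra).
    exists (Rmin 1 (d1 / M)). split; [apply Rmin_pos; [lra|apply Rdiv_lt_0_compat; assumption]|].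
    intros x y eps Hx Hy Heps. pose proof (Rmin_l 1 (d1 / M)). pose proof (Rmin_r 1 (d1 / M)).
    assert (He0 : eps <> 0). { intros ->. rewrite Rabs_R0 in Heps. lra. }
    set (ph := fun z => (exp (eps * (l * z)) - 1) / eps).
    destruct (MVT_gen ph y x (fun z => l * exp (eps * (l * z)))) as [c [Hc E]].
    { intros z _. unfold ph. auto_derive; [first [exact I|assumption]|]. field. assumption. }
    { intros z _. apply continuity_pt_filterlim. apply (ex_derive_continuous ph z). unfold ph. auto_derive. first [exact I|assumption]. }
    change (Rabs (ph x - ph y - l * (x - y)) <= eta * Rabs (x - y)). rewrite E.
    replace (l * exp (eps * (l * c)) * (x - y) - l * (x - y)) with (l * (exp (eps * (l * c)) - 1) * (x - y)) by ring.
    rewrite !Rabs_mult. apply Rmult_le_compat_r; [apply Rabs_pos|].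
    assert (Hcf : Rabs c <= Rabs f + 1).
    { replace c with ((c - f) + f) by ring. eapply Rle_trans; [apply Rabs_triang|].
      assert (Rabs (c - f) <= 1); [|lra]. apply Rabs_le. apply Rabs_def2 in Hx. apply Rabs_def2 in Hy.
      revert Hc. unfold Rmin at 1, Rmax at 1. destruct (Rle_dec y x); lra. }
    assert (Hz : Rabs (eps * (l * c)) < d1).
    { rewrite !Rabs_mult. apply Rle_lt_trans with (Rabs eps * M).
      - apply Rmult_le_compat_l; [lra|]. unfold M. apply Rmult_le_compat; try apply Rabs_pos; lra.
      - apply Rlt_le_trans with (d1 / M * M); [apply Rmult_lt_compat_r; lra|]. right. field. lra. }
    specialize (Q' _ Hz).
    apply Rle_trans with ((Rabs l + 1) * (eta / (Rabs l + 1))).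
    - apply Rmult_le_compat; try apply Rabs_pos; try lra. assert (e1 <= eta / (Rabs l + 1)) by apply Rmin_r. lra.
    - right. field. lra. }
  apply (sd_comp (fun e x => (exp (e * (l * x)) - 1) / e) F f L (l * f) l H); [|exact Key].
  intros eta He. assert (Hl := Rabs_pos l).
  assert (Df : is_derive (fun t => exp (t * (l * f))) 0 (l * f)) by (auto_derive; [exact I|rewrite Rmult_0_l, exp_0; ring]).
  destruct (proj1 (is_derive_R_DQ _ _ _) Df (mkposreal (eta / 2) ltac:(lra))) as [d1 Q1]. simpl in Q1.
  destruct (Key 1 Rlt_0_1) as [d2 [P2 Q2]]. set (d3 := eta / (2 * (Rabs l + 2))).
  assert (P3 : 0 < d3) by (apply Rdiv_lt_0_compat; lra).
  exists (Rmin d1 (Rmin d2 d3)). split; [repeat apply Rmin_pos; try assumption; apply cond_pos|]. intros x eps Hx Heps.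
  pose proof (Rmin_l d1 (Rmin d2 d3)). pose proof (Rmin_r d1 (Rmin d2 d3)). pose proof (Rmin_l d2 d3). pose proof (Rmin_r d2 d3).
  specialize (Q1 eps ltac:(intros ->; rewrite Rabs_R0 in Heps; lra) ltac:(lra)). rewrite Rplus_0_l, Rmult_0_l, exp_0 in Q1.
  specialize (Q2 x f eps ltac:(lra) ltac:(rewrite Rminus_diag, Rabs_R0; lra) ltac:(lra)).
  set (gx := (exp (eps * (l * x)) - 1) / eps) in *. set (gf := (exp (eps * (l * f)) - 1) / eps) in *.
  replace (gx - l * f) with ((gx - gf - l * (x - f)) + (gf - l * f) + l * (x - f)) by ring.
  eapply Rle_lt_trans; [apply Rabs_triang|]. eapply Rle_lt_trans; [apply Rplus_le_compat_r, Rabs_triang|]. rewrite (Rabs_mult l).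
  assert (E3 : d3 * (Rabs l + 2) = eta / 2) by (unfold d3; field; lra). nra.
Qed.
End SD.

(** * Defects of a passage through a zone *)

(** The tangential coordinate Y = y + x/2 and x parametrise the manifold. *)
Definition spt (c d x Y : R) : R3 :=
  (x, Y - x / 2, Y ^ 2 - (1 - c) * x * Y - (c / 2 - 1 / 4 - d) * x ^ 2).

Lemma spt_px c d x Y : px (spt c d x Y) = x. Proof. reflexivity. Qed.
Lemma spt_tY c d x Y : tY (spt c d x Y) = Y. Proof. unfold tY, spt, px, py; simpl. ring. Qed.
Lemma spt_tw c d x Y Z : tw Z (spt c d x Y) = Y ^ 2 - x / 2 - (1 - c) * x * Y - (c / 2 - 1 / 4 - d) * x ^ 2 - zm Z.
Proof. unfold tw, spt, px, pz; simpl. ring. Qed.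
Lemma quadric_tilde c d p : quadric c d p = (pz p - px p / 2) - tY p ^ 2 + px p / 2 + (1 - c) * px p * tY p
  + (c / 2 - 1 / 4 - d) * px p ^ 2.
Proof. destruct p as [[x y] z]. unfold quadric, tY, px, py, pz; simpl. field. Qed.
Lemma spt_quadric c d x Y : quadric c d (spt c d x Y) = 0.
Proof. rewrite quadric_tilde, spt_tY. unfold spt, px, pz; simpl. field. Qed.
Lemma quadric_spt c d p : quadric c d p = 0 -> p = spt c d (px p) (tY p).
Proof.
  intros H. rewrite quadric_tilde in H. destruct p as [[x y] z]. unfold spt, tY, px, py, pz in *. simpl in *.
  apply R3_eq; unfold px, py, pz; simpl; lra.
Qed.

(** Time needed for the angle to pass from p1 to p2 with n extra full turns. *)
Definition tT (Z : zone) (e n : R) (p1 p2 : R3) : R :=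
  (2 * PI * n + atan (cU Z e p1 / cV Z e p1) - atan (cU Z e p2 / cV Z e p2)) / om Z e.
Definition qn Z e p := cU Z e p ^ 2 + cV Z e p ^ 2.
(** Defects of the claim that the flow carries p1 to p2 in the time tT: transversally and in the squared radius. Both
    are O(eps), hence the division. *)
Definition Fx Z e n p1 p2 := (cH Z e p2 - exp (tT Z e n p1 p2) * cH Z e p1) / e.
Definition Fq Z e n p1 p2 := (qn Z e p2 - exp (e * (2 * zl Z * tT Z e n p1 p2)) * qn Z e p1) / e.

(** Unknowns of one passage: the level s, and for each endpoint its tangential and x-displacements, rescaled by eps.
    *)
Definition V5 : Type := (R * R * R * R * R)%type.
Definition v5s (v : V5) := fst (fst (fst (fst v))).
Definition v5t1 (v : V5) := snd (fst (fst (fst v))).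
Definition v5x1 (v : V5) := snd (fst (fst v)).
Definition v5t2 (v : V5) := snd (fst v).
Definition v5x2 (v : V5) := snd v.
Definition D5 (v w : V5) : R := Rabs (v5s v - v5s w) + Rabs (v5t1 v - v5t1 w) + Rabs (v5x1 v - v5x1 w)
  + Rabs (v5t2 v - v5t2 w) + Rabs (v5x2 v - v5x2 w).

Lemma D5_pos v w : 0 <= D5 v w.
Proof. unfold D5. repeat apply Rplus_le_le_0_compat; apply Rabs_pos. Qed.

Lemma cont_at_0 (f : R -> R) : ex_derive f 0 -> continuous f 0.
Proof. exact (ex_derive_continuous f 0). Qed.

Section Functional.
Variables (c d : R) (Z : zone) (h n : R).
Hypothesis Hh : h * h = 1.
Definition p1v (v : V5) (e : R) := spt c d (e * v5x1 v) (h * v5s v + e * v5t1 v).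
Definition p2v (v : V5) (e : R) := spt c d (e * v5x2 v) (- h * v5s v + e * v5t2 v).

Variable v0 : V5.
Let s0 := v5s v0.
Let t1 := v5t1 v0.
Let x1 := v5x1 v0.
Let t2 := v5t2 v0.
Let x2 := v5x2 v0.
Let W0 := s0 ^ 2 - zm Z.
Hypothesis HW : 0 < W0.
Let g := 1 - c.
Notation sdv := (sd D5 v0).

Lemma proj_le5 v w : Rabs (v5s v - v5s w) <= D5 v w /\ Rabs (v5t1 v - v5t1 w) <= D5 v w /\ Rabs (v5x1 v - v5x1 w) <= D5 v w
  /\ Rabs (v5t2 v - v5t2 w) <= D5 v w /\ Rabs (v5x2 v - v5x2 w) <= D5 v w.
Proof.
  unfold D5. pose proof (Rabs_pos (v5s v - v5s w)). pose proof (Rabs_pos (v5t1 v - v5t1 w)).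
  pose proof (Rabs_pos (v5x1 v - v5x1 w)). pose proof (Rabs_pos (v5t2 v - v5t2 w)). pose proof (Rabs_pos (v5x2 v - v5x2 w)). lra.
Qed.

Lemma sd_s : sdv (fun v _ => v5s v) s0 (fun v w => v5s v - v5s w).
Proof. apply (sd_proj D5 v0 D5_pos v5s). intros; apply proj_le5. Qed.
Lemma sd_t1 : sdv (fun v _ => v5t1 v) t1 (fun v w => v5t1 v - v5t1 w).
Proof. apply (sd_proj D5 v0 D5_pos v5t1). intros; apply proj_le5. Qed.
Lemma sd_x1 : sdv (fun v _ => v5x1 v) x1 (fun v w => v5x1 v - v5x1 w).
Proof. apply (sd_proj D5 v0 D5_pos v5x1). intros; apply proj_le5. Qed.
Lemma sd_t2 : sdv (fun v _ => v5t2 v) t2 (fun v w => v5t2 v - v5t2 w).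
Proof. apply (sd_proj D5 v0 D5_pos v5t2). intros; apply proj_le5. Qed.
Lemma sd_x2 : sdv (fun v _ => v5x2 v) x2 (fun v w => v5x2 v - v5x2 w).
Proof. apply (sd_proj D5 v0 D5_pos v5x2). intros; apply proj_le5. Qed.

Lemma sd_e : sdv (fun _ e => e) 0 (fun _ _ => 0).
Proof. apply (sd_eps D5 v0 D5_pos (fun e => e)). apply continuous_id. Qed.
Lemma sd_k k : sdv (fun _ _ => k) k (fun _ _ => 0).
Proof. apply sd_const, D5_pos. Qed.
Lemma sd_of_eps (f : R -> R) k : f 0 = k -> ex_derive f 0 -> sdv (fun _ => f) k (fun _ _ => 0).
Proof. intros <- H. apply (sd_eps D5 v0 D5_pos f). apply cont_at_0, H. Qed.

Lemma om_0 : om Z 0 = 1.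
Proof. unfold om. replace (1 - 0 ^ 2 * zn Z ^ 2) with 1 by ring. apply sqrt_1. Qed.
Lemma sd_om : sdv (fun _ => om Z) 1 (fun _ _ => 0).
Proof. apply sd_of_eps; [exact om_0|]. unfold om. auto_derive. simpl. lra. Qed.
Lemma sd_y1 : sdv (fun _ => y1 Z) (- zk Z) (fun _ _ => 0).
Proof. apply sd_of_eps; unfold y1, cDl; [field|auto_derive; simpl; lra]. Qed.
Lemma sd_w1 : sdv (fun _ => w1 Z) 0 (fun _ _ => 0).
Proof. apply sd_of_eps; unfold w1, y1, cDl; [field|auto_derive; simpl; lra]. Qed.
Definition P0 := (- zg1 Z - zg2 Z) / 2.
Definition Q0 := (zg1 Z - zg2 Z) / 2.
Lemma sd_P : sdv (fun _ => cP Z) P0 (fun _ _ => 0).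
Proof. apply sd_of_eps; unfold cP, P0, cdet; [field|auto_derive; simpl; lra]. Qed.
Lemma sd_Q : sdv (fun _ => cQ Z) Q0 (fun _ _ => 0).
Proof. apply sd_of_eps; unfold cQ, Q0, cdet; [field|auto_derive; simpl; lra]. Qed.
Lemma sd_R : sdv (fun _ => cR Z) (- zg0 Z) (fun _ _ => 0).
Proof. apply sd_of_eps; unfold cR, w1, y1, cDl; [field|auto_derive; simpl; lra]. Qed.

Lemma sdp F f L G k K : sdv F f L -> sdv G k K -> sdv (fun v e => F v e + G v e) (f + k) (fun v w => L v w + K v w).
Proof. apply sd_plus. Qed.
Lemma sdm F f L G k K : sdv F f L -> sdv G k K -> sdv (fun v e => F v e - G v e) (f - k) (fun v w => L v w - K v w).
Proof. apply sd_minus, D5_pos. Qed.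
Lemma sdx F f L G k K : sdv F f L -> sdv G k K -> sdv (fun v e => F v e * G v e) (f * k) (fun v w => k * L v w + f * K v w).
Proof. apply sd_mult, D5_pos. Qed.

(** Height of an endpoint over s^2, divided by eps. *)
Definition zeta (k s t x e : R) := 2 * k * s * t + e * (t * t) - / 2 * x - g * (x * (k * s + e * t)) - (c / 2 - 1 / 4 - d) * (e * (x * x)).
Definition ww (k s t x e : R) := s * s - zm Z + e * (zeta k s t x e - w1 Z e).
Definition zeta0 k s t x := 2 * k * s * t - / 2 * x - g * (x * (k * s)).

Lemma dw_spt k s t x e : k * k = 1 -> dw Z e (spt c d (e * x) (k * s + e * t)) = ww k s t x e.
Proof.
  intros Hk. unfold dw. rewrite spt_tw. unfold ww, zeta, g.
  replace ((k * s + e * t) ^ 2) with (k * k * (s * s) + 2 * k * s * (e * t) + e * e * (t * t)) by ring.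
  rewrite Hk. field.
Qed.
Lemma dY_spt k s t x e : dY Z e (spt c d (e * x) (k * s + e * t)) = k * s + e * t - e * y1 Z e.
Proof. unfold dY. rewrite spt_tY. reflexivity. Qed.

Section End.
Variables (k : R) (pt px' : V5 -> R) (t x : R) (Lt Lx : V5 -> V5 -> R).
Hypotheses (Hk : k * k = 1) (St : sdv (fun v _ => pt v) t Lt) (Sx : sdv (fun v _ => px' v) x Lx).
Let pp v e := spt c d (e * px' v) (k * v5s v + e * pt v).
Let Ls (v w : V5) := v5s v - v5s w.

Lemma sd_zeta : sdv (fun v e => zeta k (v5s v) (pt v) (px' v) e) (zeta0 k s0 t x)
  (fun v w => 2 * k * s0 * Lt v w + 2 * k * t * Ls v w - (/ 2 + g * k * s0) * Lx v w - g * k * x * Ls v w).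
Proof.
  unfold zeta. eapply sd_eq.
  - apply sdm; [apply sdm; [apply sdm; [apply sdp|]|]|].
    + apply sdx; [apply sdx; [apply sd_k|apply sd_s]|exact St].
    + apply sdx; [apply sd_e|apply sdx; exact St].
    + apply sdx; [apply sd_k|exact Sx].
    + apply sdx; [apply sd_k|]. apply sdx; [exact Sx|]. apply sdp; apply sdx; [apply sd_k|apply sd_s|apply sd_e|exact St].
    + apply sdx; [apply sd_k|]. apply sdx; [apply sd_e|apply sdx; exact Sx].
  - unfold zeta0. ring.
  - intros v w. cbv beta. unfold Ls. ring.
Qed.

Lemma sd_ww : sdv (fun v e => ww k (v5s v) (pt v) (px' v) e) W0 (fun v w => 2 * s0 * Ls v w).
Proof.
  unfold ww. eapply sd_eq.
  - apply sdp; [apply sdm; [apply sdx; apply sd_s|apply sd_k]|]. apply sdx; [apply sd_e|].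
    apply sdm; [apply sd_zeta|apply sd_w1].
  - unfold W0. ring.
  - intros v w. cbv beta. unfold Ls. ring.
Qed.

Lemma sd_cU : sdv (fun v e => cU Z e (pp v e)) (k * s0) (fun v w => k * Ls v w).
Proof.
  apply (sd_ext D5 v0 (fun v e => k * v5s v + e * pt v - e * y1 Z e - e * zn Z * ww k (v5s v) (pt v) (px' v) e)).
  { exists 1. split; [lra|]. intros. unfold cU, pp. rewrite dY_spt, dw_spt by exact Hk. reflexivity. }
  eapply sd_eq.
  - apply sdm; [apply sdm; [apply sdp|]|]; apply sdx; [apply sd_k|apply sd_s|apply sd_e|exact St|apply sd_e|apply sd_y1| |apply sd_ww].
    apply sdx; [apply sd_e|apply sd_k].
  - ring.
  - intros v w. cbv beta. unfold Ls. ring.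
Qed.
Lemma sd_cV : sdv (fun v e => cV Z e (pp v e)) W0 (fun v w => 2 * s0 * Ls v w).
Proof.
  apply (sd_ext D5 v0 (fun v e => om Z e * ww k (v5s v) (pt v) (px' v) e)).
  { exists 1. split; [lra|]. intros. unfold cV, pp. rewrite dw_spt by exact Hk. reflexivity. }
  eapply sd_eq; [apply sdx; [apply sd_om|apply sd_ww]| |]; [ring|intros v w; cbv beta; ring].
Qed.
Lemma sd_cH : sdv (fun v e => cH Z e (pp v e) / e) (x - (P0 * (k * s0) + Q0 * W0 - zg0 Z))
  (fun v w => Lx v w - (P0 * k + 2 * Q0 * s0) * Ls v w).
Proof.
  apply (sd_ext D5 v0 (fun v e => px' v - (cP Z e * (k * v5s v + e * pt v - e * y1 Z e) + cQ Z e * ww k (v5s v) (pt v) (px' v) e + cR Z e))).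
  { exists 1. split; [lra|]. intros v e _ He. unfold cH, pp. rewrite dY_spt, dw_spt by exact Hk. rewrite spt_px. field.
    intros ->. rewrite Rabs_R0 in He. lra. }
  eapply sd_eq.
  - apply sdm; [exact Sx|]. apply sdp; [apply sdp; apply sdx; [apply sd_P| |apply sd_Q|apply sd_ww]|apply sd_R].
    apply sdm; [apply sdp; apply sdx; [apply sd_k|apply sd_s|apply sd_e|exact St]|apply sdx; [apply sd_e|apply sd_y1]].
  - ring.
  - intros v w. cbv beta. unfold Ls. ring.
Qed.
Lemma sd_angle : sdv (fun v e => atan (cU Z e (pp v e) / cV Z e (pp v e))) (atan (k * s0 / W0))
  (fun v w => k * (- (s0 ^ 2 + zm Z) / (W0 ^ 2 + s0 ^ 2)) * Ls v w).
Proof.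
  eapply sd_eq; [apply sd_atan; [exact D5_pos|]; apply sdx; [apply sd_cU|apply sd_inv; [exact D5_pos| |apply sd_cV]; lra]| |].
  - reflexivity.
  - intros v w. cbv beta. unfold Ls.
    assert (K2 : (k * s0 * / W0) ^ 2 = s0 ^ 2 * / W0 ^ 2).
    { replace ((k * s0 * / W0) ^ 2) with (k * k * (s0 ^ 2 * (/ W0) ^ 2)) by ring. rewrite Hk, pow_inv. ring. }
    rewrite K2. replace (zm Z) with (s0 ^ 2 - W0) by (unfold W0; ring). field. repeat split; nra.
Qed.
End End.

Definition T0 := 2 * PI * n + atan (h * s0 / W0) - atan (- h * s0 / W0).
Definition T0' := 2 * h * (- (s0 ^ 2 + zm Z) / (W0 ^ 2 + s0 ^ 2)).
Let Ls (v w : V5) := v5s v - v5s w.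
Let Lt1 (v w : V5) := v5t1 v - v5t1 w.
Let Lx1 (v w : V5) := v5x1 v - v5x1 w.
Let Lt2 (v w : V5) := v5t2 v - v5t2 w.
Let Lx2 (v w : V5) := v5x2 v - v5x2 w.
Lemma Hnh : - h * - h = 1. Proof. lra. Qed.

(** Only the level enters the limit, and the rescaled displacements move the time by O(eps). *)
Lemma sd_T : sdv (fun v e => tT Z e n (p1v v e) (p2v v e)) T0 (fun v w => T0' * Ls v w).
Proof.
  unfold tT. eapply sd_eq.
  - apply sdx.
    + apply sdm; [apply sdp; [apply sd_k|]|].
      * apply (sd_angle h v5t1 v5x1 t1 x1 Lt1 Lx1 Hh sd_t1 sd_x1).
      * apply (sd_angle (- h) v5t2 v5x2 t2 x2 Lt2 Lx2 Hnh sd_t2 sd_x2).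
    + apply sd_inv; [exact D5_pos| |apply sd_om]; lra.
  - unfold T0. field.
  - intros v w. cbv beta. unfold T0', Ls. field. nra.
Qed.

(** First order x-position of the invariant plane over the crossing point. *)
Definition rho (k s : R) := P0 * (k * s) + Q0 * (s ^ 2 - zm Z) - zg0 Z.
Definition Lfx (ds dx1 dx2 : R) :=
  dx2 - (P0 * - h + 2 * Q0 * s0) * ds - exp T0 * (dx1 - (P0 * h + 2 * Q0 * s0) * ds)
  - exp T0 * T0' * (x1 - rho h s0) * ds.

Lemma sd_Fx : sdv (fun v e => Fx Z e n (p1v v e) (p2v v e)) (x2 - rho (- h) s0 - exp T0 * (x1 - rho h s0))
   (fun v w => Lfx (Ls v w) (Lx1 v w) (Lx2 v w)).
Proof.
  apply (sd_ext D5 v0 (fun v e => cH Z e (p2v v e) / e - exp (tT Z e n (p1v v e) (p2v v e)) * (cH Z e (p1v v e) / e))).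
  { exists 1. split; [lra|]. intros v e _ He. unfold Fx. field. intros ->. rewrite Rabs_R0 in He. lra. }
  eapply sd_eq.
  - apply sdm.
    + apply (sd_cH (- h) v5t2 v5x2 t2 x2 Lt2 Lx2 Hnh sd_t2 sd_x2).
    + apply sdx; [apply sd_exp; [exact D5_pos|apply sd_T]|apply (sd_cH h v5t1 v5x1 t1 x1 Lt1 Lx1 Hh sd_t1 sd_x1)].
  - unfold rho, W0. ring.
  - intros v w. cbv beta. unfold Lfx, rho, Lx1, Lx2, Ls, W0. ring.
Qed.

(** Limit of Fq; h = 1 above and h = -1 below. *)
Definition fq0 (s t1 x1 t2 x2 T : R) :=
  - 2 * h * s * (1 + 2 * (s ^ 2 - zm Z)) * (t1 + t2) - (s ^ 2 - zm Z) * (x2 - x1) + 2 * g * h * s * (s ^ 2 - zm Z) * (x1 + x2)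
  - 4 * zk Z * h * s + 4 * zn Z * h * s * (s ^ 2 - zm Z) - 2 * zl Z * T * (s ^ 2 + (s ^ 2 - zm Z) ^ 2).
(** Partial derivative of fq0 in s, the time T being a function of s with derivative dT. *)
Definition fq0s (s t1 x1 t2 x2 T dT : R) :=
  - 2 * h * (1 + 2 * (s ^ 2 - zm Z)) * (t1 + t2) - 2 * h * s * (4 * s) * (t1 + t2)
  - 2 * s * (x2 - x1) + 2 * g * h * (s ^ 2 - zm Z) * (x1 + x2) + 2 * g * h * s * (2 * s) * (x1 + x2)
  - 4 * zk Z * h + 4 * zn Z * h * (s ^ 2 - zm Z) + 4 * zn Z * h * s * (2 * s)
  - 2 * zl Z * dT * (s ^ 2 + (s ^ 2 - zm Z) ^ 2) - 2 * zl Z * T * (2 * s + 2 * (s ^ 2 - zm Z) * (2 * s)).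
Definition Lfq (ds dt1 dx1 dt2 dx2 : R) :=
  - 2 * h * s0 * (1 + 2 * W0) * (dt1 + dt2) - W0 * (dx2 - dx1) + 2 * g * h * s0 * W0 * (dx1 + dx2)
  + fq0s s0 t1 x1 t2 x2 T0 T0' * ds.

(** The difference of squares is factored: the sum of the U and the difference of the V are multiples of e, which
    cancels the division. *)
Lemma sd_Fq : sdv (fun v e => Fq Z e n (p1v v e) (p2v v e)) (fq0 s0 t1 x1 t2 x2 T0)
   (fun v w => Lfq (Ls v w) (Lt1 v w) (Lx1 v w) (Lt2 v w) (Lx2 v w)).
Proof.
  pose proof (sd_ww h v5t1 v5x1 t1 x1 Lt1 Lx1 sd_t1 sd_x1) as SW1.
  pose proof (sd_ww (- h) v5t2 v5x2 t2 x2 Lt2 Lx2 sd_t2 sd_x2) as SW2.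
  pose proof (sd_zeta h v5t1 v5x1 t1 x1 Lt1 Lx1 sd_t1 sd_x1) as SZ1.
  pose proof (sd_zeta (- h) v5t2 v5x2 t2 x2 Lt2 Lx2 sd_t2 sd_x2) as SZ2.
  pose proof (sd_cU h v5t1 v5x1 t1 x1 Lt1 Lx1 Hh sd_t1 sd_x1) as SU1.
  pose proof (sd_cU (- h) v5t2 v5x2 t2 x2 Lt2 Lx2 Hnh sd_t2 sd_x2) as SU2.
  pose proof (sd_cV h v5t1 v5x1 t1 x1 Lt1 Lx1 Hh sd_t1 sd_x1) as SV1.
  pose proof (sd_cV (- h) v5t2 v5x2 t2 x2 Lt2 Lx2 Hnh sd_t2 sd_x2) as SV2.
  fold (p1v) in *.
  apply (sd_ext D5 v0 (fun v e =>
     (v5t1 v + v5t2 v - 2 * y1 Z e - zn Z * (ww h (v5s v) (v5t1 v) (v5x1 v) e + ww (- h) (v5s v) (v5t2 v) (v5x2 v) e))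
       * (cU Z e (p2v v e) - cU Z e (p1v v e))
     + om Z e * (zeta (- h) (v5s v) (v5t2 v) (v5x2 v) e - zeta h (v5s v) (v5t1 v) (v5x1 v) e) * (cV Z e (p1v v e) + cV Z e (p2v v e))
     - (exp (e * (2 * zl Z * tT Z e n (p1v v e) (p2v v e))) - 1) / e
        * (cU Z e (p1v v e) * cU Z e (p1v v e) + cV Z e (p1v v e) * cV Z e (p1v v e)))).
  { exists 1. split; [lra|]. intros v e _ He.
    assert (He0 : e <> 0) by (intros ->; rewrite Rabs_R0 in He; lra).
    unfold Fq, qn. set (ex := exp _).
    assert (EU : cU Z e (p2v v e) + cU Z e (p1v v e) = e * (v5t1 v + v5t2 v - 2 * y1 Z e - zn Z * (ww h (v5s v) (v5t1 v) (v5x1 v) e + ww (- h) (v5s v) (v5t2 v) (v5x2 v) e))).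
    { unfold cU, p1v, p2v. rewrite !dY_spt, !dw_spt by (first [exact Hh|exact Hnh]). ring. }
    assert (EV : cV Z e (p2v v e) - cV Z e (p1v v e) = e * (om Z e * (zeta (- h) (v5s v) (v5t2 v) (v5x2 v) e - zeta h (v5s v) (v5t1 v) (v5x1 v) e))).
    { unfold cV, p1v, p2v. rewrite !dw_spt by (first [exact Hh|exact Hnh]). unfold ww. ring. }
    set (U1 := cU Z e (p1v v e)) in *. set (U2 := cU Z e (p2v v e)) in *. set (V1 := cV Z e (p1v v e)) in *. set (V2 := cV Z e (p2v v e)) in *.
    match goal with |- ?a * _ + ?b * _ - _ = _ => set (A := a) in *; set (B := b) in * end.
    replace (U2 ^ 2 + V2 ^ 2 - ex * (U1 ^ 2 + V1 ^ 2)) with ((U2 + U1) * (U2 - U1) + (V2 - V1) * (V1 + V2) - (ex - 1) * (U1 * U1 + V1 * V1)) by ring.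
    rewrite EU, EV. field. exact He0. }
  eapply sd_eq.
  - apply sdm; [apply sdp; apply sdx|].
    + apply sdm; [apply sdm; [apply sdp; [apply sd_t1|apply sd_t2]|apply sdx; [apply sd_k|apply sd_y1]]|].
      apply sdx; [apply sd_k|]. apply sdp; [exact SW1|exact SW2].
    + apply sdm; [exact SU2|exact SU1].
    + apply sdx; [apply sd_om|]. apply sdm; [exact SZ2|exact SZ1].
    + apply sdp; [exact SV1|exact SV2].
    + apply sdx; [apply (sd_expm1 D5 v0 D5_pos _ _ _ (2 * zl Z) sd_T)|].
      apply sdp; apply sdx; [exact SU1|exact SU1|exact SV1|exact SV1].
  - unfold fq0, zeta0. fold W0. 
    field [Hh].
  - intros v w. cbv beta. unfold Lfq, fq0s, zeta0, Ls, Lt1, Lt2, Lx1, Lx2. fold W0.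
    field [Hh].
Qed.
End Functional.

(** * Branches of periodic passages *)

Lemma sd_pull {V W : Type} (D : V -> V -> R) (D' : W -> W -> R) (f : W -> V) w0 F f0 L :
  (forall v w, D (f v) (f w) <= D' v w) -> sd D (f w0) F f0 L ->
  sd D' w0 (fun w e => F (f w) e) f0 (fun v w => L (f v) (f w)).
Proof.
  intros H [[C [HC B]] A S]. split.
  - exists C. split; [exact HC|]. intros v w. eapply Rle_trans; [apply B|]. apply Rmult_le_compat_l; auto.
  - intros eta He. destruct (A eta He) as [d [Hd Q]]. exists d. split; [exact Hd|]. intros v e Hv Hep.
    apply Q; [|exact Hep]. eapply Rle_lt_trans; [apply H|exact Hv].
  - intros eta He. destruct (S eta He) as [d [Hd Q]]. exists d. split; [exact Hd|]. intros v w e Hv Hw Hep.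
    eapply Rle_trans; [apply Q; try exact Hep; eapply Rle_lt_trans; try apply H; assumption|].
    apply Rmult_le_compat_l; [lra|apply H].
Qed.

Record V4 : Type := mk4 { qa : R; qb : R; qs : R; qg : R }.
Definition D4 (v w : V4) : R := Rabs (qa v - qa w) + Rabs (qb v - qb w) + Rabs (qs v - qs w) + Rabs (qg v - qg w).

Lemma D4_refl v : D4 v v = 0.
Proof. unfold D4. rewrite !Rminus_diag, Rabs_R0. ring. Qed.
Lemma D4_sym v w : D4 v w = D4 w v.
Proof. unfold D4. rewrite (Rabs_minus_sym (qa v)), (Rabs_minus_sym (qb v)), (Rabs_minus_sym (qs v)), (Rabs_minus_sym (qg v)). reflexivity. Qed.
Lemma D4_tri u v w : D4 u w <= D4 u v + D4 v w.
Proof.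
  unfold D4. 
  pose proof (Rabs_triang (qa u - qa v) (qa v - qa w)). pose proof (Rabs_triang (qb u - qb v) (qb v - qb w)).
  pose proof (Rabs_triang (qs u - qs v) (qs v - qs w)). pose proof (Rabs_triang (qg u - qg v) (qg v - qg w)).
  replace (qa u - qa w) with (qa u - qa v + (qa v - qa w)) by ring. replace (qb u - qb w) with (qb u - qb v + (qb v - qb w)) by ring.
  replace (qs u - qs w) with (qs u - qs v + (qs v - qs w)) by ring. replace (qg u - qg w) with (qg u - qg v + (qg v - qg w)) by ring.
  lra.
Qed.
Lemma D4_eq v w : D4 v w <= 0 -> v = w.
Proof.
  unfold D4. intros H. destruct v, w. simpl in H.
  pose proof (Rabs_pos (qa0 - qa1)). pose proof (Rabs_pos (qb0 - qb1)). pose proof (Rabs_pos (qs0 - qs1)). pose proof (Rabs_pos (qg0 - qg1)).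
  assert (X : forall x y, Rabs (x - y) = 0 -> x = y).
  { intros x y E. destruct (Req_dec x y); [assumption|]. exfalso. apply (Rabs_no_R0 (x - y)); lra. }
  f_equal; apply X; lra.
Qed.

Lemma geom_cauchy (u : nat -> R) C : 0 <= C -> (forall n, Rabs (u (S n) - u n) <= C * (1 / 2) ^ n) ->
  exists l, forall n, Rabs (u n - l) <= 2 * C * (1 / 2) ^ n.
Proof.
  intros HC H.
  assert (T : forall n k, Rabs (u (n + k)%nat - u n) <= 2 * C * (1 / 2) ^ n).
  { intros n k. apply Rle_trans with (C * (1/2)^n * (2 - 2 * (1/2)^k)).
    - induction k.
      + rewrite Nat.add_0_r, Rminus_diag, Rabs_R0. simpl. lra.
      + replace (n + S k)%nat with (S (n + k)) by lia.
        replace (u (S (n + k)) - u n) with ((u (S (n + k)) - u (n + k)%nat) + (u (n + k)%nat - u n)) by ring.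
        eapply Rle_trans; [apply Rabs_triang|]. specialize (H (n + k)%nat). rewrite pow_add in H. simpl. lra.
    - assert (0 <= (1/2)^n) by (apply pow_le; lra). assert (0 <= (1/2)^k) by (apply pow_le; lra).
      assert (0 <= C * (1/2)^n) by (apply Rmult_le_pos; assumption). nra. }
  assert (Cau : Cauchy_crit u).
  { intros e He. destruct (pow_lt_1_zero (1/2) ltac:(rewrite Rabs_pos_eq; lra) (e / (4 * C + 1)) ltac:(apply Rdiv_lt_0_compat; lra)) as [N HN].
    exists N.
    assert (HN' : 2 * C * (1/2)^N < e / 2).
    { specialize (HN N (le_n N)). rewrite Rabs_pos_eq in HN by (apply pow_le; lra).
      apply (Rmult_lt_compat_r (4 * C + 1)) in HN; [|lra]. 
      replace (e / (4 * C + 1) * (4 * C + 1)) with e in HN by (field; lra).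
      assert (0 < (1/2)^N) by (apply pow_lt; lra). nra. }
    intros n m Hn Hm. unfold Rdist.
    pose proof (T N (n - N)%nat) as X1. pose proof (T N (m - N)%nat) as X2.
    replace (N + (n - N))%nat with n in X1 by lia. replace (N + (m - N))%nat with m in X2 by lia.
    replace (u n - u m) with ((u n - u N) - (u m - u N)) by ring.
    eapply Rle_lt_trans; [apply Rabs_triang|]. rewrite Rabs_Ropp. lra. }
  destruct (Rcomplete.R_complete u Cau) as [l Hl]. exists l. intros n.
  apply Rle_plus_epsilon. intros e He. destruct (Hl e He) as [N HN].
  specialize (HN (n + N)%nat ltac:(lia)). unfold Rdist in HN. specialize (T n N).
  replace (u n - l) with (- (u (n + N)%nat - u n) + (u (n + N)%nat - l)) by ring.
  eapply Rle_trans; [apply Rabs_triang|]. rewrite Rabs_Ropp. lra.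
Qed.

(** Contraction principle; the iterates converge coordinatewise by the geometric estimate. *)
Lemma banach4 (K : V4 -> V4) v0 r : 0 < r ->
  (forall v w, D4 v v0 <= r -> D4 w v0 <= r -> D4 (K v) (K w) <= 1 / 2 * D4 v w) ->
  D4 (K v0) v0 <= r / 2 -> exists v, D4 v v0 <= r /\ K v = v.
Proof.
  intros Hr Hc H0.
  set (u := fun n => Nat.iter n K v0).
  assert (Hin : forall n, D4 (u n) v0 <= r).
  { induction n. { change (D4 v0 v0 <= r). rewrite D4_refl. lra. }
    change (D4 (K (u n)) v0 <= r). eapply Rle_trans; [apply (D4_tri _ (K v0))|].
    specialize (Hc (u n) v0 IHn ltac:(rewrite D4_refl; lra)). lra. }
  assert (Hst : forall n, D4 (u (S n)) (u n) <= r / 2 * (1 / 2) ^ n).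
  { induction n. { change (D4 (K v0) v0 <= r / 2 * 1). lra. }
    change (D4 (K (u (S n))) (K (u n)) <= r / 2 * (1 / 2) ^ (S n)).
    eapply Rle_trans; [apply Hc; apply Hin|]. change ((1 / 2) ^ S n) with (1 / 2 * (1 / 2) ^ n). lra. }
  assert (Hc4 : forall f : V4 -> R, (forall v w, Rabs (f v - f w) <= D4 v w) ->
     exists l, forall n, Rabs (f (u n) - l) <= 2 * (r / 2) * (1/2) ^ n).
  { intros f Hf. apply geom_cauchy; [lra|]. intros n. eapply Rle_trans; [apply Hf|apply Hst]. }
  assert (Hb : forall v w, Rabs (qa v - qa w) <= D4 v w /\ Rabs (qb v - qb w) <= D4 v w /\ Rabs (qs v - qs w) <= D4 v w /\ Rabs (qg v - qg w) <= D4 v w).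
  { intros v w. unfold D4. pose proof (Rabs_pos (qa v - qa w)). pose proof (Rabs_pos (qb v - qb w)).
    pose proof (Rabs_pos (qs v - qs w)). pose proof (Rabs_pos (qg v - qg w)). lra. }
  destruct (Hc4 qa ltac:(apply Hb)) as [la Ha]. destruct (Hc4 qb ltac:(apply Hb)) as [lb Hlb].
  destruct (Hc4 qs ltac:(apply Hb)) as [ls Hs]. destruct (Hc4 qg ltac:(apply Hb)) as [lg Hg].
  set (v := mk4 la lb ls lg).
  assert (Hlim : forall n, D4 (u n) v <= 4 * r * (1/2)^n).
  { intros n. unfold D4. simpl. specialize (Ha n). specialize (Hlb n). specialize (Hs n). specialize (Hg n). lra. }
  assert (Hsmall : forall e, 0 < e -> exists n, 4 * r * (1/2)^n < e).
  { intros e He. destruct (pow_lt_1_zero (1/2) ltac:(rewrite Rabs_pos_eq; lra) (e / (4 * r)) ltac:(apply Rdiv_lt_0_compat; lra)) as [N HN].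
    exists N. specialize (HN N (le_n N)). rewrite Rabs_pos_eq in HN by (apply pow_le; lra).
    apply (Rmult_lt_compat_l (4 * r)) in HN; [|lra]. replace (4 * r * (e / (4 * r))) with e in HN by (field; lra). exact HN. }
  assert (Hv : D4 v v0 <= r).
  { apply Rle_plus_epsilon. intros e He. destruct (Hsmall e He) as [n Hn].
    eapply Rle_trans; [apply (D4_tri v (u n))|]. rewrite D4_sym. specialize (Hlim n). specialize (Hin n). lra. }
  exists v. split; [exact Hv|]. apply D4_eq.
  apply Rle_plus_epsilon. intros e He. destruct (Hsmall (e / 2) ltac:(lra)) as [n Hn].
  eapply Rle_trans; [apply (D4_tri _ (K (u n)))|].
  pose proof (Hc v (u n) Hv (Hin n)) as A. rewrite (D4_sym v) in A.
  pose proof (Hlim (S n)) as B. change (u (S n)) with (K (u n)) in B. pose proof (Hlim n) as C.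
  simpl in B. assert (0 <= (1/2)^n) by (apply pow_le; lra). nra.
Qed.

(** Unknowns of a full turn A, B, A': rescaled x-coordinates ra, rb, ra', level rs, and rescaled tangential
    displacements rg of B and rt of A'. A closed orbit has ra' = ra and rt = 0, which is what emb encodes. *)
Record V6 : Type := mk6 { ra : R; rb : R; rs : R; rg : R; ra' : R; rt : R }.
Definition D6 (v w : V6) : R := Rabs (ra v - ra w) + Rabs (rb v - rb w) + Rabs (rs v - rs w) + Rabs (rg v - rg w)
  + Rabs (ra' v - ra' w) + Rabs (rt v - rt w).
Definition emb (v : V4) : V6 := mk6 (qa v) (qb v) (qs v) (qg v) (qa v) 0.

Lemma D6_pos v w : 0 <= D6 v w.
Proof. unfold D6. repeat apply Rplus_le_le_0_compat; apply Rabs_pos. Qed.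
Lemma D6_emb v w : D6 (emb v) (emb w) <= 2 * D4 v w.
Proof.
  unfold D6, D4, emb. simpl. rewrite Rminus_diag, Rabs_R0.
  pose proof (Rabs_pos (qa v - qa w)). pose proof (Rabs_pos (qb v - qb w)).
  pose proof (Rabs_pos (qs v - qs w)). pose proof (Rabs_pos (qg v - qg w)). lra.
Qed.

Section Branch.
Variables (E1 E2 E3 E4 : V6 -> R -> R) (v0 : V4).
Variables (Lp Lm jp jm Np Nm pa pb pb' pa' rp rm' ka kb : R).
Definition L1 (v w : V6) := (rb v - rb w) - Lp * (ra v - ra w) + jp * (rs v - rs w).
Definition L2 (v w : V6) := (ra' v - ra' w) - Lm * (rb v - rb w) + jm * (rs v - rs w).
Definition L3 (v w : V6) := - Np * (rg v - rg w) + pa * (ra v - ra w) + pb * (rb v - rb w) + rp * (rs v - rs w).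
Definition L4 (v w : V6) := Nm * ((rg v - rg w) + (rt v - rt w)) + pb' * (rb v - rb w) + pa' * (ra' v - ra' w) + rm' * (rs v - rs w).
Hypotheses (S1 : sd D6 (emb v0) E1 0 L1) (S2 : sd D6 (emb v0) E2 0 L2) (S3 : sd D6 (emb v0) E3 0 L3) (S4 : sd D6 (emb v0) E4 0 L4).
Hypotheses (Hjp : kb - Lp * ka + jp = 0) (Hjm : ka - Lm * kb + jm = 0) (HNp : 0 < Np) (HNm : 0 < Nm).
(** Expansion factor of x along a turn. *)
Definition Lam := Lp * Lm.
Definition mup := pa * ka + pb * kb + rp.
Definition mum := pb' * kb + pa' * ka + rm'.
(** In the application a multiple of the derivative of the Melnikov function: L3 and L4, combined so that rg cancels,
    along the slow direction (ka, kb, 1). *)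
Definition mu := Nm * mup + Np * mum.
Hypotheses (HLp : 0 < Lp) (HLm : 0 < Lm) (HLam : 1 < Lam) (Hmu : mu <> 0).

Lemma four_strict eta : 0 < eta -> exists d, 0 < d /\ forall v w e, D6 v (emb v0) < d -> D6 w (emb v0) < d -> 0 < Rabs e < d ->
  Rabs (E1 v e - E1 w e - L1 v w) <= eta * D6 v w /\ Rabs (E2 v e - E2 w e - L2 v w) <= eta * D6 v w /\
  Rabs (E3 v e - E3 w e - L3 v w) <= eta * D6 v w /\ Rabs (E4 v e - E4 w e - L4 v w) <= eta * D6 v w.
Proof.
  intros He. destruct S1 as [_ _ T1], S2 as [_ _ T2], S3 as [_ _ T3], S4 as [_ _ T4].
  destruct (T1 eta He) as [d1 [P1 Q1]]. destruct (T2 eta He) as [d2 [P2 Q2]].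
  destruct (T3 eta He) as [d3 [P3 Q3]]. destruct (T4 eta He) as [d4 [P4 Q4]].
  set (d := Rmin (Rmin d1 d2) (Rmin d3 d4)).
  assert (Hd : d <= d1 /\ d <= d2 /\ d <= d3 /\ d <= d4).
  { unfold d. pose proof (Rmin_l (Rmin d1 d2) (Rmin d3 d4)). pose proof (Rmin_r (Rmin d1 d2) (Rmin d3 d4)).
    pose proof (Rmin_l d1 d2). pose proof (Rmin_r d1 d2). pose proof (Rmin_l d3 d4). pose proof (Rmin_r d3 d4). lra. }
  exists d. split; [unfold d; repeat apply Rmin_pos; assumption|]. intros v w e H1 H2 H3.
  repeat split; [apply Q1|apply Q2|apply Q3|apply Q4]; lra.
Qed.

(** Solution operator of the linearised equations for closed orbits: the two x-equations are solved first, by 1 < Lam,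
    then the level by mu <> 0, and last the displacement of B. *)
Definition al' (e1 e2 : R) := (e2 + Lm * e1) / (1 - Lam).
Definition be' (e1 e2 : R) := Lp * al' e1 e2 + e1.
Definition sN (e1 e2 e3 e4 : R) :=
  (Nm * e3 + Np * e4 - (Nm * pa + Np * pa') * al' e1 e2 - (Nm * pb + Np * pb') * be' e1 e2) / mu.
Definition lin_inv (e1 e2 e3 e4 : R) : V4 :=
  let s := sN e1 e2 e3 e4 in
  mk4 (ka * s + al' e1 e2) (kb * s + be' e1 e2) s
      ((pa * al' e1 e2 + pb * be' e1 e2 + mup * s - e3) / Np).

Lemma lin_inv_left (v w : V4) :
  lin_inv (L1 (emb v) (emb w)) (L2 (emb v) (emb w)) (L3 (emb v) (emb w)) (L4 (emb v) (emb w))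
  = mk4 (qa v - qa w) (qb v - qb w) (qs v - qs w) (qg v - qg w).
Proof.
  assert (Jp : jp = Lp * ka - kb) by lra. assert (Jm : jm = Lm * kb - ka) by lra.
  assert (HL : 1 - Lam <> 0) by lra.
  set (A := qa v - qa w). set (B := qb v - qb w). set (C := qs v - qs w). set (G := qg v - qg w).
  assert (X1 : L1 (emb v) (emb w) = B - Lp * A + jp * C) by reflexivity.
  assert (X2 : L2 (emb v) (emb w) = A - Lm * B + jm * C) by reflexivity.
  assert (X3 : L3 (emb v) (emb w) = - Np * G + pa * A + pb * B + rp * C) by reflexivity.
  assert (X4 : L4 (emb v) (emb w) = Nm * G + pb' * B + pa' * A + rm' * C).
  { unfold L4, emb. simpl. unfold G, B, A, C. ring. }
  rewrite X1, X2, X3, X4.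
  assert (HA : al' (B - Lp * A + jp * C) (A - Lm * B + jm * C) = A - ka * C).
  { unfold al'. rewrite Jp, Jm. unfold Lam in *. field. exact HL. }
  assert (HB : be' (B - Lp * A + jp * C) (A - Lm * B + jm * C) = B - kb * C).
  { unfold be'. rewrite HA, Jp. ring. }
  assert (HS : sN (B - Lp * A + jp * C) (A - Lm * B + jm * C) (- Np * G + pa * A + pb * B + rp * C) (Nm * G + pb' * B + pa' * A + rm' * C) = C).
  { unfold sN. rewrite HA, HB. unfold mu, mup, mum in *. field. exact Hmu. }
  unfold lin_inv. rewrite HA, HB, HS. f_equal; try ring. unfold mup. field. lra.
Qed.

Lemma lin_inv_bound : exists C, 0 <= C /\ forall e1 e2 e3 e4 f1 f2 f3 f4,
  D4 (lin_inv e1 e2 e3 e4) (lin_inv f1 f2 f3 f4) <= C * (Rabs (e1 - f1) + Rabs (e2 - f2) + Rabs (e3 - f3) + Rabs (e4 - f4)).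
Proof.
  assert (Lin : forall c1 c2 c3 c4, exists C, 0 <= C /\ forall x1 x2 x3 x4,
     Rabs (c1 * x1 + c2 * x2 + c3 * x3 + c4 * x4) <= C * (Rabs x1 + Rabs x2 + Rabs x3 + Rabs x4)).
  { intros c1 c2 c3 c4. exists (Rabs c1 + Rabs c2 + Rabs c3 + Rabs c4).
    pose proof (Rabs_pos c1). pose proof (Rabs_pos c2). pose proof (Rabs_pos c3). pose proof (Rabs_pos c4).
    split; [lra|]. intros. eapply Rle_trans; [apply Rabs_triang|].
    eapply Rle_trans; [apply Rplus_le_compat_r, Rabs_triang|].
    eapply Rle_trans; [apply Rplus_le_compat_r, Rplus_le_compat_r, Rabs_triang|]. rewrite !Rabs_mult.
    pose proof (Rabs_pos x1). pose proof (Rabs_pos x2). pose proof (Rabs_pos x3). pose proof (Rabs_pos x4). nra. }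
  assert (HL : 1 - Lam <> 0) by lra. assert (HNp' : Np <> 0) by lra.
  set (u1 := Lm / (1 - Lam)). set (u2 := 1 / (1 - Lam)).
  set (ca := Nm * pa + Np * pa'). set (cb := Nm * pb + Np * pb').
  set (s1 := (- ca * u1 - cb * (Lp * u1 + 1)) / mu). set (s2 := (- ca * u2 - cb * (Lp * u2)) / mu).
  set (s3 := Nm / mu). set (s4 := Np / mu).
  destruct (Lin (ka * s1 + u1) (ka * s2 + u2) (ka * s3) (ka * s4)) as [C1 [P1 B1]].
  destruct (Lin (kb * s1 + (Lp * u1 + 1)) (kb * s2 + Lp * u2) (kb * s3) (kb * s4)) as [C2 [P2 B2]].
  destruct (Lin s1 s2 s3 s4) as [C3 [P3 B3]].
  destruct (Lin ((pa * u1 + pb * (Lp * u1 + 1) + mup * s1) / Np) ((pa * u2 + pb * (Lp * u2) + mup * s2) / Np)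
    ((mup * s3 - 1) / Np) ((mup * s4) / Np)) as [C4 [P4 B4]].
  exists (C1 + C2 + C3 + C4). split; [lra|]. intros.
  specialize (B1 (e1 - f1) (e2 - f2) (e3 - f3) (e4 - f4)). specialize (B2 (e1 - f1) (e2 - f2) (e3 - f3) (e4 - f4)).
  specialize (B3 (e1 - f1) (e2 - f2) (e3 - f3) (e4 - f4)). specialize (B4 (e1 - f1) (e2 - f2) (e3 - f3) (e4 - f4)).
  set (Sm := Rabs (e1 - f1) + Rabs (e2 - f2) + Rabs (e3 - f3) + Rabs (e4 - f4)) in *.
  unfold D4, lin_inv. cbn [qa qb qs qg].
  assert (Es : sN e1 e2 e3 e4 - sN f1 f2 f3 f4 = s1 * (e1 - f1) + s2 * (e2 - f2) + s3 * (e3 - f3) + s4 * (e4 - f4)).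
  { unfold sN, be', al', s1, s2, s3, s4, ca, cb, u1, u2. field. split; [exact Hmu|exact HL]. }
  assert (Ea : al' e1 e2 - al' f1 f2 = u1 * (e1 - f1) + u2 * (e2 - f2)).
  { unfold al', u1, u2. field. exact HL. }
  match goal with |- Rabs ?x1 + Rabs ?x2 + Rabs ?x3 + Rabs ?x4 <= _ =>
    replace x1 with ((ka * s1 + u1) * (e1 - f1) + (ka * s2 + u2) * (e2 - f2) + ka * s3 * (e3 - f3) + ka * s4 * (e4 - f4));
    [replace x2 with ((kb * s1 + (Lp * u1 + 1)) * (e1 - f1) + (kb * s2 + Lp * u2) * (e2 - f2) + kb * s3 * (e3 - f3) + kb * s4 * (e4 - f4));
    [replace x3 with (s1 * (e1 - f1) + s2 * (e2 - f2) + s3 * (e3 - f3) + s4 * (e4 - f4)) by (rewrite Es; ring);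
    replace x4 with ((pa * u1 + pb * (Lp * u1 + 1) + mup * s1) / Np * (e1 - f1) + (pa * u2 + pb * (Lp * u2) + mup * s2) / Np * (e2 - f2)
      + (mup * s3 - 1) / Np * (e3 - f3) + mup * s4 / Np * (e4 - f4))|]|] end.
  - lra.
  - transitivity ((pa * (al' e1 e2 - al' f1 f2) + pb * (Lp * (al' e1 e2 - al' f1 f2) + (e1 - f1)) + mup * (sN e1 e2 e3 e4 - sN f1 f2 f3 f4) - (e3 - f3)) / Np).
    + rewrite Es, Ea. field. exact HNp'.
    + unfold be'. field. exact HNp'.
  - transitivity (kb * (sN e1 e2 e3 e4 - sN f1 f2 f3 f4) + (Lp * (al' e1 e2 - al' f1 f2) + (e1 - f1))).
    + rewrite Es, Ea. ring.
    + unfold be'. ring.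
  - transitivity (ka * (sN e1 e2 e3 e4 - sN f1 f2 f3 f4) + (al' e1 e2 - al' f1 f2)).
    + rewrite Es, Ea. ring.
    + ring.
Qed.

Lemma lin_inv_zero e1 e2 e3 e4 : lin_inv e1 e2 e3 e4 = mk4 0 0 0 0 -> e1 = 0 /\ e2 = 0 /\ e3 = 0 /\ e4 = 0.
Proof.
  assert (HL : 1 - Lam <> 0) by lra. assert (HNp' : Np <> 0) by lra.
  unfold lin_inv. intros H. injection H. intros H4 H3 H2 H1. rewrite H3 in *.
  assert (Ha : al' e1 e2 = 0) by lra. assert (Hb : be' e1 e2 = 0) by lra.
  assert (e1 = 0). { unfold be' in Hb. rewrite Ha in Hb. lra. }
  assert (e2 = 0). { unfold al' in Ha. apply (Rmult_eq_compat_r (1 - Lam)) in Ha. 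
    replace ((e2 + Lm * e1) / (1 - Lam) * (1 - Lam)) with (e2 + Lm * e1) in Ha by (field; exact HL). rewrite H0 in Ha. lra. }
  assert (e3 = 0). { rewrite Ha, Hb in H4. apply (Rmult_eq_compat_r Np) in H4.
    replace ((pa * 0 + pb * 0 + mup * 0 - e3) / Np * Np) with (- e3) in H4 by (field; exact HNp'). lra. }
  repeat split; try assumption.
  unfold sN in H3. rewrite Ha, Hb, H6 in H3. apply (Rmult_eq_compat_r mu) in H3.
  replace ((Nm * 0 + Np * e4 - (Nm * pa + Np * pa') * 0 - (Nm * pb + Np * pb') * 0) / mu * mu) with (Np * e4) in H3 by (field; exact Hmu).
  rewrite Rmult_0_l in H3. apply Rmult_integral in H3. destruct H3; [contradiction|assumption].
Qed.

Definition minus4 (v n : V4) : V4 := mk4 (qa v - qa n) (qb v - qb n) (qs v - qs n) (qg v - qg n).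
(** Newton step with the derivative frozen at the limit. *)
Definition newton (e : R) (v : V4) : V4 := minus4 v (lin_inv (E1 (emb v) e) (E2 (emb v) e) (E3 (emb v) e) (E4 (emb v) e)).

(** The Newton map is a contraction near v0, uniformly in e, since the four equations are strictly differentiable; the
    defect of v0 itself tends to 0. *)
Lemma branch_exists : exists (dl : R) (br : R -> V4), 0 < dl /\
  (forall e, 0 < Rabs e < dl -> E1 (emb (br e)) e = 0 /\ E2 (emb (br e)) e = 0 /\ E3 (emb (br e)) e = 0 /\ E4 (emb (br e)) e = 0) /\
  (forall eta, 0 < eta -> exists d, 0 < d /\ forall e, 0 < Rabs e < d -> D4 (br e) v0 < eta).
Proof.
  destruct lin_inv_bound as [C [HC HN]].
  destruct (four_strict (1 / (16 * (C + 1))) ltac:(apply Rdiv_lt_0_compat; lra)) as [d [Hd HS]].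
  set (r := d / 3). assert (Hr : 0 < r) by (unfold r; lra).
  assert (Hcon : forall e v w, 0 < Rabs e < d -> D4 v v0 <= r -> D4 w v0 <= r -> D4 (newton e v) (newton e w) <= 1 / 2 * D4 v w).
  { intros e v w He Hv Hw.
    pose proof (D6_emb v v0). pose proof (D6_emb w v0). pose proof (D6_emb v w) as Dvw.
    destruct (HS (emb v) (emb w) e ltac:(unfold r in *; lra) ltac:(unfold r in *; lra) He) as [Q1 [Q2 [Q3 Q4]]].
    pose proof (lin_inv_left v w) as NL.
    specialize (HN (L1 (emb v) (emb w)) (L2 (emb v) (emb w)) (L3 (emb v) (emb w)) (L4 (emb v) (emb w))
      (E1 (emb v) e - E1 (emb w) e) (E2 (emb v) e - E2 (emb w) e) (E3 (emb v) e - E3 (emb w) e) (E4 (emb v) e - E4 (emb w) e)).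
    rewrite NL in HN.
    rewrite (Rabs_minus_sym (L1 _ _)), (Rabs_minus_sym (L2 _ _)), (Rabs_minus_sym (L3 _ _)), (Rabs_minus_sym (L4 _ _)) in HN.
    assert (HN2 : D4 (newton e v) (newton e w) <= C * (4 * (1 / (16 * (C + 1)) * D6 (emb v) (emb w)))).
    { eapply Rle_trans; [|eapply Rle_trans; [exact HN|]].
      - right. unfold newton, minus4, D4, lin_inv, sN, be', al'. cbn [qa qb qs qg].
        f_equal; [f_equal; [f_equal|]|]; f_equal; field; repeat split; lra.
      - apply Rmult_le_compat_l; [exact HC|]. lra. }
    eapply Rle_trans; [exact HN2|].
    replace (C * (4 * (1 / (16 * (C + 1)) * D6 (emb v) (emb w)))) with (C / (C + 1) * (1 / 4 * D6 (emb v) (emb w))) by (field; lra).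
    assert (C / (C + 1) <= 1). { apply Rmult_le_reg_r with (C + 1); [lra|]. unfold Rdiv. rewrite Rmult_assoc, Rinv_l by lra. lra. }
    pose proof (D6_pos (emb v) (emb w)). assert (0 <= C / (C + 1)) by (apply Rmult_le_pos; [lra|left; apply Rinv_0_lt_compat; lra]).
    apply Rle_trans with (1 * (1 / 4 * D6 (emb v) (emb w))); [apply Rmult_le_compat_r; lra|]. lra. }
  (* the defect of v0 tends to 0 *)
  assert (Hdef : forall eta, 0 < eta -> exists d1, 0 < d1 /\ forall e, 0 < Rabs e < d1 -> D4 (newton e v0) v0 < eta).
  { intros eta He. 
    assert (He' : 0 < eta / (4 * (C + 1))) by (apply Rdiv_lt_0_compat; lra).
    destruct S1 as [_ T1 _], S2 as [_ T2 _], S3 as [_ T3 _], S4 as [_ T4 _].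
    destruct (T1 _ He') as [d1 [P1 Q1]]. destruct (T2 _ He') as [d2 [P2 Q2]].
    destruct (T3 _ He') as [d3 [P3 Q3]]. destruct (T4 _ He') as [d4 [P4 Q4]].
    set (dd := Rmin (Rmin d1 d2) (Rmin d3 d4)).
    assert (Hdd : dd <= d1 /\ dd <= d2 /\ dd <= d3 /\ dd <= d4).
    { unfold dd. pose proof (Rmin_l (Rmin d1 d2) (Rmin d3 d4)). pose proof (Rmin_r (Rmin d1 d2) (Rmin d3 d4)).
      pose proof (Rmin_l d1 d2). pose proof (Rmin_r d1 d2). pose proof (Rmin_l d3 d4). pose proof (Rmin_r d3 d4). lra. }
    exists dd. split; [unfold dd; repeat apply Rmin_pos; assumption|]. intros e Hep.
    assert (Hz : D6 (emb v0) (emb v0) = 0).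
    { pose proof (D6_emb v0 v0) as X. rewrite D4_refl in X. pose proof (D6_pos (emb v0) (emb v0)). lra. }
    specialize (Q1 (emb v0) e ltac:(lra) ltac:(lra)). specialize (Q2 (emb v0) e ltac:(lra) ltac:(lra)).
    specialize (Q3 (emb v0) e ltac:(lra) ltac:(lra)). specialize (Q4 (emb v0) e ltac:(lra) ltac:(lra)).
    specialize (HN (E1 (emb v0) e) (E2 (emb v0) e) (E3 (emb v0) e) (E4 (emb v0) e) 0 0 0 0).
    assert (N0 : lin_inv 0 0 0 0 = mk4 0 0 0 0).
    { unfold lin_inv, sN, be', al'. f_equal; field; repeat split; lra. }
    rewrite N0 in HN.
    eapply Rle_lt_trans with (D4 (lin_inv (E1 (emb v0) e) (E2 (emb v0) e) (E3 (emb v0) e) (E4 (emb v0) e)) (mk4 0 0 0 0)).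
    { right. unfold newton, minus4, D4. set (X := lin_inv _ _ _ _). cbn [qa qb qs qg].
      rewrite <- (Rabs_Ropp (qa X - 0)), <- (Rabs_Ropp (qb X - 0)), <- (Rabs_Ropp (qs X - 0)), <- (Rabs_Ropp (qg X - 0)).
      f_equal; [f_equal; [f_equal|]|]; f_equal; ring. }
    eapply Rle_lt_trans; [exact HN|].
    apply Rle_lt_trans with (C * (4 * (eta / (4 * (C + 1))))).
    - apply Rmult_le_compat_l; [exact HC|]. lra.
    - replace (C * (4 * (eta / (4 * (C + 1))))) with (eta * (C / (C + 1))) by (field; lra).
      assert (C / (C + 1) < 1). { apply Rmult_lt_reg_r with (C + 1); [lra|]. unfold Rdiv. rewrite Rmult_assoc, Rinv_l by lra. lra. }
      nra. }
  destruct (Hdef (r / 2) ltac:(lra)) as [d1 [Hd1 Hdef1]].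
  set (dl := Rmin d d1). assert (Hdl : dl <= d /\ dl <= d1) by (split; [apply Rmin_l|apply Rmin_r]).
  assert (Hfix : forall e, exists v, 0 < Rabs e < dl -> D4 v v0 <= r /\ newton e v = v).
  { intros e. destruct (Rlt_le_dec 0 (Rabs e)) as [A|A]; [destruct (Rlt_le_dec (Rabs e) dl) as [B|B]|].
    - destruct (banach4 (newton e) v0 r Hr) as [v Hv].
      + intros v w. apply Hcon. lra.
      + left. apply Hdef1. lra.
      + exists v. intros _. exact Hv.
    - exists v0. intros; lra.
    - exists v0. intros; lra. }
  set (br := fun e => proj1_sig (constructive_indefinite_description _ (Hfix e))).
  assert (Hbr : forall e, 0 < Rabs e < dl -> D4 (br e) v0 <= r /\ newton e (br e) = br e).
  { intros e. unfold br. destruct (constructive_indefinite_description _ (Hfix e)) as [v Hv]. exact Hv. }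
  exists dl, br. split; [apply Rmin_pos; assumption|]. split.
  - intros e He. destruct (Hbr e He) as [_ Hk]. apply lin_inv_zero.
    unfold newton, minus4 in Hk. set (X := lin_inv _ _ _ _) in *. clearbody X. destruct (br e) as [a b s g], X as [xa xb xs xg].
    cbn [qa qb qs qg] in Hk. injection Hk. intros. f_equal; lra.
  - intros eta He. destruct (Hdef (eta / 2) ltac:(lra)) as [d2 [Hd2 Hdef2]].
    exists (Rmin dl d2). split; [apply Rmin_pos; [apply Rmin_pos; assumption|assumption]|].
    intros e Hep. pose proof (Rmin_l dl d2). pose proof (Rmin_r dl d2).
    destruct (Hbr e ltac:(lra)) as [A B]. specialize (Hdef2 e ltac:(lra)).
    pose proof (D4_tri (br e) (newton e v0) v0) as T. rewrite <- B in T at 1.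
    pose proof (Hcon e (br e) v0 ltac:(lra) A ltac:(rewrite D4_refl; lra)) as Cn. rewrite B in T. rewrite B in Cn. lra.
Qed.

Lemma lin6 c1 c2 c3 c4 c5 c6 : exists C, 0 <= C /\ forall x1 x2 x3 x4 x5 x6,
  Rabs (c1 * x1 + c2 * x2 + c3 * x3 + c4 * x4 + c5 * x5 + c6 * x6)
  <= C * (Rabs x1 + Rabs x2 + (Rabs x3 + Rabs x4 + Rabs x5 + Rabs x6)).
Proof.
  exists (Rabs c1 + Rabs c2 + Rabs c3 + Rabs c4 + Rabs c5 + Rabs c6).
  pose proof (Rabs_pos c1). pose proof (Rabs_pos c2). pose proof (Rabs_pos c3). pose proof (Rabs_pos c4).
  pose proof (Rabs_pos c5). pose proof (Rabs_pos c6).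
  split; [lra|]. intros.
  set (S := Rabs x1 + Rabs x2 + (Rabs x3 + Rabs x4 + Rabs x5 + Rabs x6)).
  pose proof (Rabs_pos x1). pose proof (Rabs_pos x2). pose proof (Rabs_pos x3). pose proof (Rabs_pos x4).
  pose proof (Rabs_pos x5). pose proof (Rabs_pos x6).
  assert (X : forall c x, 0 <= Rabs c -> Rabs x <= S -> Rabs (c * x) <= Rabs c * S).
  { intros c x Hc Hx. rewrite Rabs_mult. apply Rmult_le_compat_l; assumption. }
  pose proof (X c1 x1 H ltac:(unfold S; lra)). pose proof (X c2 x2 H0 ltac:(unfold S; lra)).
  pose proof (X c3 x3 H1 ltac:(unfold S; lra)). pose proof (X c4 x4 H2 ltac:(unfold S; lra)).
  pose proof (X c5 x5 H3 ltac:(unfold S; lra)). pose proof (X c6 x6 H4 ltac:(unfold S; lra)).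
  pose proof (Rabs_triang (c1 * x1 + c2 * x2 + c3 * x3 + c4 * x4 + c5 * x5) (c6 * x6)).
  pose proof (Rabs_triang (c1 * x1 + c2 * x2 + c3 * x3 + c4 * x4) (c5 * x5)).
  pose proof (Rabs_triang (c1 * x1 + c2 * x2 + c3 * x3) (c4 * x4)).
  pose proof (Rabs_triang (c1 * x1 + c2 * x2) (c3 * x3)).
  pose proof (Rabs_triang (c1 * x1) (c2 * x2)). lra.
Qed.

Definition kz := Np * (pb' * Lp + pa' * Lam) + Nm * (pa + pb * Lp).

(** The four equations at v and w are subtracted, and the six increments are expressed through z, dS and the four
    residuals. The residuals are a small multiple of the increments, which are thus bounded by z and dS. Here z is the
    deviation of x from the slow direction; it is multiplied by Lam while dS changes by O(e) only. *)
Lemma passage_estimate : exists C, 0 <= C /\ forall eta, 0 < eta -> exists dl, 0 < dl /\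
  forall (e : R) (v : V4) (w : V6), 0 < Rabs e < dl -> D6 (emb v) (emb v0) < dl -> D6 w (emb v0) < dl ->
  (E1 (emb v) e = 0 /\ E2 (emb v) e = 0 /\ E3 (emb v) e = 0 /\ E4 (emb v) e = 0) ->
  (E1 w e = 0 /\ E2 w e = 0 /\ E3 w e = 0 /\ E4 w e = 0) ->
  let dS := rs w - qs v in let z := (ra w - qa v) - ka * dS in
  Rabs ((ra' w - qa v) - ka * dS - Lam * z) <= eta * (Rabs z + Rabs dS) /\
  Rabs (rt w + (mu * dS + kz * z) / (Np * Nm)) <= eta * (Rabs z + Rabs dS) /\
  Rabs (rb w - qb v) + Rabs (rg w - qg v) <= C * (Rabs z + Rabs dS).
Proof.
  assert (Jp : jp = Lp * ka - kb) by lra. assert (Jm : jm = Lm * kb - ka) by lra.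
  assert (HNp' : Np <> 0) by lra. assert (HNm' : Nm <> 0) by lra.
  (* bounds for the six increments, linear forms in z, dS and the residuals; Cd and Cf bound the parts without z and dS *)
  destruct (lin6 1 ka 0 0 0 0) as [Ca [Pa Ba]].
  destruct (lin6 Lp kb 1 0 0 0) as [Cb [Pb Bb]].
  destruct (lin6 0 1 0 0 0 0) as [Cs [Ps Bs]].
  destruct (lin6 ((pa + pb * Lp) / Np) (mup / Np) (pb / Np) 0 (- / Np) 0) as [Cg [Pg Bg]].
  destruct (lin6 Lam ka Lm 1 0 0) as [Cc [Pc Bc]].
  destruct (lin6 (- kz / (Np * Nm)) (- mu / (Np * Nm)) (- (pb' + pa' * Lm) / Nm - pb / Np) (- pa' / Nm) (/ Np) (/ Nm)) as [Ct [Pt Bt]].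
  destruct (lin6 0 0 Lm 1 0 0) as [Cd [Pd Bd]].
  destruct (lin6 0 0 (- (pb' + pa' * Lm) / Nm - pb / Np) (- pa' / Nm) (/ Np) (/ Nm)) as [Cf [Pf Bf]].
  set (C0 := Ca + Cb + Cs + Cg + Cc + Ct + 1).
  exists (2 * C0). split; [unfold C0; lra|]. intros eta He.
  set (eta1 := Rmin (1 / (8 * C0)) (eta / (8 * C0 * (Cd + Cf + 1)))).
  assert (HC0 : 1 <= C0) by (unfold C0; lra).
  assert (He1 : 0 < eta1).
  { unfold eta1. apply Rmin_pos; apply Rdiv_lt_0_compat; try lra. apply Rmult_lt_0_compat; lra. }
  assert (He1a : eta1 * (8 * C0) <= 1).
  { assert (X : eta1 <= 1 / (8 * C0)) by apply Rmin_l. apply (Rmult_le_compat_r (8 * C0)) in X; [|lra].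
    replace (1 / (8 * C0) * (8 * C0)) with 1 in X by (field; lra). exact X. }
  assert (He1b : eta1 * (8 * C0) * (Cd + Cf + 1) <= eta).
  { assert (X : eta1 <= eta / (8 * C0 * (Cd + Cf + 1))) by apply Rmin_r.
    apply (Rmult_le_compat_r (8 * C0 * (Cd + Cf + 1))) in X; [|apply Rmult_le_pos; lra].
    replace (eta / (8 * C0 * (Cd + Cf + 1)) * (8 * C0 * (Cd + Cf + 1))) with eta in X by (field; lra). lra. }
  destruct (four_strict eta1 He1) as [dl [Hdl HS]]. exists dl. split; [exact Hdl|].
  intros e v w Hep Hv Hw [V1 [V2 [V3 V4]]] [W1 [W2 [W3 W4]]] dS z.
  destruct (HS w (emb v) e Hw Hv Hep) as [Q1 [Q2 [Q3 Q4]]].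
  rewrite V1, W1 in Q1. rewrite V2, W2 in Q2. rewrite V3, W3 in Q3. rewrite V4, W4 in Q4.
  rewrite Rminus_diag, Rminus_0_l, Rabs_Ropp in Q1, Q2, Q3, Q4.
  set (e1 := L1 w (emb v)) in *. set (e2 := L2 w (emb v)) in *. set (e3 := L3 w (emb v)) in *. set (e4 := L4 w (emb v)) in *.
  set (D := D6 w (emb v)) in *.
  assert (ED : D = Rabs (ra w - qa v) + Rabs (rb w - qb v) + Rabs dS + Rabs (rg w - qg v) + Rabs (ra' w - qa v) + Rabs (rt w)).
  { unfold D, D6, emb. cbn. rewrite Rminus_0_r. reflexivity. }
  assert (Xa : ra w - qa v = 1 * z + ka * dS + 0 * e1 + 0 * e2 + 0 * e3 + 0 * e4) by (unfold z; ring).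
  assert (Y1 : e1 = (rb w - qb v) - Lp * (ra w - qa v) + jp * dS) by reflexivity.
  assert (Y2 : e2 = (ra' w - qa v) - Lm * (rb w - qb v) + jm * dS) by reflexivity.
  assert (Y3 : e3 = - Np * (rg w - qg v) + pa * (ra w - qa v) + pb * (rb w - qb v) + rp * dS) by reflexivity.
  assert (Y4 : e4 = Nm * ((rg w - qg v) + (rt w - 0)) + pb' * (rb w - qb v) + pa' * (ra' w - qa v) + rm' * dS) by reflexivity.
  set (dA := ra w - qa v) in *. set (dB := rb w - qb v) in *. set (dG := rg w - qg v) in *. set (dA' := ra' w - qa v) in *. set (dT := rt w) in *.
  assert (Xb : dB = Lp * z + kb * dS + 1 * e1 + 0 * e2 + 0 * e3 + 0 * e4) by (rewrite Y1, Jp; unfold z; ring).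
  assert (Xc : dA' = Lam * z + ka * dS + Lm * e1 + 1 * e2 + 0 * e3 + 0 * e4).
  { transitivity (e2 + Lm * dB - jm * dS); [rewrite Y2; ring|]. rewrite Xb, Jm. unfold Lam. ring. }
  assert (Xg : dG = (pa + pb * Lp) / Np * z + mup / Np * dS + pb / Np * e1 + 0 * e2 + - / Np * e3 + 0 * e4).
  { transitivity ((pa * dA + pb * dB + rp * dS - e3) / Np); [rewrite Y3; field; exact HNp'|].
    rewrite Xa, Xb. unfold mup. field. exact HNp'. }
  assert (Xt : dT = - kz / (Np * Nm) * z + - mu / (Np * Nm) * dS + (- (pb' + pa' * Lm) / Nm - pb / Np) * e1 + - pa' / Nm * e2 + / Np * e3 + / Nm * e4).
  { transitivity ((e4 - pb' * dB - pa' * dA' - rm' * dS) / Nm - dG); [rewrite Y4; field; exact HNm'|].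
    rewrite Xb, Xc, Xg. unfold kz, mu, mup, mum. field. split; assumption. }
  specialize (Ba z dS e1 e2 e3 e4). specialize (Bb z dS e1 e2 e3 e4). specialize (Bs z dS e1 e2 e3 e4).
  specialize (Bg z dS e1 e2 e3 e4). specialize (Bc z dS e1 e2 e3 e4). specialize (Bt z dS e1 e2 e3 e4).
  specialize (Bd 0 0 e1 e2 e3 e4). specialize (Bf 0 0 e1 e2 e3 e4). rewrite Rabs_R0, !Rplus_0_l in Bd, Bf.
  rewrite <- Xa in Ba. rewrite <- Xb in Bb. rewrite <- Xc in Bc. rewrite <- Xg in Bg. rewrite <- Xt in Bt.
  replace (0 * z + 1 * dS + 0 * e1 + 0 * e2 + 0 * e3 + 0 * e4) with dS in Bs by ring.
  set (Rz := Rabs z + Rabs dS) in *. set (Re := Rabs e1 + Rabs e2 + Rabs e3 + Rabs e4) in *.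
  assert (HRz : 0 <= Rz) by (unfold Rz; pose proof (Rabs_pos z); pose proof (Rabs_pos dS); lra).
  assert (HRe : Re <= 4 * (eta1 * D)) by (unfold Re; lra).
  assert (HRe0 : 0 <= Re) by (unfold Re; pose proof (Rabs_pos e1); pose proof (Rabs_pos e2); pose proof (Rabs_pos e3); pose proof (Rabs_pos e4); lra).
  assert (HD : D <= C0 * (Rz + Re)) by (unfold C0; lra).
  assert (HD0 : 0 <= D) by apply D6_pos.
  assert (HCe : C0 * (4 * (eta1 * D)) <= 1 / 2 * D).
  { replace (C0 * (4 * (eta1 * D))) with (eta1 * (8 * C0) * (1 / 2 * D)) by field.
    replace (1 / 2 * D) with (1 * (1 / 2 * D)) at 2 by ring. apply Rmult_le_compat_r; lra. }
  assert (HD2 : D <= 2 * C0 * Rz).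
  { assert (C0 * Re <= C0 * (4 * (eta1 * D))) by (apply Rmult_le_compat_l; lra). lra. }
  assert (HRe2 : (Cd + Cf + 1) * Re <= eta * Rz).
  { apply Rle_trans with ((Cd + Cf + 1) * (4 * (eta1 * (2 * C0 * Rz)))).
    - apply Rmult_le_compat_l; [lra|]. assert (eta1 * D <= eta1 * (2 * C0 * Rz)) by (apply Rmult_le_compat_l; lra). lra.
    - replace ((Cd + Cf + 1) * (4 * (eta1 * (2 * C0 * Rz)))) with (eta1 * (8 * C0) * (Cd + Cf + 1) * Rz) by ring.
      apply Rmult_le_compat_r; assumption. }
  split; [|split].
  - apply Rle_trans with (Cd * Re); [|eapply Rle_trans; [apply Rmult_le_compat_r with (r2 := Cd + Cf + 1); lra|exact HRe2]]. eapply Rle_trans; [|exact Bd]. right. f_equal. rewrite Xc. ring.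
  - apply Rle_trans with (Cf * Re); [|eapply Rle_trans; [apply Rmult_le_compat_r with (r2 := Cd + Cf + 1); lra|exact HRe2]]. eapply Rle_trans; [|exact Bf]. right. f_equal. rewrite Xt. field. split; assumption.
  - pose proof (Rabs_pos dA). pose proof (Rabs_pos dA'). pose proof (Rabs_pos dT). pose proof (Rabs_pos dS). lra.
Qed.
End Branch.

(** * Bifurcation from a simple zero *)

Definition ptA c d (w : V6) (e : R) := spt c d (e * ra w) (rs w).
Definition ptB c d (w : V6) (e : R) := spt c d (e * rb w) (- rs w + e * rg w).
Definition ptA' c d (w : V6) (e : R) := spt c d (e * ra' w) (rs w + e * rt w).

(** Two consecutive arcs of the piecewise system. The lower one has winding number 1 since it runs through V < 0,
    where the angle, an arctangent, jumps. *)
Definition passage c d Zp Zm (w : V6) (e : R) : Prop :=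
  Fx Zp e 0 (ptA c d w e) (ptB c d w e) = 0 /\ Fx Zm e 1 (ptB c d w e) (ptA' c d w e) = 0 /\
  Fq Zp e 0 (ptA c d w e) (ptB c d w e) = 0 /\ Fq Zm e 1 (ptB c d w e) (ptA' c d w e) = 0.

(** Above, the parameters kp, nu, lp of the Melnikov function; x is not forced. *)
Definition zonep kp nu lp : zone := Zone (-1) lp nu kp 0 0 0.
(** Below, x is forced; the three coefficients are those for which rho on the manifold is d0 + d1 s + d2 s^2. *)
Definition zonem km lm d0 d1 d2 : zone := Zone 1 lm 0 km (- d0 - d2) (d2 - d1) (- d1 - d2).

Lemma fq0_derive c Z h s0 t1 t2 (f1 f2 T : R -> R) f1' f2' T' :
  is_derive f1 s0 f1' -> is_derive f2 s0 f2' -> is_derive T s0 T' ->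
  is_derive (fun s => fq0 c Z h s t1 (f1 s) t2 (f2 s) (T s)) s0
    (- (s0 ^ 2 - zm Z) * (f2' - f1') + 2 * (1 - c) * h * s0 * (s0 ^ 2 - zm Z) * (f1' + f2')
     + fq0s c Z h s0 t1 (f1 s0) t2 (f2 s0) (T s0) T').
Proof.
  intros H1 H2 H3. unfold fq0, fq0s.
  assert (X1 : ex_derive f1 s0) by (eexists; exact H1). assert (X2 : ex_derive f2 s0) by (eexists; exact H2).
  assert (X3 : ex_derive T s0) by (eexists; exact H3).
  auto_derive; [repeat split; assumption|].
  change (fun x => f1 x) with f1. change (fun x => f2 x) with f2. change (fun x => T x) with T.
  rewrite (is_derive_unique _ _ _ H1), (is_derive_unique _ _ _ H2), (is_derive_unique _ _ _ H3). ring.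
Qed.

Section Bif.
Variables c d kp km nu lp lm d0 d1 d2 : R.
Let gam := 1 - c.
Let Zp := zonep kp nu lp.
Let Zm := zonem km lm d0 d1 d2.
Definition XA s := exp (- ta s) * Kf d0 d1 d2 s.
Definition XB s := exp (ta s) * Kf d0 d1 d2 s.

(** Transport of the x-displacement through the upper zone. *)
Lemma XAB1 s : XB s - exp (2 * ta s) * XA s = 0.
Proof. unfold XA, XB. rewrite <- Rmult_assoc, <- exp_plus. replace (2 * ta s + - ta s) with (ta s) by ring. ring. Qed.

Definition Dq s := d0 + d1 * s + d2 * s ^ 2.
(** Transport of the x-displacement through the lower zone, relative to its invariant plane. *)
Lemma XAB2 s : 1 < s -> XA s - Dq s - exp (2 * tb s) * (XB s - Dq (- s)) = 0.
Proof.
  intros Hs. unfold XA, XB, Kf, Dq.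
  pose proof (ta_bounds s ltac:(lra)). pose proof (tb_bounds s Hs).
  assert (Hp : 0 < sinh (ta s + tb s)) by (apply sinh_pos; pose proof PI_RGT_0; lra).
  set (a := ta s) in *. set (b := tb s) in *.
  apply Rmult_eq_reg_r with (sinh (a + b)); [|lra].
  match goal with |- ?l = ?r => transitivity (exp (- a) * ((d0 + d2 * s ^ 2) * sinh b - d1 * s * cosh b)
     - (d0 + d1 * s + d2 * s ^ 2) * sinh (a + b)
     - exp (2 * b) * (exp a * ((d0 + d2 * s ^ 2) * sinh b - d1 * s * cosh b) - (d0 + d1 * - s + d2 * (- s) ^ 2) * sinh (a + b))) end.
  - field. lra.
  - unfold sinh, cosh. rewrite !Ropp_plus_distr. replace (2 * b) with (b + b) by ring. rewrite !exp_plus, !exp_Ropp.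
    pose proof (exp_pos a). pose proof (exp_pos b). field. split; lra.
Qed.

Lemma C1_XA : contdiff XA.
Proof.
  unfold XA. apply (C1_mult (fun s => exp (- ta s)) (Kf d0 d1 d2)); [|apply C1_Kf].
  apply (C1_comp (fun x => exp (- x)) (fun x => - exp (- x)) ta).
  - intros x. auto_derive; [exact I|ring].
  - intros x. apply (ex_derive_continuous (fun x => - exp (- x)) x). auto_derive. exact I.
  - apply C1_ta.
Qed.
Lemma C1_XB : contdiff XB.
Proof.
  unfold XB. apply (C1_mult (fun s => exp (ta s)) (Kf d0 d1 d2)); [|apply C1_Kf].
  apply (C1_comp exp exp ta).
  - intros x. apply is_derive_exp.
  - intros x. apply (ex_derive_continuous exp x). auto_derive. exact I.
  - apply C1_ta.
Qed.

(** The two radius equations, combined so that the displacement sg of B cancels. *)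
Lemma mel_balance s sg : 1 < s ->
  (2 * s * (2 * s ^ 2 - 1)) * fq0 c Zp 1 s 0 (XA s) sg (XB s) (2 * ta s)
  + (2 * s * (2 * s ^ 2 + 3)) * fq0 c Zm (-1) s sg (XB s) 0 (XA s) (2 * tb s)
  = 8 * s * mel gam kp km nu lp lm d0 d1 d2 s.
Proof.
  intros Hs. unfold fq0, mel, XA, XB, gam. simpl zm. simpl zk. simpl zn. simpl zl.
  unfold sinh, cosh. set (K := Kf d0 d1 d2 s). field.
Qed.

Variable s0 : R.
Hypothesis Hs0 : 1 < s0.
Hypothesis Hmel : mel gam kp km nu lp lm d0 d1 d2 s0 = 0.
Variable l : R.
Hypothesis Hl : l <> 0.
Hypothesis Dmel : is_derive (mel gam kp km nu lp lm d0 d1 d2) s0 l.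

(** The four limiting equations hold at the first order data of the unperturbed orbit: the x-equations by the choice
    of Kf, the first radius equation by the choice of sg0, the second by mel s0 = 0. The slow direction (ka, kb, 1) is
    the tangent of the curve of first order data, as differentiating the transport equations shows, and mu is then 8
    s0 times the derivative of mel by differentiating mel_balance. *)
Theorem bifurcation : exists v0 ka Lam mu kz C br dl,
  qs v0 = s0 /\ 1 < Lam /\ mu <> 0 /\ 0 < dl /\
  (forall e, 0 < Rabs e < dl -> passage c d Zp Zm (emb (br e)) e) /\
  (forall eta, 0 < eta -> exists d, 0 < d /\ forall e, 0 < Rabs e < d -> D4 (br e) v0 < eta) /\
  0 <= C /\ forall eta, 0 < eta -> exists dl', 0 < dl' /\
  forall (e : R) (v : V4) (w : V6), 0 < Rabs e < dl' -> D6 (emb v) (emb v0) < dl' -> D6 w (emb v0) < dl' ->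
    passage c d Zp Zm (emb v) e -> passage c d Zp Zm w e ->
    let dS := rs w - qs v in let z := (ra w - qa v) - ka * dS in
    Rabs ((ra' w - qa v) - ka * dS - Lam * z) <= eta * (Rabs z + Rabs dS) /\
    Rabs (rt w - (mu * dS + kz * z)) <= eta * (Rabs z + Rabs dS) /\
    Rabs (rb w - qb v) + Rabs (rg w - qg v) <= C * (Rabs z + Rabs dS).
Proof.
  set (a0 := XA s0). set (b0 := XB s0).
  set (Np := 2 * s0 * (2 * s0 ^ 2 + 3)). set (Nm := 2 * s0 * (2 * s0 ^ 2 - 1)).
  assert (HNp : 0 < Np) by (unfold Np; nra). assert (HNm : 0 < Nm) by (unfold Nm; nra).
  set (sg0 := fq0 c Zp 1 s0 0 a0 0 b0 (2 * ta s0) / Np).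
  set (v0 := mk4 a0 b0 s0 sg0).
  (* A has no tangential displacement, by the choice of the level; A' has one until the orbit is known to close *)
  set (emp := fun w : V6 => (rs w, 0, ra w, rg w, rb w) : V5).
  set (emm := fun w : V6 => (rs w, rg w, rb w, rt w, ra' w) : V5).
  assert (Bp : forall v w, D5 (emp v) (emp w) <= D6 v w).
  { intros v w. unfold D5, D6, emp, v5s, v5t1, v5x1, v5t2, v5x2. simpl. rewrite Rminus_diag, Rabs_R0.
    pose proof (Rabs_pos (ra' v - ra' w)). pose proof (Rabs_pos (rt v - rt w)). lra. }
  assert (Bm : forall v w, D5 (emm v) (emm w) <= D6 v w).
  { intros v w. unfold D5, D6, emm, v5s, v5t1, v5x1, v5t2, v5x2. simpl.
    pose proof (Rabs_pos (ra v - ra w)). lra. }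
  assert (Wp : 0 < v5s (emp (emb v0)) ^ 2 - zm Zp) by (unfold v5s; simpl; nra).
  assert (Wm : 0 < v5s (emm (emb v0)) ^ 2 - zm Zm) by (unfold v5s; simpl; nra).
  assert (H1 : 1 * 1 = 1) by ring. assert (Hm1 : (-1) * (-1) = 1) by ring.
  pose proof (sd_pull D5 D6 emp (emb v0) _ _ _ Bp (sd_Fx c d Zp 1 0 H1 (emp (emb v0)) Wp)) as S1.
  pose proof (sd_pull D5 D6 emm (emb v0) _ _ _ Bm (sd_Fx c d Zm (-1) 1 Hm1 (emm (emb v0)) Wm)) as S2.
  pose proof (sd_pull D5 D6 emp (emb v0) _ _ _ Bp (sd_Fq c d Zp 1 0 H1 (emp (emb v0)) Wp)) as S3.
  pose proof (sd_pull D5 D6 emm (emb v0) _ _ _ Bm (sd_Fq c d Zm (-1) 1 Hm1 (emm (emb v0)) Wm)) as S4.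
  assert (TP : T0 Zp 1 0 (emp (emb v0)) = 2 * ta s0).
  { unfold T0, ta. change (v5s (emp (emb v0))) with s0. change (zm Zp) with (-1).
    match goal with |- _ + atan ?x - atan ?y = _ => replace y with (- (s0 / (s0 ^ 2 + 1))) by (field; nra);
      replace x with (s0 / (s0 ^ 2 + 1)) by (field; nra) end.
    rewrite atan_opp. ring. }
  assert (TM : T0 Zm (-1) 1 (emm (emb v0)) = 2 * tb s0).
  { unfold T0, tb. change (v5s (emm (emb v0))) with s0. change (zm Zm) with 1.
    match goal with |- _ + atan ?x - atan ?y = _ => replace x with (- (s0 / (s0 ^ 2 - 1))) by (field; nra);
      replace y with (s0 / (s0 ^ 2 - 1)) by (field; nra) end.
    rewrite atan_opp. ring. }
  set (tp' := 2 * ((1 - s0 ^ 2) / (s0 ^ 4 + 3 * s0 ^ 2 + 1))).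
  set (tm' := 2 * ((s0 ^ 2 + 1) / (s0 ^ 4 - s0 ^ 2 + 1))).
  assert (TP' : T0' Zp 1 (emp (emb v0)) = tp').
  { unfold T0', tp'. change (v5s (emp (emb v0))) with s0. change (zm Zp) with (-1). field. repeat split; nra. }
  assert (TM' : T0' Zm (-1) (emm (emb v0)) = tm').
  { unfold T0', tm'. change (v5s (emm (emb v0))) with s0. change (zm Zm) with 1. field. repeat split; nra. }
  destruct C1_XA as [XA' DXA]. destruct C1_XB as [XB' DXB].
  destruct (DXA s0 Hs0) as [DA _]. destruct (DXB s0 Hs0) as [DB _].
  set (ka := XA' s0) in *. set (kb := XB' s0) in *.
  set (Lp := exp (2 * ta s0)). set (Lm := exp (2 * tb s0)).
  set (jp := - (Lp * tp' * a0)).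
  set (jm := - (d1 + 2 * d2 * s0) + Lm * (- d1 + 2 * d2 * s0) - Lm * tm' * (b0 - Dq (- s0))).
  set (pa := (s0 ^ 2 + 1) + 2 * gam * s0 * (s0 ^ 2 + 1)). set (pb := - (s0 ^ 2 + 1) + 2 * gam * s0 * (s0 ^ 2 + 1)).
  set (pb' := (s0 ^ 2 - 1) - 2 * gam * s0 * (s0 ^ 2 - 1)). set (pa' := - (s0 ^ 2 - 1) - 2 * gam * s0 * (s0 ^ 2 - 1)).
  set (rp := fq0s c Zp 1 s0 0 a0 sg0 b0 (2 * ta s0) tp').
  set (rm := fq0s c Zm (-1) s0 sg0 b0 0 a0 (2 * tb s0) tm').
  assert (GA : forall v e, p1v c d 1 (emp v) e = ptA c d v e).
  { intros v e. unfold p1v, ptA. change (v5s (emp v)) with (rs v). change (v5t1 (emp v)) with 0.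
    change (v5x1 (emp v)) with (ra v). f_equal. ring. }
  assert (GB : forall v e, p2v c d 1 (emp v) e = ptB c d v e).
  { intros v e. unfold p2v, ptB. change (v5s (emp v)) with (rs v). change (v5t2 (emp v)) with (rg v).
    change (v5x2 (emp v)) with (rb v). f_equal. ring. }
  assert (GB' : forall v e, p1v c d (-1) (emm v) e = ptB c d v e).
  { intros v e. unfold p1v, ptB. change (v5s (emm v)) with (rs v). change (v5t1 (emm v)) with (rg v).
    change (v5x1 (emm v)) with (rb v). f_equal. ring. }
  assert (GA' : forall v e, p2v c d (-1) (emm v) e = ptA' c d v e).
  { intros v e. unfold p2v, ptA'. change (v5s (emm v)) with (rs v). change (v5t2 (emm v)) with (rt v).
    change (v5x2 (emm v)) with (ra' v). f_equal. ring. }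
  assert (Fp0 : fq0 c Zp 1 s0 0 a0 sg0 b0 (2 * ta s0) = 0).
  { transitivity (- Np * sg0 + fq0 c Zp 1 s0 0 a0 0 b0 (2 * ta s0)); [unfold fq0, Np; simpl; ring|]. unfold sg0. field. lra. }
  assert (Fm0 : fq0 c Zm (-1) s0 sg0 b0 0 a0 (2 * tb s0) = 0).
  { pose proof (mel_balance s0 sg0 Hs0) as MB. fold a0 b0 in MB. rewrite Fp0, Hmel in MB. fold Np Nm in MB.
    apply Rmult_eq_reg_l with Np; lra. }
  assert (S1' : sd D6 (emb v0) (fun v e => Fx Zp e 0 (ptA c d v e) (ptB c d v e)) 0 (L1 Lp jp)).
  { eapply sd_eq; [eapply sd_ext; [|exact S1]; exists 1; split; [lra|]; intros v e _ _; cbv beta; rewrite GA, GB; reflexivity| |].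
    - rewrite TP. pose proof (XAB1 s0) as X. unfold rho, P0, Q0, v5s, v5x1, v5x2. simpl. fold a0 b0 in X. fold Lp in X |- *. lra.
    - intros v w. unfold Lfx. rewrite TP, TP'. fold Lp. unfold L1, jp, rho, P0, Q0, v5s, v5x1, v5x2. simpl. field. }
  assert (S2' : sd D6 (emb v0) (fun v e => Fx Zm e 1 (ptB c d v e) (ptA' c d v e)) 0 (L2 Lm jm)).
  { eapply sd_eq; [eapply sd_ext; [|exact S2]; exists 1; split; [lra|]; intros v e _ _; cbv beta; rewrite GB', GA'; reflexivity| |].
    - rewrite TM. pose proof (XAB2 s0 Hs0) as X. unfold rho, P0, Q0, v5s, v5x1, v5x2. simpl. fold a0 b0 in X. fold Lm in X |- *.
      rewrite <- X. unfold Dq. field.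
    - intros v w. unfold Lfx. rewrite TM, TM'. fold Lm. unfold L2, jm, rho, P0, Q0, Dq, v5s, v5x1, v5x2. simpl. field. }
  assert (S3' : sd D6 (emb v0) (fun v e => Fq Zp e 0 (ptA c d v e) (ptB c d v e)) 0 (L3 Np pa pb rp)).
  { eapply sd_eq; [eapply sd_ext; [|exact S3]; exists 1; split; [lra|]; intros v e _ _; cbv beta; rewrite GA, GB; reflexivity| |].
    - rewrite TP. exact Fp0.
    - intros v w. unfold Lfq. rewrite TP, TP'. unfold v5s, v5x1, v5x2, v5t1, v5t2. simpl fst. simpl snd. fold rp.
      unfold L3, Np, pa, pb, gam. simpl zm. ring. }
  assert (S4' : sd D6 (emb v0) (fun v e => Fq Zm e 1 (ptB c d v e) (ptA' c d v e)) 0 (L4 Nm pb' pa' rm)).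
  { eapply sd_eq; [eapply sd_ext; [|exact S4]; exists 1; split; [lra|]; intros v e _ _; cbv beta; rewrite GB', GA'; reflexivity| |].
    - rewrite TM. exact Fm0.
    - intros v w. unfold Lfq. rewrite TM, TM'. unfold v5s, v5x1, v5x2, v5t1, v5t2. simpl fst. simpl snd. fold rm.
      unfold L4, Nm, pa', pb', gam. simpl zm. ring. }
  assert (DTa : is_derive (fun s => 2 * ta s) s0 tp') by (apply (is_derive_scal ta s0 2), ta_derive).
  assert (DTb : is_derive (fun s => 2 * tb s) s0 tm') by (apply (is_derive_scal tb s0 2), tb_derive, Hs0).
  (* the curve of first order data is tangent to the slow direction *)
  assert (Hjp : kb - Lp * ka + jp = 0).
  { assert (DD : is_derive (fun s => XB s - exp (2 * ta s) * XA s) s0 (kb - (tp' * exp (2 * ta s0) * XA s0 + exp (2 * ta s0) * ka))).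
    { apply der_minus; [exact DB|]. apply (is_derive_mult_R (fun s => exp (2 * ta s)) XA); [|exact DA].
      apply (is_derive_comp exp (fun s => 2 * ta s) s0 _ _ (is_derive_exp _) DTa). }
    assert (D0 : is_derive (fun s => XB s - exp (2 * ta s) * XA s) s0 0).
    { apply (der_ext (fun _ => 0)); [intros; symmetry; apply XAB1|apply der_const]. }
    apply is_derive_unique in DD. apply is_derive_unique in D0. rewrite D0 in DD. unfold jp, Lp, a0. lra. }
  assert (Hjm : ka - Lm * kb + jm = 0).
  { assert (DD : is_derive (fun s => XA s - Dq s - exp (2 * tb s) * (XB s - Dq (- s))) s0
      (ka - (d1 + 2 * d2 * s0) - (tm' * exp (2 * tb s0) * (XB s0 - Dq (- s0)) + exp (2 * tb s0) * (kb - (- d1 + 2 * d2 * s0))))).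
    { apply (der_minus (fun s => XA s - Dq s) (fun s => exp (2 * tb s) * (XB s - Dq (- s)))).
      - apply der_minus; [exact DA|]. unfold Dq. auto_derive; [exact I|]. ring.
      - apply (is_derive_mult_R (fun s => exp (2 * tb s)) (fun s => XB s - Dq (- s))).
        + apply (is_derive_comp exp (fun s => 2 * tb s) s0 _ _ (is_derive_exp _) DTb).
        + apply (der_minus XB (fun s => Dq (- s))); [exact DB|]. unfold Dq. auto_derive; [exact I|]. ring. }
    assert (D0 : is_derive (fun s => XA s - Dq s - exp (2 * tb s) * (XB s - Dq (- s))) s0 0).
    { apply (is_derive_ext_loc (fun _ => 0)).
      - exists (mkposreal (s0 - 1) ltac:(lra)). intros t Ht. symmetry. apply XAB2.
        change (Rabs (t - s0) < s0 - 1) in Ht. apply Rabs_def2 in Ht. lra.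
      - apply der_const. }
    apply is_derive_unique in DD. apply is_derive_unique in D0. rewrite D0 in DD. unfold jm, Lm, b0. lra. }
  assert (HLp : 0 < Lp) by apply exp_pos. assert (HLm : 0 < Lm) by apply exp_pos.
  assert (HLam : 1 < Lam Lp Lm).
  { unfold Lam, Lp, Lm. rewrite <- exp_plus, <- exp_0. apply exp_increasing.
    pose proof (ta_bounds s0 ltac:(lra)). pose proof (tb_bounds s0 Hs0). pose proof PI_RGT_0. lra. }
  assert (Hmu : mu Np Nm pa pb pb' pa' rp rm ka kb = 8 * s0 * l).
  { assert (DD : is_derive (fun s => (2 * s * (2 * s ^ 2 - 1)) * fq0 c Zp 1 s 0 (XA s) sg0 (XB s) (2 * ta s)
      + (2 * s * (2 * s ^ 2 + 3)) * fq0 c Zm (-1) s sg0 (XB s) 0 (XA s) (2 * tb s)) s0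
      ((12 * s0 ^ 2 - 2) * fq0 c Zp 1 s0 0 (XA s0) sg0 (XB s0) (2 * ta s0) + Nm *
        (- (s0 ^ 2 - zm Zp) * (kb - ka) + 2 * (1 - c) * 1 * s0 * (s0 ^ 2 - zm Zp) * (ka + kb)
     + fq0s c Zp 1 s0 0 (XA s0) sg0 (XB s0) (2 * ta s0) tp')
      + ((12 * s0 ^ 2 + 6) * fq0 c Zm (-1) s0 sg0 (XB s0) 0 (XA s0) (2 * tb s0) + Np *
        (- (s0 ^ 2 - zm Zm) * (ka - kb) + 2 * (1 - c) * (-1) * s0 * (s0 ^ 2 - zm Zm) * (kb + ka)
     + fq0s c Zm (-1) s0 sg0 (XB s0) 0 (XA s0) (2 * tb s0) tm')))).
    { apply (der_plus (fun s => (2 * s * (2 * s ^ 2 - 1)) * fq0 c Zp 1 s 0 (XA s) sg0 (XB s) (2 * ta s))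
         (fun s => (2 * s * (2 * s ^ 2 + 3)) * fq0 c Zm (-1) s sg0 (XB s) 0 (XA s) (2 * tb s))).
      - apply (is_derive_mult_R (fun s => 2 * s * (2 * s ^ 2 - 1)) (fun s => fq0 c Zp 1 s 0 (XA s) sg0 (XB s) (2 * ta s))).
        + auto_derive; [exact I|]. ring.
        + apply (fq0_derive c Zp 1 s0 0 sg0 XA XB (fun s => 2 * ta s)); assumption.
      - apply (is_derive_mult_R (fun s => 2 * s * (2 * s ^ 2 + 3)) (fun s => fq0 c Zm (-1) s sg0 (XB s) 0 (XA s) (2 * tb s))).
        + auto_derive; [exact I|]. ring.
        + apply (fq0_derive c Zm (-1) s0 sg0 0 XB XA (fun s => 2 * tb s)); assumption. }
    assert (D8 : is_derive (fun s => 8 * s * mel gam kp km nu lp lm d0 d1 d2 s) s0 (8 * mel gam kp km nu lp lm d0 d1 d2 s0 + 8 * s0 * l)).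
    { apply (is_derive_mult_R (fun s => 8 * s) (mel gam kp km nu lp lm d0 d1 d2)); [|exact Dmel]. auto_derive; [exact I|ring]. }
    assert (D9 : is_derive (fun s => 8 * s * mel gam kp km nu lp lm d0 d1 d2 s) s0 
      ((12 * s0 ^ 2 - 2) * fq0 c Zp 1 s0 0 (XA s0) sg0 (XB s0) (2 * ta s0) + Nm *
        (- (s0 ^ 2 - zm Zp) * (kb - ka) + 2 * (1 - c) * 1 * s0 * (s0 ^ 2 - zm Zp) * (ka + kb)
     + fq0s c Zp 1 s0 0 (XA s0) sg0 (XB s0) (2 * ta s0) tp')
      + ((12 * s0 ^ 2 + 6) * fq0 c Zm (-1) s0 sg0 (XB s0) 0 (XA s0) (2 * tb s0) + Np *
        (- (s0 ^ 2 - zm Zm) * (ka - kb) + 2 * (1 - c) * (-1) * s0 * (s0 ^ 2 - zm Zm) * (kb + ka)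
     + fq0s c Zm (-1) s0 sg0 (XB s0) 0 (XA s0) (2 * tb s0) tm')))).
    { apply (is_derive_ext_loc (fun s => (2 * s * (2 * s ^ 2 - 1)) * fq0 c Zp 1 s 0 (XA s) sg0 (XB s) (2 * ta s)
      + (2 * s * (2 * s ^ 2 + 3)) * fq0 c Zm (-1) s sg0 (XB s) 0 (XA s) (2 * tb s))); [|exact DD].
      exists (mkposreal (s0 - 1) ltac:(lra)). intros t Ht. apply mel_balance.
      change (Rabs (t - s0) < s0 - 1) in Ht. apply Rabs_def2 in Ht. lra. }
    apply is_derive_unique in D8. apply is_derive_unique in D9. rewrite D8, Hmel in D9.
    fold a0 b0 in D9. rewrite Fp0, Fm0 in D9. fold rp rm in D9.
    unfold mu, mup, mum, pa, pb, pa', pb', gam. simpl zm in D9. lra. }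
  assert (Hmu0 : mu Np Nm pa pb pb' pa' rp rm ka kb <> 0).
  { rewrite Hmu. apply Rmult_integral_contrapositive_currified; [lra|exact Hl]. }
  destruct (branch_exists _ _ _ _ v0 Lp Lm jp jm Np Nm pa pb pb' pa' rp rm ka kb S1' S2' S3' S4' Hjp Hjm HNp HLam Hmu0)
    as [dl [br [Hdl [Hbr Hlim]]]].
  destruct (passage_estimate _ _ _ _ v0 Lp Lm jp jm Np Nm pa pb pb' pa' rp rm ka kb S1' S2' S3' S4' Hjp Hjm HNp HNm)
    as [C [HC Hest]].
  exists v0, ka, (Lam Lp Lm), (- mu Np Nm pa pb pb' pa' rp rm ka kb / (Np * Nm)), (- kz Lp Lm Np Nm pa pb pb' pa' / (Np * Nm)), C, br, dl.
  split; [reflexivity|]. split; [exact HLam|]. split.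
  { intros E. apply Hmu0. apply (Rmult_eq_compat_r (Np * Nm)) in E. 
    replace (- mu Np Nm pa pb pb' pa' rp rm ka kb / (Np * Nm) * (Np * Nm)) with (- mu Np Nm pa pb pb' pa' rp rm ka kb) in E by (field; lra). lra. }
  split; [exact Hdl|]. split; [exact Hbr|]. split; [exact Hlim|]. split; [exact HC|].
  intros eta He. destruct (Hest eta He) as [dl' [Hdl' H]]. exists dl'. split; [exact Hdl'|].
  intros e v w He1 Hv Hw Pv Pw dS z. destruct (H e v w He1 Hv Hw Pv Pw) as [Q1 [Q2 Q3]].
  split; [exact Q1|]. split; [|exact Q3].
  eapply Rle_trans; [|exact Q2]. right. f_equal. unfold z, dS. field. lra.
Qed.
End Bif.

(** * Flow and transit time *)

(** The angle is measured from the V-axis: the crossing points always have V > 0. *)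
Lemma polar U V : 0 < V ->
  U = sqrt (U ^ 2 + V ^ 2) * sin (atan (U / V)) /\ V = sqrt (U ^ 2 + V ^ 2) * cos (atan (U / V)).
Proof.
  intros HV. rewrite sin_atan, cos_atan.
  assert (E : sqrt (1 + (U / V)²) = sqrt (U ^ 2 + V ^ 2) / V).
  { replace (1 + (U / V)²) with ((U ^ 2 + V ^ 2) / (V ^ 2)) by (unfold Rsqr; field; lra).
    rewrite sqrt_div_alt by nra. rewrite sqrt_pow2 by lra. reflexivity. }
  rewrite E. assert (0 < sqrt (U ^ 2 + V ^ 2)) by (apply sqrt_lt_R0; nra).
  split; field; lra.
Qed.

Lemma exp_sqrt x q : 0 <= q -> sqrt (exp (2 * x) * q) = exp x * sqrt q.
Proof.
  intros Hq. rewrite sqrt_mult; [|left; apply exp_pos|exact Hq]. f_equal.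
  replace (2 * x) with (x + x) by ring. rewrite exp_plus. apply sqrt_square. left; apply exp_pos.
Qed.

(** Half of the difference is a zero of the sine. *)
Lemma same_angle a b : sin a = sin b -> cos a = cos b -> exists k : Z, a - b = 2 * PI * IZR k.
Proof.
  intros S C.
  assert (H : sin ((a - b) / 2) = 0).
  { assert (X : cos (a - b) = 1). { rewrite cos_minus, S, C. pose proof (sin2_cos2 b). unfold Rsqr in *. lra. }
    replace (a - b) with (2 * ((a - b) / 2)) in X by field. rewrite cos_2a_sin in X. nra. }
  apply sin_eq_0_0 in H. destruct H as [k Hk]. exists k. lra.
Qed.

Lemma sin_shift_Z x (k : Z) : sin (x + 2 * PI * IZR k) = sin x /\ cos (x + 2 * PI * IZR k) = cos x.
Proof.
  assert (N : forall (n : nat) y, sin (y + 2 * INR n * PI) = sin y /\ cos (y + 2 * INR n * PI) = cos y).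
  { intros n y. split; [apply sin_period|apply cos_period]. }
  destruct (Z.le_gt_cases 0 k).
  - destruct (N (Z.to_nat k) x) as [A B]. rewrite INR_IZR_INZ, Z2Nat.id in A, B by assumption.
    replace (x + 2 * PI * IZR k) with (x + 2 * IZR k * PI) by ring. split; assumption.
  - destruct (N (Z.to_nat (- k)) (x + 2 * PI * IZR k)) as [A B]. rewrite INR_IZR_INZ, Z2Nat.id in A, B by lia.
    rewrite opp_IZR in A, B. replace (x + 2 * PI * IZR k + 2 * - IZR k * PI) with x in A, B by ring.
    split; symmetry; assumption.
Qed.

Section Transit.
Variables (Z : zone) (e : R).
Hypothesis G : zgood Z e.
Definition ang p := atan (cU Z e p / cV Z e p).

Lemma flow_polar t p : 0 < cV Z e p ->
  cU Z e (flow Z e t p) = exp (e * zl Z * t) * sqrt (qn Z e p) * sin (ang p - om Z e * t) /\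
  cV Z e (flow Z e t p) = exp (e * zl Z * t) * sqrt (qn Z e p) * cos (ang p - om Z e * t).
Proof.
  intros HV. rewrite (cU_flow Z e G), (cV_flow Z e G).
  destruct (polar (cU Z e p) (cV Z e p) HV) as [A B]. fold (qn Z e p) in A, B. fold (ang p) in A, B.
  rewrite sin_minus, cos_minus. set (r := sqrt (qn Z e p)) in *.
  split; rewrite A at 1; rewrite B at 1; ring.
Qed.

Lemma tT_om n p1 p2 : om Z e * tT Z e n p1 p2 = 2 * PI * n + ang p1 - ang p2.
Proof. unfold tT. fold (ang p1) (ang p2). pose proof (om_pos Z e G). field. lra. Qed.

(** The time tT makes the angles agree and the vanishing defects make the radii and the transverse coordinates agree.
    *)
Lemma transit_flow (k : BinNums.Z) p1 p2 : 0 < cV Z e p1 -> 0 < cV Z e p2 ->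
  cH Z e p2 = exp (tT Z e (IZR k) p1 p2) * cH Z e p1 ->
  qn Z e p2 = exp (e * (2 * zl Z * tT Z e (IZR k) p1 p2)) * qn Z e p1 ->
  flow Z e (tT Z e (IZR k) p1 p2) p1 = p2.
Proof.
  intros V1 V2 HH Hq. pose proof (tT_om (IZR k) p1 p2) as ET.
  destruct (flow_polar (tT Z e (IZR k) p1 p2) p1 V1) as [FU FV].
  set (T := tT Z e (IZR k) p1 p2) in *.
  destruct (polar (cU Z e p2) (cV Z e p2) V2) as [A B]. fold (qn Z e p2) in A, B. fold (ang p2) in A, B.
  assert (Hsq : sqrt (qn Z e p2) = exp (e * zl Z * T) * sqrt (qn Z e p1)).
  { rewrite Hq. replace (e * (2 * zl Z * T)) with (2 * (e * zl Z * T)) by ring. apply exp_sqrt. unfold qn. nra. }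
  assert (Ea : ang p1 - om Z e * T = ang p2 + 2 * PI * IZR (- k)) by (rewrite opp_IZR; lra).
  destruct (sin_shift_Z (ang p2) (- k)) as [Sa Ca]. rewrite <- Ea in Sa, Ca.
  apply (coords_inj Z e G).
  - rewrite (cH_flow Z e G). symmetry. exact HH.
  - rewrite FU, Sa, <- Hsq. symmetry. exact A.
  - rewrite FV, Ca, <- Hsq. symmetry. exact B.
Qed.

(** Converse of transit_flow, up to the number of turns. *)
Lemma flow_transit t p1 : 0 < cV Z e p1 -> 0 < cV Z e (flow Z e t p1) ->
  (exists k : BinNums.Z, ang p1 - om Z e * t - ang (flow Z e t p1) = 2 * PI * IZR k) /\
  cH Z e (flow Z e t p1) = exp t * cH Z e p1 /\ qn Z e (flow Z e t p1) = exp (e * (2 * zl Z * t)) * qn Z e p1.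
Proof.
  intros V1 V2. destruct (flow_polar t p1 V1) as [FU FV].
  assert (Hq : qn Z e (flow Z e t p1) = exp (e * (2 * zl Z * t)) * qn Z e p1).
  { unfold qn at 1. rewrite FU, FV. 
    replace (e * (2 * zl Z * t)) with (e * zl Z * t + e * zl Z * t) by ring. rewrite exp_plus.
    assert (S : sqrt (qn Z e p1) * sqrt (qn Z e p1) = qn Z e p1) by (apply sqrt_sqrt; unfold qn; nra).
    pose proof (sin2_cos2 (ang p1 - om Z e * t)) as SC. unfold Rsqr in SC.
    set (E := exp (e * zl Z * t)) in *. set (r := sqrt (qn Z e p1)) in *. set (s := sin _) in *. set (cc := cos _) in *.
    rewrite <- S. transitivity (E * E * (r * r) * (s * s + cc * cc)); [ring|]. rewrite SC. ring. }
  split; [|split; [apply (cH_flow Z e G)|exact Hq]].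
  destruct (polar (cU Z e (flow Z e t p1)) _ V2) as [A B]. fold (qn Z e (flow Z e t p1)) in A, B. fold (ang (flow Z e t p1)) in A, B.
  assert (Hsq : sqrt (qn Z e (flow Z e t p1)) = exp (e * zl Z * t) * sqrt (qn Z e p1)).
  { rewrite Hq. replace (e * (2 * zl Z * t)) with (2 * (e * zl Z * t)) by ring. apply exp_sqrt. unfold qn. nra. }
  rewrite Hsq in A, B.
  assert (P : 0 < exp (e * zl Z * t) * sqrt (qn Z e p1)).
  { apply Rmult_lt_0_compat; [apply exp_pos|]. apply sqrt_lt_R0. unfold qn. nra. }
  apply same_angle.
  - apply Rmult_eq_reg_l with (exp (e * zl Z * t) * sqrt (qn Z e p1)); [|lra]. rewrite <- FU. exact A.
  - apply Rmult_eq_reg_l with (exp (e * zl Z * t) * sqrt (qn Z e p1)); [|lra]. rewrite <- FV. exact B.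
Qed.

Lemma passage_defects t n p1 p2 : e <> 0 -> t = tT Z e n p1 p2 ->
  cH Z e p2 = exp t * cH Z e p1 -> qn Z e p2 = exp (e * (2 * zl Z * t)) * qn Z e p1 ->
  Fx Z e n p1 p2 = 0 /\ Fq Z e n p1 p2 = 0.
Proof.
  intros He -> H1 H2. unfold Fx, Fq. rewrite <- H1, <- H2. split; unfold Rdiv; ring.
Qed.

Lemma defects_zero n p1 p2 : e <> 0 -> Fx Z e n p1 p2 = 0 -> Fq Z e n p1 p2 = 0 ->
  cH Z e p2 = exp (tT Z e n p1 p2) * cH Z e p1 /\ qn Z e p2 = exp (e * (2 * zl Z * tT Z e n p1 p2)) * qn Z e p1.
Proof.
  intros He H1 H2. unfold Fx, Fq in *. split.
  - apply (Rmult_eq_compat_r e) in H1. unfold Rdiv in H1. rewrite Rmult_assoc, Rinv_l in H1 by assumption. lra.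
  - apply (Rmult_eq_compat_r e) in H2. unfold Rdiv in H2. rewrite Rmult_assoc, Rinv_l in H2 by assumption. lra.
Qed.

Lemma ang_bound p : - PI / 2 < ang p < PI / 2.
Proof. unfold ang. pose proof (atan_bound (cU Z e p / cV Z e p)). lra. Qed.
Lemma ang_pos p : 0 < cV Z e p -> 0 < cU Z e p -> 0 < ang p.
Proof. intros. unfold ang. rewrite <- atan_0. apply atan_increasing. apply Rdiv_lt_0_compat; assumption. Qed.
Lemma ang_neg p : 0 < cV Z e p -> cU Z e p < 0 -> ang p < 0.
Proof.
  intros. unfold ang. rewrite <- atan_0. apply atan_increasing.
  unfold Rdiv. assert (0 < / cV Z e p) by (apply Rinv_0_lt_compat; assumption). nra.
Qed.

(** The number of turns is 0, as both angles are in (-PI/2, PI/2) and the total rotation is less than PI plus the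
    initial angle. *)
Lemma transit_time_upper t p1 : 0 < t -> 0 < cV Z e p1 -> 0 < cV Z e (flow Z e t p1) ->
  - PI < ang p1 - om Z e * t -> t = tT Z e 0 p1 (flow Z e t p1).
Proof.
  intros Ht V1 V2 Hb. destruct (flow_transit t p1 V1 V2) as [[k Hk] _].
  pose proof (ang_bound p1). pose proof (ang_bound (flow Z e t p1)). pose proof (om_pos Z e G) as Ho. pose proof PI_RGT_0.
  assert (0 < om Z e * t) by (apply Rmult_lt_0_compat; assumption).
  assert (k = 0%Z).
  { assert (-1 < IZR k) by nra. assert (IZR k < 1) by nra.
    apply lt_IZR in H3. apply lt_IZR in H4. lia. }
  subst k. apply Rmult_eq_reg_l with (om Z e); [|lra]. rewrite tT_om. lra.
Qed.

(** The signs of U locate the two angles on different sides of 0; the total rotation is then between 0 and 2 PI plus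
    the initial angle, which leaves one turn. *)
Lemma transit_time_lower t p1 : 0 < t -> 0 < cV Z e p1 -> 0 < cV Z e (flow Z e t p1) ->
  cU Z e p1 < 0 -> 0 < cU Z e (flow Z e t p1) ->
  - (2 * PI) < ang p1 - om Z e * t -> t = tT Z e 1 p1 (flow Z e t p1).
Proof.
  intros Ht V1 V2 U1 U2 Hb. destruct (flow_transit t p1 V1 V2) as [[k Hk] _].
  pose proof (ang_bound p1). pose proof (ang_bound (flow Z e t p1)). pose proof (om_pos Z e G) as Ho. pose proof PI_RGT_0.
  pose proof (ang_neg _ V1 U1). pose proof (ang_pos _ V2 U2).
  assert (0 < om Z e * t) by (apply Rmult_lt_0_compat; assumption).
  assert (k = (-1)%Z).
  { assert (-2 < IZR k) by nra. assert (IZR k < 0) by nra.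
    apply lt_IZR in H5. apply lt_IZR in H6. lia. }
  subst k. apply Rmult_eq_reg_l with (om Z e); [|lra]. rewrite tT_om. lra.
Qed.
End Transit.

(** * Continuity of the zone data *)

(** Continuity of a map into space by coordinates; its domain will be a time, a parameter, or a point together with a
    parameter. *)
Definition cont3 {U : UniformSpace} (P : U -> R3) (u : U) : Prop :=
  continuous (fun v => px (P v)) u /\ continuous (fun v => py (P v)) u /\ continuous (fun v => pz (P v)) u.

Section Z0.
Variable Z : zone.
Lemma om_c0 : continuous (om Z) 0.
Proof. apply cont_D. unfold om. auto_derive. simpl. lra. Qed.
Lemma y1_c0 : continuous (y1 Z) 0.
Proof. apply cont_D. unfold y1, cDl. auto_derive. simpl. lra. Qed.
Lemma w1_c0 : continuous (w1 Z) 0.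
Proof. apply cont_D. unfold w1, y1, cDl. auto_derive. simpl. lra. Qed.
Lemma cP_c0 : continuous (cP Z) 0.
Proof. apply cont_D. unfold cP, cdet. auto_derive. simpl. lra. Qed.
Lemma cQ_c0 : continuous (cQ Z) 0.
Proof. apply cont_D. unfold cQ, cdet. auto_derive. simpl. lra. Qed.
Lemma cR_c0 : continuous (cR Z) 0.
Proof. apply cont_D. unfold cR, w1, y1, cDl. auto_derive. simpl. lra. Qed.

Lemma zgood_near : exists dl, 0 < dl /\ forall e, Rabs e < dl -> zgood Z e.
Proof.
  set (M := Rabs (zl Z) + Rabs (zn Z) + 1).
  assert (HM : 1 <= M) by (unfold M; pose proof (Rabs_pos (zl Z)); pose proof (Rabs_pos (zn Z)); lra).
  exists (/ (4 * M)). split; [apply Rinv_0_lt_compat; lra|]. intros e He.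
  assert (A : Rabs e * M < 1 / 4).
  { apply (Rmult_lt_compat_r M) in He; [|lra]. replace (/ (4 * M) * M) with (1 / 4) in He by (field; lra). exact He. }
  assert (B : forall x, Rabs x <= M -> Rabs (e * x) < 1 / 4).
  { intros x Hx. rewrite Rabs_mult. pose proof (Rabs_pos e). nra. }
  assert (Bl : Rabs (e * zl Z) < 1 / 4) by (apply B; unfold M; pose proof (Rabs_pos (zn Z)); lra).
  assert (Bn : Rabs (e * zn Z) < 1 / 4) by (apply B; unfold M; pose proof (Rabs_pos (zl Z)); lra).
  apply Rabs_def2 in Bl. apply Rabs_def2 in Bn.
  unfold zgood, cDl, cdet.
  set (a := e * zl Z) in *. set (b := e * zn Z) in *.
  replace (1 + e ^ 2 * (zl Z ^ 2 - zn Z ^ 2)) with (1 + a ^ 2 - b ^ 2) by (unfold a, b; ring).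
  replace ((e * (zl Z + zn Z) - 1) * (e * (zl Z - zn Z) - 1) + 1) with (2 - 2 * a + a ^ 2 - b ^ 2) by (unfold a, b; ring).
  replace (1 - e ^ 2 * zn Z ^ 2) with (1 - b ^ 2) by (unfold b; ring).
  assert (b ^ 2 < 1 / 4) by nra. repeat split; nra.
Qed.

Context {U : UniformSpace}.
Variables (u : U) (T E : U -> R) (P : U -> R3).
Hypotheses (CT : continuous T u) (CE : continuous E u) (CP : cont3 P u) (E0 : E u = 0).

Lemma comp0 (f : R -> R) : continuous f 0 -> continuous (fun v => f (E v)) u.
Proof. intros H. apply (cont_comp f E); [exact CE|]. rewrite E0. exact H. Qed.

Lemma cont_tY : continuous (fun v => tY (P v)) u.
Proof. destruct CP as [A [B C]]. unfold tY. ctac. Qed.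
Lemma cont_tw : continuous (fun v => tw Z (P v)) u.
Proof. destruct CP as [A [B C]]. unfold tw. ctac. Qed.
Lemma cont_dY : continuous (fun v => dY Z (E v) (P v)) u.
Proof. unfold dY. pose proof cont_tY. pose proof (comp0 (y1 Z) y1_c0). ctac. Qed.
Lemma cont_dw : continuous (fun v => dw Z (E v) (P v)) u.
Proof. unfold dw. pose proof cont_tw. pose proof (comp0 (w1 Z) w1_c0). ctac. Qed.
Lemma cont_cU : continuous (fun v => cU Z (E v) (P v)) u.
Proof. unfold cU. pose proof cont_dY. pose proof cont_dw. ctac. Qed.
Lemma cont_cV : continuous (fun v => cV Z (E v) (P v)) u.
Proof. unfold cV. pose proof cont_dw. pose proof (comp0 (om Z) om_c0). ctac. Qed.
Lemma cont_cH : continuous (fun v => cH Z (E v) (P v)) u.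
Proof.
  unfold cH. destruct CP as [A _]. pose proof cont_dY. pose proof cont_dw.
  pose proof (comp0 (cP Z) cP_c0). pose proof (comp0 (cQ Z) cQ_c0). pose proof (comp0 (cR Z) cR_c0). ctac.
Qed.

Lemma cont_zinv (h a b : U -> R) : continuous h u -> continuous a u -> continuous b u ->
  cont3 (fun v => zinv Z (E v) (h v) (a v) (b v)) u.
Proof.
  intros Hh Ha Hb.
  assert (Cw : continuous (fun v => b v / om Z (E v)) u).
  { apply cont_div; [rewrite E0, om_0; lra|exact Hb|exact (comp0 (om Z) om_c0)]. }
  pose proof (comp0 (cP Z) cP_c0). pose proof (comp0 (cQ Z) cQ_c0). pose proof (comp0 (cR Z) cR_c0).
  pose proof (comp0 (y1 Z) y1_c0). pose proof (comp0 (w1 Z) w1_c0).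
  unfold cont3, zinv, px, py, pz; simpl. set (bw := fun v => b v / om Z (E v)) in *.
  change (fun v => b v / om Z (E v)) with bw in Cw.
  split; [|split].
  - apply (continuous_ext (fun v => h v + E v * (cP Z (E v) * (a v + E v * zn Z * bw v) + cQ Z (E v) * bw v + cR Z (E v)))); [reflexivity|]. ctac.
  - apply (continuous_ext (fun v => a v + E v * zn Z * bw v + E v * y1 Z (E v) - (h v + E v * (cP Z (E v) * (a v + E v * zn Z * bw v) + cQ Z (E v) * bw v + cR Z (E v))) / 2)); [reflexivity|]. ctac.
  - apply (continuous_ext (fun v => bw v + E v * w1 Z (E v) + zm Z + (h v + E v * (cP Z (E v) * (a v + E v * zn Z * bw v) + cQ Z (E v) * bw v + cR Z (E v))) / 2)); [reflexivity|]. ctac.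
Qed.

Lemma cont_flow : cont3 (fun v => flow Z (E v) (T v) (P v)) u.
Proof.
  unfold flow. pose proof cont_cU. pose proof cont_cV. pose proof cont_cH. pose proof (comp0 (om Z) om_c0).
  assert (X1 : continuous (fun v => exp (T v)) u) by (apply (cont_comp exp T); [exact CT|apply cont_D; auto_derive; exact I]).
  assert (X2 : continuous (fun v => exp (E v * zl Z * T v)) u).
  { apply (cont_comp exp (fun v => E v * zl Z * T v)); [ctac|apply cont_D; auto_derive; exact I]. }
  assert (X3 : continuous (fun v => cos (om Z (E v) * T v)) u).
  { apply (cont_comp cos (fun v => om Z (E v) * T v)); [ctac|apply cont_D; auto_derive; exact I]. }
  assert (X4 : continuous (fun v => sin (om Z (E v) * T v)) u).
  { apply (cont_comp sin (fun v => om Z (E v) * T v)); [ctac|apply cont_D; auto_derive; exact I]. }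
  apply cont_zinv; ctac.
Qed.

Lemma cont_field : cont3 (fun v => field Z (E v) (P v)) u.
Proof.
  pose proof cont_tY. pose proof cont_tw. destruct CP as [A [B C]].
  assert (continuous (fun v => zg Z (P v)) u) by (unfold zg; ctac).
  split; [|split].
  - apply (continuous_ext (fun v => px (P v) + E v * zg Z (P v))); [reflexivity|ctac].
  - apply (continuous_ext (fun v => - pz (P v) + zm Z + E v * ((zl Z + zn Z) * tY (P v) - zg Z (P v) / 2))); [reflexivity|ctac].
  - apply (continuous_ext (fun v => px (P v) + py (P v) + E v * (zk Z + (zl Z - zn Z) * tw Z (P v) + zg Z (P v) / 2))); [reflexivity|ctac].
Qed.

Lemma cont_quadric c d : continuous (fun v => quadric c d (P v)) u.
Proof.
  pose proof cont_tY. destruct CP as [A [B C]].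
  apply (continuous_ext (fun v => (pz (P v) - px (P v) / 2) - tY (P v) ^ 2 + px (P v) / 2 + (1 - c) * px (P v) * tY (P v)
    + (c / 2 - 1 / 4 - d) * px (P v) ^ 2)); [intros v; symmetry; apply quadric_tilde|ctac].
Qed.

Lemma cont_dquadric c d : continuous (fun v => dquadric c d (P v) (field Z (E v) (P v))) u.
Proof.
  destruct cont_field as [A [B C]]. destruct CP as [A' [B' C']]. unfold dquadric. ctac.
Qed.
End Z0.

Lemma cont3_spt {U : UniformSpace} c d (X Y : U -> R) u : continuous X u -> continuous Y u -> cont3 (fun v => spt c d (X v) (Y v)) u.
Proof. intros HX HY. unfold cont3, spt, px, py, pz; simpl. split; [|split]; ctac. Qed.

(** In terms of the norm of space and uniformly in the parameter, as the tube estimates need it. *)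
Lemma near_pe (F : R3 * R -> R) (p0 : R3) : continuous F ((p0, 0) : R3 * R) -> forall eta, 0 < eta ->
  exists dl, 0 < dl /\ forall (p : R3) (e : R), norm (minus p (p0 : R3) : R3) < dl -> Rabs e < dl -> Rabs (F (p, e) - F (p0, 0)) < eta.
Proof.
  intros H eta He. 
  assert (L : locally (F (p0, 0)) (fun y => Rabs (y - F (p0, 0)) < eta)).
  { exists (mkposreal eta He). intros y Hy. exact Hy. }
  destruct (H _ L) as [dl Hdl]. exists dl. split; [apply cond_pos|].
  intros p e Hp Hep. apply Hdl. split; [|change (Rabs (e - 0) < dl); rewrite Rminus_0_r; exact Hep].
  split; [split|].
  - eapply Rle_lt_trans; [exact (px_le_norm (minus p p0))|exact Hp].
  - eapply Rle_lt_trans; [exact (py_le_norm (minus p p0))|exact Hp].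
  - eapply Rle_lt_trans; [exact (pz_le_norm (minus p p0))|exact Hp].
Qed.

Lemma near_te (F : R * R -> R) (t0 : R) : continuous F (t0, 0) -> forall eta, 0 < eta ->
  exists dl, 0 < dl /\ forall t e, Rabs (t - t0) < dl -> Rabs e < dl -> Rabs (F (t, e) - F (t0, 0)) < eta.
Proof.
  intros H eta He. 
  assert (L : locally (F (t0, 0)) (fun y => Rabs (y - F (t0, 0)) < eta)).
  { exists (mkposreal eta He). intros y Hy. exact Hy. }
  destruct (H _ L) as [dl Hdl]. exists dl. split; [apply cond_pos|].
  intros t e Ht Hep. apply Hdl. split; [exact Ht|change (Rabs (e - 0) < dl); rewrite Rminus_0_r; exact Hep].
Qed.

Lemma near_pe_pos F p0 : continuous F ((p0, 0) : R3 * R) -> 0 < F (p0, 0) ->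
  exists dl, 0 < dl /\ forall (p : R3) (e : R), norm (minus p (p0 : R3) : R3) < dl -> Rabs e < dl -> 0 < F (p, e).
Proof.
  intros H P. destruct (near_pe F p0 H _ P) as [dl [Hdl Q]]. exists dl. split; [exact Hdl|].
  intros p e Hp He. specialize (Q p e Hp He). apply Rabs_def2 in Q. destruct Q as [_ Q].
  apply Rplus_lt_reg_r with (- F (p0, 0)). rewrite Rplus_0_l. exact Q.
Qed.
Lemma near_te_pos F t0 : continuous F (t0, 0) -> 0 < F (t0, 0) ->
  exists dl, 0 < dl /\ forall t e, Rabs (t - t0) < dl -> Rabs e < dl -> 0 < F (t, e).
Proof.
  intros H P. destruct (near_te F t0 H _ P) as [dl [Hdl Q]]. exists dl. split; [exact Hdl|].
  intros t e Hp He. specialize (Q t e Hp He). apply Rabs_def2 in Q. destruct Q as [_ Q].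
  apply Rplus_lt_reg_r with (- F (t0, 0)). rewrite Rplus_0_l. exact Q.
Qed.

Lemma cont3_fst (p0 : R3) : cont3 (fun v : R3 * R => fst v) (p0, 0).
Proof.
  unfold cont3, px, py, pz. split; [|split].
  - apply (continuous_comp (fun v : R3 * R => fst (fst v)) fst); [|apply continuous_fst].
    apply (continuous_comp (fun v : R3 * R => fst v) fst); apply continuous_fst.
  - apply (continuous_comp (fun v : R3 * R => fst (fst v)) snd); [|apply continuous_snd].
    apply (continuous_comp (fun v : R3 * R => fst v) fst); apply continuous_fst.
  - apply (continuous_comp (fun v : R3 * R => fst v) snd); [apply continuous_fst|apply continuous_snd].
Qed.

(** * The unperturbed arcs *)

Lemma quadric_derive c d (phi : R -> R3) t v : is_derive phi t v ->
  is_derive (fun s => quadric c d (phi s)) t (dquadric c d (phi t) v).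
Proof.
  intros H. pose proof (is_derive_px _ _ _ H) as Hx. pose proof (is_derive_py _ _ _ H) as Hy.
  pose proof (is_derive_pz _ _ _ H) as Hz.
  set (X := fun s => px (phi s)) in *. set (Y := fun s => py (phi s)) in *. set (W := fun s => pz (phi s)) in *.
  apply (is_derive_ext (fun s => - d * X s ^ 2 - c * X s * Y s - Y s ^ 2 + W s)).
  { intros s. unfold X, Y, W. destruct (phi s) as [[x y] z]. reflexivity. }
  assert (Ex : ex_derive X t) by (eexists; exact Hx). assert (Ey : ex_derive Y t) by (eexists; exact Hy).
  assert (Ez : ex_derive W t) by (eexists; exact Hz).
  auto_derive; [repeat split; assumption|].
  change (fun x => X x) with X. change (fun x => Y x) with Y. change (fun x => W x) with W.
  rewrite (is_derive_unique X _ _ Hx), (is_derive_unique Y _ _ Hy), (is_derive_unique W _ _ Hz).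
  unfold dquadric, X, Y. ring.
Qed.

(** A Lebesgue number argument for the compact interval. *)
Lemma uniform_on_compact (Q : R -> R -> Prop) a b :
  (forall t, a <= t <= b -> exists dl, 0 < dl /\ forall t' e, a <= t' <= b -> Rabs (t' - t) < dl -> Rabs e < dl -> Q t' e) ->
  exists dl, 0 < dl /\ forall t e, a <= t <= b -> Rabs e < dl -> Q t e.
Proof.
  intros H.
  assert (H' : forall t, exists dl : posreal, a <= t <= b -> forall t' e, a <= t' <= b -> Rabs (t' - t) < dl -> Rabs e < dl -> Q t' e).
  { intros t. destruct (excluded_middle_informative (a <= t <= b)) as [A|A].
    - destruct (H t A) as [dl [Hdl K]]. exists (mkposreal dl Hdl). intros _. exact K.
    - exists (mkposreal 1 Rlt_0_1). intros B. contradiction. }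
  set (delta := fun t => proj1_sig (constructive_indefinite_description _ (H' t))).
  assert (Hd : forall t, a <= t <= b -> forall t' e, a <= t' <= b -> Rabs (t' - t) < delta t -> Rabs e < delta t -> Q t' e).
  { intros t. unfold delta. destruct (constructive_indefinite_description _ (H' t)) as [dl K]. exact K. }
  destruct (compactness_value_1d a b delta) as [dl Hdl].
  exists dl. split; [apply cond_pos|]. intros t e Ht He.
  destruct (excluded_middle_informative (Q t e)) as [|N]; [assumption|exfalso].
  apply (Hdl t Ht). intros [x [Hx [Hxt Hle]]]. apply N. apply (Hd x Hx); [exact Ht|exact Hxt|]. lra.
Qed.

(** Inner times are covered by compactness, the two ends by the local hypotheses. *)
Lemma arc_sign (g : R -> R -> R) (T : R -> R) :
  0 < T 0 -> (forall eta, 0 < eta -> exists dl, 0 < dl /\ forall e, Rabs e < dl -> Rabs (T e - T 0) < eta) ->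
  (forall t, 0 < t < T 0 -> exists dl, 0 < dl /\ forall t' e, Rabs (t' - t) < dl -> Rabs e < dl -> 0 < g e t') ->
  (exists dl, 0 < dl /\ forall t' e, Rabs t' < dl -> Rabs e < dl -> 0 < t' -> 0 < g e t') ->
  (exists dl, 0 < dl /\ forall t' e, Rabs (t' - T 0) < dl -> Rabs e < dl -> t' < T e -> 0 < g e t') ->
  exists dl, 0 < dl /\ forall e, Rabs e < dl -> forall t, 0 < t < T e -> 0 < g e t.
Proof.
  intros HT HTc Hin [dA [PA HA]] [dB [PB HB]].
  destruct (uniform_on_compact (fun t e => 0 < t < T e -> 0 < g e t) 0 (T 0)) as [d1 [P1 H1]].
  { intros t Ht. destruct (Req_dec t 0) as [->|N0].
    - exists dA. split; [exact PA|]. intros t' e _ H1 H2 H3. rewrite Rminus_0_r in H1. apply HA; lra.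
    - destruct (Req_dec t (T 0)) as [->|N1].
      + exists dB. split; [exact PB|]. intros t' e _ H1 H2 H3. apply HB; lra.
      + destruct (Hin t ltac:(lra)) as [dl [P K]]. exists dl. split; [exact P|]. intros t' e _ H1 H2 _. apply K; assumption. }
  destruct (HTc dB PB) as [d2 [P2 H2]].
  exists (Rmin d1 (Rmin d2 dB)). split; [repeat apply Rmin_pos; assumption|]. intros e He t Ht.
  pose proof (Rmin_l d1 (Rmin d2 dB)). pose proof (Rmin_r d1 (Rmin d2 dB)). pose proof (Rmin_l d2 dB). pose proof (Rmin_r d2 dB).
  destruct (Rle_lt_dec t (T 0)) as [L|L].
  - apply H1; lra.
  - apply HB; try lra. specialize (H2 e ltac:(lra)). apply Rabs_def2 in H2. apply Rabs_def1; lra.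
Qed.

Lemma cos_gt phi t : 0 < phi < PI -> 0 < t < 2 * phi -> cos phi < cos (phi - t).
Proof.
  intros Hp Ht. destruct (Rle_lt_dec 0 (phi - t)) as [L|L].
  - apply cos_decreasing_1; lra.
  - replace (cos (phi - t)) with (cos (t - phi)) by (rewrite <- cos_neg; f_equal; ring). apply cos_decreasing_1; lra.
Qed.
Lemma cos_lt psi t : 0 < psi < PI -> 0 < t < 2 * PI - 2 * psi -> cos (- psi - t) < cos psi.
Proof.
  intros Hp Ht. rewrite <- cos_neg. replace (- (- psi - t)) with (psi + t) by ring.
  destruct (Rle_lt_dec (psi + t) PI) as [L|L].
  - apply cos_decreasing_1; lra.
  - replace (psi + t) with (- (2 * PI - (psi + t)) + 2 * PI) by ring.
    rewrite cos_plus, sin_2PI, cos_2PI, cos_neg.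
    replace (cos (2 * PI - (psi + t)) * 1 - sin (- (2 * PI - (psi + t))) * 0) with (cos (2 * PI - (psi + t))) by ring.
    apply cos_decreasing_1; lra.
Qed.

Section Orbits.
Variables (c d : R) (Zp Zm : zone).
Hypotheses (Hmp : zm Zp = -1) (Hmm : zm Zm = 1) (Hnm : zn Zm = 0).
Variable s0 : R.
Hypothesis Hs0 : 1 < s0.
Definition A0 := spt c d 0 s0.
Definition B0 := spt c d 0 (- s0).
Definition zsys e := PwSystem (quadric c d) (field Zp e) (field Zm e).

(** What holds near the two crossing points and near the plane x = 0, uniformly in the parameter. lf_low and lf_high
    make an orbit leave its zone before it has turned too far: sw is negative up to the height of the centre of the
    zone sw > 0, and positive straight above the centre of the zone sw < 0. *)
Record local_facts (rho : R) : Prop := LF {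
  lf_pos : 0 < rho;
  lf_good : forall e, Rabs e < rho -> zgood Zp e /\ zgood Zm e;
  lf_A : forall (p : R3) (e : R), norm (minus p A0) < rho -> Rabs e < rho ->
     0 < cV Zp e p /\ 0 < cV Zm e p /\ 0 < cU Zm e p /\
     0 < dquadric c d p (field Zp e p) /\ 0 < dquadric c d p (field Zm e p);
  lf_B : forall (p : R3) (e : R), norm (minus p B0) < rho -> Rabs e < rho ->
     0 < cV Zp e p /\ 0 < cV Zm e p /\ cU Zm e p < 0 /\
     dquadric c d p (field Zp e p) < 0 /\ dquadric c d p (field Zm e p) < 0;
  lf_low : forall (p : R3) (e : R), Rabs (px p) < rho -> Rabs e < rho -> cV Zp e p <= 0 -> quadric c d p < 0;
  lf_high : forall (p : R3) (e : R), Rabs (px p) < rho -> Rabs e < rho -> cU Zm e p = 0 -> 0 <= cV Zm e p -> 0 < quadric c d p }.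

Lemma cU_at_0 Z p : cU Z 0 p = tY p.
Proof. unfold cU, dY. ring. Qed.
Lemma cV_at_0 Z p : cV Z 0 p = tw Z p.
Proof. unfold cV, dw. rewrite om_0. ring. Qed.
Lemma cH_at_0 Z p : cH Z 0 p = px p.
Proof. unfold cH. ring. Qed.

Lemma dq_spt0 Z Y : dquadric c d (spt c d 0 Y) (field Z 0 (spt c d 0 Y)) = Y * (2 * (Y ^ 2 - zm Z) + 1).
Proof.
  unfold dquadric. rewrite px_field, py_field, pz_field, !Rmult_0_l, !Rplus_0_r.
  unfold spt, px, py, pz; simpl. field.
Qed.

Lemma point_near (F : R3 * R -> R) p0 : continuous F ((p0, 0) : R3 * R) -> 0 < F (p0, 0) ->
  exists dl, 0 < dl /\ forall (p : R3) (e : R), norm (minus p p0) < dl -> Rabs e < dl -> 0 < F (p, e).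
Proof. exact (near_pe_pos F p0). Qed.

Lemma cont_pe_V Z p0 : continuous (fun q : R3 * R => cV Z (snd q) (fst q)) ((p0, 0) : R3 * R).
Proof. apply (cont_cV Z (p0, 0) snd fst); [apply continuous_snd|apply cont3_fst|reflexivity]. Qed.
Lemma cont_pe_U Z p0 : continuous (fun q : R3 * R => cU Z (snd q) (fst q)) ((p0, 0) : R3 * R).
Proof. apply (cont_cU Z (p0, 0) snd fst); [apply continuous_snd|apply cont3_fst|reflexivity]. Qed.
Lemma cont_pe_D Z p0 : continuous (fun q : R3 * R => dquadric c d (fst q) (field Z (snd q) (fst q))) ((p0, 0) : R3 * R).
Proof. apply (cont_dquadric Z (p0, 0) snd fst); [apply continuous_snd|apply cont3_fst]. Qed.

Lemma min5 a b e f g : 0 < a -> 0 < b -> 0 < e -> 0 < f -> 0 < g -> exists m, 0 < m /\ m <= a /\ m <= b /\ m <= e /\ m <= f /\ m <= g.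
Proof.
  intros. exists (Rmin a (Rmin b (Rmin e (Rmin f g)))). split; [repeat apply Rmin_pos; assumption|].
  pose proof (Rmin_l a (Rmin b (Rmin e (Rmin f g)))). pose proof (Rmin_r a (Rmin b (Rmin e (Rmin f g)))).
  pose proof (Rmin_l b (Rmin e (Rmin f g))). pose proof (Rmin_r b (Rmin e (Rmin f g))).
  pose proof (Rmin_l e (Rmin f g)). pose proof (Rmin_r e (Rmin f g)). pose proof (Rmin_l f g). pose proof (Rmin_r f g). lra.
Qed.

Lemma near_A : exists dl, 0 < dl /\ forall (p : R3) (e : R), norm (minus p A0) < dl -> Rabs e < dl ->
     0 < cV Zp e p /\ 0 < cV Zm e p /\ 0 < cU Zm e p /\
     0 < dquadric c d p (field Zp e p) /\ 0 < dquadric c d p (field Zm e p).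
Proof.
  destruct (point_near (fun q => cV Zp (snd q) (fst q)) A0 (cont_pe_V Zp A0)) as [d1 [P1 Q1]].
  { simpl. rewrite cV_at_0. unfold A0. rewrite spt_tw, Hmp. nra. }
  destruct (point_near (fun q => cV Zm (snd q) (fst q)) A0 (cont_pe_V Zm A0)) as [d2 [P2 Q2]].
  { simpl. rewrite cV_at_0. unfold A0. rewrite spt_tw, Hmm. nra. }
  destruct (point_near (fun q => cU Zm (snd q) (fst q)) A0 (cont_pe_U Zm A0)) as [d3 [P3 Q3]].
  { simpl. rewrite cU_at_0. unfold A0. rewrite spt_tY. lra. }
  destruct (point_near (fun q => dquadric c d (fst q) (field Zp (snd q) (fst q))) A0 (cont_pe_D Zp A0)) as [d4 [P4 Q4]].
  { simpl. unfold A0. rewrite dq_spt0, Hmp. nra. }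
  destruct (point_near (fun q => dquadric c d (fst q) (field Zm (snd q) (fst q))) A0 (cont_pe_D Zm A0)) as [d5 [P5 Q5]].
  { simpl. unfold A0. rewrite dq_spt0, Hmm. nra. }
  destruct (min5 d1 d2 d3 d4 d5 P1 P2 P3 P4 P5) as [m [Hm [M1 [M2 [M3 [M4 M5]]]]]].
  exists m. split; [exact Hm|]. intros p e Hp He.
  specialize (Q1 p e ltac:(lra) ltac:(lra)). specialize (Q2 p e ltac:(lra) ltac:(lra)). specialize (Q3 p e ltac:(lra) ltac:(lra)).
  specialize (Q4 p e ltac:(lra) ltac:(lra)). specialize (Q5 p e ltac:(lra) ltac:(lra)). simpl in *. repeat split; assumption.
Qed.

Lemma near_B : exists dl, 0 < dl /\ forall (p : R3) (e : R), norm (minus p B0) < dl -> Rabs e < dl ->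
     0 < cV Zp e p /\ 0 < cV Zm e p /\ cU Zm e p < 0 /\
     dquadric c d p (field Zp e p) < 0 /\ dquadric c d p (field Zm e p) < 0.
Proof.
  destruct (point_near (fun q => cV Zp (snd q) (fst q)) B0 (cont_pe_V Zp B0)) as [d1 [P1 Q1]].
  { simpl. rewrite cV_at_0. unfold B0. rewrite spt_tw, Hmp. nra. }
  destruct (point_near (fun q => cV Zm (snd q) (fst q)) B0 (cont_pe_V Zm B0)) as [d2 [P2 Q2]].
  { simpl. rewrite cV_at_0. unfold B0. rewrite spt_tw, Hmm. nra. }
  destruct (point_near (fun q => - cU Zm (snd q) (fst q)) B0 (cont_opp _ _ (cont_pe_U Zm B0))) as [d3 [P3 Q3]].
  { simpl. rewrite cU_at_0. unfold B0. rewrite spt_tY. lra. }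
  destruct (point_near (fun q => - dquadric c d (fst q) (field Zp (snd q) (fst q))) B0 (cont_opp _ _ (cont_pe_D Zp B0))) as [d4 [P4 Q4]].
  { simpl. unfold B0. rewrite dq_spt0, Hmp. nra. }
  destruct (point_near (fun q => - dquadric c d (fst q) (field Zm (snd q) (fst q))) B0 (cont_opp _ _ (cont_pe_D Zm B0))) as [d5 [P5 Q5]].
  { simpl. unfold B0. rewrite dq_spt0, Hmm. nra. }
  destruct (min5 d1 d2 d3 d4 d5 P1 P2 P3 P4 P5) as [m [Hm [M1 [M2 [M3 [M4 M5]]]]]].
  exists m. split; [exact Hm|]. intros p e Hp He.
  specialize (Q1 p e ltac:(lra) ltac:(lra)). specialize (Q2 p e ltac:(lra) ltac:(lra)). specialize (Q3 p e ltac:(lra) ltac:(lra)).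
  specialize (Q4 p e ltac:(lra) ltac:(lra)). specialize (Q5 p e ltac:(lra) ltac:(lra)). simpl in *. repeat split; lra.
Qed.

Lemma near_low : exists dl, 0 < dl /\ forall (p : R3) (e : R), Rabs (px p) < dl -> Rabs e < dl -> cV Zp e p <= 0 -> quadric c d p < 0.
Proof.
  set (g := 1 - c). set (k := c / 2 - 1 / 4 - d).
  set (F := fun q : R * R => 1 - snd q * w1 Zp (snd q) - Rabs (fst q) / 2 - (g ^ 2 / 4 + Rabs k) * fst q ^ 2).
  destruct (near_te_pos F 0) as [dl [Hdl Q]].
  { unfold F. assert (C1 : continuous (fun q : R * R => snd q) ((0, 0) : R * R)) by apply continuous_snd.
    assert (C2 : continuous (fun q : R * R => fst q) ((0, 0) : R * R)) by apply continuous_fst.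
    assert (C3 : continuous (fun q : R * R => w1 Zp (snd q)) ((0, 0) : R * R)) by (apply (cont_comp (w1 Zp) snd); [exact C1|apply w1_c0]).
    ctac. }
  { unfold F. simpl. rewrite Rabs_R0. lra. }
  destruct (zgood_near Zp) as [d2 [P2 Q2]].
  exists (Rmin dl d2). split; [apply Rmin_pos; assumption|]. intros p e Hp He HV.
  pose proof (Rmin_l dl d2). pose proof (Rmin_r dl d2).
  pose proof (om_pos Zp e (Q2 e ltac:(lra))) as Ho.
  assert (Hw : dw Zp e p <= 0) by (unfold cV in HV; nra).
  specialize (Q (px p) e ltac:(rewrite Rminus_0_r; lra) ltac:(lra)). unfold F in Q; simpl in Q.
  rewrite quadric_tilde. fold g k. unfold dw, tw in Hw. rewrite Hmp in Hw.
  set (x := px p) in *. set (Y := tY p) in *.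
  assert (X1 : g * x * Y <= Y ^ 2 + g ^ 2 / 4 * x ^ 2) by (pose proof (pow2_ge_0 (Y - g * x / 2)); lra).
  assert (X2 : k * x ^ 2 <= Rabs k * x ^ 2) by (apply Rmult_le_compat_r; [nra|apply Rle_abs]).
  pose proof (Rle_abs x). pose proof (pow2_ge_0 Y). lra.
Qed.

Lemma near_high : exists dl, 0 < dl /\ forall (p : R3) (e : R), Rabs (px p) < dl -> Rabs e < dl -> cU Zm e p = 0 -> 0 <= cV Zm e p -> 0 < quadric c d p.
Proof.
  set (g := 1 - c). set (k := c / 2 - 1 / 4 - d).
  set (F := fun q : R * R => 1 + snd q * w1 Zm (snd q) - 2 * (snd q * y1 Zm (snd q)) ^ 2 - Rabs (fst q) / 2 - (g ^ 2 / 4 + Rabs k) * fst q ^ 2).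
  destruct (near_te_pos F 0) as [dl [Hdl Q]].
  { unfold F. assert (C1 : continuous (fun q : R * R => snd q) ((0, 0) : R * R)) by apply continuous_snd.
    assert (C2 : continuous (fun q : R * R => fst q) ((0, 0) : R * R)) by apply continuous_fst.
    assert (C3 : continuous (fun q : R * R => w1 Zm (snd q)) ((0, 0) : R * R)) by (apply (cont_comp (w1 Zm) snd); [exact C1|apply w1_c0]).
    assert (C4 : continuous (fun q : R * R => y1 Zm (snd q)) ((0, 0) : R * R)) by (apply (cont_comp (y1 Zm) snd); [exact C1|apply y1_c0]).
    ctac. }
  { unfold F. simpl. rewrite Rabs_R0. lra. }
  destruct (zgood_near Zm) as [d2 [P2 Q2]].
  exists (Rmin dl d2). split; [apply Rmin_pos; assumption|]. intros p e Hp He HU HV.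
  pose proof (Rmin_l dl d2). pose proof (Rmin_r dl d2).
  pose proof (om_pos Zm e (Q2 e ltac:(lra))) as Ho.
  assert (Hw : 0 <= dw Zm e p) by (unfold cV in HV; nra).
  assert (HY : tY p = e * y1 Zm e) by (unfold cU, dY in HU; rewrite Hnm in HU; lra).
  specialize (Q (px p) e ltac:(rewrite Rminus_0_r; lra) ltac:(lra)). unfold F in Q; simpl fst in Q; simpl snd in Q. rewrite <- HY in Q.
  rewrite quadric_tilde. fold g k. unfold dw, tw in Hw. rewrite Hmm in Hw.
  set (x := px p) in *. set (Y := tY p) in *.
  assert (X1 : - (g * x * Y) <= Y ^ 2 + g ^ 2 / 4 * x ^ 2) by (pose proof (pow2_ge_0 (Y + g * x / 2)); lra).
  assert (X2 : - (k * x ^ 2) <= Rabs k * x ^ 2).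
  { replace (- (k * x ^ 2)) with ((- k) * x ^ 2) by ring. apply Rmult_le_compat_r; [nra|]. rewrite <- Rabs_Ropp. apply Rle_abs. }
  assert (- x <= Rabs x) by (rewrite <- Rabs_Ropp; apply Rle_abs). lra.
Qed.

Lemma local_facts_exist : exists rho, local_facts rho.
Proof.
  destruct near_A as [d1 [P1 Q1]]. destruct near_B as [d2 [P2 Q2]]. destruct near_low as [d3 [P3 Q3]].
  destruct near_high as [d4 [P4 Q4]]. destruct (zgood_near Zp) as [d5 [P5 Q5]]. destruct (zgood_near Zm) as [d6 [P6 Q6]].
  destruct (min5 d1 d2 d3 d4 (Rmin d5 d6) P1 P2 P3 P4 ltac:(apply Rmin_pos; assumption)) as [m [Hm [M1 [M2 [M3 [M4 M5]]]]]].
  pose proof (Rmin_l d5 d6). pose proof (Rmin_r d5 d6).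
  exists m. split; [exact Hm| | | | |]; intros.
  - split; [apply Q5|apply Q6]; lra.
  - apply Q1; lra.
  - apply Q2; lra.
  - apply (Q3 p e); lra.
  - apply (Q4 p e); lra.
Qed.

Lemma quadric_0 Z p : px p = 0 -> quadric c d p = cV Z 0 p ^ 2 + cV Z 0 p + zm Z - qn Z 0 p.
Proof.
  intros H. rewrite quadric_tilde, H. unfold qn. rewrite cU_at_0, cV_at_0. unfold tw. rewrite H. field.
Qed.

Lemma zgood_0 Z : zgood Z 0.
Proof. destruct (zgood_near Z) as [dl [Hdl H]]. apply H. rewrite Rabs_R0. exact Hdl. Qed.

(** For e = 0 the plane x = 0 is invariant and the radius is conserved. *)
Lemma flow_0_facts Z t p : px p = 0 -> 0 < cV Z 0 p ->
  px (flow Z 0 t p) = 0 /\ qn Z 0 (flow Z 0 t p) = qn Z 0 p /\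
  cV Z 0 (flow Z 0 t p) = sqrt (qn Z 0 p) * cos (ang Z 0 p - t).
Proof.
  intros H HV. pose proof (zgood_0 Z) as G.
  destruct (flow_polar Z 0 G t p HV) as [FU FV]. rewrite om_0 in FU, FV.
  replace (0 * zl Z * t) with 0 in FU, FV by ring. rewrite exp_0 in FU, FV. rewrite !Rmult_1_l in FU, FV.
  split; [|split; [|exact FV]].
  - rewrite <- (cH_at_0 Z), (cH_flow Z 0 G), cH_at_0, H. ring.
  - unfold qn at 1. rewrite FU, FV.
    assert (S : sqrt (qn Z 0 p) * sqrt (qn Z 0 p) = qn Z 0 p) by (apply sqrt_sqrt; unfold qn; nra).
    pose proof (sin2_cos2 (ang Z 0 p - t)) as SC. unfold Rsqr in SC. rewrite <- S at 3.
    transitivity (sqrt (qn Z 0 p) * sqrt (qn Z 0 p) * (sin (ang Z 0 p - t) * sin (ang Z 0 p - t) + cos (ang Z 0 p - t) * cos (ang Z 0 p - t))); [ring|].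
    rewrite SC. ring.
Qed.

Definition tp0 := 2 * atan (s0 / (s0 ^ 2 + 1)).
Definition tm0 := 2 * PI - 2 * atan (s0 / (s0 ^ 2 - 1)).

Lemma A0_px : px A0 = 0. Proof. reflexivity. Qed.
Lemma B0_px : px B0 = 0. Proof. reflexivity. Qed.
Lemma A0_V Z : cV Z 0 A0 = s0 ^ 2 - zm Z.
Proof. rewrite cV_at_0. unfold A0. rewrite spt_tw. field. Qed.
Lemma B0_V Z : cV Z 0 B0 = s0 ^ 2 - zm Z.
Proof. rewrite cV_at_0. unfold B0. rewrite spt_tw. field. Qed.
Lemma A0_U Z : cU Z 0 A0 = s0.
Proof. rewrite cU_at_0. apply spt_tY. Qed.
Lemma B0_U Z : cU Z 0 B0 = - s0.
Proof. rewrite cU_at_0. apply spt_tY. Qed.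

(** On a circle around the centre sw is a quadratic polynomial of the height V that is positive above the height of
    the crossing points. *)
Lemma arc0_pos t : 0 < t < tp0 -> 0 < quadric c d (flow Zp 0 t A0).
Proof.
  intros Ht. assert (HV : 0 < cV Zp 0 A0) by (rewrite A0_V, Hmp; nra).
  destruct (flow_0_facts Zp t A0 A0_px HV) as [F1 [F2 F3]].
  rewrite (quadric_0 Zp _ F1), F2, Hmp.
  set (phi := ang Zp 0 A0) in *.
  assert (Hphi : phi = atan (s0 / (s0 ^ 2 + 1))).
  { unfold phi, ang. rewrite A0_U, A0_V, Hmp. do 2 f_equal. ring. }
  assert (Hb : 0 < phi < PI).
  { split; [rewrite Hphi, <- atan_0; apply atan_increasing, Rdiv_lt_0_compat; nra|].
    rewrite Hphi. pose proof (atan_bound (s0 / (s0 ^ 2 + 1))). pose proof PI_RGT_0. lra. }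
  assert (C := cos_gt phi t Hb ltac:(unfold tp0 in Ht; rewrite Hphi; lra)).
  destruct (polar (cU Zp 0 A0) (cV Zp 0 A0) HV) as [_ PV]. fold (qn Zp 0 A0) in PV. fold (ang Zp 0 A0) in PV. fold phi in PV.
  set (q := qn Zp 0 A0) in *.
  assert (Hq : q = s0 ^ 2 + (s0 ^ 2 + 1) ^ 2) by (unfold q, qn; rewrite A0_U, A0_V, Hmp; ring).
  assert (Hsq : 0 < sqrt q) by (apply sqrt_lt_R0; rewrite Hq; nra).
  rewrite F3. rewrite A0_V, Hmp in PV.
  assert (s0 ^ 2 + 1 < sqrt q * cos (phi - t)) by nra.
  set (V := sqrt q * cos (phi - t)) in *. rewrite Hq. nra.
Qed.

(** As arc0_pos, with the arc of the circle below the crossing points. *)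
Lemma arc0_neg t : 0 < t < tm0 -> quadric c d (flow Zm 0 t B0) < 0.
Proof.
  intros Ht. assert (HV : 0 < cV Zm 0 B0) by (rewrite B0_V, Hmm; nra).
  destruct (flow_0_facts Zm t B0 B0_px HV) as [F1 [F2 F3]].
  rewrite (quadric_0 Zm _ F1), F2, Hmm.
  set (phi := ang Zm 0 B0) in *.
  set (psi := atan (s0 / (s0 ^ 2 - 1))).
  assert (Hphi : phi = - psi).
  { unfold phi, psi, ang. rewrite B0_U, B0_V, Hmm, <- atan_opp. f_equal. field. nra. }
  assert (Hb : 0 < psi < PI).
  { unfold psi. split; [rewrite <- atan_0; apply atan_increasing, Rdiv_lt_0_compat; nra|].
    pose proof (atan_bound (s0 / (s0 ^ 2 - 1))). pose proof PI_RGT_0. lra. }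
  assert (C := cos_lt psi t Hb ltac:(unfold tm0 in Ht; fold psi in Ht; lra)).
  destruct (polar (cU Zm 0 B0) (cV Zm 0 B0) HV) as [_ PV]. fold (qn Zm 0 B0) in PV. fold (ang Zm 0 B0) in PV. fold phi in PV.
  rewrite Hphi, cos_neg in PV.
  set (q := qn Zm 0 B0) in *.
  assert (Hq : q = s0 ^ 2 + (s0 ^ 2 - 1) ^ 2) by (unfold q, qn; rewrite B0_U, B0_V, Hmm; ring).
  assert (Hsq : 0 < sqrt q) by (apply sqrt_lt_R0; rewrite Hq; nra).
  rewrite F3, Hphi. rewrite B0_V, Hmm in PV.
  assert (U1 : sqrt q * cos (- psi - t) < s0 ^ 2 - 1) by nra.
  assert (Hsq2 : sqrt q < s0 ^ 2).
  { rewrite <- (sqrt_pow2 (s0 ^ 2)) by nra. apply sqrt_lt_1_alt. rewrite Hq. nra. }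
  assert (U2 : - s0 ^ 2 < sqrt q * cos (- psi - t)).
  { pose proof (COS_bound (- psi - t)). nra. }
  set (V := sqrt q * cos (- psi - t)) in *. rewrite Hq.
  replace (V ^ 2 + V + 1 - (s0 ^ 2 + (s0 ^ 2 - 1) ^ 2)) with ((V + s0 ^ 2) * (V - (s0 ^ 2 - 1))) by ring. nra.
Qed.
End Orbits.

(** * The family of closed orbits *)

Lemma cont_eps_delta (f : R -> R) : continuous f 0 -> forall eta, 0 < eta -> exists dl, 0 < dl /\ forall e, Rabs e < dl -> Rabs (f e - f 0) < eta.
Proof.
  intros H eta He. destruct (proj2 (continuity_pt_filterlim f 0) H eta He) as [d [Hd Q]]. exists d. split; [exact Hd|].
  intros e Hep. destruct (Req_dec e 0) as [->|N]; [rewrite Rminus_diag, Rabs_R0; exact He|].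
  apply Q. split; [split; [exact I|intros X; apply N; symmetry; exact X]|]. simpl. unfold Rdist. rewrite Rminus_0_r. exact Hep.
Qed.

Lemma eps_delta_cont (f : R -> R) : (forall eta, 0 < eta -> exists dl, 0 < dl /\ forall e, Rabs e < dl -> Rabs (f e - f 0) < eta) -> continuous f 0.
Proof.
  intros H. apply continuity_pt_filterlim. intros eta He. destruct (H eta He) as [d [Hd Q]]. exists d. split; [exact Hd|].
  intros x [_ Hx]. apply Q. simpl in Hx. unfold Rdist in Hx. rewrite Rminus_0_r in Hx. exact Hx.
Qed.

Lemma cont3_norm (P : R -> R3) : cont3 P 0 -> forall eta, 0 < eta -> exists dl, 0 < dl /\ forall e, Rabs e < dl -> norm (minus (P e) (P 0)) < eta.
Proof.
  intros [A [B C]] eta He.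
  destruct (cont_eps_delta _ A (eta / 3) ltac:(lra)) as [d1 [P1 Q1]].
  destruct (cont_eps_delta _ B (eta / 3) ltac:(lra)) as [d2 [P2 Q2]].
  destruct (cont_eps_delta _ C (eta / 3) ltac:(lra)) as [d3 [P3 Q3]].
  exists (Rmin d1 (Rmin d2 d3)). split; [repeat apply Rmin_pos; assumption|]. intros e Hep.
  pose proof (Rmin_l d1 (Rmin d2 d3)). pose proof (Rmin_r d1 (Rmin d2 d3)). pose proof (Rmin_l d2 d3). pose proof (Rmin_r d2 d3).
  specialize (Q1 e ltac:(lra)). specialize (Q2 e ltac:(lra)). specialize (Q3 e ltac:(lra)).
  eapply Rle_lt_trans; [apply norm_le_sum|]. rewrite px_minus, py_minus, pz_minus. lra.
Qed.

(** In the interior the sign persists by compactness; near the ends by transversality, through the mean value theorem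
    from the endpoint, which lies on the manifold. *)
Lemma arc_family_sign c d (Z : zone) (sg : R) (P P' : R -> R3) (T : R -> R) :
  cont3 P 0 -> continuous T 0 -> 0 < T 0 ->
  (exists dl, 0 < dl /\ forall e, Rabs e < dl -> zgood Z e /\ flow Z e (T e) (P e) = P' e /\ quadric c d (P e) = 0 /\ quadric c d (P' e) = 0) ->
  (forall t, 0 < t < T 0 -> 0 < sg * quadric c d (flow Z 0 t (P 0))) ->
  0 < sg * dquadric c d (P 0) (field Z 0 (P 0)) -> sg * dquadric c d (P' 0) (field Z 0 (P' 0)) < 0 ->
  exists dl, 0 < dl /\ forall e, Rabs e < dl -> forall t, 0 < t < T e -> 0 < sg * quadric c d (flow Z e t (P e)).
Proof.
  intros CP CT HT [d0 [Hd0 Hfam]] Hint HA HB.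
  assert (G0 : zgood Z 0 /\ flow Z 0 (T 0) (P 0) = P' 0) by (destruct (Hfam 0 ltac:(rewrite Rabs_R0; exact Hd0)) as [X [Y _]]; split; assumption).
  assert (Cfl : forall t0 : R, cont3 (fun q : R * R => flow Z (snd q) (fst q) (P (snd q))) ((t0, 0) : R * R)).
  { intros t0. apply (cont_flow Z (t0, 0) fst snd (fun q => P (snd q))).
    - apply continuous_fst.
    - apply continuous_snd.
    - destruct CP as [A [B C]]. split; [|split].
      + apply (cont_comp (fun e => px (P e)) snd); [apply continuous_snd|exact A].
      + apply (cont_comp (fun e => py (P e)) snd); [apply continuous_snd|exact B].
      + apply (cont_comp (fun e => pz (P e)) snd); [apply continuous_snd|exact C].
    - reflexivity. }
  assert (Cg : forall t0 : R, continuous (fun q : R * R => sg * quadric c d (flow Z (snd q) (fst q) (P (snd q)))) ((t0, 0) : R * R)).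
  { intros t0. apply (cont_mult (fun _ => sg)); [apply cont_const|].
    apply (cont_quadric (t0, 0) (fun q : R * R => flow Z (snd q) (fst q) (P (snd q)))). apply Cfl. }
  assert (Cd : forall t0 : R, continuous (fun q : R * R => sg * dquadric c d (flow Z (snd q) (fst q) (P (snd q))) (field Z (snd q) (flow Z (snd q) (fst q) (P (snd q))))) ((t0, 0) : R * R)).
  { intros t0. apply (cont_mult (fun _ => sg)); [apply cont_const|].
    apply (cont_dquadric Z (t0, 0) snd (fun q : R * R => flow Z (snd q) (fst q) (P (snd q)))); [apply continuous_snd|apply Cfl]. }
  assert (Dg : forall e t, Rabs e < d0 -> is_derive (fun s => sg * quadric c d (flow Z e s (P e))) t (sg * dquadric c d (flow Z e t (P e)) (field Z e (flow Z e t (P e))))).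
  { intros e t He. apply (is_derive_scal (fun s => quadric c d (flow Z e s (P e)))).
    apply (quadric_derive c d (fun s => flow Z e s (P e))). apply flow_derive. apply Hfam, He. }
  assert (Cc : forall e t, Rabs e < d0 -> continuity_pt (fun s => sg * quadric c d (flow Z e s (P e))) t).
  { intros e t He. apply continuity_pt_filterlim. apply (cont_D (fun s => sg * quadric c d (flow Z e s (P e))) t).
    exists (sg * dquadric c d (flow Z e t (P e)) (field Z e (flow Z e t (P e)))). exact (Dg e t He). }
  assert (Tc := cont_eps_delta T CT).
  apply (arc_sign (fun e t => sg * quadric c d (flow Z e t (P e))) T HT Tc).
  - intros t Ht. destruct (near_te_pos _ t (Cg t)) as [dl [Hdl Q]]; [apply Hint, Ht|].
    exists dl. split; [exact Hdl|]. intros t' e H1 H2. exact (Q t' e H1 H2).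
  - destruct (near_te_pos _ 0 (Cd 0)) as [dl [Hdl Q]].
    { simpl. rewrite flow_0 by apply G0. exact HA. }
    exists (Rmin dl d0). split; [apply Rmin_pos; assumption|]. intros t e Ht He Htp.
    pose proof (Rmin_l dl d0). pose proof (Rmin_r dl d0).
    destruct (MVT_gen (fun s => sg * quadric c d (flow Z e s (P e))) 0 t
       (fun s => sg * dquadric c d (flow Z e s (P e)) (field Z e (flow Z e s (P e))))) as [x [Hx E]].
    + intros s _. apply Dg. lra.
    + intros s _. apply Cc. lra.
    + rewrite Rmin_left, Rmax_right in Hx by lra. rewrite flow_0 in E by (apply Hfam; lra).
      destruct (Hfam e ltac:(lra)) as [_ [_ [Z1 _]]]. rewrite Z1 in E.
      apply Rabs_def2 in Ht.
      pose proof (Q x e ltac:(rewrite Rminus_0_r; apply Rabs_def1; lra) ltac:(lra)) as Qx. simpl in Qx. nra.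
  - destruct (near_te_pos _ (T 0) (cont_opp _ _ (Cd (T 0)))) as [dl [Hdl Q]].
    { simpl. destruct G0 as [_ ->]. lra. }
    destruct (Tc dl Hdl) as [d1 [P1 Q1]].
    exists (Rmin dl (Rmin d0 d1)). split; [repeat apply Rmin_pos; assumption|]. intros t e Ht He HtT.
    pose proof (Rmin_l dl (Rmin d0 d1)). pose proof (Rmin_r dl (Rmin d0 d1)). pose proof (Rmin_l d0 d1). pose proof (Rmin_r d0 d1).
    specialize (Q1 e ltac:(lra)).
    destruct (MVT_gen (fun s => sg * quadric c d (flow Z e s (P e))) t (T e)
       (fun s => sg * dquadric c d (flow Z e s (P e)) (field Z e (flow Z e s (P e))))) as [x [Hx E]].
    + intros s _. apply Dg. lra.
    + intros s _. apply Cc. lra.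
    + rewrite Rmin_left, Rmax_right in Hx by lra.
      destruct (Hfam e ltac:(lra)) as [_ [Fl [_ Z2]]]. rewrite Fl, Z2 in E.
      apply Rabs_def2 in Ht. apply Rabs_def2 in Q1.
      pose proof (Q x e ltac:(apply Rabs_def1; lra) ltac:(lra)) as Qx. simpl in Qx. nra.
Qed.

Section Family.
Variables (c d : R) (Zp Zm : zone).
Hypotheses (Hmp : zm Zp = -1) (Hmm : zm Zm = 1) (Hnm : zn Zm = 0).
Variable s0 : R.
Hypothesis Hs0 : 1 < s0.
Variable vb : R -> V4.
Hypothesis Hvb : forall eta, 0 < eta -> exists dl, 0 < dl /\ forall e, Rabs e < dl -> D4 (vb e) (vb 0) < eta.
Hypothesis Hvs : qs (vb 0) = s0.
Hypothesis Hpass : exists dl, 0 < dl /\ forall e, 0 < Rabs e < dl -> passage c d Zp Zm (emb (vb e)) e.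

(** vb collects the rescaled data of the closed orbit; at e = 0 it carries the unperturbed ones, so that Gam 0 is an
    unperturbed orbit. *)
Definition Ae e := spt c d (e * qa (vb e)) (qs (vb e)).
Definition Be e := spt c d (e * qb (vb e)) (- qs (vb e) + e * qg (vb e)).
Definition tpe e := tT Zp e 0 (Ae e) (Be e).
Definition tme e := tT Zm e 1 (Be e) (Ae e).

Lemma vb_cont : continuous (fun e => qa (vb e)) 0 /\ continuous (fun e => qb (vb e)) 0 /\
  continuous (fun e => qs (vb e)) 0 /\ continuous (fun e => qg (vb e)) 0.
Proof.
  assert (X : forall f : V4 -> R, (forall v w, Rabs (f v - f w) <= D4 v w) -> continuous (fun e => f (vb e)) 0).
  { intros f Hf. apply eps_delta_cont. intros eta He. destruct (Hvb eta He) as [dl [P Q]]. exists dl. split; [exact P|].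
    intros e Hep. eapply Rle_lt_trans; [apply Hf|apply Q, Hep]. }
  repeat split; apply X; intros v w; unfold D4; pose proof (Rabs_pos (qa v - qa w)); pose proof (Rabs_pos (qb v - qb w));
    pose proof (Rabs_pos (qs v - qs w)); pose proof (Rabs_pos (qg v - qg w)); lra.
Qed.

Lemma Ae_cont : cont3 Ae 0.
Proof.
  destruct vb_cont as [Ca [_ [Cs _]]]. apply cont3_spt; [|exact Cs].
  apply (cont_mult (fun e => e)); [apply continuous_id|exact Ca].
Qed.
Lemma Be_cont : cont3 Be 0.
Proof.
  destruct vb_cont as [_ [Cb [Cs Cg]]]. apply cont3_spt.
  - apply (cont_mult (fun e => e)); [apply continuous_id|exact Cb].
  - apply (cont_plus (fun e => - qs (vb e)) (fun e => e * qg (vb e))); [apply cont_opp; exact Cs|].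
    apply (cont_mult (fun e => e)); [apply continuous_id|exact Cg].
Qed.
Lemma Ae_0 : Ae 0 = A0 c d s0.
Proof. unfold Ae, A0. rewrite Hvs, Rmult_0_l. reflexivity. Qed.
Lemma Be_0 : Be 0 = B0 c d s0.
Proof. unfold Be, B0. rewrite Hvs, !Rmult_0_l, Rplus_0_r. reflexivity. Qed.

Lemma cont_ang Z P : cont3 P 0 -> 0 < cV Z 0 (P 0) -> continuous (fun e => ang Z e (P e)) 0.
Proof.
  intros CP HV. unfold ang. apply (cont_comp atan (fun e => cU Z e (P e) / cV Z e (P e))).
  - apply cont_div; [lra| |].
    + apply (cont_cU Z 0 (fun e => e) P); [apply continuous_id|exact CP|reflexivity].
    + apply (cont_cV Z 0 (fun e => e) P); [apply continuous_id|exact CP|reflexivity].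
  - apply cont_D. auto_derive. exact I.
Qed.

Lemma tT_cont Z n P P' : cont3 P 0 -> cont3 P' 0 -> 0 < cV Z 0 (P 0) -> 0 < cV Z 0 (P' 0) ->
  continuous (fun e => tT Z e n (P e) (P' e)) 0.
Proof.
  intros C1 C2 V1 V2. unfold tT. apply cont_div; [rewrite om_0; lra| |apply om_c0].
  apply (cont_minus (fun e => 2 * PI * n + ang Z e (P e)) (fun e => ang Z e (P' e))); [|apply cont_ang; assumption].
  apply (cont_plus (fun _ => 2 * PI * n)); [apply cont_const|apply cont_ang; assumption].
Qed.

Lemma V_A0 Z : zm Z <= 1 -> 0 < cV Z 0 (Ae 0).
Proof. intros H. rewrite Ae_0, A0_V. nra. Qed.
Lemma V_B0 Z : zm Z <= 1 -> 0 < cV Z 0 (Be 0).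
Proof. intros H. rewrite Be_0, B0_V. nra. Qed.

Lemma tpe_cont : continuous tpe 0.
Proof. apply tT_cont; [apply Ae_cont|apply Be_cont|apply V_A0; lra|apply V_B0; lra]. Qed.
Lemma tme_cont : continuous tme 0.
Proof. apply tT_cont; [apply Be_cont|apply Ae_cont|apply V_B0; lra|apply V_A0; lra]. Qed.

Lemma tpe_0 : tpe 0 = tp0 s0.
Proof.
  unfold tpe, tT, tp0. rewrite Ae_0, Be_0, om_0, A0_U, B0_U, A0_V, B0_V, Hmp.
  replace (- s0 / (s0 ^ 2 - -1)) with (- (s0 / (s0 ^ 2 + 1))) by (field; nra).
  replace (s0 / (s0 ^ 2 - -1)) with (s0 / (s0 ^ 2 + 1)) by (field; nra).
  rewrite atan_opp. field.
Qed.
Lemma tme_0 : tme 0 = tm0 s0.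
Proof.
  unfold tme, tT, tm0. rewrite Ae_0, Be_0, om_0, A0_U, B0_U, A0_V, B0_V, Hmm.
  replace (- s0 / (s0 ^ 2 - 1)) with (- (s0 / (s0 ^ 2 - 1))) by (field; nra).
  rewrite atan_opp. field.
Qed.
Lemma tp0_pos : 0 < tp0 s0.
Proof. unfold tp0. assert (0 < atan (s0 / (s0 ^ 2 + 1))); [|lra]. rewrite <- atan_0. apply atan_increasing, Rdiv_lt_0_compat; nra. Qed.
Lemma tm0_pos : 0 < tm0 s0.
Proof. unfold tm0. pose proof (atan_bound (s0 / (s0 ^ 2 - 1))). pose proof PI_RGT_0. lra. Qed.

Lemma Ae_quadric e : quadric c d (Ae e) = 0. Proof. apply spt_quadric. Qed.
Lemma Be_quadric e : quadric c d (Be e) = 0. Proof. apply spt_quadric. Qed.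

Variable rho : R.
Hypothesis LFr : local_facts c d Zp Zm s0 rho.

Lemma near_AB : exists dl, 0 < dl /\ forall e, Rabs e < dl -> norm (minus (Ae e) (A0 c d s0)) < rho /\ norm (minus (Be e) (B0 c d s0)) < rho.
Proof.
  destruct LFr as [Hr _ _ _ _ _].
  destruct (cont3_norm Ae Ae_cont rho Hr) as [d1 [P1 Q1]]. destruct (cont3_norm Be Be_cont rho Hr) as [d2 [P2 Q2]].
  rewrite Ae_0 in Q1. rewrite Be_0 in Q2.
  exists (Rmin d1 d2). split; [apply Rmin_pos; assumption|]. intros e He.
  pose proof (Rmin_l d1 d2). pose proof (Rmin_r d1 d2). split; [apply Q1|apply Q2]; lra.
Qed.

(** For e <> 0 the passage equations say that the defects vanish; for e = 0 they hold by symmetry. *)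
Lemma arcs_close : exists dl, 0 < dl /\ forall e, Rabs e < dl ->
  flow Zp e (tpe e) (Ae e) = Be e /\ flow Zm e (tme e) (Be e) = Ae e.
Proof.
  destruct near_AB as [d1 [P1 Q1]]. destruct Hpass as [d2 [P2 Q2]]. destruct LFr as [Hr Hg HA HB _ _].
  destruct (min5 d1 d2 rho rho rho P1 P2 Hr Hr Hr) as [m [Hm [M1 [M2 [M3 _]]]]].
  exists m. split; [exact Hm|]. intros e He. destruct (Q1 e ltac:(lra)) as [NA NB].
  destruct (Hg e ltac:(lra)) as [Gp Gm].
  destruct (HA (Ae e) e NA ltac:(lra)) as [VA1 [VA2 _]]. destruct (HB (Be e) e NB ltac:(lra)) as [VB1 [VB2 _]].
  destruct (Req_dec e 0) as [->|N].
  - split.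
    + apply (transit_flow Zp 0 Gp 0 (Ae 0) (Be 0) VA1 VB1).
      * rewrite !cH_at_0, Ae_0, Be_0, A0_px, B0_px. ring.
      * rewrite Rmult_0_l, exp_0. unfold qn. rewrite Ae_0, Be_0, A0_U, B0_U, A0_V, B0_V. ring.
    + apply (transit_flow Zm 0 Gm 1 (Be 0) (Ae 0) VB2 VA2).
      * rewrite !cH_at_0, Ae_0, Be_0, A0_px, B0_px. ring.
      * rewrite Rmult_0_l, exp_0. unfold qn. rewrite Ae_0, Be_0, A0_U, B0_U, A0_V, B0_V. ring.
  - destruct (Q2 e ltac:(split; [apply Rabs_pos_lt; exact N|lra])) as [E1 [E2 [E3 E4]]].
    assert (EA : ptA' c d (emb (vb e)) e = Ae e).
    { unfold ptA', Ae, emb. simpl. f_equal. ring. }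
    rewrite EA in E2, E4. change (ptA c d (emb (vb e)) e) with (Ae e) in E1, E3.
    change (ptB c d (emb (vb e)) e) with (Be e) in E1, E2, E3, E4.
    destruct (defects_zero Zp e 0 _ _ N E1 E3) as [X1 X2]. destruct (defects_zero Zm e 1 _ _ N E2 E4) as [Y1 Y2].
    split; [apply (transit_flow Zp e Gp 0 (Ae e) (Be e))|apply (transit_flow Zm e Gm 1 (Be e) (Ae e))]; assumption.
Qed.

Lemma arcs_sign : exists dl, 0 < dl /\ forall e, Rabs e < dl ->
  (forall t, 0 < t < tpe e -> 0 < quadric c d (flow Zp e t (Ae e))) /\
  (forall t, 0 < t < tme e -> quadric c d (flow Zm e t (Be e)) < 0).
Proof.
  destruct arcs_close as [d1 [P1 Q1]]. destruct LFr as [Hr Hg _ _ _ _].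
  destruct (arc_family_sign c d Zp 1 Ae Be tpe Ae_cont tpe_cont) as [d2 [P2 Q2]].
  - rewrite tpe_0. apply tp0_pos.
  - exists (Rmin d1 rho). split; [apply Rmin_pos; assumption|]. intros e He.
    pose proof (Rmin_l d1 rho). pose proof (Rmin_r d1 rho). split; [apply Hg; lra|]. split; [apply Q1; lra|].
    split; [apply Ae_quadric|apply Be_quadric].
  - intros t Ht. rewrite tpe_0 in Ht. rewrite Ae_0, Rmult_1_l. apply (arc0_pos c d Zp Hmp s0 Hs0 t Ht).
  - rewrite Ae_0. unfold A0. rewrite dq_spt0, Hmp. nra.
  - rewrite Be_0. unfold B0. rewrite dq_spt0, Hmp. nra.
  - destruct (arc_family_sign c d Zm (-1) Be Ae tme Be_cont tme_cont) as [d3 [P3 Q3]].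
    + rewrite tme_0. apply tm0_pos.
    + exists (Rmin d1 rho). split; [apply Rmin_pos; assumption|]. intros e He.
      pose proof (Rmin_l d1 rho). pose proof (Rmin_r d1 rho). split; [apply Hg; lra|]. split; [apply Q1; lra|].
      split; [apply Be_quadric|apply Ae_quadric].
    + intros t Ht. rewrite tme_0 in Ht. rewrite Be_0. pose proof (arc0_neg c d Zm Hmm s0 Hs0 t Ht). lra.
    + rewrite Be_0. unfold B0. rewrite dq_spt0, Hmm. nra.
    + rewrite Ae_0. unfold A0. rewrite dq_spt0, Hmm. nra.
    + exists (Rmin d2 d3). split; [apply Rmin_pos; assumption|]. intros e He.
      pose proof (Rmin_l d2 d3). pose proof (Rmin_r d2 d3). split; intros t Ht.
      * pose proof (Q2 e ltac:(lra) t Ht). lra.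
      * pose proof (Q3 e ltac:(lra) t Ht). lra.
Qed.

Definition Gam e := arcs_range (fun t => flow Zp e t (Ae e)) (fun t => flow Zm e t (Be e)) (tpe e) (tme e).

Record orbit_facts (e : R) : Prop := OF {
  of_rho : Rabs e < rho;
  of_A : norm (minus (Ae e) (A0 c d s0)) < rho;
  of_B : norm (minus (Be e) (B0 c d s0)) < rho;
  of_p : flow Zp e (tpe e) (Ae e) = Be e;
  of_m : flow Zm e (tme e) (Be e) = Ae e;
  of_tp : 0 < tpe e;
  of_tm : 0 < tme e;
  of_sp : forall t, 0 < t < tpe e -> 0 < quadric c d (flow Zp e t (Ae e));
  of_sm : forall t, 0 < t < tme e -> quadric c d (flow Zm e t (Be e)) < 0 }.

Lemma orbit_facts_exist : exists dl, 0 < dl /\ forall e, Rabs e < dl -> orbit_facts e.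
Proof.
  destruct near_AB as [d1 [P1 Q1]]. destruct arcs_close as [d2 [P2 Q2]]. destruct arcs_sign as [d3 [P3 Q3]].
  destruct (cont_eps_delta tpe tpe_cont (tp0 s0) tp0_pos) as [d4 [P4 Q4]].
  destruct (cont_eps_delta tme tme_cont (tm0 s0) tm0_pos) as [d5 [P5 Q5]].
  rewrite tpe_0 in Q4. rewrite tme_0 in Q5. pose proof (lf_pos _ _ _ _ _ _ LFr) as Hr.
  destruct (min5 d1 d2 d3 d4 (Rmin d5 rho) P1 P2 P3 P4 ltac:(apply Rmin_pos; assumption)) as [m [Hm [M1 [M2 [M3 [M4 M5]]]]]].
  pose proof (Rmin_l d5 rho). pose proof (Rmin_r d5 rho).
  exists m. split; [exact Hm|]. intros e He.
  specialize (Q4 e ltac:(lra)). specialize (Q5 e ltac:(lra)). apply Rabs_def2 in Q4. apply Rabs_def2 in Q5.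
  destruct (Q1 e ltac:(lra)) as [X1 X2]. destruct (Q2 e ltac:(lra)) as [X3 X4]. destruct (Q3 e ltac:(lra)) as [X5 X6].
  split; [lra|exact X1|exact X2|exact X3|exact X4|lra|lra|exact X5|exact X6].
Qed.

Lemma AB_distinct e : orbit_facts e -> Ae e <> Be e.
Proof.
  intros F E. destruct LFr as [Hr Hg HA HB _ _].
  destruct (HA (Ae e) e (of_A e F) (of_rho e F)) as [_ [_ [U1 _]]].
  destruct (HB (Be e) e (of_B e F) (of_rho e F)) as [_ [_ [U2 _]]]. rewrite E in U1. lra.
Qed.

Lemma Gam_crossing e : orbit_facts e -> crossing_periodic_orbit (zsys c d Zp Zm e) (Gam e).
Proof.
  intros F. destruct LFr as [Hr Hg HA HB _ _]. destruct (Hg e (of_rho e F)) as [Gp Gm].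
  destruct (HA (Ae e) e (of_A e F) (of_rho e F)) as [_ [_ [_ [A1 A2]]]].
  destruct (HB (Be e) e (of_B e F) (of_rho e F)) as [_ [_ [_ [B1 B2]]]].
  apply (glued_crossing_orbit (fun t => flow Zp e t (Ae e)) (fun t => flow Zm e t (Be e)) (tpe e) (tme e) (of_tp e F) (of_tm e F));
    rewrite ?(flow_0 Zp e Gp), ?(flow_0 Zm e Gm).
  - apply (of_p e F).
  - apply (of_m e F).
  - intros t. apply (flow_derive Zp e Gp).
  - intros t. apply (flow_derive Zm e Gm).
  - intros t Ht. apply (of_sp e F t Ht).
  - intros t Ht. apply (of_sm e F t Ht).
  - apply Ae_quadric.
  - apply Be_quadric.
  - apply (AB_distinct e F).
  - split; [apply Ae_quadric|]. simpl. rewrite !lie_quadric. nra.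
  - split; [apply Be_quadric|]. simpl. rewrite !lie_quadric. nra.
Qed.

(** The arcs are compared at proportional times. *)
Lemma arc_uniform Z P T : cont3 P 0 -> continuous T 0 -> forall eta, 0 < eta ->
  exists dl, 0 < dl /\ forall u e, 0 <= u <= 1 -> Rabs e < dl ->
    norm (minus (flow Z e (u * T e) (P e)) (flow Z 0 (u * T 0) (P 0))) < eta.
Proof.
  intros CP CT eta He. apply uniform_on_compact. intros u Hu.
  assert (Ce : continuous (fun q : R * R => snd q) ((u, 0) : R * R)) by apply continuous_snd.
  assert (Cu : continuous (fun q : R * R => fst q) ((u, 0) : R * R)) by apply continuous_fst.
  assert (C1 : cont3 (fun q : R * R => flow Z (snd q) (fst q * T (snd q)) (P (snd q))) ((u, 0) : R * R)).
  { apply (cont_flow Z (u, 0) (fun q => fst q * T (snd q)) snd (fun q => P (snd q))); [|exact Ce| |reflexivity].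
    - apply (cont_mult fst (fun q => T (snd q))); [exact Cu|]. apply (cont_comp T snd); [exact Ce|exact CT].
    - destruct CP as [X [Y W]]. split; [|split].
      + apply (cont_comp (fun e => px (P e)) snd); [exact Ce|exact X].
      + apply (cont_comp (fun e => py (P e)) snd); [exact Ce|exact Y].
      + apply (cont_comp (fun e => pz (P e)) snd); [exact Ce|exact W]. }
  assert (C2 : cont3 (fun q : R * R => flow Z 0 (fst q * T 0) (P 0)) ((u, 0) : R * R)).
  { apply (cont_flow Z (u, 0) (fun q => fst q * T 0) (fun _ => 0) (fun _ => P 0)); [|apply cont_const| |reflexivity].
    - apply (cont_mult fst (fun q => T 0)); [exact Cu|apply cont_const].
    - split; [|split]; apply cont_const. }
  destruct C1 as [X1 [Y1 W1]]. destruct C2 as [X2 [Y2 W2]].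
  destruct (near_te _ u (cont_minus _ _ _ X1 X2) (eta / 3) ltac:(lra)) as [d1 [P1 Q1]].
  destruct (near_te _ u (cont_minus _ _ _ Y1 Y2) (eta / 3) ltac:(lra)) as [d2 [P2 Q2]].
  destruct (near_te _ u (cont_minus _ _ _ W1 W2) (eta / 3) ltac:(lra)) as [d3 [P3 Q3]].
  exists (Rmin d1 (Rmin d2 d3)). split; [repeat apply Rmin_pos; assumption|]. intros u' e _ H1 H2.
  pose proof (Rmin_l d1 (Rmin d2 d3)). pose proof (Rmin_r d1 (Rmin d2 d3)). pose proof (Rmin_l d2 d3). pose proof (Rmin_r d2 d3).
  specialize (Q1 u' e ltac:(lra) ltac:(lra)). specialize (Q2 u' e ltac:(lra) ltac:(lra)). specialize (Q3 u' e ltac:(lra) ltac:(lra)).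
  cbv beta in Q1, Q2, Q3. simpl fst in Q1, Q2, Q3. simpl snd in Q1, Q2, Q3.
  rewrite (Rminus_diag (px _)), Rminus_0_r in Q1. rewrite (Rminus_diag (py _)), Rminus_0_r in Q2. rewrite (Rminus_diag (pz _)), Rminus_0_r in Q3.
  eapply Rle_lt_trans; [apply norm_le_sum|]. rewrite px_minus, py_minus, pz_minus.
  apply Rlt_le_trans with (eta / 3 + eta / 3 + eta / 3); [|lra]. repeat apply Rplus_lt_compat; assumption.
Qed.

Lemma Gam_close : forall eta, 0 < eta -> exists dl, 0 < dl /\ forall e, Rabs e < dl -> in_tube eta (Gam e) (Gam 0) /\ in_tube eta (Gam 0) (Gam e).
Proof.
  intros eta He. destruct orbit_facts_exist as [d0 [P0 Q0]].
  destruct (arc_uniform Zp Ae tpe Ae_cont tpe_cont eta He) as [d1 [P1 Q1]].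
  destruct (arc_uniform Zm Be tme Be_cont tme_cont eta He) as [d2 [P2 Q2]].
  exists (Rmin d0 (Rmin d1 d2)). split; [repeat apply Rmin_pos; assumption|]. intros e Hep.
  pose proof (Rmin_l d0 (Rmin d1 d2)). pose proof (Rmin_r d0 (Rmin d1 d2)). pose proof (Rmin_l d1 d2). pose proof (Rmin_r d1 d2).
  pose proof (Q0 e ltac:(lra)) as F. pose proof (Q0 0 ltac:(rewrite Rabs_R0; exact P0)) as F0.
  assert (Hq : forall T t, 0 < T -> 0 <= t <= T -> 0 <= t / T <= 1 /\ t = t / T * T).
  { intros T t HT Ht. split; [|field; lra]. split; [apply Rmult_le_pos; [lra|left; apply Rinv_0_lt_compat; lra]|].
    apply Rmult_le_reg_r with T; [lra|]. unfold Rdiv. rewrite Rmult_assoc, Rinv_l by lra. lra. }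
  assert (Hq2 : forall T u, 0 < T -> 0 <= u <= 1 -> 0 <= u * T <= T) by (intros; nra).
  split; intros p [[t [Ht <-]]|[t [Ht <-]]].
  - destruct (Hq _ t (of_tp e F) Ht) as [U E]. exists (flow Zp 0 (t / tpe e * tpe 0) (Ae 0)). split.
    + left. exists (t / tpe e * tpe 0). split; [apply Hq2; [apply (of_tp 0 F0)|exact U]|reflexivity].
    + rewrite E at 1. apply Q1; [exact U|lra].
  - destruct (Hq _ t (of_tm e F) Ht) as [U E]. exists (flow Zm 0 (t / tme e * tme 0) (Be 0)). split.
    + right. exists (t / tme e * tme 0). split; [apply Hq2; [apply (of_tm 0 F0)|exact U]|reflexivity].
    + rewrite E at 1. apply Q2; [exact U|lra].
  - destruct (Hq _ t (of_tp 0 F0) Ht) as [U E]. exists (flow Zp e (t / tpe 0 * tpe e) (Ae e)). split.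
    + left. exists (t / tpe 0 * tpe e). split; [apply Hq2; [apply (of_tp e F)|exact U]|reflexivity].
    + rewrite norm_minus_sym. rewrite E at 2. apply Q1; [exact U|lra].
  - destruct (Hq _ t (of_tm 0 F0) Ht) as [U E]. exists (flow Zm e (t / tme 0 * tme e) (Be e)). split.
    + right. exists (t / tme 0 * tme e). split; [apply Hq2; [apply (of_tm e F)|exact U]|reflexivity].
    + rewrite norm_minus_sym. rewrite E at 2. apply Q2; [exact U|lra].
Qed.

Lemma Gam_0_plane p : Gam 0 p -> px p = 0.
Proof.
  intros [[t [_ <-]]|[t [_ <-]]].
  - rewrite <- (cH_at_0 Zp), (cH_flow Zp 0 (zgood_0 Zp)), cH_at_0, Ae_0, A0_px. ring.
  - rewrite <- (cH_at_0 Zm), (cH_flow Zm 0 (zgood_0 Zm)), cH_at_0, Be_0, B0_px. ring.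
Qed.
End Family.

(** * Orbits that stay near a closed orbit *)

Lemma abs_sup (E : R -> Prop) x0 M : E x0 -> (forall x, E x -> Rabs x <= M) ->
  exists s, 0 <= s /\ (forall x, E x -> Rabs x <= s) /\ forall b, (forall x, E x -> Rabs x <= b) -> s <= b.
Proof.
  intros H0 HM. destruct (completeness (fun y => exists x, E x /\ y = Rabs x)) as [s [Hu Hl]].
  - exists M. intros y [x [Hx ->]]. apply HM, Hx.
  - exists (Rabs x0), x0. split; [exact H0|reflexivity].
  - assert (A : forall x, E x -> Rabs x <= s) by (intros x Hx; apply Hu; exists x; split; [exact Hx|reflexivity]).
    exists s. split; [pose proof (A x0 H0); pose proof (Rabs_pos x0); lra|]. split; [exact A|].
    intros b Hb. apply Hl. intros y [x [Hx ->]]. apply Hb, Hx.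
Qed.

(** One step of a map that expands z by Lam and multiplies S by 1 + m, up to errors; those of the second line are
    relative to m, which may be arbitrarily small compared with k. *)
Definition saddle_step Lam m k K h z S z' S' :=
  Rabs (z' - Lam * z) <= k * (Rabs z + Rabs S) /\ Rabs (S' - (1 + m) * S) <= Rabs m * (K * Rabs z + h * Rabs S).

(** Take suprema Zb and Sb. Expansion of z and the invariance under successors give Zb <= k' Sb. If m > 0 then S
    expands, and successors give Sb = 0; if m < 0 then S contracts, and predecessors give Sb = 0. *)
Lemma saddle_trivial (X : R -> R -> Prop) Lam m k K h M : 0 < k -> k < Lam - 1 -> 0 <= K -> 0 <= h ->
  K * (k / (Lam - 1 - k)) + h < 1 -> m <> 0 -> Rabs m < 1 ->
  (forall z S, X z S -> Rabs z <= M /\ Rabs S <= M) ->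
  (forall z S, X z S -> exists z' S', X z' S' /\ saddle_step Lam m k K h z S z' S') ->
  (forall z' S', X z' S' -> exists z S, X z S /\ saddle_step Lam m k K h z S z' S') ->
  forall z S, X z S -> z = 0 /\ S = 0.
Proof.
  intros Hk HL HK Hh HC Hm Hm1 HM Hs Hp z0 S0 H0.
  destruct (abs_sup (fun z => exists S, X z S) z0 M) as [Zb [Z0 [Z1 Z2]]].
  { exists S0. exact H0. } { intros z [S HX]. apply (HM z S HX). }
  destruct (abs_sup (fun S => exists z, X z S) S0 M) as [Sb [T0 [T1 T2]]].
  { exists z0. exact H0. } { intros S [z HX]. apply (HM z S HX). }
  assert (HmA : 0 < Rabs m) by (apply Rabs_pos_lt; exact Hm).
  assert (BZ : Zb <= k / (Lam - 1 - k) * Sb).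
  { assert (A : Zb <= (Zb + k * (Zb + Sb)) / Lam).
    { apply Z2. intros z [S HX]. destruct (Hs z S HX) as [z' [S' [HX' [E1 _]]]].
      pose proof (Z1 z (ex_intro _ S HX)). pose proof (Z1 z' (ex_intro _ S' HX')). pose proof (T1 S (ex_intro _ z HX)).
      pose proof (Rabs_triang_inv (Lam * z) z') as E2. rewrite Rabs_minus_sym in E1.
      rewrite Rabs_mult, (Rabs_right Lam) in E2 by lra.
      apply Rmult_le_reg_l with Lam; [lra|]. replace (Lam * ((Zb + k * (Zb + Sb)) / Lam)) with (Zb + k * (Zb + Sb)) by (field; lra).
      assert (k * (Rabs z + Rabs S) <= k * (Zb + Sb)) by (apply Rmult_le_compat_l; lra). lra. }
    assert (Lam * Zb <= Zb + k * (Zb + Sb)).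
    { apply Rmult_le_compat_l with (r := Lam) in A; [|lra]. replace (Lam * ((Zb + k * (Zb + Sb)) / Lam)) with (Zb + k * (Zb + Sb)) in A by (field; lra). exact A. }
    apply Rmult_le_reg_l with (Lam - 1 - k); [lra|]. replace ((Lam - 1 - k) * (k / (Lam - 1 - k) * Sb)) with (k * Sb) by (field; lra). lra. }
  assert (BB : forall z S, X z S -> K * Rabs z + h * Rabs S <= (K * (k / (Lam - 1 - k)) + h) * Sb).
  { intros z S HX. pose proof (Z1 z (ex_intro _ S HX)). pose proof (T1 S (ex_intro _ z HX)).
    assert (K * Rabs z <= K * (k / (Lam - 1 - k) * Sb)) by (apply Rmult_le_compat_l; lra).
    assert (h * Rabs S <= h * Sb) by (apply Rmult_le_compat_l; lra). lra. }
  set (q := K * (k / (Lam - 1 - k)) + h) in *.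
  assert (BS : Sb <= 0).
  { destruct (Rle_lt_dec 0 m) as [P|P].
    - assert (A : Sb <= (Sb + m * (q * Sb)) / (1 + m)).
      { apply T2. intros S [z HX]. destruct (Hs z S HX) as [z' [S' [HX' [_ E1]]]]. pose proof (T1 S' (ex_intro _ z' HX')).
        pose proof (BB z S HX). pose proof (Rabs_triang_inv ((1 + m) * S) S') as E2. rewrite Rabs_minus_sym in E1.
        rewrite Rabs_mult, (Rabs_right (1 + m)) in E2 by lra. rewrite (Rabs_right m) in E1 by lra.
        assert (m * (K * Rabs z + h * Rabs S) <= m * (q * Sb)) by (apply Rmult_le_compat_l; lra).
        apply Rmult_le_reg_l with (1 + m); [lra|]. replace ((1 + m) * ((Sb + m * (q * Sb)) / (1 + m))) with (Sb + m * (q * Sb)) by (field; lra). lra. }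
      apply Rmult_le_compat_l with (r := 1 + m) in A; [|lra]. replace ((1 + m) * ((Sb + m * (q * Sb)) / (1 + m))) with (Sb + m * (q * Sb)) in A by (field; lra).
      assert (m * ((1 - q) * Sb) <= 0) by lra. assert (0 < m) by lra.
      apply Rnot_lt_le. intros Y. assert (0 < m * ((1 - q) * Sb)) by (repeat apply Rmult_lt_0_compat; lra). lra.
    - rewrite (Rabs_left m) in * by exact P.
      assert (A : Sb <= (1 + m) * Sb + - m * (q * Sb)).
      { apply T2. intros S' [z' HX']. destruct (Hp z' S' HX') as [z [S [HX [_ E1]]]]. pose proof (T1 S (ex_intro _ z HX)).
        pose proof (BB z S HX). pose proof (Rabs_triang_inv S' ((1 + m) * S)) as E2.
        rewrite Rabs_mult, (Rabs_right (1 + m)) in E2 by lra. 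
        assert (- m * (K * Rabs z + h * Rabs S) <= - m * (q * Sb)) by (apply Rmult_le_compat_l; lra).
        assert ((1 + m) * Rabs S <= (1 + m) * Sb) by (apply Rmult_le_compat_l; lra). rewrite (Rabs_left m) in E1 by exact P. lra. }
      assert (- m * ((1 - q) * Sb) <= 0) by lra.
      apply Rnot_lt_le. intros Y. assert (0 < - m * ((1 - q) * Sb)) by (repeat apply Rmult_lt_0_compat; lra). lra. }
  assert (Sb = 0) by lra. assert (Zb = 0) by (assert (Zb <= 0) by (rewrite H, Rmult_0_r in BZ; exact BZ); lra).
  pose proof (Z1 z0 (ex_intro _ S0 H0)). pose proof (T1 S0 (ex_intro _ z0 H0)).
  assert (Y : forall x, Rabs x <= 0 -> x = 0) by (intros x Hx; destruct (Req_dec x 0) as [|N]; [assumption|exfalso; pose proof (Rabs_pos_lt x N); lra]).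
  split; apply Y; lra.
Qed.

(** Near an interior point of the arc sw is nonzero, and the arc is compact. *)
Lemma arc_ends c d (f : R -> R3) T sg : (forall t, curve_cont f t) ->
  (forall t, 0 < t < T -> 0 < sg * quadric c d (f t)) ->
  forall eta, 0 < eta -> exists r, 0 < r /\ forall t p, 0 <= t <= T -> norm (minus p (f t)) < r -> quadric c d p = 0 ->
    norm (minus p (f 0)) < eta \/ norm (minus p (f T)) < eta.
Proof.
  intros HC HS eta He.
  destruct (uniform_on_compact (fun t r => forall p : R3, norm (minus p (f t)) <= Rabs r -> quadric c d p = 0 ->
    norm (minus p (f 0)) < eta \/ norm (minus p (f T)) < eta) 0 T) as [dl [P Q]].
  - assert (End : forall t, t = 0 \/ t = T -> exists dl, 0 < dl /\ forall t' e, 0 <= t' <= T -> Rabs (t' - t) < dl -> Rabs e < dl ->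
      forall p : R3, norm (minus p (f t')) <= Rabs e -> quadric c d p = 0 -> norm (minus p (f t)) < eta).
    { intros t _. destruct (HC t (eta / 2) ltac:(lra)) as [dl [Pd Hdl]].
      exists (Rmin dl (eta / 2)). split; [apply Rmin_pos; [assumption|lra]|]. intros t' e _ H1 H2 p Hp _.
      pose proof (Rmin_l dl (eta / 2)). pose proof (Rmin_r dl (eta / 2)).
      pose proof (norm_minus_tri p (f t') (f t)). specialize (Hdl t' ltac:(lra)). lra. }
    intros t Ht. destruct (Req_dec t 0) as [E0|N0]; [|destruct (Req_dec t T) as [E1|N1]].
    + destruct (End t (or_introl E0)) as [dl [P Q]]. exists dl. split; [exact P|]. intros t' e A B C p Hp Hq. left. rewrite <- E0. exact (Q t' e A B C p Hp Hq).
    + destruct (End t (or_intror E1)) as [dl [P Q]]. exists dl. split; [exact P|]. intros t' e A B C p Hp Hq. right. rewrite <- E1. exact (Q t' e A B C p Hp Hq).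
    + destruct (near_pe_pos (fun q : R3 * R => sg * quadric c d (fst q)) (f t)) as [dl [P Q]].
      { apply (cont_mult (fun _ => sg)); [apply cont_const|]. apply (cont_quadric ((f t, 0) : R3 * R) fst). apply cont3_fst. }
      { simpl. apply HS. lra. }
      destruct (HC t (dl / 2) ltac:(lra)) as [d2 [Pd2 Hd2]].
      exists (Rmin d2 (dl / 2)). split; [apply Rmin_pos; [assumption|lra]|]. intros t' e _ H1 H2 p Hp Hq. exfalso.
      pose proof (Rmin_l d2 (dl / 2)). pose proof (Rmin_r d2 (dl / 2)).
      pose proof (norm_minus_tri p (f t') (f t)). specialize (Hd2 t' ltac:(lra)).
      specialize (Q p 0 ltac:(lra) ltac:(rewrite Rabs_R0; lra)). simpl in Q. rewrite Hq in Q. lra.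
  - exists (dl / 2). split; [lra|]. intros t p Ht Hp Hq. apply (Q t (dl / 2) Ht); [rewrite Rabs_right; lra|rewrite Rabs_right; lra|exact Hq].
Qed.

(** The step in S is e times the increment r, so its error is relative to e mu. *)
Lemma saddle_of_estimates eta ka Lam mu kz e z S a' r : mu <> 0 -> 0 <= eta ->
  Rabs (a' - ka * S - Lam * z) <= eta * (Rabs z + Rabs S) ->
  Rabs (r - (mu * S + kz * z)) <= eta * (Rabs z + Rabs S) ->
  saddle_step Lam (e * mu) (eta + Rabs ka * Rabs e * (Rabs mu + Rabs kz + eta)) ((Rabs kz + eta) / Rabs mu) (eta / Rabs mu)
    z S (a' - ka * (S + e * r)) (S + e * r).
Proof.
  intros Hmu He E1 E2. pose proof (Rabs_pos_lt mu Hmu) as Pm.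
  pose proof (Rabs_pos z). pose proof (Rabs_pos S). pose proof (Rabs_pos kz). pose proof (Rabs_pos e). pose proof (Rabs_pos ka).
  assert (E3 : Rabs (r - mu * S) <= Rabs kz * Rabs z + eta * (Rabs z + Rabs S)).
  { replace (r - mu * S) with (kz * z + (r - (mu * S + kz * z))) by ring. eapply Rle_trans; [apply Rabs_triang|]. rewrite Rabs_mult. lra. }
  split.
  - assert (E4 : Rabs r <= (Rabs mu + Rabs kz + eta) * (Rabs z + Rabs S)).
    { replace r with (mu * S + (r - mu * S)) by ring. eapply Rle_trans; [apply Rabs_triang|]. rewrite Rabs_mult. nra. }
    replace (a' - ka * (S + e * r) - Lam * z) with ((a' - ka * S - Lam * z) + - (ka * e * r)) by ring.
    eapply Rle_trans; [apply Rabs_triang|]. rewrite Rabs_Ropp, !Rabs_mult.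
    assert (Rabs ka * Rabs e * Rabs r <= Rabs ka * Rabs e * ((Rabs mu + Rabs kz + eta) * (Rabs z + Rabs S))).
    { apply Rmult_le_compat_l; [apply Rmult_le_pos; assumption|exact E4]. }
    lra.
  - replace (S + e * r - (1 + e * mu) * S) with (e * (r - mu * S)) by ring. rewrite !Rabs_mult.
    replace (Rabs e * Rabs mu * ((Rabs kz + eta) / Rabs mu * Rabs z + eta / Rabs mu * Rabs S)) with
      (Rabs e * (Rabs kz * Rabs z + eta * (Rabs z + Rabs S))) by (field; lra).
    apply Rmult_le_compat_l; assumption.
Qed.

(** Some rotation moves a vector to the positive V-axis; the bound on the angle allows to shift it into positive or
    negative times. *)
Lemma rotation_to_axis U V : exists th, - (2 * PI) < th < 2 * PI /\ U * cos th - V * sin th = 0 /\ 0 <= U * sin th + V * cos th.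
Proof.
  pose proof PI_RGT_0 as HPI. pose proof (atan_bound (U / V)).
  assert (K : V <> 0 -> exists k, 0 < k /\ U * cos (atan (U / V)) - V * sin (atan (U / V)) = 0 /\
    k * (U * sin (atan (U / V)) + V * cos (atan (U / V))) = V).
  { intros N. assert (E : U = V * tan (atan (U / V))) by (rewrite tan_atan; field; exact N).
    set (a := atan (U / V)) in *. assert (Hc : 0 < cos a) by (apply cos_gt_0; lra). unfold tan in E.
    exists (cos a). split; [exact Hc|]. assert (SC := sin2_cos2 a). unfold Rsqr in SC.
    split; rewrite E; [field; lra|]. transitivity (V * (sin a * sin a + cos a * cos a)); [field; lra|rewrite SC; ring]. }
  destruct (Rtotal_order V 0) as [HV|[HV|HV]].
  - destruct K as [k [Hk [E1 E2]]]; [lra|]. exists (atan (U / V) + PI). rewrite neg_cos, neg_sin. split; [lra|]. split; [lra|nra].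
  - subst V. destruct (Rle_lt_dec 0 U).
    + exists (PI / 2). rewrite cos_PI2, sin_PI2. lra.
    + exists (- (PI / 2)). rewrite cos_neg, sin_neg, cos_PI2, sin_PI2. lra.
  - destruct K as [k [Hk [E1 E2]]]; [lra|]. exists (atan (U / V)). split; [lra|]. split; [lra|nra].
Qed.

(** As long as it does not meet the manifold the orbit follows the flow of its zone, which takes it to the other side
    in finite time, forwards and backwards. *)
Lemma zone_exit c d (Z : zone) e (sg : R) phi t0 : zgood Z e ->
  (forall t, curve_cont phi t) ->
  (forall t, 0 < sg * quadric c d (phi t) -> is_derive phi t (field Z e (phi t))) ->
  (exists h, 0 < h /\ forall t, flow Z e h (phi t0) = phi t -> sg * quadric c d (phi t) <= 0) ->
  (exists h, h < 0 /\ forall t, flow Z e h (phi t0) = phi t -> sg * quadric c d (phi t) <= 0) ->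
  0 < sg * quadric c d (phi t0) ->
  exists t2 t1, t2 < t0 < t1 /\ quadric c d (phi t2) = 0 /\ quadric c d (phi t1) = 0 /\ forall t, t2 < t < t1 -> 0 < sg * quadric c d (phi t).
Proof.
  intros G HC HD [h [Hh Th]] [h' [Hh' Th']] H0.
  assert (Cq : forall t, continuous (fun s => sg * quadric c d (phi s)) t).
  { intros t. apply (cont_mult (fun _ => sg)); [apply cont_const|]. apply (cont_quadric t phi).
    split; [|split]; [apply curve_cont_px|apply curve_cont_py|apply curve_cont_pz]; apply HC. }
  assert (S0 : sg <> 0) by (intros ->; lra).
  assert (F1 : exists t1, t0 < t1 /\ quadric c d (phi t1) = 0 /\ forall t, t0 <= t < t1 -> 0 < sg * quadric c d (phi t)).
  { assert (X : exists t', t0 < t' /\ sg * quadric c d (phi t') <= 0).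
    { destruct (excluded_middle_informative (exists t', t0 < t' /\ sg * quadric c d (phi t') <= 0)) as [|N]; [assumption|exfalso].
      assert (P : forall t, t0 < t -> 0 < sg * quadric c d (phi t)).
      { intros t Ht. apply Rnot_le_lt. intros X. apply N. exists t. split; assumption. }
      destruct (zone_unique_le Z e G phi t0 (t0 + h) ltac:(lra) HC) as [E _].
      { intros t Ht. apply HD, P. lra. }
      replace (t0 + h - t0) with h in E by ring. symmetry in E. apply Th in E. specialize (P (t0 + h) ltac:(lra)). lra. }
    destruct X as [t' [Ht' Hq]].
    destruct (first_zero (fun s => sg * quadric c d (phi s)) t0 t' (fun t _ => Cq t) H0 Ht' Hq) as [t1 [A [B C]]].
    exists t1. split; [lra|]. split; [|exact C]. apply Rmult_integral in B. destruct B; [contradiction|assumption]. }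
  assert (F2 : exists t1, t1 < t0 /\ quadric c d (phi t1) = 0 /\ forall t, t1 < t <= t0 -> 0 < sg * quadric c d (phi t)).
  { assert (X : exists t', t' < t0 /\ sg * quadric c d (phi t') <= 0).
    { destruct (excluded_middle_informative (exists t', t' < t0 /\ sg * quadric c d (phi t') <= 0)) as [|N]; [assumption|exfalso].
      assert (P : forall t, t < t0 -> 0 < sg * quadric c d (phi t)).
      { intros t Ht. apply Rnot_le_lt. intros X. apply N. exists t. split; assumption. }
      destruct (zone_unique_le Z e G phi (t0 + h') t0 ltac:(lra) HC) as [_ E].
      { intros t Ht. apply HD, P. lra. }
      replace (t0 + h' - t0) with h' in E by ring. symmetry in E. apply Th' in E. specialize (P (t0 + h') ltac:(lra)). lra. }
    destruct X as [t' [Ht' Hq]].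
    destruct (last_zero (fun s => sg * quadric c d (phi s)) t0 t' (fun t _ => Cq t) H0 Ht' Hq) as [t1 [A [B C]]].
    exists t1. split; [lra|]. split; [|exact C]. apply Rmult_integral in B. destruct B; [contradiction|assumption]. }
  destruct F1 as [t1 [A1 [B1 C1]]]. destruct F2 as [t2 [A2 [B2 C2]]].
  exists t2, t1. split; [lra|]. split; [exact B2|]. split; [exact B1|]. intros t Ht.
  destruct (Rle_lt_dec t t0); [apply C2|apply C1]; lra.
Qed.

(** Naming the sides by booleans treats entry and exit of both zones at once: a crossing of type b leads into side b.
    *)
Definition side (b : bool) (x : R) : Prop := if b then 0 < x else x < 0.
Lemma side_excl b x : side b x -> side (negb b) x -> False.
Proof. destruct b; simpl; lra. Qed.
Lemma side_0 b : ~ side b 0.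
Proof. destruct b; simpl; lra. Qed.

Section Tube.
Variables (c d : R) (Zp Zm : zone) (s0 rho : R).
Hypothesis LFr : local_facts c d Zp Zm s0 rho.
Variable e : R.
Hypothesis He : Rabs e < rho.
Variable phi : R -> R3.
Hypothesis Hsol : solution (zsys c d Zp Zm e) phi.
Hypothesis Hpx : forall t, Rabs (px (phi t)) < rho.
Definition crosses (b : bool) t := quadric c d (phi t) = 0 /\ norm (minus (phi t) (if b then A0 c d s0 else B0 c d s0)) < rho.
Hypothesis Hsig : forall t, quadric c d (phi t) = 0 -> exists b, crosses b t.
Notation isA := (crosses true).
Notation isB := (crosses false).

Let Gp : zgood Zp e. Proof. apply (lf_good _ _ _ _ _ _ LFr e He). Qed.
Let Gm : zgood Zm e. Proof. apply (lf_good _ _ _ _ _ _ LFr e He). Qed.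
Let HC := solution_cont _ _ Hsol.

Lemma crosses_local b t : crosses b t -> exists dl, 0 < dl /\ forall h, 0 < h < dl ->
  side b (quadric c d (phi (t + h))) /\ side (negb b) (quadric c d (phi (t - h))).
Proof.
  intros [H1 H2]. destruct b.
  - destruct (lf_A _ _ _ _ _ _ LFr _ e H2 He) as [_ [_ [_ [X1 X2]]]].
    destruct (crossing_local c d (field Zp e) (field Zm e) phi t 1 (or_introl eq_refl) Hsol H1) as [dl [P Q]]; [lra|lra|].
    exists dl. split; [exact P|]. intros h Hh. destruct (Q h Hh). simpl. lra.
  - destruct (lf_B _ _ _ _ _ _ LFr _ e H2 He) as [_ [_ [_ [X1 X2]]]].
    destruct (crossing_local c d (field Zp e) (field Zm e) phi t (-1) (or_intror eq_refl) Hsol H1) as [dl [P Q]]; [lra|lra|].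
    exists dl. split; [exact P|]. intros h Hh. destruct (Q h Hh). simpl. lra.
Qed.

(** A crossing of the other type would have the wrong sign next to the piece. *)
Lemma piece_ends b t t1 : t < t1 -> (forall u, t < u < t1 -> side b (quadric c d (phi u))) ->
  (quadric c d (phi t) = 0 -> crosses b t) /\ (quadric c d (phi t1) = 0 -> crosses (negb b) t1).
Proof.
  intros Ht HP. assert (Neq : forall b', b' = b \/ b' = negb b) by (intros []; destruct b; auto).
  assert (Small : forall dl, 0 < dl -> exists h, 0 < h < dl /\ t < t + h < t1 /\ t < t1 - h < t1).
  { intros dl P. exists (Rmin dl (t1 - t) / 2). pose proof (Rmin_pos dl (t1 - t) P ltac:(lra)). pose proof (Rmin_l dl (t1 - t)). pose proof (Rmin_r dl (t1 - t)). lra. }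
  split; intros H0.
  - destruct (Hsig t H0) as [b' HB]. destruct (Neq b') as [-> | ->]; [exact HB|exfalso].
    destruct (crosses_local _ t HB) as [dl [P Q]]. destruct (Small dl P) as [h [H1 [H2 _]]].
    exact (side_excl b _ (HP _ H2) (proj1 (Q h H1))).
  - destruct (Hsig t1 H0) as [b' HB]. destruct (Neq b') as [-> | ->]; [exfalso|exact HB].
    destruct (crosses_local _ t1 HB) as [dl [P Q]]. destruct (Small dl P) as [h [H1 [_ H2]]].
    exact (side_excl b _ (HP _ H2) (proj2 (Q h H1))).
Qed.

(** An orbit with sw > 0 has V > 0, which a rotation by PI reverses; an orbit with sw < 0 is rotated to the place
    straight above the centre of its zone. In both cases sw has changed sign. *)
Lemma piece b t0 : side b (quadric c d (phi t0)) -> exists t2 t1, t2 < t0 < t1 /\ crosses b t2 /\ crosses (negb b) t1 /\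
  forall t, t2 < t < t1 -> side b (quadric c d (phi t)).
Proof.
  intros H0. pose proof PI_RGT_0 as HPI.
  assert (X : exists t2 t1, t2 < t0 < t1 /\ quadric c d (phi t2) = 0 /\ quadric c d (phi t1) = 0 /\
    forall t, t2 < t < t1 -> side b (quadric c d (phi t))).
  { destruct b.
    - pose proof (om_pos Zp e Gp) as Ho. simpl in H0.
      assert (HV : 0 < cV Zp e (phi t0)).
      { apply Rnot_le_lt. intros X. pose proof (lf_low _ _ _ _ _ _ LFr _ e (Hpx t0) He X). lra. }
      assert (Q : forall h t, cos (om Zp e * h) = -1 -> sin (om Zp e * h) = 0 -> flow Zp e h (phi t0) = phi t -> 1 * quadric c d (phi t) <= 0).
      { intros h t Hc Hs E. rewrite Rmult_1_l. left. apply (lf_low _ _ _ _ _ _ LFr _ e (Hpx t) He). rewrite <- E.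
        rewrite (cV_flow Zp e Gp), Hc, Hs. pose proof (exp_pos (e * zl Zp * h)). nra. }
      assert (0 < PI / om Zp e) by (apply Rdiv_lt_0_compat; assumption).
      destruct (zone_exit c d Zp e 1 phi t0 Gp HC) as [t2 [t1 [A [B [C D]]]]].
      + intros t Ht. apply (proj1 (Hsol t)). simpl. lra.
      + exists (PI / om Zp e). split; [assumption|]. intros t. apply Q; replace (om Zp e * (PI / om Zp e)) with PI by (field; lra); [apply cos_PI|apply sin_PI].
      + exists (- (PI / om Zp e)). split; [lra|].
        intros t. apply Q; replace (om Zp e * - (PI / om Zp e)) with (- PI) by (field; lra); [rewrite cos_neg; apply cos_PI|rewrite sin_neg, sin_PI; lra].
      + lra.
      + exists t2, t1. split; [exact A|]. split; [exact B|]. split; [exact C|]. intros t Ht. specialize (D t Ht). simpl. lra.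
    - pose proof (om_pos Zm e Gm) as Ho. simpl in H0.
      destruct (rotation_to_axis (cU Zm e (phi t0)) (cV Zm e (phi t0))) as [th [Hth [TU TV]]].
      assert (Q : forall h t, cos (om Zm e * h) = cos th -> sin (om Zm e * h) = sin th -> flow Zm e h (phi t0) = phi t -> -1 * quadric c d (phi t) <= 0).
      { intros h t Hc Hs E. assert (0 < quadric c d (phi t)); [|lra]. apply (lf_high _ _ _ _ _ _ LFr _ e (Hpx t) He); rewrite <- E.
        - rewrite (cU_flow Zm e Gm), Hc, Hs, TU. ring.
        - rewrite (cV_flow Zm e Gm), Hc, Hs. pose proof (exp_pos (e * zl Zm * h)). apply Rmult_le_pos; lra. }
      assert (0 < / om Zm e) by (apply Rinv_0_lt_compat; exact Ho).
      destruct (zone_exit c d Zm e (-1) phi t0 Gm HC) as [t2 [t1 [A [B [C D]]]]].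
      + intros t Ht. apply (proj1 (proj2 (Hsol t))). simpl. lra.
      + exists ((th + 2 * PI) / om Zm e). split; [apply Rdiv_lt_0_compat; lra|]. intros t. pose proof (sin_shift_Z th 1) as [S1 S2].
        apply Q; replace (om Zm e * ((th + 2 * PI) / om Zm e)) with (th + 2 * PI * 1) by (field; lra); assumption.
      + exists ((th - 2 * PI) / om Zm e). split; [unfold Rdiv; nra|].
        intros t. pose proof (sin_shift_Z th (-1)) as [S1 S2].
        apply Q; replace (om Zm e * ((th - 2 * PI) / om Zm e)) with (th + 2 * PI * -1) by (field; lra); assumption.
      + lra.
      + exists t2, t1. split; [exact A|]. split; [exact B|]. split; [exact C|]. intros t Ht. specialize (D t Ht). simpl. lra. }
  destruct X as [t2 [t1 [A [B [C D]]]]]. destruct (piece_ends b t2 t1 ltac:(lra) D) as [E1 E2].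
  exists t2, t1. split; [exact A|]. split; [exact (E1 B)|]. split; [exact (E2 C)|exact D].
Qed.

Lemma next_crossing b t0 : crosses b t0 -> exists t1, t0 < t1 /\ crosses (negb b) t1 /\ forall t, t0 < t < t1 -> side b (quadric c d (phi t)).
Proof.
  intros HA. destruct (crosses_local b t0 HA) as [dl [P Q]].
  destruct (piece b (t0 + dl / 2)) as [t2 [t1 [A [B [C D]]]]]; [apply (Q (dl / 2)); lra|].
  assert (t2 = t0).
  { destruct (Rtotal_order t2 t0) as [X|[X|X]]; [|exact X|]; exfalso; apply (side_0 b).
    - rewrite <- (proj1 HA). apply D. lra.
    - rewrite <- (proj1 B). replace t2 with (t0 + (t2 - t0)) by ring. apply Q. lra. }
  subst t2. exists t1. split; [lra|]. split; [exact C|exact D].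
Qed.
Lemma prev_crossing b t0 : crosses (negb b) t0 -> exists t1, t1 < t0 /\ crosses b t1 /\ forall t, t1 < t < t0 -> side b (quadric c d (phi t)).
Proof.
  intros HA. destruct (crosses_local (negb b) t0 HA) as [dl [P Q]].
  rewrite Bool.negb_involutive in Q.
  destruct (piece b (t0 - dl / 2)) as [t2 [t1 [A [B [C D]]]]]; [apply (Q (dl / 2)); lra|].
  assert (t1 = t0).
  { destruct (Rtotal_order t1 t0) as [X|[X|X]]; [|exact X|]; exfalso; apply (side_0 b).
    - rewrite <- (proj1 C). replace t1 with (t0 - (t0 - t1)) by ring. apply Q. lra.
    - rewrite <- (proj1 HA). apply D. lra. }
  subst t1. exists t2. split; [lra|]. split; [exact B|exact D].
Qed.

(** The transit has no extra turn, as otherwise the orbit would have passed through V < 0 on its way. *)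
Lemma upper_arc t0 t1 : t0 < t1 -> isA t0 -> isB t1 -> (forall t, t0 < t < t1 -> 0 < quadric c d (phi t)) ->
  (forall t, t0 <= t <= t1 -> phi t = flow Zp e (t - t0) (phi t0)) /\ t1 - t0 = tT Zp e 0 (phi t0) (phi t1).
Proof.
  intros Ht HA HB HP. pose proof (om_pos Zp e Gp) as Ho. pose proof PI_RGT_0 as HPI.
  assert (F : forall t, t0 <= t <= t1 -> phi t = flow Zp e (t - t0) (phi t0)).
  { intros t Htt. apply (zone_unique_le Zp e Gp phi t0 t ltac:(lra) HC). intros u Hu. apply (proj1 (Hsol u)), HP. lra. }
  split; [exact F|].
  destruct (lf_A _ _ _ _ _ _ LFr _ e (proj2 HA) He) as [V1 _]. destruct (lf_B _ _ _ _ _ _ LFr _ e (proj2 HB) He) as [V2 _].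
  pose proof (F t1 ltac:(lra)) as F1. rewrite F1. apply transit_time_upper; [exact Gp|lra|exact V1|rewrite <- F1; exact V2|].
  apply Rnot_le_lt. intros X. set (a := ang Zp e (phi t0)) in *. pose proof (ang_bound Zp e (phi t0)) as Hb. fold a in Hb.
  set (tau := (a + PI) / om Zp e).
  assert (Et : om Zp e * tau = a + PI) by (unfold tau; field; lra).
  assert (0 < tau) by (unfold tau; apply Rdiv_lt_0_compat; lra).
  assert (tau <= t1 - t0) by nra.
  destruct (flow_polar Zp e Gp tau (phi t0) V1) as [_ FV]. fold a in FV. rewrite Et in FV.
  replace (a - (a + PI)) with (- PI) in FV by ring. rewrite cos_neg, cos_PI in FV.
  replace tau with (t0 + tau - t0) in FV at 1 by ring. rewrite <- F in FV by lra.
  assert (cV Zp e (phi (t0 + tau)) <= 0).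
  { rewrite FV. pose proof (exp_pos (e * zl Zp * tau)). pose proof (sqrt_pos (qn Zp e (phi t0))).
    assert (0 <= exp (e * zl Zp * tau) * sqrt (qn Zp e (phi t0))) by (apply Rmult_le_pos; lra). lra. }
  destruct (Req_dec (t0 + tau) t1) as [E|N]; [rewrite E in H1; lra|].
  pose proof (lf_low _ _ _ _ _ _ LFr _ e (Hpx (t0 + tau)) He H1). specialize (HP (t0 + tau) ltac:(lra)). lra.
Qed.

(** The transit has exactly one turn, as otherwise the orbit would have passed straight above the centre of its zone
    on its way. *)
Lemma lower_arc t0 t1 : t0 < t1 -> isB t0 -> isA t1 -> (forall t, t0 < t < t1 -> quadric c d (phi t) < 0) ->
  (forall t, t0 <= t <= t1 -> phi t = flow Zm e (t - t0) (phi t0)) /\ t1 - t0 = tT Zm e 1 (phi t0) (phi t1).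
Proof.
  intros Ht HB HA HP. pose proof (om_pos Zm e Gm) as Ho. pose proof PI_RGT_0 as HPI.
  assert (F : forall t, t0 <= t <= t1 -> phi t = flow Zm e (t - t0) (phi t0)).
  { intros t Htt. apply (zone_unique_le Zm e Gm phi t0 t ltac:(lra) HC). intros u Hu. apply (proj1 (proj2 (Hsol u))), HP. lra. }
  split; [exact F|].
  destruct (lf_A _ _ _ _ _ _ LFr _ e (proj2 HA) He) as [_ [V2 [U2 _]]]. destruct (lf_B _ _ _ _ _ _ LFr _ e (proj2 HB) He) as [_ [V1 [U1 _]]].
  pose proof (F t1 ltac:(lra)) as F1. rewrite F1.
  apply transit_time_lower; [exact Gm|lra|exact V1|rewrite <- F1; exact V2|exact U1|rewrite <- F1; exact U2|].
  apply Rnot_le_lt. intros X. set (a := ang Zm e (phi t0)) in *. pose proof (ang_bound Zm e (phi t0)) as Hb. fold a in Hb.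
  set (tau := (a + 2 * PI) / om Zm e).
  assert (Et : om Zm e * tau = a + 2 * PI) by (unfold tau; field; lra).
  assert (0 < tau) by (unfold tau; apply Rdiv_lt_0_compat; lra).
  assert (tau <= t1 - t0) by nra.
  destruct (flow_polar Zm e Gm tau (phi t0) V1) as [FU FV]. fold a in FU, FV. rewrite Et in FU, FV.
  replace (a - (a + 2 * PI)) with (- (2 * PI)) in FU, FV by ring. rewrite cos_neg, cos_2PI in FV. rewrite sin_neg, sin_2PI in FU.
  replace tau with (t0 + tau - t0) in FU, FV at 1 by ring. rewrite <- F in FU, FV by lra.
  assert (cU Zm e (phi (t0 + tau)) = 0) by (rewrite FU; ring).
  destruct (Req_dec (t0 + tau) t1) as [E|N]; [rewrite E in H1; lra|].
  assert (0 < quadric c d (phi (t0 + tau))).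
  { apply (lf_high _ _ _ _ _ _ LFr _ e (Hpx (t0 + tau)) He H1). rewrite FV, Rmult_1_r.
    apply Rmult_le_pos; [left; apply exp_pos|apply sqrt_pos]. }
  specialize (HP (t0 + tau) ltac:(lra)). lra.
Qed.

(** Rescaled data of three consecutive crossings. *)
Definition wof t0 t1 t2 : V6 := mk6 (px (phi t0) / e) (px (phi t1) / e) (tY (phi t0)) ((tY (phi t1) + tY (phi t0)) / e)
  (px (phi t2) / e) ((tY (phi t2) - tY (phi t0)) / e).

Lemma wof_points t0 t1 t2 : e <> 0 -> isA t0 -> isB t1 -> isA t2 ->
  ptA c d (wof t0 t1 t2) e = phi t0 /\ ptB c d (wof t0 t1 t2) e = phi t1 /\ ptA' c d (wof t0 t1 t2) e = phi t2.
Proof.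
  intros N [H0 _] [H1 _] [H2 _]. unfold ptA, ptB, ptA', wof; simpl.
  split; [|split].
  - rewrite (quadric_spt c d _ H0) at 3. f_equal. field. exact N.
  - rewrite (quadric_spt c d _ H1) at 3. f_equal; field; exact N.
  - rewrite (quadric_spt c d _ H2) at 3. f_equal; field; exact N.
Qed.

Lemma wof_passage t0 t1 t2 : e <> 0 -> t0 < t1 < t2 -> isA t0 -> isB t1 -> isA t2 ->
  (forall t, t0 < t < t1 -> 0 < quadric c d (phi t)) -> (forall t, t1 < t < t2 -> quadric c d (phi t) < 0) ->
  passage c d Zp Zm (wof t0 t1 t2) e.
Proof.
  intros N Ht HA HB HA' HP HN. unfold passage. destruct (wof_points t0 t1 t2 N HA HB HA') as [-> [-> ->]].
  destruct (upper_arc t0 t1 ltac:(lra) HA HB HP) as [F1 T1]. destruct (lower_arc t1 t2 ltac:(lra) HB HA' HN) as [F2 T2].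
  pose proof (F1 t1 ltac:(lra)) as E1. pose proof (F2 t2 ltac:(lra)) as E2.
  destruct (lf_A _ _ _ _ _ _ LFr _ e (proj2 HA) He) as [V1 _]. destruct (lf_B _ _ _ _ _ _ LFr _ e (proj2 HB) He) as [V2 [V3 _]].
  destruct (lf_A _ _ _ _ _ _ LFr _ e (proj2 HA') He) as [_ [V4 _]].
  destruct (flow_transit Zp e Gp (t1 - t0) (phi t0) V1) as [_ [X1 X2]]; [rewrite <- E1; exact V2|]. rewrite <- E1 in X1, X2.
  destruct (flow_transit Zm e Gm (t2 - t1) (phi t1) V3) as [_ [Y1 Y2]]; [rewrite <- E2; exact V4|]. rewrite <- E2 in Y1, Y2.
  destruct (passage_defects Zp e (t1 - t0) 0 _ _ N T1 X1 X2) as [A1 A2].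
  destruct (passage_defects Zm e (t2 - t1) 1 _ _ N T2 Y1 Y2) as [B1 B2].
  split; [exact A1|]. split; [exact B1|]. split; [exact A2|exact B2].
Qed.
Variable vb : R -> V4.
Hypothesis Hne : e <> 0.
Hypothesis F : orbit_facts c d Zp Zm s0 vb rho e.
Notation v := (vb e).

Lemma A_or_B_exists : exists t, isA t.
Proof.
  destruct (Rtotal_order (quadric c d (phi 0)) 0) as [X|[X|X]].
  - destruct (piece false 0 X) as [t2 [t1 [_ [_ [A _]]]]]. exists t1. exact A.
  - destruct (Hsig 0 X) as [[|] B]; [exists 0; exact B|].
    destruct (next_crossing false 0 B) as [t1 [_ [A _]]]. exists t1. exact A.
  - destruct (piece true 0 X) as [t2 [t1 [_ [A _]]]]. exists t2. exact A.
Qed.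

(** The arcs of phi are those of the closed orbit, since they start at the same points and have the same transit
    times. *)
Lemma same_range : (forall t, isA t -> phi t = Ae c d vb e) -> (forall t, isB t -> phi t = Be c d vb e) ->
  forall p, (exists t, phi t = p) <-> Gam c d Zp Zm vb e p.
Proof.
  intros PA PB.
  assert (TU : forall t0 t1, t0 < t1 -> isA t0 -> isB t1 -> (forall t, t0 < t < t1 -> 0 < quadric c d (phi t)) ->
    t1 - t0 = tpe c d Zp vb e /\ forall t, t0 <= t <= t1 -> phi t = flow Zp e (t - t0) (Ae c d vb e)).
  { intros t0 t1 Ht HA HB HP. destruct (upper_arc t0 t1 Ht HA HB HP) as [X Y].
    rewrite (PA t0 HA) in X, Y. rewrite (PB t1 HB) in Y. split; assumption. }
  assert (TL : forall t0 t1, t0 < t1 -> isB t0 -> isA t1 -> (forall t, t0 < t < t1 -> quadric c d (phi t) < 0) ->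
    t1 - t0 = tme c d Zm vb e /\ forall t, t0 <= t <= t1 -> phi t = flow Zm e (t - t0) (Be c d vb e)).
  { intros t0 t1 Ht HA HB HP. destruct (lower_arc t0 t1 Ht HA HB HP) as [X Y].
    rewrite (PB t0 HA) in X, Y. rewrite (PA t1 HB) in Y. split; assumption. }
    intros p. split.
  - intros [t <-]. destruct (Rtotal_order (quadric c d (phi t)) 0) as [X|[X|X]].
    + destruct (piece false t X) as [t2 [t1 [Ht [B [A N]]]]].
      destruct (TL t2 t1 ltac:(lra) B A N) as [T1 T2]. right. exists (t - t2). split; [lra|]. symmetry. apply T2. lra.
    + destruct (Hsig t X) as [[|] B].
      * rewrite (PA t B). left. exists 0. split; [pose proof (of_tp _ _ _ _ _ _ _ _ F); lra|]. apply (flow_0 Zp e Gp).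
      * rewrite (PB t B). right. exists 0. split; [pose proof (of_tm _ _ _ _ _ _ _ _ F); lra|]. apply (flow_0 Zm e Gm).
    + destruct (piece true t X) as [t2 [t1 [Ht [A [B N]]]]].
      destruct (TU t2 t1 ltac:(lra) A B N) as [T1 T2]. left. exists (t - t2). split; [lra|]. symmetry. apply T2. lra.
  - destruct A_or_B_exists as [t0 A].
    destruct (next_crossing true t0 A) as [t1 [H1 [B P]]].
    destruct (next_crossing false t1 B) as [t2 [H2 [A' N]]].
    destruct (TU t0 t1 H1 A B P) as [T1 T2]. destruct (TL t1 t2 H2 B A' N) as [T3 T4].
    intros [[t [Ht <-]]|[t [Ht <-]]].
    + exists (t0 + t). rewrite T2 by lra. f_equal. ring.
    + exists (t1 + t). rewrite T4 by lra. f_equal. ring.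
Qed.

Variables (ka Lam mu kz C eta dl : R).
Hypotheses (HLam : 1 < Lam) (Hmu : mu <> 0) (Heta : 0 < eta) (Hem : Rabs (e * mu) < 1).
Let k := eta + Rabs ka * Rabs e * (Rabs mu + Rabs kz + eta).
Let K := (Rabs kz + eta) / Rabs mu.
Let h := eta / Rabs mu.
Hypotheses (Hk : k < Lam - 1) (HKh : K * (k / (Lam - 1 - k)) + h < 1).
Hypothesis Hnear : forall t0 t1 t2, isA t0 -> isB t1 -> isA t2 -> D6 (wof t0 t1 t2) (emb (vb 0)) < dl.
Hypothesis Hest : forall w, D6 w (emb (vb 0)) < dl -> passage c d Zp Zm w e ->
    let dS := rs w - qs v in let z := (ra w - qa v) - ka * dS in
    Rabs ((ra' w - qa v) - ka * dS - Lam * z) <= eta * (Rabs z + Rabs dS) /\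
    Rabs (rt w - (mu * dS + kz * z)) <= eta * (Rabs z + Rabs dS) /\
    Rabs (rb w - qb v) + Rabs (rg w - qg v) <= C * (Rabs z + Rabs dS).

Let sS t := tY (phi t) - qs v.
Let zS t := (px (phi t) / e - qa v) - ka * sS t.

Lemma cycle_estimates t0 t1 t2 : t0 < t1 < t2 -> isA t0 -> isB t1 -> isA t2 ->
  (forall t, t0 < t < t1 -> 0 < quadric c d (phi t)) -> (forall t, t1 < t < t2 -> quadric c d (phi t) < 0) ->
  saddle_step Lam (e * mu) k K h (zS t0) (sS t0) (zS t2) (sS t2) /\
  Rabs (px (phi t1) / e - qb v) + Rabs ((tY (phi t1) + tY (phi t0)) / e - qg v) <= C * (Rabs (zS t0) + Rabs (sS t0)).
Proof.
  intros Ht HA HB HA' HP HN.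
  destruct (Hest (wof t0 t1 t2) (Hnear t0 t1 t2 HA HB HA')
    (wof_passage t0 t1 t2 Hne Ht HA HB HA' HP HN)) as [E1 [E2 E3]].
  unfold wof in E1, E2, E3; simpl in E1, E2, E3. split; [|exact E3].
  pose proof (saddle_of_estimates eta ka Lam mu kz e (zS t0) (sS t0) _ _ Hmu (Rlt_le _ _ Heta) E1 E2) as Q. fold k K h in Q.
  replace (sS t0 + e * ((tY (phi t2) - tY (phi t0)) / e)) with (sS t2) in Q by (unfold sS; field; exact Hne). exact Q.
Qed.

(** The data (z, S) of all A-crossings of phi form a bounded set in which every element has a successor and a
    predecessor. By saddle_trivial it is the fixed point, and the estimates then fix the B-crossings too. *)
Lemma crossings_fixed : (forall t, isA t -> phi t = Ae c d vb e) /\ (forall t, isB t -> phi t = Be c d vb e).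
Proof.
  assert (Hk0 : 0 < k).
  { unfold k. pose proof (Rabs_pos ka). pose proof (Rabs_pos e). pose proof (Rabs_pos mu). pose proof (Rabs_pos kz).
    assert (0 <= Rabs ka * Rabs e * (Rabs mu + Rabs kz + eta)) by (repeat apply Rmult_le_pos; lra). lra. }
  pose proof (Rabs_pos_lt mu Hmu) as Pm.
  assert (T : forall z S, (exists t, isA t /\ z = zS t /\ S = sS t) -> z = 0 /\ S = 0).
  { apply (saddle_trivial _ Lam (e * mu) k K h
      (dl + Rabs (qa (vb 0) - qa v) + (1 + Rabs ka) * (dl + Rabs (qs (vb 0) - qs v)))).
    - exact Hk0.
    - exact Hk.
    - unfold K. apply Rmult_le_pos; [pose proof (Rabs_pos kz); lra|left; apply Rinv_0_lt_compat, Pm].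
    - unfold h. apply Rmult_le_pos; [lra|left; apply Rinv_0_lt_compat, Pm].
    - exact HKh.
    - apply Rmult_integral_contrapositive; split; assumption.
    - exact Hem.
    - intros z S [t0 [A [-> ->]]].
      destruct (next_crossing true t0 A) as [t1 [_ [B _]]].
      pose proof (Hnear t0 t1 t0 A B A) as D. unfold D6, wof, emb in D; simpl in D.
      set (x1 := px (phi t0) / e) in *. set (y1 := tY (phi t0)) in *.
      pose proof (Rabs_pos (x1 - qa (vb 0))). pose proof (Rabs_pos (y1 - qs (vb 0))).
      repeat match type of D with context [Rabs ?x] => lazymatch goal with H : 0 <= Rabs x |- _ => fail | _ => pose proof (Rabs_pos x) end end.
      pose proof (Rabs_triang (x1 - qa (vb 0)) (qa (vb 0) - qa v)) as T1. pose proof (Rabs_triang (y1 - qs (vb 0)) (qs (vb 0) - qs v)) as T2.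
      replace (x1 - qa (vb 0) + (qa (vb 0) - qa v)) with (x1 - qa v) in T1 by ring.
      replace (y1 - qs (vb 0) + (qs (vb 0) - qs v)) with (y1 - qs v) in T2 by ring.
      assert (BS : Rabs (sS t0) <= dl + Rabs (qs (vb 0) - qs v)) by (unfold sS; fold y1; lra).
      pose proof (Rabs_pos ka). pose proof (Rabs_pos (qa (vb 0) - qa v)). pose proof (Rabs_pos (sS t0)).
      assert (Rabs ka * Rabs (sS t0) <= Rabs ka * (dl + Rabs (qs (vb 0) - qs v))) by (apply Rmult_le_compat_l; assumption).
      assert (0 <= Rabs ka * Rabs (sS t0)) by (apply Rmult_le_pos; assumption).
      split; [|lra]. unfold zS. fold x1. unfold Rminus at 1. eapply Rle_trans; [apply Rabs_triang|]. rewrite Rabs_Ropp, Rabs_mult. lra.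
    - intros z S [t0 [A [-> ->]]].
      destruct (next_crossing true t0 A) as [t1 [H1 [B P]]].
      destruct (next_crossing false t1 B) as [t2 [H2 [A' N]]].
      exists (zS t2), (sS t2). split; [exists t2; split; [exact A'|split; reflexivity]|].
      apply (cycle_estimates t0 t1 t2 (conj H1 H2) A B A' P N).
    - intros z S [t2 [A' [-> ->]]].
      destruct (prev_crossing false t2 A') as [t1 [H2 [B N]]].
      destruct (prev_crossing true t1 B) as [t0 [H1 [A P]]].
      exists (zS t0), (sS t0). split; [exists t0; split; [exact A|split; reflexivity]|].
      apply (cycle_estimates t0 t1 t2 (conj H1 H2) A B A' P N). }
  assert (TA : forall t, isA t -> px (phi t) / e = qa v /\ tY (phi t) = qs v /\ zS t = 0 /\ sS t = 0).
  { intros t A. destruct (T (zS t) (sS t)) as [E1 E2]; [exists t; split; [exact A|split; reflexivity]|].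
    unfold zS in E1. rewrite E2, Rmult_0_r in E1. split; [lra|]. split; [unfold sS in E2; lra|]. split; [|exact E2].
    unfold zS. rewrite E2. lra. }
  split; intros t HA.
  - destruct (TA t HA) as [E1 [E2 _]]. destruct HA as [HA _]. rewrite (quadric_spt c d _ HA). unfold Ae. f_equal; [|exact E2].
    rewrite <- E1. field. exact Hne.
  - destruct (prev_crossing true t HA) as [t0 [H1 [A P]]].
    destruct (next_crossing false t HA) as [t2 [H2 [A' N]]].
    destruct (cycle_estimates t0 t t2 (conj H1 H2) A HA A' P N) as [_ E]. destruct (TA t0 A) as [_ [Y0 [Z0 S0]]].
    rewrite Z0, S0, Rabs_R0 in E. replace (C * (0 + 0)) with 0 in E by ring.
    pose proof (Rabs_pos (px (phi t) / e - qb v)). pose proof (Rabs_pos ((tY (phi t) + tY (phi t0)) / e - qg v)).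
    assert (Y : forall x, Rabs x <= 0 -> x = 0) by (intros x Hx; destruct (Req_dec x 0) as [|M]; [assumption|exfalso; pose proof (Rabs_pos_lt x M); lra]).
    assert (E1 := Y (px (phi t) / e - qb v) ltac:(lra)). assert (E2 := Y ((tY (phi t) + tY (phi t0)) / e - qg v) ltac:(lra)).
    destruct HA as [HA _]. rewrite (quadric_spt c d _ HA). unfold Be. f_equal.
    + replace (qb v) with (px (phi t) / e) by lra. field. exact Hne.
    + replace (qg v) with ((tY (phi t) + tY (phi t0)) / e) by lra. rewrite Y0. field. exact Hne.
Qed.
End Tube.

(** * Isolation of the closed orbits *)

(** Constants for saddle_trivial that do not depend on e. *)
Lemma saddle_constants Lam mu kz ka : 1 < Lam -> mu <> 0 -> exists eta dl, 0 < eta /\ 0 < dl /\ forall e, Rabs e < dl ->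
  let k := eta + Rabs ka * Rabs e * (Rabs mu + Rabs kz + eta) in
  k < Lam - 1 /\ (Rabs kz + eta) / Rabs mu * (k / (Lam - 1 - k)) + eta / Rabs mu < 1 /\ Rabs (e * mu) < 1.
Proof.
  intros HL Hmu. pose proof (Rabs_pos_lt mu Hmu) as Pm. pose proof (Rabs_pos kz) as Pk. pose proof (Rabs_pos ka) as Pa.
  set (K1 := (Rabs kz + 1) / Rabs mu). assert (HK1 : 0 < K1) by (apply Rdiv_lt_0_compat; lra).
  (* for k <= k0 the first product of the second condition is at most 1/4 *)
  set (k0 := (Lam - 1) / (4 * K1 + 4)). assert (Hk0 : 0 < k0) by (apply Rdiv_lt_0_compat; lra).
  assert (Ek0 : k0 * (4 * K1 + 4) = Lam - 1) by (unfold k0; field; lra).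
  set (q := Rabs ka * (Rabs mu + Rabs kz + 1)). assert (Hq : 0 <= q) by (apply Rmult_le_pos; lra).
  set (eta := Rmin 1 (Rmin (Rabs mu / 4) (k0 / 2))).
  assert (He : 0 < eta) by (repeat apply Rmin_pos; lra).
  assert (E1 : eta <= 1) by apply Rmin_l.
  assert (E2 : eta <= Rabs mu / 4) by (eapply Rle_trans; [apply Rmin_r|apply Rmin_l]).
  assert (E3 : eta <= k0 / 2) by (eapply Rle_trans; [apply Rmin_r|apply Rmin_r]).
  exists eta, (Rmin (k0 / 2 / (q + 1)) (/ Rabs mu)). split; [exact He|]. split.
  { apply Rmin_pos; [apply Rdiv_lt_0_compat; lra|apply Rinv_0_lt_compat; exact Pm]. }
  intros e Hep k. pose proof (Rmin_l (k0 / 2 / (q + 1)) (/ Rabs mu)). pose proof (Rmin_r (k0 / 2 / (q + 1)) (/ Rabs mu)).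
  pose proof (Rabs_pos e).
  assert (A1 : Rabs e * (q + 1) <= k0 / 2).
  { apply Rle_trans with (k0 / 2 / (q + 1) * (q + 1)); [apply Rmult_le_compat_r; lra|right; field; lra]. }
  assert (A2 : Rabs ka * Rabs e * (Rabs mu + Rabs kz + eta) <= Rabs e * q).
  { unfold q. replace (Rabs ka * Rabs e * (Rabs mu + Rabs kz + eta)) with (Rabs e * (Rabs ka * (Rabs mu + Rabs kz + eta))) by ring.
    apply Rmult_le_compat_l; [assumption|]. apply Rmult_le_compat_l; lra. }
  assert (Hk : k <= k0) by (unfold k; lra).
  assert (Hkp : 0 < k).
  { unfold k. assert (0 <= Rabs ka * Rabs e * (Rabs mu + Rabs kz + eta)) by (repeat apply Rmult_le_pos; lra). lra. }
  assert (Hk1 : k * (4 * K1 + 4) <= Lam - 1) by (rewrite <- Ek0; apply Rmult_le_compat_r; lra).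
  assert (Hlt : k < Lam - 1) by nra.
  split; [exact Hlt|]. split.
  - assert (B1 : k / (Lam - 1 - k) <= / (4 * K1 + 3)).
    { apply Rmult_le_reg_r with (Lam - 1 - k); [lra|]. replace (k / (Lam - 1 - k) * (Lam - 1 - k)) with k by (field; lra).
      apply Rmult_le_reg_l with (4 * K1 + 3); [lra|]. replace ((4 * K1 + 3) * (/ (4 * K1 + 3) * (Lam - 1 - k))) with (Lam - 1 - k) by (field; lra). lra. }
    assert (B2 : (Rabs kz + eta) / Rabs mu <= K1).
    { unfold K1, Rdiv. apply Rmult_le_compat_r; [left; apply Rinv_0_lt_compat; exact Pm|lra]. }
    assert (B3 : (Rabs kz + eta) / Rabs mu * (k / (Lam - 1 - k)) <= K1 * / (4 * K1 + 3)).
    { apply Rmult_le_compat; try assumption.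
      - left. apply Rdiv_lt_0_compat; lra.
      - left. apply Rdiv_lt_0_compat; lra. }
    assert (B4 : K1 * / (4 * K1 + 3) <= 1 / 4).
    { apply Rmult_le_reg_r with (4 * K1 + 3); [lra|]. rewrite Rmult_assoc, Rinv_l by lra. lra. }
    assert (B5 : eta / Rabs mu <= 1 / 4).
    { apply Rmult_le_reg_r with (Rabs mu); [exact Pm|]. unfold Rdiv at 1. rewrite Rmult_assoc, Rinv_l by lra. lra. }
    lra.
  - rewrite Rabs_mult. apply Rlt_le_trans with (/ Rabs mu * Rabs mu); [apply Rmult_lt_compat_r; lra|right; field; lra].
Qed.

Lemma crossing_is_periodic Z G : crossing_periodic_orbit Z G -> periodic_orbit Z G.
Proof. intros [phi [tau [T [H1 [H2 _]]]]]. exists phi, T. split; assumption. Qed.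

Lemma D6_tri u v w : D6 u w <= D6 u v + D6 v w.
Proof.
  unfold D6.
  assert (X : forall x y z, Rabs (x - z) <= Rabs (x - y) + Rabs (y - z)).
  { intros x y z. replace (x - z) with (x - y + (y - z)) by ring. apply Rabs_triang. }
  pose proof (X (ra u) (ra v) (ra w)). pose proof (X (rb u) (rb v) (rb w)). pose proof (X (rs u) (rs v) (rs w)).
  pose proof (X (rg u) (rg v) (rg w)). pose proof (X (ra' u) (ra' v) (ra' w)). pose proof (X (rt u) (rt v) (rt w)). lra.
Qed.

Section Cycle.
Variables (c d : R) (Zp Zm : zone).
Hypotheses (Hmp : zm Zp = -1) (Hmm : zm Zm = 1) (Hnm : zn Zm = 0).
Variable s0 : R.
Hypothesis Hs0 : 1 < s0.
Variable vb : R -> V4.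
Hypothesis Hvb : forall eta, 0 < eta -> exists dl, 0 < dl /\ forall e, Rabs e < dl -> D4 (vb e) (vb 0) < eta.
Hypothesis Hvs : qs (vb 0) = s0.
Hypothesis Hpass : exists dl, 0 < dl /\ forall e, 0 < Rabs e < dl -> passage c d Zp Zm (emb (vb e)) e.
Variable rho : R.
Hypothesis LFr : local_facts c d Zp Zm s0 rho.

(** arc_ends for both arcs. *)
Lemma Gam_ends e : orbit_facts c d Zp Zm s0 vb rho e -> forall eta, 0 < eta -> exists r, 0 < r /\ forall p q,
  Gam c d Zp Zm vb e q -> norm (minus p q) < r -> quadric c d p = 0 ->
  norm (minus p (Ae c d vb e)) < eta \/ norm (minus p (Be c d vb e)) < eta.
Proof.
  intros F eta He. destruct (lf_good _ _ _ _ _ _ LFr e (of_rho _ _ _ _ _ _ _ _ F)) as [Gp Gm].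
  destruct (arc_ends c d (fun t => flow Zp e t (Ae c d vb e)) (tpe c d Zp vb e) 1) with (eta := eta) as [r1 [P1 Q1]]; [| |exact He|].
  { intros t. apply (is_derive_curve_cont _ _ _ (flow_derive Zp e Gp t (Ae c d vb e))). }
  { intros t Ht. rewrite Rmult_1_l. apply (of_sp _ _ _ _ _ _ _ _ F t Ht). }
  destruct (arc_ends c d (fun t => flow Zm e t (Be c d vb e)) (tme c d Zm vb e) (-1)) with (eta := eta) as [r2 [P2 Q2]]; [| |exact He|].
  { intros t. apply (is_derive_curve_cont _ _ _ (flow_derive Zm e Gm t (Be c d vb e))). }
  { intros t Ht. pose proof (of_sm _ _ _ _ _ _ _ _ F t Ht). lra. }
  exists (Rmin r1 r2). split; [apply Rmin_pos; assumption|]. intros p q Hq Hp Hz.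
  pose proof (Rmin_l r1 r2). pose proof (Rmin_r r1 r2).
  destruct Hq as [[t [Ht <-]]|[t [Ht <-]]].
  - destruct (Q1 t p Ht ltac:(lra) Hz) as [X|X].
    + left. rewrite (flow_0 Zp e Gp) in X. exact X.
    + right. rewrite (of_p _ _ _ _ _ _ _ _ F) in X. exact X.
  - destruct (Q2 t p Ht ltac:(lra) Hz) as [X|X].
    + right. rewrite (flow_0 Zm e Gm) in X. exact X.
    + left. rewrite (of_m _ _ _ _ _ _ _ _ F) in X. exact X.
Qed.

Variables (ka Lam mu kz C : R).
Hypotheses (HLam : 1 < Lam) (Hmu : mu <> 0).
Hypothesis Hest : forall eta, 0 < eta -> exists dl', 0 < dl' /\
  forall (e : R) (v : V4) (w : V6), 0 < Rabs e < dl' -> D6 (emb v) (emb (vb 0)) < dl' -> D6 w (emb (vb 0)) < dl' ->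
    passage c d Zp Zm (emb v) e -> passage c d Zp Zm w e ->
    let dS := rs w - qs v in let z := (ra w - qa v) - ka * dS in
    Rabs ((ra' w - qa v) - ka * dS - Lam * z) <= eta * (Rabs z + Rabs dS) /\
    Rabs (rt w - (mu * dS + kz * z)) <= eta * (Rabs z + Rabs dS) /\
    Rabs (rb w - qb v) + Rabs (rg w - qg v) <= C * (Rabs z + Rabs dS).

(** The rescaling costs a factor 1/|e|, so the tube must be thin compared with |e|. *)
Lemma wof_near phi e r t0 t1 t2 : e <> 0 -> Rabs e < 1 -> 0 < r ->
  norm (minus (phi t0) (Ae c d vb e)) < r -> norm (minus (phi t1) (Be c d vb e)) < r -> norm (minus (phi t2) (Ae c d vb e)) < r ->
  D6 (wof e phi t0 t1 t2) (emb (vb e)) < 20 * r / Rabs e.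
Proof.
  intros N H1 Hr HA HB HA'.
  assert (X : forall p q : R3, norm (minus p q) < r -> Rabs (px p - px q) <= r /\ Rabs (tY p - tY q) <= 2 * r).
  { intros p q H. pose proof (px_le_norm (minus p q)) as Y1. pose proof (py_le_norm (minus p q)) as Y2. rewrite px_minus in Y1. rewrite py_minus in Y2.
    split; [lra|]. unfold tY. replace (py p + px p / 2 - (py q + px q / 2)) with ((py p - py q) + (px p - px q) / 2) by field.
    eapply Rle_trans; [apply Rabs_triang|]. unfold Rdiv. rewrite Rabs_mult, (Rabs_right (/ 2)) by lra. lra. }
  destruct (X _ _ HA) as [A1 A2]. destruct (X _ _ HB) as [B1 B2]. destruct (X _ _ HA') as [A3 A4].
  unfold Ae in A1, A2, A3, A4. unfold Be in B1, B2. rewrite spt_px in *. rewrite spt_tY in *.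
  assert (Pe : 0 < Rabs e) by (apply Rabs_pos_lt; exact N).
  assert (Dv : forall y a, Rabs (y - e * a) <= r -> Rabs (y / e - a) <= r / Rabs e).
  { intros y a H. replace (y / e - a) with ((y - e * a) / e) by (field; exact N). unfold Rdiv. rewrite Rabs_mult, Rabs_inv.
    apply Rmult_le_compat_r; [left; apply Rinv_0_lt_compat; exact Pe|exact H]. }
  assert (Dv4 : forall y a, Rabs (y - e * a) <= 4 * r -> Rabs (y / e - a) <= 4 * r / Rabs e).
  { intros y a H. replace (y / e - a) with ((y - e * a) / e) by (field; exact N). unfold Rdiv. rewrite Rabs_mult, Rabs_inv.
    apply Rmult_le_compat_r; [left; apply Rinv_0_lt_compat; exact Pe|exact H]. }
  unfold D6, wof, emb; simpl.
  pose proof (Dv _ _ A1). pose proof (Dv _ _ B1). pose proof (Dv _ _ A3).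
  assert (Y1 : Rabs ((tY (phi t1) + tY (phi t0)) / e - qg (vb e)) <= 4 * r / Rabs e).
  { apply Dv4. replace (tY (phi t1) + tY (phi t0) - e * qg (vb e)) with
      ((tY (phi t1) - (- qs (vb e) + e * qg (vb e))) + (tY (phi t0) - qs (vb e))) by ring.
    eapply Rle_trans; [apply Rabs_triang|]. lra. }
  assert (Y2 : Rabs ((tY (phi t2) - tY (phi t0)) / e - 0) <= 4 * r / Rabs e).
  { apply Dv4. replace (tY (phi t2) - tY (phi t0) - e * 0) with ((tY (phi t2) - qs (vb e)) + - (tY (phi t0) - qs (vb e))) by ring.
    eapply Rle_trans; [apply Rabs_triang|]. rewrite Rabs_Ropp. lra. }
  assert (Y3 : 2 * r <= 2 * r / Rabs e).
  { apply Rmult_le_reg_r with (Rabs e); [exact Pe|]. replace (2 * r / Rabs e * Rabs e) with (2 * r) by (field; lra). nra. }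
  assert (E : 20 * r / Rabs e = 20 * (r / Rabs e)) by (unfold Rdiv; ring).
  assert (E4 : 4 * r / Rabs e = 4 * (r / Rabs e)) by (unfold Rdiv; ring).
  assert (E2 : 2 * r / Rabs e = 2 * (r / Rabs e)) by (unfold Rdiv; ring).
  assert (0 < r / Rabs e) by (apply Rdiv_lt_0_compat; assumption). lra.
Qed.

(** For fixed e a tube thin compared with e is chosen. A periodic orbit in the tube only meets the manifold near the
    two crossing points, so it consists of passages close to the one of the closed orbit, to which the saddle argument
    applies. *)
Theorem Gam_limit_cycle : exists dl, 0 < dl /\ forall e, 0 < Rabs e < dl -> limit_cycle (zsys c d Zp Zm e) (Gam c d Zp Zm vb e).
Proof.
  pose proof (lf_pos _ _ _ _ _ _ LFr) as Hr.
  destruct (saddle_constants Lam mu kz ka HLam Hmu) as [eta [d1 [Heta [P1 Q1]]]].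
  destruct (Hest eta Heta) as [dl' [Pd Qd]].
  destruct (orbit_facts_exist c d Zp Zm Hmp Hmm s0 Hs0 vb Hvb Hvs Hpass rho LFr) as [d2 [P2 Q2]].
  destruct (Gam_close c d Zp Zm Hmp Hmm s0 Hs0 vb Hvb Hvs Hpass rho LFr (rho / 2) ltac:(lra)) as [d3 [P3 Q3]].
  destruct (Hvb (dl' / 4) ltac:(lra)) as [d4 [P4 Q4]]. destruct Hpass as [d5 [P5 Q5]].
  destruct (min5 d1 d2 d3 d4 (Rmin d5 (Rmin dl' 1)) P1 P2 P3 P4) as [m [Hm [M1 [M2 [M3 [M4 M5]]]]]].
  { repeat apply Rmin_pos; lra. }
  pose proof (Rmin_l d5 (Rmin dl' 1)). pose proof (Rmin_r d5 (Rmin dl' 1)). pose proof (Rmin_l dl' 1). pose proof (Rmin_r dl' 1).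
  exists m. split; [exact Hm|]. intros e He.
  assert (N : e <> 0) by (intros ->; rewrite Rabs_R0 in He; lra).
  destruct (Q1 e ltac:(lra)) as [K1 [K2 K3]]. pose proof (Q2 e ltac:(lra)) as F. destruct (Q3 e ltac:(lra)) as [T _].
  specialize (Q4 e ltac:(lra)). specialize (Q5 e ltac:(lra)).
  assert (Dv : D6 (emb (vb e)) (emb (vb 0)) < dl' / 2) by (pose proof (D6_emb (vb e) (vb 0)); lra).
  split; [apply crossing_is_periodic, (Gam_crossing c d Zp Zm s0 vb rho LFr e F)|].
  pose proof (of_A _ _ _ _ _ _ _ _ F) as FA. pose proof (of_B _ _ _ _ _ _ _ _ F) as FB.
  set (A := Ae c d vb e) in *. set (B := Be c d vb e) in *.
  (* 40 leaves room for the factor 20 of wof_near and for the distance of vb e to vb 0 *)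
  set (r0 := Rmin (rho - norm (minus A (A0 c d s0))) (Rmin (rho - norm (minus B (B0 c d s0))) (Rabs e * dl' / 40))).
  assert (Hr0 : 0 < r0) by (repeat apply Rmin_pos; nra).
  assert (R1 : r0 <= rho - norm (minus A (A0 c d s0))) by apply Rmin_l.
  assert (R2 : r0 <= rho - norm (minus B (B0 c d s0))) by (eapply Rle_trans; [apply Rmin_r|apply Rmin_l]).
  assert (R3' : r0 <= Rabs e * dl' / 40) by (eapply Rle_trans; [apply Rmin_r|apply Rmin_r]).
  destruct (Gam_ends e F r0 Hr0) as [r1 [Pr1 Qr1]]. fold A B in Qr1.
  assert (Hr2 : 0 < Rmin r1 (rho / 2)) by (apply Rmin_pos; lra).
  exists (mkposreal _ Hr2). simpl. intros G' [phi [T' [[Hsol _] Hran]]] HT.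
  pose proof (Rmin_l r1 (rho / 2)). pose proof (Rmin_r r1 (rho / 2)).
  assert (Tub : forall t, exists q, Gam c d Zp Zm vb e q /\ norm (minus (phi t) q) < Rmin r1 (rho / 2)).
  { intros t. apply HT. apply Hran. exists t. reflexivity. }
  assert (Hpx : forall t, Rabs (px (phi t)) < rho).
  { intros t. destruct (Tub t) as [q [Gq Dq]]. destruct (T q Gq) as [q0 [Gq0 Dq0]]. simpl in Dq0.
    pose proof (Gam_0_plane c d Zp Zm s0 vb Hvs q0 Gq0) as E. pose proof (norm_minus_tri (phi t) q q0) as Tr.
    pose proof (px_le_norm (minus (phi t) q0)) as Y. rewrite px_minus, E, Rminus_0_r in Y. lra. }
  assert (Zr : forall t, quadric c d (phi t) = 0 -> norm (minus (phi t) A) < r0 \/ norm (minus (phi t) B) < r0).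
  { intros t Hz. destruct (Tub t) as [q [Gq Dq]]. apply (Qr1 (phi t) q Gq); [lra|exact Hz]. }
  set (isA := crosses c d s0 rho phi true). set (isB := crosses c d s0 rho phi false).
  assert (ZA : forall t, quadric c d (phi t) = 0 -> norm (minus (phi t) A) < r0 -> isA t).
  { intros t Hz Hn. split; [exact Hz|]. pose proof (norm_minus_tri (phi t) A (A0 c d s0)). lra. }
  assert (ZB : forall t, quadric c d (phi t) = 0 -> norm (minus (phi t) B) < r0 -> isB t).
  { intros t Hz Hn. split; [exact Hz|]. pose proof (norm_minus_tri (phi t) B (B0 c d s0)). lra. }
  assert (Hsig : forall t, quadric c d (phi t) = 0 -> exists b, crosses c d s0 rho phi b t).
  { intros t Hz. destruct (Zr t Hz); [exists true; apply ZA|exists false; apply ZB]; assumption. }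
  assert (Hor : Rabs e < rho) by apply (of_rho _ _ _ _ _ _ _ _ F).
  assert (Ex : forall t, isA t -> isB t -> False).
  { intros t [_ XA] [_ XB]. destruct (lf_A _ _ _ _ _ _ LFr _ e XA Hor) as [_ [_ [U1 _]]].
    destruct (lf_B _ _ _ _ _ _ LFr _ e XB Hor) as [_ [_ [U2 _]]]. lra. }
  assert (NA : forall t, isA t -> norm (minus (phi t) A) < r0).
  { intros t HA. destruct (Zr t (proj1 HA)) as [X|X]; [exact X|]. exfalso. apply (Ex t HA), ZB; [apply HA|exact X]. }
  assert (NB : forall t, isB t -> norm (minus (phi t) B) < r0).
  { intros t HB. destruct (Zr t (proj1 HB)) as [X|X]; [|exact X]. exfalso. apply (Ex t); [apply ZA; [apply HB|exact X]|exact HB]. }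
  destruct (crossings_fixed c d Zp Zm s0 rho LFr e Hor phi Hsol Hpx Hsig vb N ka Lam mu kz C eta dl' Hmu Heta K3 K1 K2) as [FA' FB'].
  - intros t0 t1 t2 W0 W1 W2. eapply Rle_lt_trans; [apply (D6_tri _ (emb (vb e)))|].
    pose proof (wof_near phi e r0 t0 t1 t2 N ltac:(lra) Hr0 (NA t0 W0) (NB t1 W1) (NA t2 W2)) as W.
    assert (20 * r0 / Rabs e <= dl' / 2); [|lra].
    apply Rmult_le_reg_r with (Rabs e); [lra|]. unfold Rdiv at 1. rewrite Rmult_assoc, Rinv_l by lra. lra.
  - intros w Hw Pw. apply (Qd e (vb e) w ltac:(lra) ltac:(lra) Hw Q5 Pw).
  - intros p. rewrite <- (same_range c d Zp Zm s0 rho LFr e Hor phi Hsol Hpx Hsig vb F FA' FB' p). apply Hran.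
Qed.
End Cycle.

(** The last item separates the branches of different zeros: an unperturbed orbit meets the manifold only at its two
    crossing points. *)
Theorem branch_of_limit_cycles c d kp km nu lp lm d0 d1 d2 s0 l : 1 < s0 ->
  mel (1 - c) kp km nu lp lm d0 d1 d2 s0 = 0 -> l <> 0 -> is_derive (mel (1 - c) kp km nu lp lm d0 d1 d2) s0 l ->
  exists G : R -> R3 -> Prop,
    let Z := zsys c d (zonep kp nu lp) (zonem km lm d0 d1 d2) in
    crossing_periodic_orbit (Z 0) (G 0) /\ (forall p, G 0 p -> px p = 0) /\
    (forall eta, 0 < eta -> exists dl, 0 < dl /\ forall e, Rabs e < dl -> in_tube eta (G e) (G 0) /\ in_tube eta (G 0) (G e)) /\
    (exists dl, 0 < dl /\ forall e, 0 < Rabs e < dl -> limit_cycle (Z e) (G e)) /\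
    G 0 (A0 c d s0) /\
    (forall eta, 0 < eta -> exists r, 0 < r /\ forall p q, G 0 q -> norm (minus p q) < r -> quadric c d p = 0 ->
       norm (minus p (A0 c d s0)) < eta \/ norm (minus p (B0 c d s0)) < eta).
Proof.
  intros Hs Hz Hl Hd.
  destruct (bifurcation c d kp km nu lp lm d0 d1 d2 s0 Hs Hz l Hl Hd) as
    [v0 [ka [Lam [mu [kz [C [br [dl [E0 [HLam [Hmu [Hdl [Hp [Hb [HC Hest]]]]]]]]]]]]]]].
  set (Zp := zonep kp nu lp) in *. set (Zm := zonem km lm d0 d1 d2) in *.
  set (vb := fun e => if Req_EM_T e 0 then v0 else br e).
  assert (V0 : vb 0 = v0) by (unfold vb; destruct (Req_EM_T 0 0); [reflexivity|contradiction]).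
  assert (V1 : forall e, 0 < Rabs e -> vb e = br e).
  { intros e He. unfold vb. destruct (Req_EM_T e 0) as [->|]; [rewrite Rabs_R0 in He; lra|reflexivity]. }
  assert (Hvb : forall eta, 0 < eta -> exists dl, 0 < dl /\ forall e, Rabs e < dl -> D4 (vb e) (vb 0) < eta).
  { intros eta He. destruct (Hb eta He) as [dl1 [P Q]]. exists dl1. split; [exact P|]. intros e Hep. rewrite V0.
    destruct (Req_dec e 0) as [->|N]; [rewrite V0, D4_refl; exact He|]. apply Rabs_pos_lt in N. rewrite V1 by exact N. apply Q. lra. }
  assert (Hvs : qs (vb 0) = s0) by (rewrite V0; exact E0).
  assert (Hpass : exists dl, 0 < dl /\ forall e, 0 < Rabs e < dl -> passage c d Zp Zm (emb (vb e)) e).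
  { exists dl. split; [exact Hdl|]. intros e He. rewrite V1 by lra. apply Hp, He. }
  assert (Hmp : zm Zp = -1) by reflexivity. assert (Hmm : zm Zm = 1) by reflexivity. assert (Hnm : zn Zm = 0) by reflexivity.
  destruct (local_facts_exist c d Zp Zm Hmp Hmm Hnm s0 Hs) as [rho LFr].
  destruct (orbit_facts_exist c d Zp Zm Hmp Hmm s0 Hs vb Hvb Hvs Hpass rho LFr) as [d2' [P2 Q2]].
  pose proof (Q2 0 ltac:(rewrite Rabs_R0; exact P2)) as F0.
  exists (Gam c d Zp Zm vb). intros Z.
  split; [exact (Gam_crossing c d Zp Zm s0 vb rho LFr 0 F0)|].
  split; [exact (Gam_0_plane c d Zp Zm s0 vb Hvs)|].
  split; [exact (Gam_close c d Zp Zm Hmp Hmm s0 Hs vb Hvb Hvs Hpass rho LFr)|].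
  split.
  { rewrite <- V0 in Hest. exact (Gam_limit_cycle c d Zp Zm Hmp Hmm s0 Hs vb Hvb Hvs Hpass rho LFr ka Lam mu kz C HLam Hmu Hest). }
  rewrite <- (Ae_0 c d s0 vb Hvs), <- (Be_0 c d s0 vb Hvs).
  split; [|exact (Gam_ends c d Zp Zm s0 vb rho LFr 0 F0)].
  left. exists 0. split; [pose proof (of_tp _ _ _ _ _ _ _ _ F0); lra|]. apply (flow_0 Zp 0 (zgood_0 Zp)).
Qed.

(** * The invariant plane and the charts of the annulus *)

(** Both fields have the same first component x, so the Filippov segment projects to a point. *)
Lemma px_derive c d phi : solution (unperturbed c d) phi -> forall t, is_derive (fun s => px (phi s)) t (px (phi t)).
Proof.
  intros H t. destruct (H t) as [Hp [Hn H0]]. simpl in Hp, Hn, H0.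
  assert (Ep : px (X0_pos (phi t)) = px (phi t)) by (destruct (phi t) as [[x y] z]; reflexivity).
  assert (En : px (X0_neg (phi t)) = px (phi t)) by (destruct (phi t) as [[x y] z]; reflexivity).
  destruct (Rtotal_order (quadric c d (phi t)) 0) as [C|[C|C]].
  - rewrite <- En. apply is_derive_px, Hn, C.
  - apply is_derive_R_DQ. intros eta. specialize (H0 C eta). apply locally'_ball in H0. destruct H0 as [dl Hdl].
    exists dl. intros s Hs Hsd. destruct (Hdl s Hs Hsd) as [l [_ Hl]].
    eapply Rle_lt_trans; [|exact Hl]. eapply Rle_trans; [|apply px_le_norm].
    rewrite px_minus, px_plus, !px_scal, px_minus, Ep, En. right. f_equal. field. exact Hs.
  - rewrite <- Ep. apply is_derive_px, Hp, C.
Qed.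

Lemma plane_S_px p : plane_S p <-> px p = 0.
Proof. destruct p as [[x y] z]. reflexivity. Qed.

(** x exp (- t) is constant along solutions. *)
Theorem plane_invariant c d : invariant_set (unperturbed c d) plane_S.
Proof.
  intros phi Hs [t0 H0] t. apply plane_S_px. apply plane_S_px in H0.
  pose proof (px_derive c d phi Hs) as D. set (X := fun s => px (phi s)) in *.
  assert (E : forall s, is_derive (fun s => X s * exp (- s)) s 0).
  { intros s. replace 0 with (X s * exp (- s) + X s * (- exp (- s))) by ring.
    apply (is_derive_mult_R X (fun s => exp (- s)) s (X s) (- exp (- s))); [exact (D s)|]. auto_derive; [exact I|ring]. }
  assert (C : forall s, continuous (fun s => X s * exp (- s)) s) by (intros s; apply cont_D; eexists; apply E).
  assert (V : X t * exp (- t) = X t0 * exp (- t0)).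
  { destruct (Rle_lt_dec t t0).
    - apply (const_interval (fun s => X s * exp (- s))); [assumption|intros; apply C|intros; apply E].
    - symmetry. apply (const_interval (fun s => X s * exp (- s))); [lra|intros; apply C|intros; apply E]. }
  change (px (phi t)) with (X t). change (X t0 = 0) in H0. rewrite H0, Rmult_0_l in V.
  apply Rmult_integral in V. destruct V as [V|V]; [exact V|]. pose proof (exp_pos (- t)). lra.
Qed.

(** The orbit through (0, s, s^2) consists of an arc of the circle of radius rad 1 s around (0, -1) and an arc of the
    circle of radius rad (-1) s around (0, 1). *)
Definition rad sg s := sqrt (s ^ 4 + (1 + 2 * sg) * s ^ 2 + 1).
Definition amp sg s := rad sg s - sg * s ^ 2 - 1.
(** Chart of one half (sg = 1 above, sg = -1 below) of the annulus: the circle of radius s in the model goes to the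
    orbit of level s, the height being affine in q2 and s^2 at q2 = 0. *)
Definition cz sg s q2 := s ^ 2 + q2 / s * amp sg s.
Definition cy sg s q1 q2 := q1 * sqrt (amp sg s * (rad sg s + sg * cz sg s q2 + 1) / (s * (s + sg * q2))).
(** Solves the equation of the circle for s; iq1 and iq2 invert the chart on the level s. *)
Definition lev sg y z := sqrt ((- (1 + 2 * sg) + sqrt (4 * (y ^ 2 + (z + sg) ^ 2) - 4 + (1 + 2 * sg) ^ 2)) / 2).
Definition iq2 sg s z := s * (z - s ^ 2) / amp sg s.
Definition iq1 sg s y z := y * sqrt (s * (s + sg * iq2 sg s z) / (amp sg s * (rad sg s + sg * z + 1))).

Section Chart.
Variable sg : R.
Hypothesis Hsg : sg = 1 \/ sg = -1.

Lemma rad_sq s : 1 < s -> rad sg s ^ 2 = s ^ 4 + (1 + 2 * sg) * s ^ 2 + 1.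
Proof. intros H. unfold rad. rewrite <- Rsqr_pow2. apply Rsqr_sqrt. destruct Hsg as [-> | ->]; nra. Qed.
Lemma rad_pos s : 1 < s -> 0 < rad sg s.
Proof. intros H. apply sqrt_lt_R0. destruct Hsg as [-> | ->]; nra. Qed.
Lemma amp_pos s : 1 < s -> 0 < amp sg s.
Proof.
  intros H. pose proof (rad_sq s H) as E. pose proof (rad_pos s H) as P. unfold amp. set (r := rad sg s) in *.
  destruct Hsg as [-> | ->]; [|nra]. apply Rnot_le_lt. intros X. assert (r * r <= (s ^ 2 + 1) * (s ^ 2 + 1)) by (apply Rmult_le_compat; nra). nra.
Qed.

Lemma lev_level s y z : 1 < s -> y ^ 2 + (z + sg) ^ 2 = rad sg s ^ 2 -> lev sg y z = s.
Proof.
  intros H E. unfold lev. rewrite E, rad_sq by exact H.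
  replace (4 * (s ^ 4 + (1 + 2 * sg) * s ^ 2 + 1) - 4 + (1 + 2 * sg) ^ 2) with ((2 * s ^ 2 + (1 + 2 * sg)) ^ 2) by ring.
  rewrite sqrt_pow2 by (destruct Hsg as [-> | ->]; nra).
  replace ((- (1 + 2 * sg) + (2 * s ^ 2 + (1 + 2 * sg))) / 2) with (s ^ 2) by field. apply sqrt_pow2. lra.
Qed.

Lemma lev_spec y z : 3 + 2 * sg < y ^ 2 + (z + sg) ^ 2 -> 1 < lev sg y z /\ y ^ 2 + (z + sg) ^ 2 = rad sg (lev sg y z) ^ 2.
Proof.
  intros H. set (N := y ^ 2 + (z + sg) ^ 2) in *. set (w := sqrt (4 * N - 4 + (1 + 2 * sg) ^ 2)).
  assert (Ew : w ^ 2 = 4 * N - 4 + (1 + 2 * sg) ^ 2) by (unfold w; rewrite <- Rsqr_pow2; apply Rsqr_sqrt; destruct Hsg as [-> | ->]; nra).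
  assert (Pw : 0 <= w) by apply sqrt_pos.
  assert (Hw : 3 + 2 * sg < w) by (destruct Hsg as [-> | ->]; nra).
  set (s := lev sg y z). assert (Es : s ^ 2 = (- (1 + 2 * sg) + w) / 2).
  { unfold s, lev. fold N w. rewrite <- Rsqr_pow2. apply Rsqr_sqrt. destruct Hsg as [-> | ->]; lra. }
  assert (Ps : 0 <= s) by apply sqrt_pos. assert (H1 : 1 < s) by nra.
  split; [exact H1|]. rewrite rad_sq by exact H1. replace (s ^ 4) with (s ^ 2 * s ^ 2) by ring. rewrite Es. nra.
Qed.

(** On the circle of level s, the parabola is met only at the height s^2. *)
Lemma level_factor s y z : 1 < s -> y ^ 2 + (z + sg) ^ 2 = rad sg s ^ 2 -> z - y ^ 2 = (z - s ^ 2) * (z + s ^ 2 + 1 + 2 * sg).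
Proof. intros H E. rewrite rad_sq in E by exact H. destruct Hsg as [-> | ->]; nra. Qed.

Lemma side_s s y z : 1 < s -> y ^ 2 + (z + sg) ^ 2 = rad sg s ^ 2 -> 0 <= sg * (z - s ^ 2) \/ 0 <= sg * (z - y ^ 2) -> 0 < z + s ^ 2 + 1 + 2 * sg.
Proof.
  intros H E. pose proof (rad_sq s H) as R. pose proof (rad_pos s H). set (r := rad sg s) in *.
  destruct Hsg as [-> | ->]; intros S; [destruct S; nra|].
  assert (r < s ^ 2) by nra. nra.
Qed.

Lemma side_pos s y z : 1 < s -> y ^ 2 + (z + sg) ^ 2 = rad sg s ^ 2 -> 0 <= sg * (z - s ^ 2) -> 0 < rad sg s + sg * z + 1.
Proof.
  intros H E S. pose proof (rad_sq s H) as R. pose proof (rad_pos s H). set (r := rad sg s) in *.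
  destruct Hsg as [-> | ->]; [nra|]. assert (s ^ 2 - 1 < r) by nra. lra.
Qed.

Lemma chart_facts s q1 q2 : 1 < s -> q1 ^ 2 + q2 ^ 2 = s ^ 2 -> 0 <= sg * q2 ->
  cy sg s q1 q2 ^ 2 + (cz sg s q2 + sg) ^ 2 = rad sg s ^ 2 /\
  iq2 sg s (cz sg s q2) = q2 /\ iq1 sg s (cy sg s q1 q2) (cz sg s q2) = q1 /\
  sg * (cz sg s q2 - s ^ 2) = sg * q2 / s * amp sg s.
Proof.
  intros H Hq S. pose proof (amp_pos s H) as Pa. pose proof (rad_pos s H) as Pr. pose proof (rad_sq s H) as Er.
  assert (Ei : iq2 sg s (cz sg s q2) = q2) by (unfold iq2, cz; field; lra).
  assert (Ez : sg * (cz sg s q2 - s ^ 2) = sg * q2 / s * amp sg s) by (unfold cz; field; lra).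
  set (z := cz sg s q2) in *. set (a := amp sg s) in *. set (r := rad sg s) in *.
  assert (Z0 : 0 <= sg * (z - s ^ 2)).
  { rewrite Ez. apply Rmult_le_pos; [|lra]. apply Rmult_le_pos; [exact S|left; apply Rinv_0_lt_compat; lra]. }
  assert (Pz : 0 < r + sg * z + 1).
  { destruct Hsg as [-> | ->]; [nra|]. assert (s ^ 2 - 1 < r) by nra. lra. }
  assert (Ps : 0 < s + sg * q2) by lra.
  set (X := a * (r + sg * z + 1) / (s * (s + sg * q2))).
  assert (PX : 0 < X) by (apply Rdiv_lt_0_compat; apply Rmult_lt_0_compat; lra).
  assert (Sg2 : sg * sg = 1) by (destruct Hsg as [-> | ->]; ring).
  assert (Ey : cy sg s q1 q2 = q1 * sqrt X) by reflexivity.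
  split; [|split; [exact Ei|split; [|exact Ez]]].
  - rewrite Ey, Rpow_mult_distr. replace (sqrt X ^ 2) with X by (rewrite <- Rsqr_pow2, Rsqr_sqrt; [reflexivity|lra]).
    assert (Q1 : q1 ^ 2 = (s - sg * q2) * (s + sg * q2)) by (replace ((s - sg * q2) * (s + sg * q2)) with (s ^ 2 - sg * sg * q2 ^ 2) by ring; rewrite Sg2; lra).
    rewrite Q1. unfold X.
    replace ((s - sg * q2) * (s + sg * q2) * (a * (r + sg * z + 1) / (s * (s + sg * q2)))) with ((a - sg * q2 / s * a) * (r + sg * z + 1)) by (field; lra).
    rewrite <- Ez. unfold a, amp. fold r.
    replace ((r - sg * s ^ 2 - 1 - sg * (z - s ^ 2)) * (r + sg * z + 1)) with (r ^ 2 - (sg * sg * z ^ 2 + 2 * sg * z + 1)) by ring.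
    rewrite Sg2. replace ((z + sg) ^ 2) with (z ^ 2 + 2 * sg * z + sg * sg) by ring. rewrite Sg2. ring.
  - unfold iq1. rewrite Ei. fold a r. rewrite Ey, Rmult_assoc.
    replace (s * (s + sg * q2) / (a * (r + sg * z + 1))) with (/ X) by (unfold X; field; lra).
    rewrite <- sqrt_mult by (try (left; apply Rinv_0_lt_compat); lra). rewrite Rinv_r, sqrt_1 by lra. ring.
Qed.

Lemma inverse_facts s y z : 1 < s -> y ^ 2 + (z + sg) ^ 2 = rad sg s ^ 2 -> 0 <= sg * (z - s ^ 2) ->
  let q2 := iq2 sg s z in let q1 := iq1 sg s y z in
  q1 ^ 2 + q2 ^ 2 = s ^ 2 /\ sg * q2 = s / amp sg s * (sg * (z - s ^ 2)) /\ cz sg s q2 = z /\ cy sg s q1 q2 = y.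
Proof.
  intros H E S q2 q1. pose proof (amp_pos s H) as Pa. pose proof (rad_pos s H) as Pr. pose proof (side_pos s y z H E S) as Pz.
  assert (Ez : cz sg s q2 = z) by (unfold cz, q2, iq2; field; lra).
  assert (Eq : sg * q2 = s / amp sg s * (sg * (z - s ^ 2))) by (unfold q2, iq2; field; lra).
  unfold q1, iq1, cy. fold q2. rewrite Ez.
  assert (Eamp : amp sg s = rad sg s - sg * s ^ 2 - 1) by reflexivity.
  set (a := amp sg s) in *. set (r := rad sg s) in *.
  assert (S2 : 0 <= sg * q2).
  { rewrite Eq. apply Rmult_le_pos; [|exact S]. left. apply Rdiv_lt_0_compat; lra. }
  assert (Ps : 0 < s + sg * q2) by lra.
  assert (Sg2 : sg * sg = 1) by (destruct Hsg as [-> | ->]; ring).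
  set (X := s * (s + sg * q2) / (a * (r + sg * z + 1))).
  assert (PX : 0 < X) by (apply Rdiv_lt_0_compat; apply Rmult_lt_0_compat; lra).
  split; [|split; [exact Eq|split; [reflexivity|]]].
  - rewrite Rpow_mult_distr. replace (sqrt X ^ 2) with X by (rewrite <- Rsqr_pow2, Rsqr_sqrt; [reflexivity|lra]).
    assert (Ey : y ^ 2 = (a - sg * q2 * a / s) * (r + sg * z + 1)).
    { replace (sg * q2 * a / s) with (sg * (z - s ^ 2)) by (rewrite Eq; field; lra). rewrite Eamp.
      replace ((r - sg * s ^ 2 - 1 - sg * (z - s ^ 2)) * (r + sg * z + 1)) with (r ^ 2 - (sg * sg * z ^ 2 + 2 * sg * z + 1)) by ring.
      rewrite Sg2, <- E. replace ((z + sg) ^ 2) with (z ^ 2 + 2 * sg * z + sg * sg) by ring. rewrite Sg2. ring. }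
    rewrite Ey. unfold X.
    replace ((a - sg * q2 * a / s) * (r + sg * z + 1) * (s * (s + sg * q2) / (a * (r + sg * z + 1)))) with ((s - sg * q2) * (s + sg * q2)) by (field; lra).
    replace ((s - sg * q2) * (s + sg * q2)) with (s ^ 2 - sg * sg * q2 ^ 2) by ring. rewrite Sg2. ring.
  - rewrite Rmult_assoc. replace (a * (r + sg * z + 1) / (s * (s + sg * q2))) with (/ X) by (unfold X; field; lra).
    rewrite <- sqrt_mult by (try (left; apply Rinv_0_lt_compat); lra). rewrite Rinv_r, sqrt_1 by lra. ring.
Qed.

(** So the two charts fit together continuously. *)
Lemma chart_seam s q1 : 1 < s -> cz sg s 0 = s ^ 2 /\ cy sg s q1 0 = q1 /\ iq2 sg s (s ^ 2) = 0 /\ iq1 sg s q1 (s ^ 2) = q1.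
Proof.
  intros H. pose proof (amp_pos s H) as Pa. pose proof (rad_sq s H) as Er.
  assert (Ez : cz sg s 0 = s ^ 2) by (unfold cz; field; lra).
  assert (Ei : iq2 sg s (s ^ 2) = 0) by (unfold iq2; field; lra).
  assert (Sg2 : sg * sg = 1) by (destruct Hsg as [-> | ->]; ring).
  assert (E : amp sg s * (rad sg s + sg * s ^ 2 + 1) = s ^ 2).
  { unfold amp. replace ((rad sg s - sg * s ^ 2 - 1) * (rad sg s + sg * s ^ 2 + 1)) with (rad sg s ^ 2 - (sg * sg * s ^ 4 + 2 * sg * s ^ 2 + 1)) by ring.
    rewrite Sg2, Er. ring. }
  split; [exact Ez|]. split; [|split; [exact Ei|]].
  - unfold cy. rewrite Ez, E. replace (s ^ 2 / (s * (s + sg * 0))) with 1 by (field; lra). rewrite sqrt_1. ring.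
  - unfold iq1. rewrite Ei, E. replace (s * (s + sg * 0) / s ^ 2) with 1 by (field; lra). rewrite sqrt_1. ring.
Qed.
End Chart.

(** * The annulus as a homeomorphic image *)

Lemma cont_sqrt {U : UniformSpace} (g : U -> R) u : 0 <= g u -> continuous g u -> continuous (fun v => sqrt (g v)) u.
Proof. intros H Hg. apply (cont_comp sqrt g); [exact Hg|]. apply continuity_pt_filterlim, continuity_pt_sqrt, H. Qed.

(** Both pieces are continuous in a full neighbourhood of the seam, where they agree. *)
Lemma continuous_on_paste {U : UniformSpace} (A : U -> Prop) (F f1 f2 : U -> R) :
  (forall x, A x -> continuous F x) -> (forall x, A x -> 0 <= F x -> continuous f1 x) ->
  (forall x, A x -> F x <= 0 -> continuous f2 x) -> (forall x, A x -> F x = 0 -> f1 x = f2 x) ->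
  continuous_on A (fun x => if Rle_dec 0 (F x) then f1 x else f2 x).
Proof.
  intros CF C1 C2 E x Ax P HP. unfold filtermap, within.
  destruct (Rtotal_order (F x) 0) as [N|[Z|N]].
  - destruct (Rle_dec 0 (F x)) as [X|_]; [lra|].
    pose proof (CF x Ax (fun y => y < 0) (open_lt 0 (F x) N)) as L1. pose proof (C2 x Ax ltac:(lra) P HP) as L2. unfold filtermap in L1, L2.
    generalize (filter_and _ _ L1 L2). apply filter_imp. intros y [Y1 Y2] _. destruct (Rle_dec 0 (F y)); [lra|exact Y2].
  - destruct (Rle_dec 0 (F x)) as [_|X]; [|lra].
    pose proof (C1 x Ax ltac:(lra) P HP) as L1. rewrite (E x Ax Z) in HP. pose proof (C2 x Ax ltac:(lra) P HP) as L2. unfold filtermap in L1, L2.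
    generalize (filter_and _ _ L1 L2). apply filter_imp. intros y [Y1 Y2] _. destruct (Rle_dec 0 (F y)); assumption.
  - destruct (Rle_dec 0 (F x)) as [_|X]; [|lra].
    pose proof (CF x Ax (fun y => 0 < y) (open_gt 0 (F x) N)) as L1. pose proof (C1 x Ax ltac:(lra) P HP) as L2. unfold filtermap in L1, L2.
    generalize (filter_and _ _ L1 L2). apply filter_imp. intros y [Y1 Y2] _. destruct (Rle_dec 0 (F y)); [exact Y2|lra].
Qed.

Lemma continuous_on_pair {U V W : UniformSpace} (A : U -> Prop) (f : U -> V) (g : U -> W) :
  continuous_on A f -> continuous_on A g -> continuous_on (U := prod_UniformSpace V W) A (fun x => (f x, g x)).
Proof.
  intros Hf Hg x Ax P [eps HP].
  assert (L1 := Hf x Ax (ball (f x) eps) (locally_ball (f x) eps)). assert (L2 := Hg x Ax (ball (g x) eps) (locally_ball (g x) eps)).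
  unfold filtermap in *. generalize (filter_and _ _ L1 L2). apply filter_imp. intros y [Y1 Y2]. apply HP. split; assumption.
Qed.

Lemma minus_side x : x <= 0 -> 0 <= -1 * x.
Proof. lra. Qed.
Lemma plus_side x : 0 <= x -> 0 <= 1 * x.
Proof. lra. Qed.

Section Charts.
Variable sg : R.
Hypothesis Hsg : sg = 1 \/ sg = -1.

Section At.
Context {U : UniformSpace}.
Variables (S Q Y Z : U -> R) (u : U).
Hypotheses (CS : continuous S u) (HS : 1 < S u).

Lemma cont_rad : continuous (fun v => rad sg (S v)) u.
Proof. unfold rad. apply (cont_sqrt (fun v => S v ^ 4 + (1 + 2 * sg) * S v ^ 2 + 1)); [destruct Hsg as [-> | ->]; nra|ctac]. Qed.
Lemma cont_amp : continuous (fun v => amp sg (S v)) u.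
Proof. unfold amp. pose proof cont_rad. ctac. Qed.
Lemma cont_cz : continuous Q u -> continuous (fun v => cz sg (S v) (Q v)) u.
Proof.
  intros CQ. unfold cz. pose proof cont_amp. assert (continuous (fun v => Q v / S v) u) by (apply cont_div; [lra|assumption|assumption]).
  apply (cont_plus (fun v => S v ^ 2) (fun v => Q v / S v * amp sg (S v))); [ctac|].
  apply (cont_mult (fun v => Q v / S v)); assumption.
Qed.
Lemma cont_cy : continuous Q u -> continuous Y u -> 0 <= sg * Q u -> Y u ^ 2 + Q u ^ 2 = S u ^ 2 -> continuous (fun v => cy sg (S v) (Y v) (Q v)) u.
Proof.
  intros CQ CY Hq E. unfold cy. pose proof cont_amp. pose proof cont_rad. pose proof (cont_cz CQ).
  destruct (chart_facts sg Hsg (S u) (Y u) (Q u) HS E Hq) as [F1 [_ [_ F2]]].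
  pose proof (amp_pos sg Hsg _ HS) as Pa.
  assert (Z0 : 0 <= sg * (cz sg (S u) (Q u) - S u ^ 2)).
  { rewrite F2. apply Rmult_le_pos; [|lra]. apply Rmult_le_pos; [exact Hq|left; apply Rinv_0_lt_compat; lra]. }
  pose proof (side_pos sg Hsg _ _ _ HS F1 Z0) as Pz.
  apply (cont_mult Y); [exact CY|].
  apply (cont_sqrt (fun v => amp sg (S v) * (rad sg (S v) + sg * cz sg (S v) (Q v) + 1) / (S v * (S v + sg * Q v)))).
  - left. apply Rdiv_lt_0_compat; apply Rmult_lt_0_compat; lra.
  - apply cont_div.
    + apply Rgt_not_eq, Rmult_lt_0_compat; lra.
    + apply (cont_mult (fun v => amp sg (S v))); [assumption|].
      apply (cont_plus (fun v => rad sg (S v) + sg * cz sg (S v) (Q v)) (fun _ => 1)); [|apply cont_const].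
      apply (cont_plus (fun v => rad sg (S v))); [assumption|]. apply (cont_mult (fun _ => sg)); [apply cont_const|assumption].
    + ctac.
Qed.
Lemma cont_iq2 : continuous Z u -> continuous (fun v => iq2 sg (S v) (Z v)) u.
Proof.
  intros CZ. unfold iq2. pose proof cont_amp. pose proof (amp_pos sg Hsg _ HS).
  apply (cont_div (fun v => S v * (Z v - S v ^ 2))); [lra|ctac|assumption].
Qed.
Lemma cont_iq1 : continuous Z u -> continuous Y u -> Y u ^ 2 + (Z u + sg) ^ 2 = rad sg (S u) ^ 2 -> 0 <= sg * (Z u - S u ^ 2) ->
  continuous (fun v => iq1 sg (S v) (Y v) (Z v)) u.
Proof.
  intros CZ CY E Hz. unfold iq1. pose proof cont_amp. pose proof cont_rad. pose proof (cont_iq2 CZ).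
  pose proof (amp_pos sg Hsg _ HS) as Pa. pose proof (side_pos sg Hsg _ _ _ HS E Hz) as Pz.
  destruct (inverse_facts sg Hsg _ _ _ HS E Hz) as [_ [F2 _]].
  assert (S2 : 0 <= sg * iq2 sg (S u) (Z u)).
  { rewrite F2. apply Rmult_le_pos; [|exact Hz]. left. apply Rdiv_lt_0_compat; lra. }
  apply (cont_mult Y); [exact CY|].
  apply (cont_sqrt (fun v => S v * (S v + sg * iq2 sg (S v) (Z v)) / (amp sg (S v) * (rad sg (S v) + sg * Z v + 1)))).
  - left. apply Rdiv_lt_0_compat; apply Rmult_lt_0_compat; lra.
  - apply cont_div.
    + apply Rgt_not_eq, Rmult_lt_0_compat; lra.
    + apply (cont_mult S); [assumption|]. apply (cont_plus S (fun v => sg * iq2 sg (S v) (Z v))); [assumption|].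
      apply (cont_mult (fun _ => sg)); [apply cont_const|assumption].
    + apply (cont_mult (fun v => amp sg (S v))); [assumption|].
      apply (cont_plus (fun v => rad sg (S v) + sg * Z v) (fun _ => 1)); [|apply cont_const].
      apply (cont_plus (fun v => rad sg (S v))); [assumption|]. apply (cont_mult (fun _ => sg)); [apply cont_const|assumption].
Qed.
Lemma cont_lev : continuous Y u -> continuous Z u -> 3 + 2 * sg < Y u ^ 2 + (Z u + sg) ^ 2 -> continuous (fun v => lev sg (Y v) (Z v)) u.
Proof.
  intros CY CZ H. unfold lev.
  assert (P1 : 0 <= 4 * (Y u ^ 2 + (Z u + sg) ^ 2) - 4 + (1 + 2 * sg) ^ 2) by (destruct Hsg as [-> | ->]; nra).
  assert (C1 : continuous (fun v => sqrt (4 * (Y v ^ 2 + (Z v + sg) ^ 2) - 4 + (1 + 2 * sg) ^ 2)) u).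
  { apply (cont_sqrt (fun v => 4 * (Y v ^ 2 + (Z v + sg) ^ 2) - 4 + (1 + 2 * sg) ^ 2)); [exact P1|ctac]. }
  set (w := fun v => sqrt (4 * (Y v ^ 2 + (Z v + sg) ^ 2) - 4 + (1 + 2 * sg) ^ 2)) in *.
  apply (cont_sqrt (fun v => (- (1 + 2 * sg) + w v) / 2)); [|ctac].
  assert (Ew : w u ^ 2 = 4 * (Y u ^ 2 + (Z u + sg) ^ 2) - 4 + (1 + 2 * sg) ^ 2) by (unfold w; rewrite <- Rsqr_pow2; apply Rsqr_sqrt, P1).
  assert (0 <= w u) by apply sqrt_pos. destruct Hsg as [-> | ->]; nra.
Qed.
End At.
End Charts.

Definition nrm (q : R * R) := sqrt (fst q ^ 2 + snd q ^ 2).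
Definition hmap (q : R * R) : R3 :=
  (0, if Rle_dec 0 (snd q) then cy 1 (nrm q) (fst q) (snd q) else cy (-1) (nrm q) (fst q) (snd q),
      if Rle_dec 0 (snd q) then cz 1 (nrm q) (snd q) else cz (-1) (nrm q) (snd q)).
Definition gS sg p := lev sg (py p) (pz p).
Definition gmap (p : R3) : R * R :=
  (if Rle_dec 0 (pz p - py p ^ 2) then iq1 1 (gS 1 p) (py p) (pz p) else iq1 (-1) (gS (-1) p) (py p) (pz p),
   if Rle_dec 0 (pz p - py p ^ 2) then iq2 1 (gS 1 p) (pz p) else iq2 (-1) (gS (-1) p) (pz p)).

Lemma annulus_level p sg : annulus_A p -> (sg = 1 \/ sg = -1) -> 0 <= sg * (pz p - py p ^ 2) ->
  3 + 2 * sg < py p ^ 2 + (pz p + sg) ^ 2.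
Proof.
  destruct p as [[x y] z]. unfold px, py, pz; simpl. intros [[_ [H1 H2]]|[_ [H1 H2]]] [-> | ->] H; simpl in *; nra.
Qed.
Lemma annulus_px p : annulus_A p -> px p = 0.
Proof. destruct p as [[x y] z]. intros [[H _]|[H _]]; exact H. Qed.
Lemma annulus_of_level p sg s : px p = 0 -> (sg = 1 \/ sg = -1) -> 1 < s -> py p ^ 2 + (pz p + sg) ^ 2 = rad sg s ^ 2 ->
  0 <= sg * (pz p - s ^ 2) -> annulus_A p.
Proof.
  intros H0 Hsg Hs E H. pose proof (level_factor sg Hsg s _ _ Hs E) as L. pose proof (side_s sg Hsg s _ _ Hs E (or_introl H)) as P.
  rewrite rad_sq in E by assumption.
  assert (F : 3 + 2 * sg < s ^ 4 + (1 + 2 * sg) * s ^ 2 + 1).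
  { assert (S2 : 1 < s ^ 2) by nra. replace (s ^ 4) with (s ^ 2 * s ^ 2) by ring. set (w := s ^ 2) in *. destruct Hsg as [-> | ->]; nra. }
  assert (L' : 0 <= sg * (pz p - py p ^ 2)) by (rewrite L, <- Rmult_assoc; apply Rmult_le_pos; lra).
  rewrite <- E in F. destruct p as [[x y] z]. unfold px, py, pz in *; simpl in *. subst x.
  destruct Hsg as [-> | ->]; [right|left]; (split; [reflexivity|split; simpl; lra]).
Qed.

Lemma nrm_gt q : 1 < fst q ^ 2 + snd q ^ 2 -> 1 < nrm q /\ fst q ^ 2 + snd q ^ 2 = nrm q ^ 2.
Proof.
  intros H. unfold nrm. split; [rewrite <- sqrt_1 at 1; apply sqrt_lt_1_alt; lra|]. rewrite pow2_sqrt by lra. reflexivity.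
Qed.

(** The sign of q2 decides the side of the manifold, also for the image. *)
Lemma hmap_side q : 1 < nrm q -> fst q ^ 2 + snd q ^ 2 = nrm q ^ 2 -> exists sg, (sg = 1 \/ sg = -1) /\ 0 <= sg * snd q /\
  (0 <= sg * (pz (hmap q) - py (hmap q) ^ 2)) /\ (sg = -1 -> pz (hmap q) - py (hmap q) ^ 2 < 0) /\
  px (hmap q) = 0 /\ py (hmap q) ^ 2 + (pz (hmap q) + sg) ^ 2 = rad sg (nrm q) ^ 2 /\ 0 <= sg * (pz (hmap q) - nrm q ^ 2) /\
  iq1 sg (nrm q) (py (hmap q)) (pz (hmap q)) = fst q /\ iq2 sg (nrm q) (pz (hmap q)) = snd q.
Proof.
  intros Hn En. set (sg := if Rle_dec 0 (snd q) then 1 else -1).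
  assert (Hsg : sg = 1 \/ sg = -1) by (unfold sg; destruct (Rle_dec 0 (snd q)); [left|right]; reflexivity).
  assert (Hs : 0 <= sg * snd q) by (unfold sg; destruct (Rle_dec 0 (snd q)); lra).
  assert (Ey : py (hmap q) = cy sg (nrm q) (fst q) (snd q)) by (unfold hmap, py, sg; simpl; destruct (Rle_dec 0 (snd q)); reflexivity).
  assert (Ez : pz (hmap q) = cz sg (nrm q) (snd q)) by (unfold hmap, pz, sg; simpl; destruct (Rle_dec 0 (snd q)); reflexivity).
  destruct (chart_facts sg Hsg _ _ _ Hn En Hs) as [F1 [F2 [F3 F4]]]. rewrite <- Ey, <- Ez in *.
  pose proof (amp_pos sg Hsg _ Hn) as Pa.
  assert (Pi : 0 < / nrm q) by (apply Rinv_0_lt_compat; lra).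
  assert (Z0 : 0 <= sg * (pz (hmap q) - nrm q ^ 2)) by (rewrite F4; apply Rmult_le_pos; [apply Rmult_le_pos; lra|lra]).
  pose proof (level_factor sg Hsg _ _ _ Hn F1) as L. pose proof (side_s sg Hsg _ _ _ Hn F1 (or_introl Z0)) as P.
  exists sg. split; [exact Hsg|]. split; [exact Hs|]. split; [rewrite L, <- Rmult_assoc; apply Rmult_le_pos; lra|].
  split; [|split; [reflexivity|split; [exact F1|split; [exact Z0|split; [exact F3|exact F2]]]]].
  intros E1. rewrite L. assert (snd q < 0) by (unfold sg in E1; destruct (Rle_dec 0 (snd q)); lra).
  assert (0 < sg * (pz (hmap q) - nrm q ^ 2)).
  { rewrite F4. apply Rmult_lt_0_compat; [apply Rmult_lt_0_compat; [rewrite E1; lra|exact Pi]|exact Pa]. }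
  assert (0 < - ((pz (hmap q) - nrm q ^ 2) * (pz (hmap q) + nrm q ^ 2 + 1 + 2 * sg))); [|lra].
  replace (- ((pz (hmap q) - nrm q ^ 2) * (pz (hmap q) + nrm q ^ 2 + 1 + 2 * sg))) with ((sg * (pz (hmap q) - nrm q ^ 2)) * (pz (hmap q) + nrm q ^ 2 + 1 + 2 * sg)) by (rewrite E1; ring).
  apply Rmult_lt_0_compat; assumption.
Qed.

Lemma gmap_hmap q : 1 < fst q ^ 2 + snd q ^ 2 -> annulus_A (hmap q) /\ gmap (hmap q) = q.
Proof.
  intros H. destruct (nrm_gt q H) as [Hn En].
  destruct (hmap_side q Hn En) as [sg [Hsg [Hs [Hz [Hzs [H0 [Hc [Hz2 [I1 I2]]]]]]]]].
  split; [exact (annulus_of_level _ sg _ H0 Hsg Hn Hc Hz2)|].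
  assert (L : gS sg (hmap q) = nrm q) by (apply (lev_level sg Hsg); assumption).
  unfold gmap. destruct (Rle_dec 0 (pz (hmap q) - py (hmap q) ^ 2)) as [X|X].
  - assert (sg = 1) by (destruct Hsg as [E|E]; [exact E|specialize (Hzs E); lra]). subst sg. rewrite L, I1, I2. destruct q; reflexivity.
  - assert (sg = -1) by (destruct Hsg as [E|E]; [subst sg; lra|exact E]). subst sg. rewrite L, I1, I2. destruct q; reflexivity.
Qed.

Lemma hmap_gmap_level p sg s : px p = 0 -> (sg = 1 \/ sg = -1) -> 1 < s -> py p ^ 2 + (pz p + sg) ^ 2 = rad sg s ^ 2 ->
  0 <= sg * (pz p - s ^ 2) -> (sg = -1 -> pz p - s ^ 2 < 0) -> gS sg p = s ->
  exists q, fst q ^ 2 + snd q ^ 2 = s ^ 2 /\ hmap q = p /\ q = (iq1 sg s (py p) (pz p), iq2 sg s (pz p)).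
Proof.
  intros H0 Hsg Hs E Hz Hzs L. destruct (inverse_facts sg Hsg s _ _ Hs E Hz) as [F1 [F2 [F3 F4]]].
  exists (iq1 sg s (py p) (pz p), iq2 sg s (pz p)). set (q := (iq1 sg s (py p) (pz p), iq2 sg s (pz p))).
  split; [exact F1|]. split; [|reflexivity].
  assert (En : nrm q = s) by (unfold nrm; change (fst q) with (iq1 sg s (py p) (pz p)); change (snd q) with (iq2 sg s (pz p)); rewrite F1; apply sqrt_pow2; lra).
  pose proof (amp_pos sg Hsg s Hs) as Pa.
  assert (Pq : 0 < s / amp sg s) by (apply Rdiv_lt_0_compat; lra).
  unfold hmap. rewrite En. change (fst q) with (iq1 sg s (py p) (pz p)). change (snd q) with (iq2 sg s (pz p)).
  apply R3_eq; [symmetry; exact H0| |].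
  - destruct (Rle_dec 0 (iq2 sg s (pz p))) as [X|X].
    + destruct Hsg as [-> | ->]; [exact F4|]. specialize (Hzs eq_refl). nra.
    + destruct Hsg as [-> | ->]; [|exact F4]. nra.
  - destruct (Rle_dec 0 (iq2 sg s (pz p))) as [X|X].
    + destruct Hsg as [-> | ->]; [exact F3|]. specialize (Hzs eq_refl). nra.
    + destruct Hsg as [-> | ->]; [|exact F3]. nra.
Qed.

Lemma annulus_side p sg : annulus_A p -> (sg = 1 \/ sg = -1) -> 0 <= sg * (pz p - py p ^ 2) ->
  1 < gS sg p /\ py p ^ 2 + (pz p + sg) ^ 2 = rad sg (gS sg p) ^ 2 /\ 0 <= sg * (pz p - gS sg p ^ 2) /\
  (pz p - py p ^ 2 = 0 -> pz p = gS sg p ^ 2) /\ (pz p = gS sg p ^ 2 -> pz p - py p ^ 2 = 0).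
Proof.
  intros A Hsg H. destruct (lev_spec sg Hsg (py p) (pz p) (annulus_level p sg A Hsg H)) as [L1 L2]. fold (gS sg p) in L1, L2.
  pose proof (level_factor sg Hsg _ _ _ L1 L2) as F. pose proof (side_s sg Hsg _ _ _ L1 L2 (or_intror H)) as P.
  split; [exact L1|]. split; [exact L2|]. split; [|split].
  - rewrite F, <- Rmult_assoc in H. nra.
  - intros E. rewrite E in F. symmetry in F. apply Rmult_integral in F. destruct F; lra.
  - intros E. rewrite F, E. replace (gS sg p ^ 2 - gS sg p ^ 2) with 0 by ring. ring.
Qed.

Lemma hmap_gmap p : annulus_A p -> 1 < fst (gmap p) ^ 2 + snd (gmap p) ^ 2 /\ hmap (gmap p) = p.
Proof.
  intros A. pose proof (annulus_px p A) as H0.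
  assert (X : exists sg, (sg = 1 \/ sg = -1) /\ 0 <= sg * (pz p - py p ^ 2) /\ (sg = -1 -> pz p - py p ^ 2 < 0) /\
     gmap p = (iq1 sg (gS sg p) (py p) (pz p), iq2 sg (gS sg p) (pz p))).
  { unfold gmap. destruct (Rle_dec 0 (pz p - py p ^ 2)).
    - exists 1. split; [left; reflexivity|]. split; [lra|]. split; [lra|reflexivity].
    - exists (-1). split; [right; reflexivity|]. split; [lra|]. split; [lra|reflexivity]. }
  destruct X as [sg [Hsg [Hz [Hzs Eg]]]]. destruct (annulus_side p sg A Hsg Hz) as [L1 [L2 [L3 [_ L5]]]].
  destruct (hmap_gmap_level p sg (gS sg p) H0 Hsg L1 L2 L3) as [q [Q1 [Q2 Q3]]].
  - intros E. specialize (Hzs E). subst sg. destruct (Rle_lt_or_eq_dec _ _ L3) as [Y|Y]; [lra|]. rewrite L5 in Hzs; lra.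
  - reflexivity.
  - rewrite Eg, <- Q3. split; [rewrite Q1; nra|exact Q2].
Qed.

Lemma nrm_cont q : continuous nrm q.
Proof.
  unfold nrm. apply (cont_sqrt (fun q : R * R => fst q ^ 2 + snd q ^ 2)); [nra|].
  assert (continuous (fun q : R * R => fst q) q) by apply continuous_fst. assert (continuous (fun q : R * R => snd q) q) by apply continuous_snd. ctac.
Qed.

Lemma hmap_seam q : 1 < nrm q -> snd q = 0 -> cy 1 (nrm q) (fst q) (snd q) = cy (-1) (nrm q) (fst q) (snd q) /\ cz 1 (nrm q) (snd q) = cz (-1) (nrm q) (snd q).
Proof.
  intros H E. rewrite E. destruct (chart_seam 1 (or_introl eq_refl) (nrm q) (fst q) H) as [-> [-> _]].
  destruct (chart_seam (-1) (or_intror eq_refl) (nrm q) (fst q) H) as [-> [-> _]]. split; reflexivity.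
Qed.

Lemma hmap_cont : continuous_on (fun q : R * R => 1 < fst q ^ 2 + snd q ^ 2) hmap.
Proof.
  assert (C1 : forall q : R * R, continuous (fun q : R * R => fst q) q) by (intros; apply continuous_fst).
  assert (C2 : forall q : R * R, continuous (fun q : R * R => snd q) q) by (intros; apply continuous_snd).
  assert (One : (1 = 1 \/ 1 = -1)) by (left; reflexivity). assert (Mone : (-1 = 1 \/ -1 = -1)) by (right; reflexivity).
  unfold hmap. apply (continuous_on_pair _ (fun q : R * R => (0, if Rle_dec 0 (snd q) then cy 1 (nrm q) (fst q) (snd q) else cy (-1) (nrm q) (fst q) (snd q)))).
  - apply (continuous_on_pair _ (fun _ : R * R => 0)); [intros q _; apply filterlim_const|].
    apply continuous_on_paste; [intros; apply C2| | |].
    + intros q H Hq. destruct (nrm_gt q H) as [H1 H2]. apply (cont_cy 1 One nrm snd fst q (nrm_cont q) H1 (C2 q) (C1 q)); [exact (plus_side _ Hq)|exact H2].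
    + intros q H Hq. destruct (nrm_gt q H) as [H1 H2]. apply (cont_cy (-1) Mone nrm snd fst q (nrm_cont q) H1 (C2 q) (C1 q)); [exact (minus_side _ Hq)|exact H2].
    + intros q H Hq. destruct (nrm_gt q H) as [H1 H2]. exact (proj1 (hmap_seam q H1 Hq)).
  - apply continuous_on_paste; [intros; apply C2| | |].
    + intros q H Hq. destruct (nrm_gt q H) as [H1 H2]. apply (cont_cz 1 One nrm snd q (nrm_cont q) H1 (C2 q)).
    + intros q H Hq. destruct (nrm_gt q H) as [H1 H2]. apply (cont_cz (-1) Mone nrm snd q (nrm_cont q) H1 (C2 q)).
    + intros q H Hq. destruct (nrm_gt q H) as [H1 H2]. exact (proj2 (hmap_seam q H1 Hq)).
Qed.

Lemma gmap_cont : continuous_on annulus_A gmap.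
Proof.
  assert (Cp : forall p : R3, cont3 (fun p : R3 => p) p).
  { intros p. split; [|split].
    - apply (continuous_comp (fst : R3 -> R * R) fst p); apply continuous_fst.
    - apply (continuous_comp (fst : R3 -> R * R) snd p); [apply continuous_fst|apply continuous_snd].
    - apply continuous_snd. }
  assert (C1 : forall p : R3, continuous py p) by (intros p; apply (Cp p)).
  assert (C2 : forall p : R3, continuous pz p) by (intros p; apply (Cp p)).
  assert (CF : forall p : R3, continuous (fun p => pz p - py p ^ 2) p) by (intros p; pose proof (C1 p); pose proof (C2 p); ctac).
  assert (One : (1 = 1 \/ 1 = -1)) by (left; reflexivity). assert (Mone : (-1 = 1 \/ -1 = -1)) by (right; reflexivity).
  assert (CS : forall sg p, (sg = 1 \/ sg = -1) -> annulus_A p -> 0 <= sg * (pz p - py p ^ 2) -> continuous (gS sg) p).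
  { intros sg p Hsg A H. apply (cont_lev sg Hsg py pz p (C1 p) (C2 p)). apply annulus_level; assumption. }
  assert (Sq : forall a b, 1 < a -> 1 < b -> a ^ 2 = b ^ 2 -> a = b) by (intros a b Ha Hb E; nra).
  assert (SE : forall p, annulus_A p -> pz p - py p ^ 2 = 0 -> 1 < gS 1 p /\ gS (-1) p = gS 1 p /\ pz p = gS 1 p ^ 2).
  { intros p A E. destruct (annulus_side p 1 A One) as [X1 [_ [_ [X2 _]]]]; [lra|]. destruct (annulus_side p (-1) A Mone) as [Y1 [_ [_ [Y2 _]]]]; [lra|].
    specialize (X2 E). specialize (Y2 E). split; [exact X1|]. split; [apply Sq; lra|exact X2]. }
  unfold gmap. apply continuous_on_pair.
  - apply continuous_on_paste; [intros; apply CF| | |].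
    + intros p A H. destruct (annulus_side p 1 A One (plus_side _ H)) as [X1 [X2 [X3 _]]].
      apply (cont_iq1 1 One (gS 1) py pz p); [apply CS; [exact One|exact A|exact (plus_side _ H)]|exact X1|apply C2|apply C1|exact X2|exact X3].
    + intros p A H. destruct (annulus_side p (-1) A Mone (minus_side _ H)) as [X1 [X2 [X3 _]]].
      apply (cont_iq1 (-1) Mone (gS (-1)) py pz p); [apply CS; [exact Mone|exact A|exact (minus_side _ H)]|exact X1|apply C2|apply C1|exact X2|exact X3].
    + intros p A H. destruct (SE p A H) as [X1 [X2 X3]]. rewrite X2, X3.
      destruct (chart_seam 1 One (gS 1 p) (py p) X1) as [_ [_ [_ ->]]]. destruct (chart_seam (-1) Mone (gS 1 p) (py p) X1) as [_ [_ [_ ->]]]. reflexivity.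
  - apply continuous_on_paste; [intros; apply CF| | |].
    + intros p A H. destruct (annulus_side p 1 A One (plus_side _ H)) as [X1 [X2 [X3 _]]].
      apply (cont_iq2 1 One (gS 1) pz p); [apply CS; [exact One|exact A|exact (plus_side _ H)]|exact X1|apply C2].
    + intros p A H. destruct (annulus_side p (-1) A Mone (minus_side _ H)) as [X1 [X2 [X3 _]]].
      apply (cont_iq2 (-1) Mone (gS (-1)) pz p); [apply CS; [exact Mone|exact A|exact (minus_side _ H)]|exact X1|apply C2].
    + intros p A H. destruct (SE p A H) as [X1 [X2 X3]]. rewrite X2, X3.
      destruct (chart_seam 1 One (gS 1 p) (py p) X1) as [_ [_ [-> _]]]. destruct (chart_seam (-1) Mone (gS 1 p) (py p) X1) as [_ [_ [-> _]]]. reflexivity.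
Qed.

(** * Level sets as crossing periodic orbits *)

Lemma zsys_unperturbed c d Zp Zm : zm Zp = -1 -> zm Zm = 1 -> zsys c d Zp Zm 0 = unperturbed c d.
Proof.
  intros Hp Hm. unfold zsys, unperturbed. f_equal; apply functional_extensionality; intros [[x y] z];
    apply R3_eq; unfold field, px, py, pz; simpl; rewrite ?Hp, ?Hm; ring.
Qed.

Lemma crossing_periodic_orbit_ext Z G G' : (forall p, G p <-> G' p) -> crossing_periodic_orbit Z G -> crossing_periodic_orbit Z G'.
Proof.
  intros E [phi [tau [T [H1 [H2 H3]]]]]. exists phi, tau, T. split; [exact H1|]. split; [|exact H3].
  intros p. rewrite <- E. apply H2.
Qed.

(** The angle runs through one full turn starting at the positive V-axis. *)
Lemma angle_exists U V r : 0 < r -> U ^ 2 + V ^ 2 = r ^ 2 -> exists b, 0 <= b <= 2 * PI /\ U = - r * sin b /\ V = r * cos b.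
Proof.
  intros Hr E. pose proof PI_RGT_0 as HPI.
  assert (B : -1 <= V / r <= 1).
  { split; apply Rmult_le_reg_r with r; try exact Hr; unfold Rdiv; rewrite Rmult_assoc, Rinv_l by lra; nra. }
  pose proof (acos_bound (V / r)) as HB.
  assert (C : r * cos (acos (V / r)) = V) by (rewrite cos_acos by exact B; field; lra).
  assert (S : r * sin (acos (V / r)) = Rabs U).
  { rewrite sin_acos by exact B. replace (1 - (V / r)²) with (U ^ 2 / r ^ 2).
    - rewrite sqrt_div_alt by nra. rewrite (sqrt_pow2 r) by lra. rewrite <- (pow2_abs U), sqrt_pow2 by apply Rabs_pos. field. lra.
    - unfold Rsqr. replace (U ^ 2) with (r ^ 2 - V ^ 2) by lra. field. lra. }
  destruct (Rle_lt_dec U 0) as [L|L].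
  - exists (acos (V / r)). split; [lra|]. rewrite Rabs_left1 in S by exact L. split; lra.
  - exists (2 * PI - acos (V / r)). split; [lra|]. rewrite Rabs_right in S by lra.
    rewrite sin_minus, cos_minus, sin_2PI, cos_2PI. split; lra.
Qed.

Section Circle.
Variables (c d : R) (Zp Zm : zone).
Hypotheses (Hmp : zm Zp = -1) (Hmm : zm Zm = 1) (Hnm : zn Zm = 0).
Variable s : R.
Hypothesis Hs : 1 < s.
Let One : 1 = 1 \/ 1 = -1 := or_introl eq_refl.
Let Mone : -1 = 1 \/ -1 = -1 := or_intror eq_refl.

Lemma quadric_plane p : px p = 0 -> quadric c d p = pz p - py p ^ 2.
Proof. destruct p as [[x y] z]. unfold px, py, pz; simpl. intros ->. ring. Qed.
Lemma qn_plane Z p : px p = 0 -> qn Z 0 p = py p ^ 2 + (pz p - zm Z) ^ 2.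
Proof. intros H. unfold qn. rewrite cU_at_0, cV_at_0. unfold tY, tw. rewrite H. field. Qed.

Lemma plane_eq Z p q : px p = 0 -> px q = 0 -> cU Z 0 p = cU Z 0 q -> cV Z 0 p = cV Z 0 q -> p = q.
Proof.
  intros Hp Hq. rewrite !cU_at_0, !cV_at_0. unfold tY, tw. rewrite Hp, Hq. intros H1 H2. apply R3_eq; lra.
Qed.

Lemma vb0 : qs ((fun _ : R => mk4 0 0 s 0) 0) = s. Proof. reflexivity. Qed.

(** The crossing points are symmetric and have the same radius. *)
Lemma unperturbed_arcs_close : flow Zp 0 (tp0 s) (A0 c d s) = B0 c d s /\ flow Zm 0 (tm0 s) (B0 c d s) = A0 c d s.
Proof.
  pose proof (tpe_0 c d Zp Hmp s (fun _ => mk4 0 0 s 0) vb0) as E1. pose proof (tme_0 c d Zm Hmm s Hs (fun _ => mk4 0 0 s 0) vb0) as E2.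
  unfold tpe in E1. unfold tme in E2. rewrite (Ae_0 c d s _ vb0), (Be_0 c d s _ vb0) in E1, E2. rewrite <- E1, <- E2.
  split.
  - apply (transit_flow Zp 0 (zgood_0 Zp) 0).
    + rewrite A0_V, Hmp. nra.
    + rewrite B0_V, Hmp. nra.
    + rewrite !cH_at_0, A0_px, B0_px. ring.
    + rewrite Rmult_0_l, exp_0. unfold qn. rewrite A0_U, B0_U, A0_V, B0_V. ring.
  - apply (transit_flow Zm 0 (zgood_0 Zm) 1).
    + rewrite B0_V, Hmm. nra.
    + rewrite A0_V, Hmm. nra.
    + rewrite !cH_at_0, A0_px, B0_px. ring.
    + rewrite Rmult_0_l, exp_0. unfold qn. rewrite A0_U, B0_U, A0_V, B0_V. ring.
Qed.

Lemma A0_qn Z : (zm Z = -1 -> qn Z 0 (A0 c d s) = rad 1 s ^ 2) /\ (zm Z = 1 -> qn Z 0 (B0 c d s) = rad (-1) s ^ 2).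
Proof.
  split; intros E; unfold qn; rewrite ?A0_U, ?A0_V, ?B0_U, ?B0_V, E, rad_sq by (assumption || (left; reflexivity) || (right; reflexivity)); ring.
Qed.

(** Above, all points have V > 0, and the bound on the angle is a bound on y / (z + 1). *)
Lemma upper_circle p : (exists t, 0 <= t <= tp0 s /\ flow Zp 0 t (A0 c d s) = p) <->
  px p = 0 /\ py p ^ 2 + (pz p + 1) ^ 2 = rad 1 s ^ 2 /\ 0 <= pz p - s ^ 2.
Proof.
  assert (HV : 0 < cV Zp 0 (A0 c d s)) by (rewrite A0_V, Hmp; nra).
  pose proof (tp0_pos s Hs) as Htp. split.
  - intros [t [Ht <-]]. destruct (flow_0_facts Zp t _ (A0_px c d s) HV) as [F1 [F2 _]].
    rewrite (proj1 (A0_qn Zp) Hmp), (qn_plane Zp _ F1), Hmp in F2.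
    replace (pz (flow Zp 0 t (A0 c d s)) - -1) with (pz (flow Zp 0 t (A0 c d s)) + 1) in F2 by ring.
    split; [exact F1|]. split; [exact F2|].
    assert (Q : 0 <= quadric c d (flow Zp 0 t (A0 c d s))).
    { destruct (Req_dec t 0) as [->|N0]; [rewrite (flow_0 Zp 0 (zgood_0 Zp)); right; symmetry; apply spt_quadric|].
      destruct (Req_dec t (tp0 s)) as [->|N1]; [rewrite (proj1 unperturbed_arcs_close); right; symmetry; apply spt_quadric|].
      left. apply (arc0_pos c d Zp Hmp s Hs). lra. }
    rewrite (quadric_plane _ F1) in Q. set (q := flow Zp 0 t (A0 c d s)) in *.
    pose proof (level_factor 1 One s _ _ Hs F2) as L. pose proof (side_s 1 One s _ _ Hs F2 (or_intror (plus_side _ Q))) as P.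
    rewrite L in Q. nra.
  - intros [P0 [P1 P2]]. pose proof (rad_sq 1 One s Hs) as Er.
    assert (Uv : cU Zp 0 p = py p) by (rewrite cU_at_0; unfold tY; rewrite P0; lra).
    assert (Vv : cV Zp 0 p = pz p + 1) by (rewrite cV_at_0; unfold tw; rewrite P0, Hmp; lra).
    assert (Vp : 0 < cV Zp 0 p) by (rewrite Vv; nra).
    exists (tT Zp 0 0 (A0 c d s) p). split.
    + unfold tT. rewrite om_0, A0_U, A0_V, Uv, Vv, Hmp. unfold tp0. pose proof PI_RGT_0.
      assert (Hy : py p ^ 2 <= s ^ 2) by nra. assert (Hya : Rabs (py p) <= s) by (rewrite <- (Rabs_right s) by lra; apply Rsqr_le_abs_0; unfold Rsqr; lra).
      assert (B : Rabs (py p / (pz p + 1)) <= s / (s ^ 2 + 1)).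
      { unfold Rdiv. rewrite Rabs_mult, (Rabs_right (/ (pz p + 1))) by (left; apply Rinv_0_lt_compat; nra).
        apply Rmult_le_compat; [apply Rabs_pos|left; apply Rinv_0_lt_compat; nra|exact Hya|apply Rinv_le_contravar; nra]. }
      assert (B' : - (s / (s ^ 2 + 1)) <= py p / (pz p + 1) <= s / (s ^ 2 + 1)) by (apply Rabs_le_between; exact B).
      assert (M : forall x y, x <= y -> atan x <= atan y) by (intros x y [X| ->]; [left; apply atan_increasing; exact X|lra]).
      pose proof (M _ _ (proj1 B')) as M1. pose proof (M _ _ (proj2 B')) as M2. rewrite atan_opp in M1.
      replace (s ^ 2 - -1) with (s ^ 2 + 1) by ring. lra.
    + apply (transit_flow Zp 0 (zgood_0 Zp) 0 _ _ HV Vp).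
      * rewrite !cH_at_0, A0_px, P0. ring.
      * rewrite Rmult_0_l, exp_0, Rmult_1_l, (proj1 (A0_qn Zp) Hmp), (qn_plane Zp _ P0), Hmp, <- P1. ring.
Qed.

(** Below, the angle of a point is compared with that of the crossing points through its cosine, the height. *)
Lemma lower_circle p : (exists t, 0 <= t <= tm0 s /\ flow Zm 0 t (B0 c d s) = p) <->
  px p = 0 /\ py p ^ 2 + (pz p + -1) ^ 2 = rad (-1) s ^ 2 /\ 0 <= -1 * (pz p - s ^ 2).
Proof.
  assert (HV : 0 < cV Zm 0 (B0 c d s)) by (rewrite B0_V, Hmm; nra).
  pose proof (tm0_pos s) as Htm. split.
  - intros [t [Ht <-]]. destruct (flow_0_facts Zm t _ (B0_px c d s) HV) as [F1 [F2 _]].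
    rewrite (proj2 (A0_qn Zm) Hmm), (qn_plane Zm _ F1), Hmm in F2.
    replace (pz (flow Zm 0 t (B0 c d s)) - 1) with (pz (flow Zm 0 t (B0 c d s)) + -1) in F2 by ring.
    split; [exact F1|]. split; [exact F2|].
    assert (Q : quadric c d (flow Zm 0 t (B0 c d s)) <= 0).
    { destruct (Req_dec t 0) as [->|N0]; [rewrite (flow_0 Zm 0 (zgood_0 Zm)); right; apply spt_quadric|].
      destruct (Req_dec t (tm0 s)) as [->|N1]; [rewrite (proj2 unperturbed_arcs_close); right; apply spt_quadric|].
      left. apply (arc0_neg c d Zm Hmm s Hs). lra. }
    rewrite (quadric_plane _ F1) in Q. set (q := flow Zm 0 t (B0 c d s)) in *.
    pose proof (level_factor (-1) Mone s _ _ Hs F2) as L. pose proof (side_s (-1) Mone s _ _ Hs F2 (or_intror (minus_side _ Q))) as P.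
    rewrite L in Q. nra.
  - intros [P0 [P1 P2]]. pose proof (rad_sq (-1) Mone s Hs) as Er. pose proof (rad_pos (-1) Mone s Hs) as Pr. pose proof PI_RGT_0 as HPI.
    assert (Uv : cU Zm 0 p = py p) by (rewrite cU_at_0; unfold tY; rewrite P0; lra).
    assert (Vv : cV Zm 0 p = pz p + -1) by (rewrite cV_at_0; unfold tw; rewrite P0, Hmm; lra).
    destruct (angle_exists _ _ _ Pr P1) as [b [Hb [Eu Ev]]].
    destruct (flow_polar Zm 0 (zgood_0 Zm) (b - atan (s / (s ^ 2 - 1))) _ HV) as [FU FV].
    rewrite (proj2 (A0_qn Zm) Hmm), sqrt_pow2 in FU, FV by lra.
    assert (Ea : ang Zm 0 (B0 c d s) = - atan (s / (s ^ 2 - 1))).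
    { unfold ang. rewrite B0_U, B0_V, Hmm, <- atan_opp. f_equal. field. nra. }
    rewrite Ea, om_0 in FU, FV. replace (0 * zl Zm * (b - atan (s / (s ^ 2 - 1)))) with 0 in FU, FV by ring. rewrite exp_0 in FU, FV.
    replace (- atan (s / (s ^ 2 - 1)) - 1 * (b - atan (s / (s ^ 2 - 1)))) with (- b) in FU, FV by ring.
    rewrite sin_neg in FU. rewrite cos_neg in FV.
    set (psi := atan (s / (s ^ 2 - 1))) in *.
    exists (b - psi). split.
    + unfold tm0. fold psi.
      assert (Hpsi : 0 < psi < PI).
      { unfold psi. split; [rewrite <- atan_0; apply atan_increasing, Rdiv_lt_0_compat; nra|].
        pose proof (atan_bound (s / (s ^ 2 - 1))). lra. }
      assert (Cpsi : rad (-1) s * cos psi = s ^ 2 - 1).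
      { destruct (polar (cU Zm 0 (B0 c d s)) (cV Zm 0 (B0 c d s)) HV) as [_ PV]. fold (qn Zm 0 (B0 c d s)) in PV. fold (ang Zm 0 (B0 c d s)) in PV.
        rewrite Ea, cos_neg, (proj2 (A0_qn Zm) Hmm), sqrt_pow2, B0_V, Hmm in PV by lra. lra. }
      assert (Cb : cos b <= cos psi) by nra.
      split.
      * apply Rnot_lt_le. intros X. assert (cos psi < cos b) by (apply cos_decreasing_1; lra). lra.
      * apply Rnot_lt_le. intros X. assert (X2 : cos psi < cos (2 * PI - b)) by (apply cos_decreasing_1; lra).
        rewrite cos_minus, cos_2PI, sin_2PI in X2. lra.
    + apply (plane_eq Zm).
      * apply (flow_0_facts Zm _ _ (B0_px c d s) HV).
      * exact P0.
      * rewrite FU, Uv, Eu. ring.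
      * rewrite FV, Vv, Ev. ring.
Qed.

Lemma level_set_arcs p : arcs_range (fun t => flow Zp 0 t (A0 c d s)) (fun t => flow Zm 0 t (B0 c d s)) (tp0 s) (tm0 s) p <->
  exists q : R * R, fst q ^ 2 + snd q ^ 2 = s ^ 2 /\ hmap q = p.
Proof.
  unfold arcs_range. rewrite upper_circle, lower_circle. split.
  - assert (Up : px p = 0 /\ py p ^ 2 + (pz p + 1) ^ 2 = rad 1 s ^ 2 /\ 0 <= pz p - s ^ 2 -> exists q : R * R, fst q ^ 2 + snd q ^ 2 = s ^ 2 /\ hmap q = p).
    { intros [P0 [P1 P2]]. destruct (hmap_gmap_level p 1 s P0 One Hs P1) as [q [Q1 [Q2 _]]]; [lra|lra|apply (lev_level 1 One); assumption|].
      exists q. split; assumption. }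
    intros [H|[P0 [P1 P2]]]; [exact (Up H)|].
    destruct (Req_dec (pz p) (s ^ 2)) as [E|N].
    + apply Up. split; [exact P0|]. rewrite E in P1 |- *. rewrite (rad_sq (-1) Mone s Hs) in P1. rewrite (rad_sq 1 One s Hs). split; [lra|lra].
    + destruct (hmap_gmap_level p (-1) s P0 Mone Hs P1 P2) as [q [Q1 [Q2 _]]]; [lra|apply (lev_level (-1) Mone); assumption|].
      exists q. split; assumption.
  - intros [q [Hq <-]]. assert (En : nrm q = s) by (unfold nrm; rewrite Hq; apply sqrt_pow2; lra).
    destruct (hmap_side q) as [sg [Hsg [_ [_ [_ [H0' [Hc [Hz _]]]]]]]]; [lra|rewrite En; exact Hq|]. rewrite En in Hc, Hz.
    destruct Hsg as [-> | ->]; [left|right]; (split; [exact H0'|split; [exact Hc|lra]]).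
Qed.

Lemma level_set_crossing : crossing_periodic_orbit (unperturbed c d) (fun p => exists q : R * R, fst q ^ 2 + snd q ^ 2 = s ^ 2 /\ hmap q = p).
Proof.
  destruct (local_facts_exist c d Zp Zm Hmp Hmm Hnm s Hs) as [rho LFr].
  set (vb := fun _ : R => mk4 0 0 s 0). pose proof (lf_pos _ _ _ _ _ _ LFr) as Hr. destruct unperturbed_arcs_close as [C1 C2].
  pose proof (tpe_0 c d Zp Hmp s vb vb0) as E1. pose proof (tme_0 c d Zm Hmm s Hs vb vb0) as E2.
  pose proof (Ae_0 c d s vb vb0) as EA. pose proof (Be_0 c d s vb vb0) as EB.
  assert (F : orbit_facts c d Zp Zm s vb rho 0).
  { split; rewrite ?E1, ?E2, ?EA, ?EB.
    - rewrite Rabs_R0. exact Hr.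
    - rewrite norm_minus_self. exact Hr.
    - rewrite norm_minus_self. exact Hr.
    - exact C1.
    - exact C2.
    - apply tp0_pos, Hs.
    - apply tm0_pos.
    - apply (arc0_pos c d Zp Hmp s Hs).
    - apply (arc0_neg c d Zm Hmm s Hs). }
  pose proof (Gam_crossing c d Zp Zm s vb rho LFr 0 F) as X. rewrite (zsys_unperturbed c d Zp Zm Hmp Hmm) in X.
  unfold Gam in X. rewrite E1, E2, EA, EB in X.
  apply (crossing_periodic_orbit_ext _ _ _ level_set_arcs X).
Qed.
End Circle.

(** The circles of the model go to the level sets, which are the unperturbed crossing orbits. *)
Theorem annulus_period c d : period_annulus (unperturbed c d) annulus_A.
Proof.
  exists hmap, gmap. split.
  - split; [exact hmap_cont|]. split; [exact gmap_cont|]. split.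
    + intros q H. exact (gmap_hmap q H).
    + intros p A. exact (hmap_gmap p A).
  - intros r Hr. apply (level_set_crossing c d (zonep 0 0 0) (zonem 0 0 0 0 0) eq_refl eq_refl eq_refl r Hr).
Qed.

(** * The seven limit cycles *)

Definition coef4 (a0 a1 a2 a3 : R) (i : nat) : R :=
  match i with O => a0 | 1%nat => a1 | 2%nat => a2 | _ => a3 end.

(** Coefficients of the perturbation in the original coordinates. *)
Definition alpha_of (Z : zone) := coef4 (zg0 Z - zg2 Z * zm Z) ((zg1 Z - zg2 Z) / 2) (zg1 Z) (zg2 Z).
Definition beta_of (Z : zone) :=
  let a := alpha_of Z in let l := zl Z + zn Z in
  coef4 (- a 0%nat / 2) (l / 2 - a 1%nat / 2) (l - a 2%nat / 2) (- a 3%nat / 2).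
Definition kappa_of (Z : zone) :=
  let a := alpha_of Z in let l := zl Z - zn Z in
  coef4 (zk Z - l * zm Z + a 0%nat / 2) (- l / 2 + a 1%nat / 2) (a 2%nat / 2) (l + a 3%nat / 2).

Lemma zsys_perturbed c d Zp Zm e : zm Zp = -1 -> zm Zm = 1 ->
  zsys c d Zp Zm e = perturbed c d (alpha_of Zp) (beta_of Zp) (kappa_of Zp) (alpha_of Zm) (beta_of Zm) (kappa_of Zm) e.
Proof.
  intros Hp Hm. unfold zsys, perturbed. f_equal; apply functional_extensionality; intros [[x y] z].
  - apply R3_eq; rewrite ?px_plus, ?py_plus, ?pz_plus, ?px_scal, ?py_scal, ?pz_scal, ?px_field, ?py_field, ?pz_field;
      unfold zg, tY, tw, px, py, pz, alpha_of, beta_of, kappa_of; simpl; unfold alpha_of; simpl; rewrite Hp; field.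
  - apply R3_eq; rewrite ?px_plus, ?py_plus, ?pz_plus, ?px_scal, ?py_scal, ?pz_scal, ?px_field, ?py_field, ?pz_field;
      unfold zg, tY, tw, px, py, pz, alpha_of, beta_of, kappa_of; simpl; unfold alpha_of; simpl; rewrite Hm; field.
Qed.

(** Minimum of finitely many bounds. *)
Lemma finitely_many_small (n : nat) (P : nat -> R -> Prop) :
  (forall i, (i < n)%nat -> exists dl, 0 < dl /\ forall e, 0 < Rabs e < dl -> P i e) ->
  exists dl, 0 < dl /\ forall e, 0 < Rabs e < dl -> forall i, (i < n)%nat -> P i e.
Proof.
  induction n as [|n IH]; intros H.
  - exists 1. split; [lra|]. intros; lia.
  - destruct IH as [d1 [P1 Q1]]; [intros i Hi; apply H; lia|]. destruct (H n ltac:(lia)) as [d2 [P2 Q2]].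
    exists (Rmin d1 d2). split; [apply Rmin_pos; assumption|]. intros e He i Hi.
    pose proof (Rmin_l d1 d2). pose proof (Rmin_r d1 d2).
    destruct (Nat.eq_dec i n) as [->|N]; [apply Q2; lra|apply Q1; [lra|lia]].
Qed.

Lemma choose_sequence {B : Type} (Q : nat -> B -> Prop) : (forall i, exists b, Q i b) -> exists f, forall i, Q i (f i).
Proof.
  intros H. exists (fun i => proj1_sig (constructive_indefinite_description _ (H i))).
  intros i. exact (proj2_sig (constructive_indefinite_description _ (H i))).
Qed.

Theorem theorem3 :
  forall c d : R,
    (c = -1 \/ c = 0 \/ c = 1) -> (d = -1 \/ d = 0 \/ d = 1) ->
    invariant_set (unperturbed c d) plane_S /\
    (forall p, annulus_A p -> plane_S p) /\
    period_annulus (unperturbed c d) annulus_A /\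
    exists ap bp kp am bm km : nat -> R,
    exists (G : nat -> R -> R3 -> Prop) (G0 : nat -> R3 -> Prop),
      (forall i, (i < 7)%nat ->
        crossing_periodic_orbit (unperturbed c d) (G0 i) /\
        (forall p, G0 i p -> plane_S p) /\
        converges_to (G i) (G0 i)) /\
      (exists eps0 : R, 0 < eps0 /\
        forall eps : R, eps <> 0 -> Rabs eps < eps0 ->
          (forall i, (i < 7)%nat ->
            limit_cycle (perturbed c d ap bp kp am bm km eps) (G i eps)) /\
          (forall i j, (i < j)%nat -> (j < 7)%nat ->
            ~ (forall p, G i eps p <-> G j eps p))).
Proof.
  intros c d Hc Hd.
  split; [apply plane_invariant|]. split; [intros p A; apply plane_S_px, annulus_px, A|]. split; [apply annulus_period|].
  destruct (mel_simple_zeros (1 - c)) as [kp [km [nu [lp [lm [d0 [d1 [d2 [s [Hs1 [Hsi Hz]]]]]]]]]]].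
  { destruct Hc as [-> | [-> | ->]]; [right|right|left]; lra. }
  set (Zp := zonep kp nu lp). set (Zm := zonem km lm d0 d1 d2).
  assert (Hmono : forall i j, (i < j)%nat -> (j < 7)%nat -> s i < s j).
  { intros i j Hij. induction Hij as [|j Hij IH]; intros Hj; [apply Hsi, Hj|].
    apply Rlt_trans with (s j); [apply IH; lia|apply Hsi, Hj]. }
  assert (HG : forall i, exists G : R -> R3 -> Prop, (i < 7)%nat ->
    crossing_periodic_orbit (zsys c d Zp Zm 0) (G 0) /\ (forall p, G 0 p -> px p = 0) /\
    (forall eta, 0 < eta -> exists dl, 0 < dl /\ forall e, Rabs e < dl -> in_tube eta (G e) (G 0) /\ in_tube eta (G 0) (G e)) /\
    (exists dl, 0 < dl /\ forall e, 0 < Rabs e < dl -> limit_cycle (zsys c d Zp Zm e) (G e)) /\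
    G 0 (A0 c d (s i)) /\
    (forall eta, 0 < eta -> exists r, 0 < r /\ forall p q, G 0 q -> norm (minus p q) < r -> quadric c d p = 0 ->
       norm (minus p (A0 c d (s i))) < eta \/ norm (minus p (B0 c d (s i))) < eta)).
  { intros i. destruct (Nat.lt_ge_cases i 7) as [L|L].
    - destruct (Hz i L) as [Z0 [l [Hl Dl]]].
      destruct (branch_of_limit_cycles c d kp km nu lp lm d0 d1 d2 (s i) l (Hs1 i L) Z0 Hl Dl) as [G HG].
      exists G. intros _. exact HG.
    - exists (fun _ _ => True). intros; lia. }
  destruct (choose_sequence _ HG) as [G PG].
  exists (alpha_of Zp), (beta_of Zp), (kappa_of Zp), (alpha_of Zm), (beta_of Zm), (kappa_of Zm), G, (fun i => G i 0).
  split.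
  - intros i Hi. destruct (PG i Hi) as [X1 [X2 [X3 _]]].
    rewrite (zsys_unperturbed c d Zp Zm eq_refl eq_refl) in X1. split; [exact X1|]. split; [intros p Hp; apply plane_S_px, X2, Hp|].
    intros eta. destruct (X3 eta (cond_pos eta)) as [dl [P Q]]. apply locally'_ball. exists (mkposreal dl P). intros e _ He. apply Q, He.
  - destruct (finitely_many_small 7 (fun i e => limit_cycle (zsys c d Zp Zm e) (G i e))) as [e1 [P1 Q1]].
    { intros i Hi. apply (PG i Hi). }
    destruct (finitely_many_small 7 (fun j e => forall i, (i < j)%nat -> ~ (forall p, G i e p <-> G j e p))) as [e2 [P2 Q2]].
    { intros j Hj. apply finitely_many_small. intros i Hij. pose proof (Hmono i j Hij Hj) as Hlt.
      destruct (PG i ltac:(lia)) as [_ [_ [Ci [_ [Ai _]]]]]. destruct (PG j Hj) as [_ [_ [Cj [_ [_ Sj]]]]].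
      destruct (Sj (s j - s i) ltac:(lra)) as [r [Hr Sep]].
      destruct (Ci (r / 2) ltac:(lra)) as [a [Pa Qa]]. destruct (Cj (r / 2) ltac:(lra)) as [b [Pb Qb]].
      exists (Rmin a b). split; [apply Rmin_pos; assumption|]. intros e He E.
      pose proof (Rmin_l a b). pose proof (Rmin_r a b).
      destruct (Qa e ltac:(lra)) as [_ T1]. destruct (Qb e ltac:(lra)) as [T2 _].
      destruct (T1 _ Ai) as [q1 [G1 D1]]. apply E in G1. destruct (T2 _ G1) as [q2 [G2 D2]].
      pose proof (norm_minus_tri (A0 c d (s i)) q1 q2).
      pose proof (Hs1 i ltac:(lia)). pose proof (Hs1 j Hj).
      assert (YA : forall x, py (A0 c d x) = x) by (intros x; unfold A0, spt, py; simpl; field).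
      assert (YB : forall x, py (B0 c d x) = - x) by (intros x; unfold B0, spt, py; simpl; field).
      destruct (Sep (A0 c d (s i)) q2 G2) as [X|X]; [lra|apply spt_quadric| |].
      - pose proof (py_le_norm (minus (A0 c d (s i)) (A0 c d (s j)))) as Y. rewrite py_minus, !YA in Y.
        rewrite Rabs_left in Y by lra. lra.
      - pose proof (py_le_norm (minus (A0 c d (s i)) (B0 c d (s j)))) as Y. rewrite py_minus, YA, YB in Y.
        rewrite Rabs_right in Y by lra. lra. }
    exists (Rmin e1 e2). split; [apply Rmin_pos; assumption|]. intros eps Hne He.
    pose proof (Rmin_l e1 e2). pose proof (Rmin_r e1 e2). apply Rabs_pos_lt in Hne. split.
    + intros i Hi. rewrite <- (zsys_perturbed c d Zp Zm eps eq_refl eq_refl). apply Q1; [lra|exact Hi].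
    + intros i j Hij Hj. apply (Q2 eps ltac:(lra) j Hj i Hij).
Qed.
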